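(* (Rigid and explicit crossing.) For each distinguished mock theta vector of order $3,5,7,11$, the modular transformation laws admit a unique holomorphic solution on the side $|Q|>1$. These solutions are explicit unary false theta vectors: (1) For order $3$, the pair $\bigl(\Phi_1^{(3)}(Q^{-1}),\Phi_2^{(3)}(Q^{-1})\bigr)$ is the unique false theta pair satisfying, for $t\in\mathbb R^-$, $$(q^{-1})^{-2/3}\Phi^{(3)}_1(-q^{-1})=i\sqrt{\tfrac{\pi}{|t|}}\,(q_1^{-1})^{-2/3}\Phi^{(3)}_1(-q_1^{-1})+i\sqrt{\tfrac{12|t|}{\pi}}\,W_3(t),$$ $$(q^{-1})^{-2/3}\Phi^{(3)}_1(q^{-1})=-i\sqrt{\tfrac{\pi}{4|t|}}\,(q_1^{-1})^{1/12}\Phi^{(3)}_2\bigl((q_1^{-1})^2\bigr)-i\sqrt{\tfrac{3|t|}{\pi}}\,W_2\!\left(\tfrac t2\right).$$ For $p=5,7,11$ consider the system $$(\mathrm E_p)\qquad \mathcal L^{(p)}_j(t)=Q^{-\Delta_{(p,j)}}\,\Phi_j^{(p)}(Q^{-1})+i\sqrt{\tfrac{\pi}{|t|}}\sum_{k=1}^{\ell_p}M^{(p)}_{jk}\,Q_1^{-\Delta_{(p,k)}}\,\Phi_k^{(p)}(Q_1^{-1}),\qquad t\in\mathbb R^-,\ 1\le j\le\ell_p=\tfrac{p-1}2 .$$ (2) For order $5$, the vector $\bigl(\Phi_1^{(5)}(Q^{-1}),\,Q\Phi_2^{(5)}(Q^{-1})\bigr)$ is the unique false theta vector satisfying $(\mathrm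 E_5)$. (3) For order $7$, the vector $\bigl(\Phi_1^{(7)}(Q^{-1}),\,Q\Phi_2^{(7)}(Q^{-1}),\,Q\Phi_3^{(7)}(Q^{-1})\bigr)$ is the unique false theta vector satisfying $(\mathrm E_7)$. (4) For order $11$, the vector $\bigl(\Phi_1^{(11)}(Q^{-1}),\,\Phi_2^{(11)}(Q^{-1}),\,Q\Phi_3^{(11)}(Q^{-1}),\,Q\Phi_4^{(11)}(Q^{-1}),\,Q^2\Phi_5^{(11)}(Q^{-1})\bigr)$ is the unique false theta vector satisfying $(\mathrm E_{11})$.
   Context: Notation: $q=e^{-t}$, $q_1=e^{-\pi^2/t}$, $Q=q^2=e^{-2t}$, $Q_1=q_1^2=e^{-2\pi^2/t}$; for $t<0$ these are positive and rational powers are positive reals. Distinguished mock theta vectors: order 3, Ramanujan's pair $(f,\omega)$; order 5, $(\chi_0,\chi_1)$; order 7, $(\mathcal F_0,\mathcal F_1,\mathcal F_2)$; order 11, Zagier's five-component vector. The modular transformation laws on the side $|Q|>1$ are the two equations in (1) for order 3 and $(\mathrm E_p)$ for $p=5,7,11$. Normalization: the equations are understood up to the freedom of changing the order vector (vector of orders of vanishing) of the false theta series and compensating by corresponding integer shifts of the $\Delta_{(p,j)}$. Such shifts change the normalization of the transformation laws, but leave unchanged the corresponding equations when written directly in terms of series in rational powers of $Q^{-1}$; rational powers and the corresponding unary series are regarded together. False theta series: $\Psi_m^{(a)}(x)=\sum_{n\ge0}\psi_{2m}^{(a)}(n)x^{n^2/(4m)}$, with $\psi_{2m}^{(a)}(n)=1$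 if $n\equiv a$, $-1$ if $n\equiv-a\pmod{2m}$, and $0$ otherwise. For a prime $p\ge5$ and $1\le j\le\ell_p$: $\Delta_{(p,j)}=\frac{(6j-p)^2}{24p}$ and $$\Phi^{(p)}_j(x)=x^{-\Delta_{(p,j)}}\bigl[\Psi_{6p}^{(6j-p)}(x)+\Psi_{6p}^{(7p-6j)}(x)+\Psi_{6p}^{(6j+p)}(x)+\Psi_{6p}^{(5p-6j)}(x)\bigr]\in\mathbb Z[[x]].$$ For order 3, $x^{-2/3}\Phi_1^{(3)}(-x)=\Psi_3^{(2)}(x)$, $\;x^{-2/3}\Phi_1^{(3)}(x)=-\Psi_6^{(2)}(x^2)-\Psi_6^{(4)}(x^2)$, and $\Phi_2^{(3)}(x)=2x^{-1/24}\bigl[\Psi_6^{(1)}(x)-\Psi_6^{(5)}(x)\bigr]$. $M^{(p)}_{jk}=\frac{2}{\sqrt p}(-1)^{j+k+\lfloor (p+3)/6\rfloor}\sin\bigl(\frac{6\pi jk}{p}\bigr)$. Mordell–Appell integrals, for $\Re t>0$: $JS_{(P,a)}(t)=\frac1t\int_0^\infty e^{-Pu^2/t}\frac{\sinh((P-a)u)}{\sinh(Pu)}\,du$, $W_3(t)=\frac1t\int_0^\infty e^{-3x^2/t}\frac{\sinh x}{\sinh3x}dx$, $W_2(t)=\frac1t\int_0^\infty e^{-\frac32x^2/t}\frac{\cosh x}{\cosh3x}dx$, $$\mathcal L^{(p)}_j(t)=\sqrt{\tfrac{48pt}{\pi}}\bigl[\mathrm{sign}(6j-p)JS_{(12p,|12j-2p|)}(t)+JS_{(12p,14p-12j)}(t)+JS_{(12p,12j+2p)}(t)+JS_{(12p,10p-12j)}(t)\bigr].$$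 For $t\in\mathbb R^-$ (the Stokes line) they denote the analytic continuations to the negative real axis; the convention is continuation through the upper half $t$-plane, $t=-T+i0$, $T>0$.
   Formalization: For p=5,7,11 (E_p) with +i fails for the continuation t=-T+i0 (e.g. p=5, j=1: the imaginary parts have opposite signs); it is proved as displayed for the value at t=-T-i0, and with -i in place of +i for t=-T+i0. *)

(* Defs.v *)
From Stdlib Require Import Reals ZArith List Lia Lra Psatz.
From Coquelicot Require Import Coquelicot.
Import ListNotations.
Open Scope R_scope.

(** * False theta series *)

(* psi m a n is the coefficient $\psi_{2m}^{(a)}(n)$ *)
Definition psi (m a : Z) (n : nat) : Z :=
  if ((Z.of_nat n - a) mod (2 * m) =? 0)%Z then 1%Z
  else if ((Z.of_nat n + a) mod (2 * m) =? 0)%Z then (-1)%Z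
  else 0%Z.

Definition Psi (m a : Z) (x : R) : R :=
  Series (fun n => IZR (psi m a n) * Rpower x (INR n ^ 2 / (4 * IZR m))).

Definition Delta (p j : nat) : R := (6 * INR j - INR p) ^ 2 / (24 * INR p).

Definition Cseries (a : nat -> C) : C :=
  (Series (fun n => Re (a n)), Series (fun n => Im (a n))).

Definition phi_coef (p j n : nat) : Z :=
  let P := Z.of_nat p in let J := Z.of_nat j in
  (psi (6 * P) (6 * J - P) n + psi (6 * P) (7 * P - 6 * J) n
   + psi (6 * P) (6 * J + P) n + psi (6 * P) (5 * P - 6 * J) n)%Z.

(* The prefactor $x^{-\Delta_{(p,j)}}$ turns the exponent $n^2/(24p)$ into
   $(n^2-(6j-p)^2)/(24p)$, a natural number whenever phi_coef p j n <> 0;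
   see Phi_Psi below. *)
Definition phi_exp (p j n : nat) : nat :=
  Z.to_nat ((Z.of_nat n ^ 2 - (6 * Z.of_nat j - Z.of_nat p) ^ 2)
            / (24 * Z.of_nat p))%Z.

Definition Phi (p j : nat) (z : C) : C :=
  Cseries (fun n => (RtoC (IZR (phi_coef p j n)) * z ^ phi_exp p j n)%C).

(* The order 3 pair, likewise with the fractional prefactors absorbed; see
   Phi3_1_neg, Phi3_1_pos and Phi3_2_Psi below. *)
Definition Phi3_1 (z : C) : C :=
  Cseries (fun n =>
    (RtoC (IZR (psi 3 2 n)) * (- z) ^ ((n ^ 2 + 8) / 12)%nat)%C).

Definition Phi3_2 (z : C) : C :=
  (2 * Cseries (fun n =>
    (RtoC (IZR (psi 6 1 n - psi 6 5 n)) * z ^ ((n ^ 2 - 1) / 24)%nat)))%C.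

(** * Mordell-Appell integrals *)

Definition Cexp (z : C) : C :=
  (exp (Re z) * cos (Im z), exp (Re z) * sin (Im z)).

(* principal branch; used on the right half-plane only *)
Definition Csqrt (z : C) : C :=
  (sqrt ((Cmod z + Re z) / 2), sign (Im z) * sqrt ((Cmod z - Re z) / 2)).

Definition CInt0oo (f : R -> C) : C :=
  @RInt_gen C_R_CompleteNormedModule f (at_point 0) (Rbar_locally p_infty).

(* As complex functions of t these are meaningful for Re t > 0 only. *)
Definition JS (P a : R) (t : C) : C :=
  (/ t * CInt0oo (fun u =>
     Cexp (- RtoC (P * u ^ 2) / t)
     * RtoC (sinh ((P - a) * u) / sinh (P * u))))%C.

Definition W3 (t : C) : C :=
  (/ t * CInt0oo (fun x =>
     Cexp (- RtoC (3 * x ^ 2) / t) * RtoC (sinh x / sinh (3 * x))))%C.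

Definition W2 (t : C) : C :=
  (/ t * CInt0oo (fun x =>
     Cexp (- RtoC (3 / 2 * x ^ 2) / t) * RtoC (cosh x / cosh (3 * x))))%C.

Definition calL (p j : nat) (t : C) : C :=
  let P := INR p in let J := INR j in
  (Csqrt (RtoC (48 * P / PI) * t)
   * (RtoC (sign (6 * J - P)) * JS (12 * P) (Rabs (12 * J - 2 * P)) t
      + JS (12 * P) (14 * P - 12 * J) t
      + JS (12 * P) (12 * J + 2 * P) t
      + JS (12 * P) (10 * P - 12 * J) t))%C.

(** * Analytic continuation to the negative real axis *)

Definition holomorphic_at (f : C -> C) (z : C) : Prop :=
  @ex_derive C_AbsRing C_NormedModule f z.

Inductive side := Upper | Lower.

Definition sgn (s : side) : R := match s with Upper => 1 | Lower => -1 end.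

(* g t is the value at t + i0 (s = Upper) or t - i0 (s = Lower), t < 0, of the
   analytic continuation of f from the right half-plane through the upper,
   resp. lower, half-plane. The domain of F is connected, so g is determined
   by f on the negative axis. *)
Definition lateral_continuation (s : side) (f : C -> C) (g : R -> C) : Prop :=
  exists F : C -> C,
    (forall t : C, 0 < Re t \/ 0 < sgn s * Im t -> holomorphic_at F t) /\
    (forall t : C, 0 < Re t -> F t = f t) /\
    (forall t : R, t < 0 ->
       filterlim (fun e : R => F (t, sgn s * e)) (at_right 0) (locally (g t))).

(** * Transformation laws on the side |Q| > 1 *)

Definition nome (t : R) : R := exp (- t).
Definition nome1 (t : R) : R := exp (- (PI ^ 2 / t)).

(* Unknowns are functions of Q: G 1 Q stands for $\Phi_1^{(3)}(Q^{-1})$ and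
   G 2 Q for $\Phi_2^{(3)}(Q^{-1})$. W3m and W2m are the continuations to the
   negative axis. *)
Definition law3 (W3m W2m : R -> C) (G : nat -> C -> C) : Prop :=
  forall t : R, t < 0 ->
    let q := nome t in let q1 := nome1 t in
    (RtoC (Rpower (/ q) (- (2 / 3))) * G 1%nat (- RtoC q)
     = Ci * RtoC (sqrt (PI / Rabs t))
         * (RtoC (Rpower (/ q1) (- (2 / 3))) * G 1%nat (- RtoC q1))
       + Ci * RtoC (sqrt (12 * Rabs t / PI)) * W3m t)%C /\
    (RtoC (Rpower (/ q) (- (2 / 3))) * G 1%nat (RtoC q)
     = - Ci * RtoC (sqrt (PI / (4 * Rabs t)))
         * (RtoC (Rpower (/ q1) (1 / 12)) * G 2%nat (RtoC (q1 ^ 2)))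
       - Ci * RtoC (sqrt (3 * Rabs t / PI)) * W2m (t / 2)%R)%C.

Definition ell (p : nat) : nat := ((p - 1) / 2)%nat.

Definition Mmat (p j k : nat) : R :=
  2 / sqrt (INR p) * (-1) ^ (j + k + (p + 3) / 6)
  * sin (6 * PI * INR j * INR k / INR p).

(* An order vector [n_1; ...; n_l] normalizes the unknown as
   $G_j(Q) = Q^{n_j}\Phi_j(Q^{-1})$, compensated by
   $\Delta_{(p,j)} \mapsto \Delta_{(p,j)} + n_j$. *)
Definition order (n : list nat) (j : nat) : nat := nth (j - 1) n 0%nat.

Definition false_theta_vector (p : nat) (n : list nat) (j : nat) (Q : C) : C :=
  (Q ^ order n j * Phi p j (/ Q))%C.

(* The two lateral values of calL p j at t < 0 are complex conjugate to each
   other, and the vector Phi p and the matrix Mmat p are real; hence the sign of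
   i depends on the side. With Mmat as normalized above, the residues give $+i$
   for the value at t - i0 and $-i$ for the value at t + i0. *)
Definition lawE (s : side) (p : nat) (n : list nat)
    (L : nat -> R -> C) (G : nat -> C -> C) : Prop :=
  forall (t : R) (j : nat), t < 0 -> (1 <= j <= ell p)%nat ->
    let Q := nome t ^ 2 in let Q1 := nome1 t ^ 2 in
    L j t =
    (RtoC (Rpower Q (- (Delta p j + INR (order n j)))) * G j (RtoC Q)
     + RtoC (- sgn s) * Ci * RtoC (sqrt (PI / Rabs t))
       * @sum_n_m C_AbelianMonoid (fun k : nat =>
           RtoC (Mmat p j k)
           * (RtoC (Rpower Q1 (- (Delta p k + INR (order n k))))
              * G k (RtoC Q1))) 1 (ell p))%C.

Definition unique_holomorphic_solution (l : nat)
    (law : (nat -> C -> C) -> Prop) (G : nat -> C -> C) : Prop :=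
  let holo (H : nat -> C -> C) :=
    forall (j : nat) (Q : C), (1 <= j <= l)%nat -> 1 < Cmod Q ->
      holomorphic_at (H j) Q in
  holo G /\ law G /\
  forall H : nat -> C -> C, holo H -> law H ->
    forall (j : nat) (Q : C), (1 <= j <= l)%nat -> 1 < Cmod Q ->
      H j Q = G j Q.

Definition order3_pair (j : nat) (Q : C) : C :=
  match j with 1%nat => Phi3_1 (/ Q) | _ => Phi3_2 (/ Q) end.

Definition order3_crossing : Prop :=
  exists W3m W2m : R -> C,
    lateral_continuation Upper W3 W3m /\ lateral_continuation Upper W2 W2m /\
    unique_holomorphic_solution 2 (law3 W3m W2m) order3_pair.

Definition crossing (s : side) (p : nat) (n : list nat) : Prop :=
  exists L : nat -> R -> C,
    (forall j, (1 <= j <= ell p)%nat ->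
       lateral_continuation s (calL p j) (L j)) /\
    unique_holomorphic_solution (ell p) (lawE s p n L) (false_theta_vector p n).

(** * The series above are those of the defining formulas *)

Local Ltac fin :=
  match goal with E : Z.of_nat ?n = _ |- _ =>
    apply Nat2Z.inj;
    rewrite ?Nat2Z.inj_add, ?Nat2Z.inj_mul, ?Nat2Z.inj_pow, ?Nat2Z.inj_add,
      ?Nat2Z.inj_mul, ?Z2Nat.id, E by nia;
    change (Z.of_nat 1) with 1%Z; change (Z.of_nat 2) with 2%Z;
    change (Z.of_nat 8) with 8%Z; change (Z.of_nat 12) with 12%Z;
    change (Z.of_nat 24) with 24%Z; ring
  end.

Lemma Cseries_real (a : nat -> C) (b : nat -> R) :
  (forall n, a n = RtoC (b n)) -> Cseries a = RtoC (Series b).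
Proof.
intros H; unfold Cseries, RtoC; f_equal.
- apply Series_ext; intros n; rewrite H; reflexivity.
- rewrite (Series_ext _ (fun n => 0 * b n)).
  + rewrite Series_scal_l; ring.
  + intros n; rewrite H; simpl; ring.
Qed.

Lemma theta_shift (c : nat -> Z) (e : nat -> nat) (m d x : R) :
  0 < x ->
  (forall n, c n <> 0%Z -> INR (e n) = INR n ^ 2 / (4 * m) - d) ->
  Series (fun n => IZR (c n) * x ^ e n)
  = Rpower x (- d) * Series (fun n => IZR (c n) * Rpower x (INR n ^ 2 / (4 * m))).
Proof.
intros Hx He; rewrite <- Series_scal_l; apply Series_ext; intros n.
destruct (Z.eq_dec (c n) 0) as [E|E].
- rewrite E; ring.
- rewrite <- Rpower_pow by exact Hx.
  rewrite (He n E); unfold Rminus; rewrite Rpower_plus; ring.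
Qed.

Lemma psi_bound m a n : Rabs (IZR (psi m a n)) <= 1.
Proof.
unfold psi; destruct (_ =? 0)%Z; [|destruct (_ =? 0)%Z];
  rewrite <- abs_IZR; simpl; lra.
Qed.

Lemma ex_Psi (m a : Z) (x : R) : (0 < m)%Z -> 0 < x < 1 ->
  ex_series (fun n => IZR (psi m a n) * Rpower x (INR n ^ 2 / (4 * IZR m))).
Proof.
intros Hm [Hx0 Hx1]; apply IZR_lt in Hm.
set (r := Rpower x (/ (4 * IZR m))).
assert (Hl : ln x < 0) by (rewrite <- ln_1; apply ln_increasing; lra).
assert (Hk : 0 < / (4 * IZR m)) by (apply Rinv_0_lt_compat; lra).
assert (Hr0 : 0 < r) by apply exp_pos.
assert (Hr : r < 1).
{ unfold r, Rpower; rewrite <- exp_0; apply exp_increasing; nra. }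
apply (@ex_series_le R_AbsRing R_CompleteNormedModule _ (fun n => r ^ n)).
- intros n; change (Rabs (IZR (psi m a n) * Rpower x (INR n ^ 2 / (4 * IZR m))) <= r ^ n).
  rewrite Rabs_mult, (Rabs_pos_eq (Rpower _ _)) by (left; apply exp_pos).
  apply Rle_trans with (1 * Rpower x (INR n ^ 2 / (4 * IZR m))).
  { apply Rmult_le_compat_r; [left; apply exp_pos | apply psi_bound]. }
  rewrite Rmult_1_l, <- (Rpower_pow n r) by exact Hr0.
  unfold r; rewrite Rpower_mult; unfold Rpower.
  assert (Hn : INR n <= INR n ^ 2).
  { destruct n as [|n]; [simpl; lra|].
    pose proof (pos_INR n); rewrite S_INR; nra. }
  assert (Hle : INR n ^ 2 / (4 * IZR m) * ln x <= / (4 * IZR m) * INR n * ln x).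
  { replace (INR n ^ 2 / (4 * IZR m) * ln x)
      with (- (/ (4 * IZR m) * - ln x) * INR n ^ 2) by (unfold Rdiv; ring).
    replace (/ (4 * IZR m) * INR n * ln x)
      with (- (/ (4 * IZR m) * - ln x) * INR n) by ring.
    assert (0 < / (4 * IZR m) * - ln x) by (apply Rmult_lt_0_compat; lra); nra. }
  destruct Hle as [Hle|Hle]; [left; now apply exp_increasing | rewrite Hle; apply Rle_refl].
- apply ex_series_geom; rewrite Rabs_pos_eq; lra.
Qed.

Lemma psi_neq0 m a n : (0 < m)%Z -> psi m a n <> 0%Z ->
  exists k : Z, (Z.of_nat n = a + 2 * m * k \/ Z.of_nat n = - a + 2 * m * k)%Z.
Proof.
intros Hm; unfold psi.
destruct (Z.eqb_spec ((Z.of_nat n - a) mod (2 * m)) 0) as [E|_].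
- intros _; apply Z.mod_divide in E; [|lia]; destruct E as [k E]; exists k; lia.
- destruct (Z.eqb_spec ((Z.of_nat n + a) mod (2 * m)) 0) as [E|_]; [|congruence].
  intros _; apply Z.mod_divide in E; [|lia]; destruct E as [k E]; exists k; lia.
Qed.

Lemma phi_exp_eq (p j n : nat) : (1 <= j)%nat -> (2 * j < p)%nat ->
  phi_coef p j n <> 0%Z ->
  INR (phi_exp p j n) = INR n ^ 2 / (4 * IZR (6 * Z.of_nat p)) - Delta p j.
Proof.
intros Hj Hp Hc.
set (P := Z.of_nat p); set (J := Z.of_nat j); set (N := Z.of_nat n).
assert (HJ : (1 <= J)%Z) by (unfold J; lia).
assert (HP : (2 * J < P)%Z) by (unfold J, P; lia).
assert (H : exists e : Z, (N ^ 2 - (6 * J - P) ^ 2 = 24 * P * e)%Z /\ (0 <= e)%Z).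
{ assert (HN : (0 <= N)%Z) by (unfold N; lia).
  assert (Hd : exists e : Z,
      (N ^ 2 - (6 * J - P) ^ 2 = 24 * P * e)%Z /\
      ((6 * J - P <= N)%Z /\ (P - 6 * J <= N)%Z)).
  { assert (Hcase : psi (6 * P) (6 * J - P) n <> 0%Z \/ psi (6 * P) (7 * P - 6 * J) n <> 0%Z
       \/ psi (6 * P) (6 * J + P) n <> 0%Z \/ psi (6 * P) (5 * P - 6 * J) n <> 0%Z).
    { unfold phi_coef in Hc; fold P J in Hc; lia. }
    destruct Hcase as [E|[E|[E|E]]]; apply psi_neq0 in E; try lia;
      fold N in E; destruct E as [k [E|E]].
    - exists (6 * P * k ^ 2 + k * (6 * J - P))%Z; split; [rewrite E; ring|].
      assert (k <= -1 \/ k = 0 \/ 1 <= k)%Z as [|[|]] by lia; subst; nia.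
    - exists (6 * P * k ^ 2 - k * (6 * J - P))%Z; split; [rewrite E; ring|].
      assert (k <= -1 \/ k = 0 \/ 1 <= k)%Z as [|[|]] by lia; subst; nia.
    - exists (6 * P * k ^ 2 + k * (7 * P - 6 * J) + (2 * P - 3 * J))%Z; split; [rewrite E; ring|].
      assert (k <= -1 \/ k = 0 \/ 1 <= k)%Z as [|[|]] by lia; subst; nia.
    - exists (6 * P * k ^ 2 - k * (7 * P - 6 * J) + (2 * P - 3 * J))%Z; split; [rewrite E; ring|].
      assert (k <= -1 \/ k = 0 \/ 1 <= k)%Z as [|[|]] by lia; subst; nia.
    - exists (6 * P * k ^ 2 + k * (6 * J + P) + J)%Z; split; [rewrite E; ring|].
      assert (k <= -1 \/ k = 0 \/ 1 <= k)%Z as [|[|]] by lia; subst; nia.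
    - exists (6 * P * k ^ 2 - k * (6 * J + P) + J)%Z; split; [rewrite E; ring|].
      assert (k <= -1 \/ k = 0 \/ 1 <= k)%Z as [|[|]] by lia; subst; nia.
    - exists (6 * P * k ^ 2 + k * (5 * P - 6 * J) + (P - 2 * J))%Z; split; [rewrite E; ring|].
      assert (k <= -1 \/ k = 0 \/ 1 <= k)%Z as [|[|]] by lia; subst; nia.
    - exists (6 * P * k ^ 2 - k * (5 * P - 6 * J) + (P - 2 * J))%Z; split; [rewrite E; ring|].
      assert (k <= -1 \/ k = 0 \/ 1 <= k)%Z as [|[|]] by lia; subst; nia. }
  destruct Hd as [e [He [H1 H2]]]; exists e; split; [exact He|].
  assert (0 <= N ^ 2 - (6 * J - P) ^ 2)%Z by nia.
  nia. }
destruct H as [e [He He0]].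
unfold phi_exp; fold P J N; rewrite He, Z.mul_comm, Z.div_mul by lia.
rewrite INR_IZR_INZ, Z2Nat.id by exact He0.
assert (HeR : INR n ^ 2 - (6 * INR j - INR p) ^ 2 = 24 * INR p * IZR e).
{ rewrite !INR_IZR_INZ; fold P J N.
  replace (IZR N ^ 2 - (6 * IZR J - IZR P) ^ 2)%R with (IZR (N ^ 2 - (6 * J - P) ^ 2)).
  - rewrite He, !mult_IZR; reflexivity.
  - rewrite minus_IZR, !Z.pow_2_r, !mult_IZR, minus_IZR, mult_IZR; ring. }
assert (HpR : INR p <> 0) by (apply not_0_INR; lia).
unfold Delta; rewrite mult_IZR; unfold P; rewrite <- INR_IZR_INZ.
apply Rmult_eq_reg_l with (24 * INR p); [|lra].
rewrite <- HeR; field; exact HpR.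
Qed.

Lemma Phi_Psi (p j : nat) (x : R) : (1 <= j)%nat -> (2 * j < p)%nat ->
  0 < x < 1 ->
  let P := Z.of_nat p in let J := Z.of_nat j in
  Phi p j (RtoC x)
  = RtoC (Rpower x (- Delta p j)
          * (Psi (6 * P) (6 * J - P) x + Psi (6 * P) (7 * P - 6 * J) x
             + Psi (6 * P) (6 * J + P) x + Psi (6 * P) (5 * P - 6 * J) x)).
Proof.
intros Hj Hp Hx P J; unfold Phi.
rewrite (Cseries_real _ (fun n => IZR (phi_coef p j n) * x ^ phi_exp p j n)).
2:{ intros n; rewrite <- RtoC_pow, RtoC_mult; reflexivity. }
rewrite (theta_shift _ _ (IZR (6 * P)) (Delta p j));
  [|apply Hx | intros n; apply phi_exp_eq; assumption].
f_equal; f_equal; unfold Psi.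
assert (HP : (0 < 6 * P)%Z) by (unfold P; lia).
rewrite <- !Series_plus;
  repeat (apply (@ex_series_plus R_AbsRing R_NormedModule)); try (apply ex_Psi; assumption).
apply Series_ext; intros n; unfold phi_coef; fold P J; rewrite !plus_IZR; ring.
Qed.

Lemma Phi3_1_neg (x : R) : 0 < x < 1 ->
  (RtoC (Rpower x (- (2 / 3))) * Phi3_1 (- RtoC x))%C = RtoC (Psi 3 2 x).
Proof.
intros Hx; unfold Phi3_1.
rewrite (Cseries_real _ (fun n => IZR (psi 3 2 n) * x ^ ((n ^ 2 + 8) / 12)%nat)).
2:{ intros n; replace (- - RtoC x)%C with (RtoC x) by ring; rewrite <- RtoC_pow, RtoC_mult; reflexivity. }
rewrite (theta_shift _ _ 3 (- (2 / 3))); [|apply Hx|].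
- rewrite <- RtoC_mult; f_equal; unfold Psi.
  rewrite <- Rmult_assoc, <- Rpower_plus.
  replace (- (2 / 3) + - - (2 / 3)) with 0 by ring.
  rewrite Rpower_O by apply Hx; ring.
- intros n E; apply psi_neq0 in E; [|lia].
  assert (H : exists e : nat, (n ^ 2 + 8 = e * 12)%nat).
  { destruct E as [k [E|E]].
    - exists (Z.to_nat (3 * k ^ 2 + 2 * k + 1)); fin.
    - exists (Z.to_nat (3 * k ^ 2 - 2 * k + 1)); fin. }
  destruct H as [e He]; rewrite He, Nat.div_mul by lia.
  apply (f_equal INR) in He.
  rewrite plus_INR, mult_INR, pow_INR in He; simpl in He |- *; lra.
Qed.

Lemma Phi3_1_pos (x : R) : 0 < x < 1 ->
  (RtoC (Rpower x (- (2 / 3))) * Phi3_1 (RtoC x))%C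
  = RtoC (- Psi 6 2 (x ^ 2) - Psi 6 4 (x ^ 2)).
Proof.
intros Hx; unfold Phi3_1.
set (c := fun n => (- (psi 6 2 n + psi 6 4 n))%Z).
assert (Hc : forall n, (IZR (psi 3 2 n) * (- x) ^ ((n ^ 2 + 8) / 12)%nat
                        = IZR (c n) * x ^ ((n ^ 2 + 8) / 12)%nat)%R).
{ intros n; pose (r := (Z.of_nat n mod 12)%Z).
  pose (k := (Z.of_nat n / 12)%Z).
  assert (Hn : Z.of_nat n = (12 * k + r)%Z) by (apply Z.div_mod; lia).
  assert (Hr : (0 <= r < 12)%Z) by (apply Z.mod_pos_bound; lia).
  assert (Hk : (0 <= k)%Z) by (apply Z.div_pos; lia).
  assert (Hm6 : forall u v w : Z, (u = 6 * w + v)%Z -> (u mod (2 * 3) = v mod 6)%Z).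
  { intros u v w ->; replace (6 * w + v)%Z with (v + w * 6)%Z by ring.
    change (2 * 3)%Z with 6%Z; apply Z.mod_add; lia. }
  assert (Hm12 : forall u v w : Z, (u = 12 * w + v)%Z -> (u mod (2 * 6) = v mod 12)%Z).
  { intros u v w ->; replace (12 * w + v)%Z with (v + w * 12)%Z by ring.
    change (2 * 6)%Z with 12%Z; apply Z.mod_add; lia. }
  unfold c, psi.
  rewrite (Hm6 (Z.of_nat n - 2)%Z (r - 2)%Z (2 * k)%Z), (Hm6 (Z.of_nat n + 2)%Z (r + 2)%Z (2 * k)%Z),
    (Hm12 (Z.of_nat n - 2)%Z (r - 2)%Z k), (Hm12 (Z.of_nat n + 2)%Z (r + 2)%Z k),
    (Hm12 (Z.of_nat n - 4)%Z (r - 4)%Z k), (Hm12 (Z.of_nat n + 4)%Z (r + 4)%Z k) by lia.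
  assert (Hodd : forall e f : nat, (e = 2 * f + 1)%nat -> (- x) ^ e = - x ^ e).
  { intros e f ->; rewrite !pow_add, !pow_mult; simpl.
    replace (- x * (- x * 1)) with (x * (x * 1)) by ring; ring. }
  assert (Heven : forall e f : nat, (e = 2 * f)%nat -> (- x) ^ e = x ^ e).
  { intros e f ->; rewrite !pow_mult; simpl.
    replace (- x * (- x * 1)) with (x * (x * 1)) by ring; ring. }
  clearbody r k.
  assert (Hnn : n = Z.to_nat (12 * k + r)) by lia.
  assert (Hdiv : forall e : nat, (n ^ 2 + 8 = e * 12)%nat -> ((n ^ 2 + 8) / 12 = e)%nat).
  { intros e ->; apply Nat.div_mul; lia. }
  assert (r = 0 \/ r = 1 \/ r = 2 \/ r = 3 \/ r = 4 \/ r = 5 \/ r = 6 \/ r = 7 \/ r = 8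
          \/ r = 9 \/ r = 10 \/ r = 11)%Z as Hcases by lia.
  destruct Hcases as [->|[->|[->|[->|[->|[->|[->|[->|[->|[->|[->| ->]]]]]]]]]]];
    cbn -[Nat.div Nat.pow Z.of_nat]; try ring.
  - rewrite (Hodd _ (Z.to_nat (6 * k ^ 2 + 2 * k))); [ring|].
    apply Hdiv; fin.
  - rewrite (Heven _ (Z.to_nat (6 * k ^ 2 + 4 * k + 1))); [ring|].
    apply Hdiv; fin.
  - rewrite (Heven _ (Z.to_nat (6 * k ^ 2 + 8 * k + 3))); [ring|].
    apply Hdiv; fin.
  - rewrite (Hodd _ (Z.to_nat (6 * k ^ 2 + 10 * k + 4))); [ring|].
    apply Hdiv; fin. }
rewrite (Cseries_real _ (fun n => IZR (c n) * x ^ ((n ^ 2 + 8) / 12)%nat)).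
2:{ intros n; rewrite <- Hc, <- RtoC_opp, <- RtoC_pow, RtoC_mult; reflexivity. }
rewrite (theta_shift _ _ 3 (- (2 / 3))); [|apply Hx|].
- rewrite <- RtoC_mult; f_equal; unfold Psi.
  rewrite <- Rmult_assoc, <- Rpower_plus.
  replace (- (2 / 3) + - - (2 / 3)) with 0 by ring.
  rewrite Rpower_O, Rmult_1_l by apply Hx.
  unfold Rminus; rewrite <- Ropp_plus_distr.
  assert (Hx2 : 0 < x ^ 2 < 1) by (simpl; nra).
  rewrite <- Series_plus by (apply ex_Psi; [lia|exact Hx2]).
  rewrite <- Series_opp; apply Series_ext; intros n.
  unfold c; rewrite opp_IZR, plus_IZR.
  replace (x ^ 2) with (Rpower x 2) by (rewrite <- Rpower_pow by apply Hx; f_equal; simpl; lra).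
  rewrite Rpower_mult.
  replace (2 * (INR n ^ 2 / (4 * 6))) with (INR n ^ 2 / (4 * 3)) by field; ring.
- intros n E.
  assert (H3 : psi 3 2 n <> 0%Z).
  { intros H0; specialize (Hc n); rewrite H0, Rmult_0_l in Hc; symmetry in Hc.
    apply Rmult_integral in Hc; destruct Hc as [Hc|Hc].
    - apply E; apply eq_IZR; exact Hc.
    - apply (pow_nonzero x ((n ^ 2 + 8) / 12)); [lra|exact Hc]. }
  apply psi_neq0 in H3; [|lia].
  assert (H : exists e : nat, (n ^ 2 + 8 = e * 12)%nat).
  { destruct H3 as [k [E3|E3]].
    - exists (Z.to_nat (3 * k ^ 2 + 2 * k + 1)); fin.
    - exists (Z.to_nat (3 * k ^ 2 - 2 * k + 1)); fin. }
  destruct H as [e He]; rewrite He, Nat.div_mul by lia.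
  apply (f_equal INR) in He.
  rewrite plus_INR, mult_INR, pow_INR in He; simpl in He |- *; lra.
Qed.

Lemma Phi3_2_Psi (x : R) : 0 < x < 1 ->
  Phi3_2 (RtoC x)
  = RtoC (2 * Rpower x (- (1 / 24)) * (Psi 6 1 x - Psi 6 5 x)).
Proof.
intros Hx; unfold Phi3_2.
rewrite (Cseries_real _ (fun n => IZR (psi 6 1 n - psi 6 5 n) * x ^ ((n ^ 2 - 1) / 24)%nat)).
2:{ intros n; rewrite <- RtoC_pow, RtoC_mult; reflexivity. }
rewrite (theta_shift _ _ 6 (1 / 24)); [|apply Hx|].
- rewrite <- RtoC_mult; f_equal; rewrite Rmult_assoc; f_equal; f_equal; unfold Psi.
  rewrite <- Series_minus by (apply ex_Psi; [lia|exact Hx]).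
  apply Series_ext; intros n; rewrite minus_IZR; ring.
- intros n E.
  assert (Hcase : psi 6 1 n <> 0%Z \/ psi 6 5 n <> 0%Z) by lia.
  assert (H : exists e : nat, (n ^ 2 = 1 + e * 24)%nat).
  { destruct Hcase as [E1|E1]; apply psi_neq0 in E1; try lia; destruct E1 as [k [E1|E1]].
    - exists (Z.to_nat (6 * k ^ 2 + k)); fin.
    - exists (Z.to_nat (6 * k ^ 2 - k)); fin.
    - exists (Z.to_nat (6 * k ^ 2 + 5 * k + 1)); fin.
    - exists (Z.to_nat (6 * k ^ 2 - 5 * k + 1)); fin. }
  destruct H as [e He].
  replace (n ^ 2 - 1)%nat with (e * 24)%nat by lia; rewrite Nat.div_mul by lia.
  apply (f_equal INR) in He.
  rewrite plus_INR, mult_INR, pow_INR in He; simpl in He |- *; lra.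
Qed.

(* Main.v *)
From Stdlib Require Import Reals ZArith List Bool Lia Lra Psatz Classical ClassicalEpsilon.
From Coquelicot Require Import Coquelicot.
Require Import Defs.
Import ListNotations.
Open Scope R_scope.

(** Expanding the hyperbolic quotient geometrically and rescaling, every Mordell
    integral becomes S(w) / w with w^2 = t, where S is the sum over k of
    L((al + N k) w) - L((N - al + N k) w) and L is the Laplace transform of the
    Gaussian exp (- c s^2). The recursion of L under integration by parts gives
    its asymptotic expansion, so the series converges up to the imaginary axis
    and S / w is the continuation to t = - T +- i0, at w = +- i sqrt T. There
    the real part of L is a Gaussian, whose sum is a false theta series in Q,
    and the imaginary part is a Dawson-type sine transform, whose sum is
    evaluated by the Fejer kernel (Poisson summation) as a sine series in the
    Gaussians of Q_1. A finite Fourier identity, checked on one period of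
    the coefficients, turns this sine series into the matrix M applied to the
    same false theta vector.

    For uniqueness, applying t -> pi^2/t twice to the difference x of two
    solutions gives x = - M (M x) with M real symmetric, hence x = 0 on the real
    ray Q > 1. The identity theorem on |Q| > 1 follows from the one on a
    half-plane by composing with exp; it rests on Goursat's theorem and the
    Cauchy formula, since holomorphy is mere complex differentiability. *)

(** * Complex preliminaries *)

(** The obstacle on the analytic side is conditional convergence. One Laplace transform decays only
    like 1/z, so neither member of a pair [al], [N - al] can be summed alone; the difference of the
    leading terms is of order 1/n^2, and the later terms converge separately. On the imaginary axis
    the slow decay survives in the imaginary part. The sums are there first known to converge, and
    the Cesàro means, integrals against a positive kernel, then identify the limit. The variable w
    with w^2 = t resolves the Stokes line: the two sides of the cut become the two halves of the
    imaginary axis. At conjugate points the real parts agree and the imaginary parts change sign,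
    whence the factor [- sgn s] in the law. The obstacle on the uniqueness side is that mere
    differentiability does not allow differentiation under the integral sign. A primitive is
    therefore built first, and the Cauchy formula is proved for the primitive, whose derivative is
    continuous. *)

Lemma C_ext (z w : C) : Re z = Re w -> Im z = Im w -> z = w.
Proof. destruct z, w; simpl; intros; subst; reflexivity. Qed.

Lemma Cexp_plus (a b : C) : Cexp (a + b) = (Cexp a * Cexp b)%C.
Proof.
destruct a as [a1 a2], b as [b1 b2]; apply C_ext; unfold Cexp; simpl;
  rewrite exp_plus, ?cos_plus, ?sin_plus; ring.
Qed.

Lemma Cexp_0 : Cexp 0 = 1%C.
Proof. apply C_ext; unfold Cexp; simpl; rewrite exp_0, ?cos_0, ?sin_0; ring. Qed.

Lemma Cmod_Cexp (z : C) : Cmod (Cexp z) = exp (Re z).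
Proof.
unfold Cmod, Cexp; cbn [fst snd].
replace ((exp (Re z) * cos (Im z)) ^ 2 + (exp (Re z) * sin (Im z)) ^ 2)
  with (exp (Re z) ^ 2 * ((sin (Im z))² + (cos (Im z))²)) by (unfold Rsqr; ring).
rewrite sin2_cos2, Rmult_1_r; apply sqrt_pow2; left; apply exp_pos.
Qed.

Lemma Cexp_RtoC (x : R) : Cexp (RtoC x) = RtoC (exp x).
Proof. apply C_ext; unfold Cexp; simpl; rewrite ?cos_0, ?sin_0; ring. Qed.

Lemma Im_le_Cmod (z : C) : Rabs (Im z) <= Cmod z.
Proof.
apply Rle_trans with (2 := Rmax_Cmod z); apply Rmax_r.
Qed.

Lemma Cmod_le_ReIm (z : C) : Cmod z <= Rabs (Re z) + Rabs (Im z).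
Proof.
rewrite <- (Rabs_pos_eq (Rabs (Re z) + Rabs (Im z)))
  by (pose proof (Rabs_pos (Re z)); pose proof (Rabs_pos (Im z)); lra).
rewrite <- sqrt_Rsqr_abs; apply sqrt_le_1_alt; unfold Rsqr.
pose proof (Rabs_pos (Re z)); pose proof (Rabs_pos (Im z)).
change (fst z) with (Re z); change (snd z) with (Im z).
rewrite <- (pow2_abs (Re z)), <- (pow2_abs (Im z)); nra.
Qed.

Lemma Cmod_minus_sym (x y : C) : Cmod (x - y) = Cmod (y - x).
Proof. rewrite <- Cmod_opp; f_equal; ring. Qed.

Lemma Cmod_triangle_minus (x y : C) : Cmod (x - y) <= Cmod x + Cmod y.
Proof. unfold Cminus; rewrite <- (Cmod_opp y); apply Cmod_triangle. Qed.

Lemma Cmod_triangle_inv (x y : C) : Cmod x - Cmod y <= Cmod (x + y).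
Proof.
assert (H := Cmod_triangle_minus (x + y) y).
replace (x + y - y)%C with x in H by ring; lra.
Qed.

Lemma Cmod_RtoC_pos (x : R) : 0 <= x -> Cmod (RtoC x) = x.
Proof. intros H; rewrite Cmod_R; apply Rabs_pos_eq, H. Qed.

Notation is_deriveC := (@is_derive R_AbsRing C_R_NormedModule).
Notation is_Cderive := (@is_derive C_AbsRing C_NormedModule).
Notation CRInt := (@RInt C_R_CompleteNormedModule).
Notation is_CRInt := (@is_RInt C_R_NormedModule).
Notation ex_CRInt := (@ex_RInt C_R_NormedModule).
Notation Ccontinuous := (@continuous R_UniformSpace C_UniformSpace).

(** The balls of the uniform structure on [C] are squares, since it is a product; the factor
    [sqrt 2] compares them with discs. From here on limits and continuity are handled with
    [Cmod]. *)
Lemma locally_C_Cmod (z : C) (P : C -> Prop) :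
  @locally C_UniformSpace z P <->
  exists d : posreal, forall w : C, Cmod (w - z) < d -> P w.
Proof.
split; intros [d Hd].
- exists d; intros w Hw; apply Hd, C_NormedModule_mixin_compat1, Hw.
- assert (H2 : 0 < sqrt 2) by (apply sqrt_lt_R0; lra).
  assert (Hd' : 0 < d / sqrt 2) by (apply Rdiv_lt_0_compat; [apply d|exact H2]).
  exists (mkposreal _ Hd'); intros w Hw; apply Hd.
  apply C_NormedModule_mixin_compat2 in Hw; simpl in Hw.
  replace (sqrt 2 * (d / sqrt 2)) with (d : R) in Hw by (field; lra).
  exact Hw.
Qed.

Lemma filterlim_C_Cmod {T : Type} (F : (T -> Prop) -> Prop) {FF : Filter F}
  (f : T -> C) (l : C) :
  filterlim f F (@locally C_UniformSpace l) <->
  forall eps : posreal, F (fun x => Cmod (f x - l) < eps).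
Proof.
split.
- intros H eps; apply (H (fun w => Cmod (w - l) < eps)).
  apply locally_C_Cmod; exists eps; auto.
- intros H P HP; apply locally_C_Cmod in HP; destruct HP as [d Hd].
  unfold filtermap; generalize (H d); apply filter_imp; intros x; apply Hd.
Qed.

Lemma Ccontinuous_pair (f : R -> C) (x : R) :
  continuous (fun s => Re (f s)) x -> continuous (fun s => Im (f s)) x ->
  Ccontinuous f x.
Proof.
intros H1 H2; apply filterlim_C_Cmod; [apply locally_filter|intros eps].
assert (He : 0 < eps / 2) by (generalize (cond_pos eps); lra).
assert (G1 := proj1 (filterlim_locally _ _) H1 (mkposreal _ He)).
assert (G2 := proj1 (filterlim_locally _ _) H2 (mkposreal _ He)).
generalize (filter_and _ _ G1 G2); apply filter_imp; intros y [A B].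
apply Rle_lt_trans with (1 := Cmod_le_ReIm _).
change (Rabs (Re (f y) - Re (f x)) < eps / 2) in A.
change (Rabs (Im (f y) - Im (f x)) < eps / 2) in B.
replace (Re (f y - f x)) with (Re (f y) - Re (f x)) by reflexivity.
replace (Im (f y - f x)) with (Im (f y) - Im (f x)) by reflexivity.
lra.
Qed.

Lemma Ccontinuous_Re (f : R -> C) (x : R) :
  Ccontinuous f x -> continuous (fun s => Re (f s)) x.
Proof.
intros H; apply filterlim_locally; intros eps.
generalize (proj1 (filterlim_C_Cmod _ _ _) H eps); apply filter_imp; intros y Hy.
change (Rabs (Re (f y) - Re (f x)) < eps).
replace (Re (f y) - Re (f x)) with (Re (f y - f x)) by reflexivity.
apply Rle_lt_trans with (1 := re_le_Cmod _), Hy.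
Qed.

Lemma Ccontinuous_Im (f : R -> C) (x : R) :
  Ccontinuous f x -> continuous (fun s => Im (f s)) x.
Proof.
intros H; apply filterlim_locally; intros eps.
generalize (proj1 (filterlim_C_Cmod _ _ _) H eps); apply filter_imp; intros y Hy.
change (Rabs (Im (f y) - Im (f x)) < eps).
replace (Im (f y) - Im (f x)) with (Im (f y - f x)) by reflexivity.
apply Rle_lt_trans with (1 := Im_le_Cmod _), Hy.
Qed.

Lemma Ccontinuous_mult (f g : R -> C) (x : R) :
  Ccontinuous f x -> Ccontinuous g x -> Ccontinuous (fun s => f s * g s)%C x.
Proof.
intros Hf Hg.
assert (F1 := Ccontinuous_Re _ _ Hf). assert (F2 := Ccontinuous_Im _ _ Hf).
assert (G1 := Ccontinuous_Re _ _ Hg). assert (G2 := Ccontinuous_Im _ _ Hg).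
pose (f1 := fun s => Re (f s)); pose (f2 := fun s => Im (f s)).
pose (g1 := fun s => Re (g s)); pose (g2 := fun s => Im (g s)).
apply Ccontinuous_pair.
- change (continuous (fun s => f1 s * g1 s - f2 s * g2 s) x).
  apply (continuous_minus (V := R_NormedModule) (fun s => f1 s * g1 s) (fun s => f2 s * g2 s)).
  + exact (continuous_mult (K := R_AbsRing) f1 g1 x F1 G1).
  + exact (continuous_mult (K := R_AbsRing) f2 g2 x F2 G2).
- change (continuous (fun s => f1 s * g2 s + f2 s * g1 s) x).
  apply (continuous_plus (V := R_NormedModule) (fun s => f1 s * g2 s) (fun s => f2 s * g1 s)).
  + exact (continuous_mult (K := R_AbsRing) f1 g2 x F1 G2).
  + exact (continuous_mult (K := R_AbsRing) f2 g1 x F2 G1).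
Qed.

Lemma Ccontinuous_plus (f g : R -> C) (x : R) :
  Ccontinuous f x -> Ccontinuous g x -> Ccontinuous (fun s => f s + g s)%C x.
Proof. apply (@continuous_plus R_UniformSpace R_AbsRing C_R_NormedModule). Qed.

Lemma Ccontinuous_minus (f g : R -> C) (x : R) :
  Ccontinuous f x -> Ccontinuous g x -> Ccontinuous (fun s => f s - g s)%C x.
Proof. apply (@continuous_minus R_UniformSpace R_AbsRing C_R_NormedModule). Qed.

Lemma Ccontinuous_const (c : C) (x : R) : Ccontinuous (fun _ => c) x.
Proof. apply continuous_const. Qed.

Lemma is_deriveC_pair (f : R -> C) (x : R) (l : C) :
  is_derive (fun s => Re (f s)) x (Re l) ->
  is_derive (fun s => Im (f s)) x (Im l) -> is_deriveC f x l.
Proof.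
intros [_ H1] [_ H2]; split; [apply is_linear_scal_l|].
intros y Hy eps.
assert (He : 0 < eps / 2) by (generalize (cond_pos eps); lra).
generalize (filter_and _ _ (H1 y Hy (mkposreal _ He)) (H2 y Hy (mkposreal _ He))).
apply filter_imp; intros z [A B]; simpl in A, B.
set (e := minus (minus (f z) (f y)) (scal (minus z y) l)) in *.
change (@norm R_AbsRing C_R_NormedModule e <= eps * norm (minus z y)).
rewrite <- Cmod_norm.
apply Rle_trans with (1 := Cmod_le_ReIm _).
change (Rabs (Re e) <= eps / 2 * norm (minus z y)) in A.
change (Rabs (Im e) <= eps / 2 * norm (minus z y)) in B.
lra.
Qed.

Lemma is_deriveC_Re (f : R -> C) (x : R) (l : C) :
  is_deriveC f x l -> is_derive (fun s => Re (f s)) x (Re l).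
Proof.
intros [_ H1]; split; [apply is_linear_scal_l|].
intros y Hy eps; generalize (H1 y Hy eps); apply filter_imp; intros z A.
set (e := minus (minus (f z) (f y)) (scal (minus z y) l)) in *.
change (@norm R_AbsRing C_R_NormedModule e <= eps * norm (minus z y)) in A.
rewrite <- Cmod_norm in A.
change (Rabs (Re e) <= eps * norm (minus z y)).
apply Rle_trans with (1 := re_le_Cmod _), A.
Qed.

Lemma is_deriveC_Im (f : R -> C) (x : R) (l : C) :
  is_deriveC f x l -> is_derive (fun s => Im (f s)) x (Im l).
Proof.
intros [_ H1]; split; [apply is_linear_scal_l|].
intros y Hy eps; generalize (H1 y Hy eps); apply filter_imp; intros z A.
set (e := minus (minus (f z) (f y)) (scal (minus z y) l)) in *.
change (@norm R_AbsRing C_R_NormedModule e <= eps * norm (minus z y)) in A.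
rewrite <- Cmod_norm in A.
change (Rabs (Im e) <= eps * norm (minus z y)).
apply Rle_trans with (1 := Im_le_Cmod _), A.
Qed.

Lemma is_deriveC_mult (f g : R -> C) (x : R) (lf lg : C) :
  is_deriveC f x lf -> is_deriveC g x lg ->
  is_deriveC (fun s => f s * g s)%C x (lf * g x + f x * lg)%C.
Proof.
intros Hf Hg.
assert (F1 := is_deriveC_Re _ _ _ Hf). assert (F2 := is_deriveC_Im _ _ _ Hf).
assert (G1 := is_deriveC_Re _ _ _ Hg). assert (G2 := is_deriveC_Im _ _ _ Hg).
assert (M : forall u v a b, is_derive u x a -> is_derive v x b ->
   is_derive (fun s => u s * v s) x (a * v x + u x * b)).
{ intros u v a b Hu Hv; apply (is_derive_mult u v x a b Hu Hv); intros; apply Rmult_comm. }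
apply is_deriveC_pair.
- evar_last.
  + apply @is_derive_minus; apply M; eassumption.
  + unfold minus, plus, opp; simpl; unfold Re, Im; ring.
- evar_last.
  + apply @is_derive_plus; apply M; eassumption.
  + unfold minus, plus, opp; simpl; unfold Re, Im; ring.
Qed.

Lemma is_deriveC_Cexp (f : R -> C) (x : R) (l : C) :
  is_deriveC f x l -> is_deriveC (fun s => Cexp (f s)) x (l * Cexp (f x))%C.
Proof.
intros H; assert (H1 := is_deriveC_Re _ _ _ H); assert (H2 := is_deriveC_Im _ _ _ H).
pose (u := fun s => Re (f s)); pose (v := fun s => Im (f s)).
change (is_derive u x (Re l)) in H1; change (is_derive v x (Im l)) in H2.
assert (E1 : Derive (fun s : R => u s) x = Re l) by apply is_derive_unique, H1.
assert (E2 : Derive (fun s : R => v s) x = Im l) by apply is_derive_unique, H2.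
apply is_deriveC_pair.
- change (is_derive (fun s => exp (u s) * cos (v s)) x
    (Re l * (exp (u x) * cos (v x)) - Im l * (exp (u x) * sin (v x)))).
  clearbody u v; auto_derive.
  + split; [eexists; exact H1|split; [eexists; exact H2|exact I]].
  + rewrite E1, E2; ring.
- change (is_derive (fun s => exp (u s) * sin (v s)) x
    (Re l * (exp (u x) * sin (v x)) + Im l * (exp (u x) * cos (v x)))).
  clearbody u v; auto_derive.
  + split; [eexists; exact H1|split; [eexists; exact H2|exact I]].
  + rewrite E1, E2; ring.
Qed.

Lemma is_deriveC_continuous (f : R -> C) (x : R) (l : C) :
  is_deriveC f x l -> Ccontinuous f x.
Proof. intros H; apply (@ex_derive_continuous R_AbsRing C_R_NormedModule); exists l; exact H. Qed.

Lemma is_Cderive_eps (f : C -> C) (z l : C) :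
  is_Cderive f z l <->
  forall eps : R, 0 < eps -> exists d : R, 0 < d /\
    forall h : C, Cmod h < d -> Cmod (f (z + h)%C - f z - h * l)%C <= eps * Cmod h.
Proof.
split.
- intros [_ H] eps He.
  destruct (H z (fun P HP => HP) (mkposreal _ He)) as [d Hd].
  exists d; split; [apply d|intros h Hh].
  assert (E : (z + h - z)%C = h) by ring.
  assert (Hb : Cmod (z + h - z)%C < d) by (rewrite E; exact Hh).
  specialize (Hd (z + h)%C Hb).
  change (Cmod (f (z + h)%C - f z - (z + h - z) * l)%C
          <= eps * Cmod (z + h - z)%C) in Hd.
  rewrite E in Hd; exact Hd.
- intros H; split; [apply is_linear_scal_l|].
  intros y Hy eps.
  assert (Ey : z = y) by (apply (@is_filter_lim_locally_unique C_AbsRing (AbsRing_NormedModule C_AbsRing)); exact Hy); subst y.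
  destruct (H eps (cond_pos eps)) as [d [Hd Hh]].
  exists (mkposreal d Hd); intros w Hw.
  specialize (Hh (w - z)%C Hw).
  assert (E : forall a b : C, (b + (a - b))%C = a) by (intros; ring).
  rewrite (E w z) in Hh; exact Hh.
Qed.

(** Quadratic remainders, unlike little-o estimates, add up over a series with summable constants.
    The derivatives of the exponential, the inverse, the square root and of series are obtained in
    this form. [M] has no prescribed sign, whence [Rabs M + 1] in the proof. *)
Lemma is_Cderive_quad (f : C -> C) (z l : C) (M d : R) :
  0 < d ->
  (forall h : C, Cmod h < d -> Cmod (f (z + h)%C - f z - h * l)%C <= M * Cmod h ^ 2) ->
  is_Cderive f z l.
Proof.
intros Hd H; apply is_Cderive_eps; intros eps He.
set (M' := Rabs M + 1); assert (HM' : 0 < M') by (unfold M'; pose proof (Rabs_pos M); lra).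
exists (Rmin d (eps / M')); split.
- apply Rmin_glb_lt; [exact Hd|apply Rdiv_lt_0_compat; assumption].
- intros h Hh; apply Rle_trans with (1 := H h (Rlt_le_trans _ _ _ Hh (Rmin_l _ _))).
  assert (Hh2 := Rlt_le_trans _ _ _ Hh (Rmin_r _ _)).
  assert (H0 := Cmod_ge_0 h).
  assert (M <= M') by (unfold M'; pose proof (Rle_abs M); lra).
  assert (M' * Cmod h <= eps).
  { apply Rmult_lt_compat_l with (r := M') in Hh2; [|exact HM'].
    replace (M' * (eps / M')) with eps in Hh2 by (field; lra); lra. }
  simpl; rewrite Rmult_1_r, <- Rmult_assoc; apply Rmult_le_compat_r; [exact H0|].
  nra.
Qed.

(** * Integrals of complex-valued functions *)

Lemma is_CRInt_Re (f : R -> C) (a b : R) (l : C) :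
  is_CRInt f a b l -> is_RInt (fun s => Re (f s)) a b (Re l).
Proof. exact (@is_RInt_fct_extend_fst R_NormedModule R_NormedModule f a b l). Qed.

Lemma is_CRInt_Im (f : R -> C) (a b : R) (l : C) :
  is_CRInt f a b l -> is_RInt (fun s => Im (f s)) a b (Im l).
Proof. exact (@is_RInt_fct_extend_snd R_NormedModule R_NormedModule f a b l). Qed.

Lemma is_CRInt_pair (f : R -> C) (a b u v : R) :
  is_RInt (fun s => Re (f s)) a b u -> is_RInt (fun s => Im (f s)) a b v ->
  is_CRInt f a b (u, v).
Proof. exact (@is_RInt_fct_extend_pair R_NormedModule R_NormedModule f a b u v). Qed.

Lemma is_CRInt_Cmult (c : C) (f : R -> C) (a b : R) (l : C) :
  is_CRInt f a b l -> is_CRInt (fun s => c * f s)%C a b (c * l)%C.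
Proof.
intros H; assert (H1 := is_CRInt_Re _ _ _ _ H); assert (H2 := is_CRInt_Im _ _ _ _ H).
apply is_CRInt_pair.
- apply (is_RInt_minus (V := R_NormedModule) (fun s => Re c * Re (f s)) (fun s => Im c * Im (f s))).
  + exact (is_RInt_scal (V := R_NormedModule) _ _ _ (Re c) _ H1).
  + exact (is_RInt_scal (V := R_NormedModule) _ _ _ (Im c) _ H2).
- apply (is_RInt_plus (V := R_NormedModule) (fun s => Re c * Im (f s)) (fun s => Im c * Re (f s))).
  + exact (is_RInt_scal (V := R_NormedModule) _ _ _ (Re c) _ H2).
  + exact (is_RInt_scal (V := R_NormedModule) _ _ _ (Im c) _ H1).
Qed.

Lemma ex_CRInt_continuous (f : R -> C) (a b : R) :
  (forall x, Rmin a b <= x <= Rmax a b -> Ccontinuous f x) -> ex_CRInt f a b.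
Proof. exact (@ex_RInt_continuous C_R_CompleteNormedModule f a b). Qed.

Lemma CRInt_correct (f : R -> C) (a b : R) :
  ex_CRInt f a b -> is_CRInt f a b (CRInt f a b).
Proof. exact (@RInt_correct C_R_CompleteNormedModule f a b). Qed.

Lemma CRInt_unique (f : R -> C) (a b : R) (l : C) :
  is_CRInt f a b l -> CRInt f a b = l.
Proof. exact (@is_RInt_unique C_R_CompleteNormedModule f a b l). Qed.

Lemma CRInt_Cmult (c : C) (f : R -> C) (a b : R) :
  ex_CRInt f a b -> CRInt (fun s => c * f s)%C a b = (c * CRInt f a b)%C.
Proof. intros H; apply CRInt_unique, is_CRInt_Cmult, CRInt_correct, H. Qed.

Lemma CRInt_norm_le (f : R -> C) (g : R -> R) (a b : R) (l : C) (lg : R) :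
  a <= b -> (forall x, a <= x <= b -> Cmod (f x) <= g x) ->
  is_CRInt f a b l -> is_RInt g a b lg -> Cmod l <= lg.
Proof.
intros Hab H Hf Hg; rewrite Cmod_norm.
apply (norm_RInt_le (V := C_R_NormedModule) f g a b l lg Hab); try assumption.
intros x Hx; rewrite <- Cmod_norm; apply H, Hx.
Qed.

Lemma CRInt_norm_const (f : R -> C) (a b M : R) (l : C) :
  a <= b -> (forall x, a <= x <= b -> Cmod (f x) <= M) ->
  is_CRInt f a b l -> Cmod l <= M * (b - a).
Proof.
intros Hab H Hf.
apply (CRInt_norm_le f (fun _ => M) a b l _ Hab H Hf).
rewrite Rmult_comm; exact (is_RInt_const (V := R_NormedModule) a b M).
Qed.

Lemma is_CRInt_derive (f df : R -> C) (a b : R) :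
  (forall x, Rmin a b <= x <= Rmax a b -> is_deriveC f x (df x)) ->
  (forall x, Rmin a b <= x <= Rmax a b -> Ccontinuous df x) ->
  is_CRInt df a b (f b - f a)%C.
Proof. exact (is_RInt_derive (V := C_R_CompleteNormedModule) f df a b). Qed.

Lemma is_CRInt_plus (f g : R -> C) (a b : R) (lf lg : C) :
  is_CRInt f a b lf -> is_CRInt g a b lg ->
  is_CRInt (fun s => f s + g s)%C a b (lf + lg)%C.
Proof. exact (is_RInt_plus (V := C_R_NormedModule) f g a b lf lg). Qed.

Lemma is_CRInt_minus (f g : R -> C) (a b : R) (lf lg : C) :
  is_CRInt f a b lf -> is_CRInt g a b lg ->
  is_CRInt (fun s => f s - g s)%C a b (lf - lg)%C.
Proof. exact (is_RInt_minus (V := C_R_NormedModule) f g a b lf lg). Qed.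

Lemma is_CRInt_Chasles (f : R -> C) (a b c : R) (l1 l2 : C) :
  is_CRInt f a b l1 -> is_CRInt f b c l2 -> is_CRInt f a c (l1 + l2)%C.
Proof. exact (is_RInt_Chasles (V := C_R_NormedModule) f a b c l1 l2). Qed.

Lemma is_CRInt_ext (f g : R -> C) (a b : R) (l : C) :
  (forall x, Rmin a b < x < Rmax a b -> f x = g x) ->
  is_CRInt f a b l -> is_CRInt g a b l.
Proof. exact (is_RInt_ext (V := C_R_NormedModule) f g a b l). Qed.

(** An improper integral with its partial integrals named, so that sums, multiples and uniqueness
    are statements about limits of ordinary integrals; [is_CInt_CInt0oo] leads back to the
    generalized integral. *)
Definition is_CInt (g : R -> C) (l : C) : Prop :=
  exists I : R -> C,
    (forall b, 0 <= b -> is_CRInt g 0 b (I b)) /\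
    filterlim I (Rbar_locally p_infty) (@locally C_UniformSpace l).

Lemma is_CInt_CInt0oo (g : R -> C) (l : C) : is_CInt g l -> CInt0oo g = l.
Proof.
intros [I [H1 H2]]; unfold CInt0oo.
refine (@is_RInt_gen_unique C_R_CompleteNormedModule (at_point 0) (Rbar_locally p_infty)
  _ _ g l _).
- intros P HP; specialize (H2 P HP).
  destruct H2 as [M HM].
  exists (fun x => x = 0) (fun y => Rmax M 0 < y).
  + reflexivity.
  + exists (Rmax M 0); auto.
  + intros x y -> Hy; exists (I y); split.
    * apply H1; pose proof (Rmax_r M 0); simpl; lra.
    * apply HM; pose proof (Rmax_l M 0); lra.
Qed.

Lemma is_CInt_unique (g : R -> C) (l1 l2 : C) : is_CInt g l1 -> is_CInt g l2 -> l1 = l2.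
Proof.
intros H1 H2; rewrite <- (is_CInt_CInt0oo _ _ H1); apply is_CInt_CInt0oo, H2.
Qed.

Lemma is_CInt_ext (f g : R -> C) (l : C) :
  (forall s, 0 < s -> f s = g s) -> is_CInt f l -> is_CInt g l.
Proof.
intros H [I [H1 H2]]; exists I; split; [|exact H2].
intros b Hb; apply (is_CRInt_ext f); [|apply H1, Hb].
intros x [Hx _]; apply H; rewrite Rmin_left in Hx; assumption.
Qed.

Lemma is_CInt_plus (f g : R -> C) (lf lg : C) :
  is_CInt f lf -> is_CInt g lg -> is_CInt (fun s => f s + g s)%C (lf + lg)%C.
Proof.
intros [I [H1 H2]] [J [G1 G2]]; exists (fun b => I b + J b)%C; split.
- intros b Hb; apply is_CRInt_plus; auto.
- exact (filterlim_comp_2 _ _ _ H2 G2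
    (@filterlim_plus R_AbsRing C_R_NormedModule lf lg)).
Qed.

Lemma is_CInt_Cmult (c : C) (f : R -> C) (lf : C) :
  is_CInt f lf -> is_CInt (fun s => c * f s)%C (c * lf)%C.
Proof.
intros [I [H1 H2]]; exists (fun b => c * I b)%C; split.
- intros b Hb; apply is_CRInt_Cmult; auto.
- apply filterlim_C_Cmod; [apply Rbar_locally_filter|intros eps].
  assert (Hc := Cmod_ge_0 c).
  assert (He : 0 < eps / (Cmod c + 1)) by (apply Rdiv_lt_0_compat; [apply eps|lra]).
  generalize (proj1 (filterlim_C_Cmod _ _ _) H2 (mkposreal _ He)); apply filter_imp.
  intros b; simpl; intros Hb.
  replace (c * I b - c * lf)%C with (c * (I b - lf))%C by ring; rewrite Cmod_mult.
  apply Rle_lt_trans with (Cmod c * (eps / (Cmod c + 1))).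
  + apply Rmult_le_compat_l; lra.
  + apply Rmult_lt_reg_r with (Cmod c + 1); [lra|].
    replace (Cmod c * (eps / (Cmod c + 1)) * (Cmod c + 1)) with (Cmod c * eps) by (field; lra).
    generalize (cond_pos eps); nra.
Qed.

Lemma is_CInt_minus (f g : R -> C) (lf lg : C) :
  is_CInt f lf -> is_CInt g lg -> is_CInt (fun s => f s - g s)%C (lf - lg)%C.
Proof.
intros Hf Hg.
assert (H := is_CInt_plus _ _ _ _ Hf (is_CInt_Cmult (-(1))%C _ _ Hg)).
replace (lf - lg)%C with (lf + - (1) * lg)%C by ring.
revert H; apply is_CInt_ext; intros; ring.
Qed.

Lemma is_RInt_exp_decay (M lam a b : R) : lam <> 0 ->
  is_RInt (fun s => M * exp (- lam * s)) a b
    (M / lam * (exp (- lam * a) - exp (- lam * b))).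
Proof.
intros Hl.
replace (M / lam * (exp (- lam * a) - exp (- lam * b)))
  with (minus (- (M / lam) * exp (- lam * b)) (- (M / lam) * exp (- lam * a)))
  by (unfold minus, plus, opp; simpl; ring).
apply (is_RInt_derive (V := R_CompleteNormedModule) (fun s => - (M / lam) * exp (- lam * s))).
- intros x _; auto_derive; [exact I|field; exact Hl].
- intros x _; apply (@ex_derive_continuous R_AbsRing R_NormedModule); auto_derive; exact I.
Qed.

Lemma exp_decay_lim (lam : R) : 0 < lam ->
  filterlim (fun b => exp (- lam * b)) (Rbar_locally p_infty) (locally 0).
Proof.
intros Hl.
apply (is_lim_comp (fun x => exp x) (fun b => - lam * b) p_infty 0 m_infty).
- apply is_lim_exp_m.
- evar_last; [apply is_lim_scal_l, is_lim_id|].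
  simpl; destruct (Rle_dec 0 (- lam)); [exfalso; lra|reflexivity].
- exists 0; intros; discriminate.
Qed.

(** The bound is asked only for [s > 0], because the hyperbolic quotients have the form 0/0 at the
    origin. The explicit value [M / lam] matters later: it makes the remainders of the geometric
    expansion tend to 0 as [lam] grows. *)
Lemma is_CInt_dominated (g : R -> C) (M lam : R) : 0 < lam ->
  (forall b, 0 <= b -> ex_CRInt g 0 b) ->
  (forall s, 0 < s -> Cmod (g s) <= M * exp (- lam * s)) ->
  exists l : C, is_CInt g l /\ Cmod l <= M / lam.
Proof.
intros Hl Hex Hb.
(* the value at 0 is irrelevant to the integral *)
pose (g' := fun s => if Rle_dec s 0 then RtoC 0 else g s).
assert (HM : 0 <= M).
{ assert (H := Hb 1 Rlt_0_1); pose proof (Cmod_ge_0 (g 1)); pose proof (exp_pos (- lam * 1)).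
  apply Rmult_le_reg_r with (exp (- lam * 1)); lra. }
assert (Hg' : forall s, 0 <= s -> Cmod (g' s) <= M * exp (- lam * s)).
{ intros s Hs; unfold g'; destruct (Rle_dec s 0).
  - rewrite Cmod_0; apply Rmult_le_pos; [exact HM|left; apply exp_pos].
  - apply Hb; lra. }
assert (HI : forall b, 0 <= b -> is_CRInt g' 0 b (CRInt g 0 b)).
{ intros b Hb0; apply (is_CRInt_ext g); [|apply CRInt_correct, Hex, Hb0].
  intros x [Hx _]; rewrite Rmin_left in Hx by exact Hb0; unfold g'.
  destruct (Rle_dec x 0); [lra|reflexivity]. }
(* This tail estimate serves twice: it gives the Cauchy criterion at infinity and, with [b = 0], the
   bound on the limit. *)
assert (HD : forall b c, 0 <= b -> b <= c ->
  Cmod (CRInt g 0 c - CRInt g 0 b)%C <= M / lam * exp (- lam * b)).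
{ intros b c Hb0 Hbc.
  assert (Hd : is_CRInt g' b c (CRInt g 0 c - CRInt g 0 b)%C).
  { replace (CRInt g 0 c - CRInt g 0 b)%C with (- CRInt g 0 b + CRInt g 0 c)%C by ring.
    apply is_CRInt_Chasles with 0; [|apply HI; lra].
    apply (is_RInt_swap (V := C_R_NormedModule)), HI, Hb0. }
  apply Rle_trans with (M / lam * (exp (- lam * b) - exp (- lam * c))).
  - apply (CRInt_norm_le g' (fun s => M * exp (- lam * s)) b c _ _ Hbc).
    + intros x Hx; apply Hg'; lra.
    + exact Hd.
    + apply is_RInt_exp_decay; lra.
  - apply Rmult_le_compat_l; [apply Rdiv_le_0_compat; lra|].
    pose proof (exp_pos (- lam * c)); lra. }
assert (Hlim : filterlim (fun b => M / lam * exp (- lam * b)) (Rbar_locally p_infty) (locally 0)).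
{ replace 0 with (M / lam * 0) by ring.
  apply (filterlim_comp _ _ _ (fun b => exp (- lam * b)) (fun y => M / lam * y) _ (locally 0)).
  - apply exp_decay_lim, Hl.
  - apply (filterlim_scal_r (V := R_NormedModule) (M / lam) 0). }
assert (Hcv : exists l : C, filterlim (fun b => CRInt g 0 b) (Rbar_locally p_infty) (@locally C_UniformSpace l)).
{ refine (proj1 (@filterlim_locally_cauchy R C_R_CompleteNormedModule _ _ _) _); intros eps.
  destruct (proj1 (filterlim_locally _ _) Hlim eps) as [B HB].
  exists (fun b => Rmax B 0 < b); split; [exists (Rmax B 0); auto|].
  assert (Haux : forall u v : R, Rmax B 0 < u -> u <= v ->
    Cmod (CRInt g 0 v - CRInt g 0 u)%C < eps).
  { intros u v Hu Huv.
    pose proof (Rmax_l B 0); pose proof (Rmax_r B 0).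
    apply Rle_lt_trans with (1 := HD u v ltac:(lra) Huv).
    assert (Hu' := HB u ltac:(lra)).
    change (Rabs (M / lam * exp (- lam * u) - 0) < eps) in Hu'.
    apply Rle_lt_trans with (2 := Hu'); rewrite Rminus_0_r; apply Rle_abs. }
  intros u v Hu Hv; apply C_NormedModule_mixin_compat1.
  change (Cmod (CRInt g 0 v - CRInt g 0 u)%C < eps).
  destruct (Rle_lt_dec u v) as [Huv|Huv].
  - apply Haux; assumption.
  - rewrite Cmod_minus_sym; apply Haux; [assumption|lra]. }
destruct Hcv as [l Hcv]; exists l; split.
- exists (fun b => CRInt g 0 b); split; [|exact Hcv].
  intros b Hb0; apply CRInt_correct, Hex, Hb0.
- apply Rnot_lt_le; intros Hlt.
  assert (He : 0 < Cmod l - M / lam) by lra.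
  destruct (proj1 (filterlim_C_Cmod _ _ _) Hcv (mkposreal _ He)) as [B HB].
  set (b := Rmax B 0 + 1).
  assert (Hb1 := HB b ltac:(unfold b; pose proof (Rmax_l B 0); lra)); simpl in Hb1.
  assert (Hb2 := HD 0 b (Rle_refl 0) ltac:(unfold b; pose proof (Rmax_r B 0); lra)).
  replace (- lam * 0) with 0 in Hb2 by ring; rewrite exp_0 in Hb2.
  assert (E0 : CRInt g 0 0 = RtoC 0) by exact (RInt_point (V := C_R_CompleteNormedModule) 0 g).
  assert (E1 : forall z : C, (z - 0)%C = z) by (intros; ring).
  assert (E2 : forall z w : C, (z + (w - z))%C = w) by (intros; ring).
  rewrite E0, E1 in Hb2.
  assert (H := Cmod_triangle_inv l (CRInt g 0 b - l)%C).
  rewrite E2 in H; lra.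
Qed.

Lemma is_CInt_derive (f df : R -> C) :
  (forall x, is_deriveC f x (df x)) -> (forall x, Ccontinuous df x) ->
  filterlim f (Rbar_locally p_infty) (@locally C_UniformSpace (RtoC 0)) ->
  is_CInt df (- f 0)%C.
Proof.
intros H1 H2 H3; exists (fun b => f b - f 0)%C; split.
- intros b _; apply is_CRInt_derive; auto.
- apply filterlim_C_Cmod; [apply Rbar_locally_filter|intros eps].
  generalize (proj1 (filterlim_C_Cmod _ _ _) H3 eps); apply filter_imp; intros b Hb.
  replace (f b - f 0%R - - f 0%R)%C with (f b - 0)%C by ring; exact Hb.
Qed.

Lemma is_CInt_le (g : R -> C) (l : C) (M lam : R) : 0 < lam -> is_CInt g l ->
  (forall s, 0 < s -> Cmod (g s) <= M * exp (- lam * s)) -> Cmod l <= M / lam.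
Proof.
intros Hl Hg Hb.
destruct (is_CInt_dominated g M lam Hl) as [l' [H1 H2]].
- intros b Hb0; destruct Hg as [I [HI _]]; exists (I b); apply HI, Hb0.
- exact Hb.
- rewrite (is_CInt_unique _ _ _ Hg H1); exact H2.
Qed.

Notation CCcontinuous := (@continuous C_UniformSpace C_UniformSpace).

Lemma CCcontinuous_eps (f : C -> C) (z : C) :
  CCcontinuous f z <->
  forall eps : R, 0 < eps -> exists d : R, 0 < d /\
    forall w : C, Cmod (w - z) < d -> Cmod (f w - f z) < eps.
Proof.
split.
- intros H eps He.
  assert (H' := proj1 (filterlim_C_Cmod _ _ _) H (mkposreal _ He)).
  apply locally_C_Cmod in H'; destruct H' as [d Hd].
  exists d; split; [apply d|exact Hd].
- intros H; apply filterlim_C_Cmod; [apply locally_filter|intros eps].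
  destruct (H eps (cond_pos eps)) as [d [Hd Hw]].
  apply locally_C_Cmod; exists (mkposreal _ Hd); exact Hw.
Qed.

Lemma is_Cderive_continuous (f : C -> C) (z l : C) :
  is_Cderive f z l -> CCcontinuous f z.
Proof.
intros H; apply CCcontinuous_eps; intros eps He.
destruct (proj1 (is_Cderive_eps _ _ _) H 1 Rlt_0_1) as [d [Hd Hh]].
set (K := Cmod l + 1); assert (HK : 0 < K) by (unfold K; pose proof (Cmod_ge_0 l); lra).
exists (Rmin d (eps / K)); split.
- apply Rmin_glb_lt; [exact Hd|apply Rdiv_lt_0_compat; assumption].
- intros w Hw; specialize (Hh (w - z)%C (Rlt_le_trans _ _ _ Hw (Rmin_l _ _))).
  replace (z + (w - z))%C with w in Hh by ring.
  assert (H2 := Rlt_le_trans _ _ _ Hw (Rmin_r _ _)).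
  assert (T := Cmod_triangle (f w - f z - (w - z) * l)%C ((w - z) * l)%C).
  replace (f w - f z - (w - z) * l + (w - z) * l)%C with (f w - f z)%C in T by ring.
  rewrite Cmod_mult in T.
  apply Rle_lt_trans with (Cmod (w - z) * K); [unfold K; lra|].
  apply Rmult_lt_compat_r with (r := K) in H2; [|exact HK].
  replace (eps / K * K) with eps in H2 by (field; lra); exact H2.
Qed.

Lemma holomorphic_at_continuous (f : C -> C) (z : C) :
  holomorphic_at f z -> CCcontinuous f z.
Proof. intros [l Hl]; apply (is_Cderive_continuous _ _ _ Hl). Qed.

Lemma Ccontinuous_comp (f : C -> C) (g : R -> C) (x : R) :
  Ccontinuous g x -> CCcontinuous f (g x) -> Ccontinuous (fun s => f (g s)) x.
Proof. apply (@continuous_comp R_UniformSpace C_UniformSpace C_UniformSpace g f x). Qed.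

Lemma is_deriveC_eps (f : R -> C) (x : R) (l : C) :
  is_deriveC f x l <->
  forall eps : R, 0 < eps -> exists d : R, 0 < d /\
    forall h : R, Rabs h < d ->
      Cmod (f (x + h)%R - f x - RtoC h * l)%C <= eps * Rabs h.
Proof.
assert (Es : forall (h : R) (c : C), @scal R_AbsRing C_R_NormedModule h c = (RtoC h * c)%C).
{ intros h [c1 c2]; apply C_ext;
    [change (h * c1 = h * c1 - 0 * c2)|change (h * c2 = h * c2 + 0 * c1)]; ring. }
split.
- intros [_ H] eps He.
  destruct (H x (fun P HP => HP) (mkposreal _ He)) as [d Hd].
  exists d; split; [apply d|intros h Hh].
  assert (E : x + h - x = h) by ring.
  assert (Hb : Rabs (x + h - x) < d) by (rewrite E; exact Hh).
  specialize (Hd (x + h) Hb).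
  change (@norm R_AbsRing C_R_NormedModule
            (minus (minus (f (x + h)) (f x)) (scal (x + h - x) l))
          <= eps * Rabs (x + h - x)) in Hd.
  rewrite <- Cmod_norm, E, Es in Hd; exact Hd.
- intros H; split; [apply is_linear_scal_l|].
  intros y Hy eps.
  assert (Ey : x = y)
    by (apply (@is_filter_lim_locally_unique R_AbsRing (AbsRing_NormedModule R_AbsRing)); exact Hy).
  subst y.
  destruct (H eps (cond_pos eps)) as [d [Hd Hh]].
  exists (mkposreal d Hd); intros w Hw.
  specialize (Hh (w - x) Hw).
  assert (E : forall a b : R, b + (a - b) = a) by (intros; ring).
  rewrite (E w x), <- Es in Hh.
  change (@norm R_AbsRing C_R_NormedModule
            (minus (minus (f w) (f x)) (scal (w - x) l))
          <= eps * Rabs (w - x)); rewrite <- Cmod_norm; exact Hh.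
Qed.

Lemma is_deriveC_path (f : C -> C) (g : R -> C) (x : R) (l v : C) :
  is_Cderive f (g x) l -> is_deriveC g x v ->
  is_deriveC (fun s => f (g s)) x (v * l)%C.
Proof.
intros Hf Hg; apply is_deriveC_eps; intros eps He.
set (M := Cmod v + 1); assert (HM : 0 < M) by (unfold M; pose proof (Cmod_ge_0 v); lra).
assert (Hl := Cmod_ge_0 l).
set (e1 := eps / (2 * M)); assert (He1 : 0 < e1) by (apply Rdiv_lt_0_compat; lra).
set (e2 := Rmin 1 (eps / (2 * (Cmod l + 1)))).
assert (He2 : 0 < e2) by (apply Rmin_glb_lt; [lra|apply Rdiv_lt_0_compat; lra]).
destruct (proj1 (is_Cderive_eps _ _ _) Hf e1 He1) as [d1 [Hd1 H1]].
destruct (proj1 (is_deriveC_eps _ _ _) Hg e2 He2) as [d2 [Hd2 H2]].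
exists (Rmin d2 (d1 / M)); split.
{ apply Rmin_glb_lt; [exact Hd2|apply Rdiv_lt_0_compat; assumption]. }
intros h Hh.
specialize (H2 h (Rlt_le_trans _ _ _ Hh (Rmin_l _ _))).
assert (Hh' := Rlt_le_trans _ _ _ Hh (Rmin_r _ _)).
set (k := (g (x + h)%R - g x)%C) in *.
assert (H0 := Rabs_pos h).
assert (Hk : Cmod k <= M * Rabs h).
{ assert (T := Cmod_triangle (k - RtoC h * v)%C (RtoC h * v)%C).
  replace (k - RtoC h * v + RtoC h * v)%C with k in T by ring.
  rewrite Cmod_mult, Cmod_R in T.
  assert (e2 <= 1) by apply Rmin_l; unfold M; nra. }
assert (Hkd : Cmod k < d1).
{ apply Rle_lt_trans with (1 := Hk).
  apply Rmult_lt_compat_l with (r := M) in Hh'; [|exact HM].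
  replace (M * (d1 / M)) with d1 in Hh' by (field; lra); exact Hh'. }
specialize (H1 k Hkd).
replace (g x + k)%C with (g (x + h)) in H1 by (unfold k; ring).
assert (T := Cmod_triangle (f (g (x + h)%R) - f (g x) - k * l)%C ((k - RtoC h * v) * l)%C).
replace (f (g (x + h)%R) - f (g x) - k * l + (k - RtoC h * v) * l)%C
  with (f (g (x + h)%R) - f (g x) - RtoC h * (v * l))%C in T by ring.
rewrite Cmod_mult in T.
assert (A : e1 * Cmod k <= eps / 2 * Rabs h).
{ apply Rle_trans with (e1 * (M * Rabs h)); [apply Rmult_le_compat_l; lra|].
  right; unfold e1; field; lra. }
assert (B : Cmod (k - RtoC h * v) * Cmod l <= eps / 2 * Rabs h).
{ apply Rle_trans with (e2 * Rabs h * Cmod l); [apply Rmult_le_compat_r; assumption|].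
  assert (E2 : e2 <= eps / (2 * (Cmod l + 1))) by apply Rmin_r.
  apply Rle_trans with (eps / (2 * (Cmod l + 1)) * Rabs h * (Cmod l + 1)).
  - apply Rmult_le_compat; [apply Rmult_le_pos; lra|lra| |lra].
    apply Rmult_le_compat_r; assumption.
  - right; field; lra. }
lra.
Qed.

(** * Goursat's theorem for rectangles *)

(** Counterclockwise boundary integral of a rectangle: bottom and right sides forward, top and left
    sides backward. [Ci] is dz/dy on the vertical sides. *)
Definition box_int (f : C -> C) (a b c d : R) : C :=
  (CRInt (fun s => f (s, c)) a b + Ci * CRInt (fun s => f (b, s)) c d
   - CRInt (fun s => f (s, d)) a b - Ci * CRInt (fun s => f (a, s)) c d)%C.

Lemma is_deriveC_hor (y s : R) : is_deriveC (fun x : R => (x, y)) s (RtoC 1).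
Proof.
apply is_deriveC_pair; simpl.
- apply (@is_derive_id R_AbsRing).
- apply (@is_derive_const R_AbsRing R_NormedModule).
Qed.

Lemma is_deriveC_ver (x s : R) : is_deriveC (fun y : R => (x, y)) s Ci.
Proof.
apply is_deriveC_pair; simpl.
- apply (@is_derive_const R_AbsRing R_NormedModule).
- apply (@is_derive_id R_AbsRing).
Qed.

Lemma Ccontinuous_hor (f : C -> C) (y s : R) :
  CCcontinuous f (s, y) -> Ccontinuous (fun x => f (x, y)) s.
Proof.
intros H; apply (Ccontinuous_comp f (fun x => (x, y))); [|exact H].
apply (is_deriveC_continuous _ _ _ (is_deriveC_hor y s)).
Qed.

Lemma Ccontinuous_ver (f : C -> C) (x s : R) :
  CCcontinuous f (x, s) -> Ccontinuous (fun y => f (x, y)) s.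
Proof.
intros H; apply (Ccontinuous_comp f (fun y => (x, y))); [|exact H].
apply (is_deriveC_continuous _ _ _ (is_deriveC_ver x s)).
Qed.

Definition cont_on_box (f : C -> C) (a b c d : R) : Prop :=
  forall x y, a <= x <= b -> c <= y <= d -> CCcontinuous f (x, y).

Lemma box_ex_hor (f : C -> C) (a b c d a' b' y : R) : cont_on_box f a b c d ->
  a <= a' -> a' <= b' -> b' <= b -> c <= y <= d ->
  is_CRInt (fun s => f (s, y)) a' b' (CRInt (fun s => f (s, y)) a' b').
Proof.
intros H H1 H2 H3 H4; apply CRInt_correct, ex_CRInt_continuous.
intros x Hx; rewrite Rmin_left, Rmax_right in Hx by assumption.
apply Ccontinuous_hor, H; lra.
Qed.

Lemma box_ex_ver (f : C -> C) (a b c d c' d' x : R) : cont_on_box f a b c d ->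
  c <= c' -> c' <= d' -> d' <= d -> a <= x <= b ->
  is_CRInt (fun s => f (x, s)) c' d' (CRInt (fun s => f (x, s)) c' d').
Proof.
intros H H1 H2 H3 H4; apply CRInt_correct, ex_CRInt_continuous.
intros y Hy; rewrite Rmin_left, Rmax_right in Hy by assumption.
apply Ccontinuous_ver, H; lra.
Qed.

Lemma box_int_split_x (f : C -> C) (a m b c d : R) : cont_on_box f a b c d ->
  a <= m <= b -> c <= d ->
  box_int f a b c d = (box_int f a m c d + box_int f m b c d)%C.
Proof.
intros H Hm Hcd.
assert (E : forall y, c <= y <= d -> CRInt (fun s => f (s, y)) a b
  = (CRInt (fun s => f (s, y)) a m + CRInt (fun s => f (s, y)) m b)%C).
{ intros y Hy; apply CRInt_unique, is_CRInt_Chasles with m;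
    apply (box_ex_hor f a b c d); auto; lra. }
unfold box_int; rewrite !E by lra; ring.
Qed.

Lemma box_int_split_y (f : C -> C) (a b c m d : R) : cont_on_box f a b c d ->
  c <= m <= d -> a <= b ->
  box_int f a b c d = (box_int f a b c m + box_int f a b m d)%C.
Proof.
intros H Hm Hab.
assert (E : forall x, a <= x <= b -> CRInt (fun s => f (x, s)) c d
  = (CRInt (fun s => f (x, s)) c m + CRInt (fun s => f (x, s)) m d)%C).
{ intros x Hx; apply CRInt_unique, is_CRInt_Chasles with m;
    apply (box_ex_ver f a b c d); auto; lra. }
unfold box_int; rewrite !E by lra; ring.
Qed.

Lemma cont_on_box_sub (f : C -> C) (a b c d a' b' c' d' : R) :
  cont_on_box f a b c d -> a <= a' -> b' <= b -> c <= c' -> d' <= d ->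
  cont_on_box f a' b' c' d'.
Proof. intros H H1 H2 H3 H4 x y Hx Hy; apply H; lra. Qed.

Lemma box_int_quarter (f : C -> C) (a c w h : R) : 0 <= w -> 0 <= h ->
  cont_on_box f a (a + w) c (c + h) ->
  exists a' c' : R, (a' = a \/ a' = a + w / 2) /\ (c' = c \/ c' = c + h / 2) /\
    Cmod (box_int f a (a + w) c (c + h))
    <= 4 * Cmod (box_int f a' (a' + w / 2) c' (c' + h / 2)).
Proof.
intros Hw Hh Hc.
set (B := fun a' c' => box_int f a' (a' + w / 2) c' (c' + h / 2)).
assert (E : box_int f a (a + w) c (c + h)
  = ((B a c + B a (c + h / 2)%R) + (B (a + w / 2)%R c + B (a + w / 2)%R (c + h / 2)%R))%C).
{ rewrite (box_int_split_x f a (a + w / 2)) by (assumption || lra).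
  unfold B; replace (a + w / 2 + w / 2) with (a + w) by field.
  replace (c + h / 2 + h / 2) with (c + h) by field.
  f_equal; apply box_int_split_y; try lra;
    apply (cont_on_box_sub f a (a + w) c (c + h)); auto; lra. }
destruct (Rle_lt_dec (Cmod (box_int f a (a + w) c (c + h))) (4 * Cmod (B a c))) as [L|L1].
{ exists a, c; repeat split; auto. }
destruct (Rle_lt_dec (Cmod (box_int f a (a + w) c (c + h))) (4 * Cmod (B a (c + h / 2)))) as [L|L2].
{ exists a, (c + h / 2); repeat split; auto. }
destruct (Rle_lt_dec (Cmod (box_int f a (a + w) c (c + h))) (4 * Cmod (B (a + w / 2) c))) as [L|L3].
{ exists (a + w / 2), c; repeat split; auto. }
exists (a + w / 2), (c + h / 2); repeat split; auto.
fold (B (a + w / 2) (c + h / 2)).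
apply Rnot_lt_le; intros L4; rewrite E in *.
revert L1 L2 L3 L4.
generalize (B a c) (B a (c + h / 2)) (B (a + w / 2) c) (B (a + w / 2) (c + h / 2)).
intros b1 b2 b3 b4 L1 L2 L3 L4.
pose proof (Cmod_triangle (b1 + b2) (b3 + b4)).
pose proof (Cmod_triangle b1 b2); pose proof (Cmod_triangle b3 b4).
lra.
Qed.

Lemma is_CRInt_hor (P p : C -> C) (a b y : R) : a <= b ->
  (forall s, a <= s <= b -> is_Cderive P (s, y) (p (s, y)) /\ CCcontinuous p (s, y)) ->
  is_CRInt (fun s => p (s, y)) a b (P (b, y) - P (a, y))%C.
Proof.
intros Hab H.
apply (is_CRInt_derive (fun s => P (s, y))); intros x Hx;
  rewrite Rmin_left, Rmax_right in Hx by exact Hab.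
- replace (p (x, y)) with (1 * p (x, y))%C by ring.
  apply (is_deriveC_path P (fun s => (s, y))); [apply H, Hx|apply is_deriveC_hor].
- apply Ccontinuous_hor, H, Hx.
Qed.

Lemma is_CRInt_ver (P p : C -> C) (c d x : R) : c <= d ->
  (forall s, c <= s <= d -> is_Cderive P (x, s) (p (x, s)) /\ CCcontinuous p (x, s)) ->
  is_CRInt (fun s => Ci * p (x, s))%C c d (P (x, d) - P (x, c))%C.
Proof.
intros Hcd H.
apply (is_CRInt_derive (fun s => P (x, s))); intros y Hy;
  rewrite Rmin_left, Rmax_right in Hy by exact Hcd.
- apply (is_deriveC_path P (fun s => (x, s))); [apply H, Hy|apply is_deriveC_ver].
- apply Ccontinuous_mult; [apply Ccontinuous_const|apply Ccontinuous_ver, H, Hy].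
Qed.

Lemma is_Cderive_affine (u v z0 : C) (z : C) :
  is_Cderive (fun z => u * (z - z0) + v / 2 * ((z - z0) * (z - z0)))%C z
    (u + v * (z - z0))%C.
Proof.
assert (H2 : RtoC 2 <> 0%C) by (intros E; apply RtoC_inj in E; lra).
apply (is_Cderive_quad _ _ _ (Cmod (v / 2)) 1 Rlt_0_1); intros h _.
match goal with |- Cmod ?x <= _ => replace x with (v / 2 * (h * h))%C by (field; exact H2) end.
rewrite !Cmod_mult; simpl; right; ring.
Qed.

Lemma CCcontinuous_affine (u v z0 z : C) :
  CCcontinuous (fun z => u + v * (z - z0))%C z.
Proof.
apply is_Cderive_continuous with v.
apply (is_Cderive_quad _ _ _ 0 1 Rlt_0_1); intros h _.
match goal with |- Cmod ?x <= _ => replace x with (RtoC 0) by ring end.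
rewrite Cmod_0; lra.
Qed.

(* An affine function has a primitive, so only the first-order error
   of [f] contributes to the boundary integral. *)
Lemma box_int_small (f : C -> C) (u v z0 : C) (a b c d e : R) :
  a <= b -> c <= d -> cont_on_box f a b c d ->
  (forall x y, a <= x <= b -> c <= y <= d ->
     Cmod (f (x, y) - (u + v * ((x, y) - z0)))%C <= e) ->
  Cmod (box_int f a b c d) <= 2 * e * ((b - a) + (d - c)).
Proof.
intros Hab Hcd Hc He.
pose (p := fun z : C => (u + v * (z - z0))%C).
pose (P := fun z : C => (u * (z - z0) + v / 2 * ((z - z0) * (z - z0)))%C).
assert (HP : forall z, is_Cderive P z (p z) /\ CCcontinuous p z).
{ intros z; split; [apply is_Cderive_affine|apply CCcontinuous_affine]. }
assert (Hh : forall y, c <= y <= d ->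
  Cmod (CRInt (fun s => f (s, y)) a b - (P (b, y) - P (a, y)))%C <= e * (b - a)).
{ intros y Hy; apply (CRInt_norm_const (fun s => f (s, y) - p (s, y))%C a b).
  - exact Hab.
  - intros x Hx; apply He; assumption.
  - apply is_CRInt_minus; [apply (box_ex_hor f a b c d); auto; lra|].
    apply is_CRInt_hor; [exact Hab|intros; apply HP]. }
assert (Hv : forall x, a <= x <= b ->
  Cmod (Ci * CRInt (fun s => f (x, s)) c d - (P (x, d) - P (x, c)))%C <= e * (d - c)).
{ intros x Hx; apply (CRInt_norm_const (fun s => Ci * f (x, s) - Ci * p (x, s))%C c d).
  - exact Hcd.
  - intros y Hy; replace (Ci * f (x, y) - Ci * p (x, y))%C
      with (Ci * (f (x, y) - p (x, y)))%C by ring.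
    rewrite Cmod_mult, Cmod_Ci, Rmult_1_l; apply He; assumption.
  - apply is_CRInt_minus.
    + apply is_CRInt_Cmult; apply (box_ex_ver f a b c d); auto; lra.
    + apply is_CRInt_ver; [exact Hcd|intros; apply HP]. }
assert (H1 := Hh c ltac:(lra)); assert (H2 := Hh d ltac:(lra)).
assert (H3 := Hv a ltac:(lra)); assert (H4 := Hv b ltac:(lra)).
unfold box_int.
set (X1 := CRInt (fun s => f (s, c)) a b : C) in *; set (X2 := CRInt (fun s => f (s, d)) a b : C) in *.
set (X3 := (Ci * CRInt (fun s => f (a, s)) c d)%C) in *; set (X4 := (Ci * CRInt (fun s => f (b, s)) c d)%C) in *.
replace (X1 + X4 - X2 - X3)%C with
  (((X1 - (P (b, c) - P (a, c))) + (X4 - (P (b, d) - P (b, c))))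
   - ((X2 - (P (b, d) - P (a, d))) + (X3 - (P (a, d) - P (a, c)))))%C by ring.
eapply Rle_trans; [apply Cmod_triangle_minus|].
pose proof (Cmod_triangle (X1 - (P (b, c) - P (a, c))) (X4 - (P (b, d) - P (b, c)))).
pose proof (Cmod_triangle (X2 - (P (b, d) - P (a, d))) (X3 - (P (a, d) - P (a, c)))).
lra.
Qed.

Lemma half_pow_lim (w eps : R) : 0 < eps -> exists n : nat, w / 2 ^ n < eps.
Proof.
intros He.
destruct (Rle_lt_dec w 0) as [Hw|Hw].
{ exists 0%nat; simpl; lra. }
destruct (pow_lt_1_zero (/ 2) ltac:(rewrite Rabs_pos_eq; lra) (eps / w)
  ltac:(apply Rdiv_lt_0_compat; assumption)) as [n Hn].
exists n; specialize (Hn n (Nat.le_refl n)).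
rewrite Rabs_pos_eq in Hn by (apply pow_le; lra).
apply Rmult_lt_compat_l with (r := w) in Hn; [|exact Hw].
replace (w * (eps / w)) with eps in Hn by (field; lra).
rewrite pow_inv in Hn; exact Hn.
Qed.

(** The hypothesis expresses that the intervals from [u n] to [u n + w / 2 ^ n] are nested; the
    limit of the left ends lies in all of them. *)
Lemma nested_lim (u : nat -> R) (w : R) : 0 <= w ->
  (forall n, u n <= u (S n) <= u n + w / 2 ^ n - w / 2 ^ S n) ->
  exists l : R, forall n, u n <= l <= u n + w / 2 ^ n.
Proof.
intros Hw Hu.
assert (Hp : forall n, 0 <= w / 2 ^ n).
{ intros n; apply Rdiv_le_0_compat; [exact Hw|apply pow_lt; lra]. }
assert (Hinc : forall n k, u n <= u (n + k)%nat).
{ intros n k; induction k as [|k IH]; [rewrite Nat.add_0_r; lra|].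
  rewrite Nat.add_succ_r; pose proof (proj1 (Hu (n + k)%nat)); lra. }
assert (Hub : forall n k, u (n + k)%nat + w / 2 ^ (n + k) <= u n + w / 2 ^ n).
{ intros n k; induction k as [|k IH]; [rewrite Nat.add_0_r; lra|].
  rewrite Nat.add_succ_r; pose proof (proj2 (Hu (n + k)%nat)); lra. }
assert (Hbd : forall n m, u m <= u n + w / 2 ^ n).
{ intros n m; destruct (Nat.le_ge_cases n m) as [L|L].
  - replace m with (n + (m - n))%nat by lia.
    pose proof (Hub n (m - n)%nat); pose proof (Hp (n + (m - n))%nat); lra.
  - replace n with (m + (n - m))%nat by lia.
    pose proof (Hinc m (n - m)%nat); pose proof (Hp (m + (n - m))%nat); lra. }
destruct (ex_finite_lim_seq_incr u (u 0%nat + w / 2 ^ 0)) as [l Hl].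
- intros n; apply Hu.
- intros n; apply Hbd.
- exists l; intros n; split.
  + apply (is_lim_seq_incr_compare u l Hl); intros k; apply Hu.
  + apply (is_lim_seq_le u (fun _ => u n + w / 2 ^ n) l (u n + w / 2 ^ n)).
    * intros k; apply Hbd.
    * exact Hl.
    * apply is_lim_seq_const.
Qed.

Theorem Goursat_box (f : C -> C) (a b c d : R) : a <= b -> c <= d ->
  (forall x y, a <= x <= b -> c <= y <= d -> holomorphic_at f (x, y)) ->
  box_int f a b c d = 0%C.
Proof.
intros Hab Hcd Hf.
set (w := b - a); set (h := d - c).
assert (Hw : 0 <= w) by (unfold w; lra); assert (Hh : 0 <= h) by (unfold h; lra).
assert (Hc : cont_on_box f a b c d).
{ intros x y Hx Hy; apply holomorphic_at_continuous, Hf; assumption. }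
pose (good := fun (n : nat) (p : R * R) =>
  a <= fst p /\ fst p + w / 2 ^ n <= b /\ c <= snd p /\ snd p + h / 2 ^ n <= d).
pose (Bn := fun (n : nat) (p : R * R) =>
  Cmod (box_int f (fst p) (fst p + w / 2 ^ n) (snd p) (snd p + h / 2 ^ n))).
assert (Hpw : forall n, w / 2 ^ S n = w / 2 ^ n / 2).
{ intros n; simpl; field; apply pow_nonzero; lra. }
assert (Hph : forall n, h / 2 ^ S n = h / 2 ^ n / 2).
{ intros n; simpl; field; apply pow_nonzero; lra. }
assert (Hw0 : forall n, 0 <= w / 2 ^ n).
{ intros n; apply Rdiv_le_0_compat; [exact Hw|apply pow_lt; lra]. }
assert (Hh0 : forall n, 0 <= h / 2 ^ n).
{ intros n; apply Rdiv_le_0_compat; [exact Hh|apply pow_lt; lra]. }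
(* The implication stands under the existential so that choice yields a successor [nxt] defined on
   every pair; [good] is then recovered along the sequence. *)
assert (Hstep : forall n p, exists p' : R * R, good n p ->
  good (S n) p' /\ Bn n p <= 4 * Bn (S n) p'
  /\ fst p <= fst p' <= fst p + w / 2 ^ n - w / 2 ^ S n
  /\ snd p <= snd p' <= snd p + h / 2 ^ n - h / 2 ^ S n).
{ intros n p.
  destruct (classic (good n p)) as [G|G]; [|exists p; intros; contradiction].
  destruct G as (G1 & G2 & G3 & G4).
  destruct (box_int_quarter f (fst p) (snd p) (w / 2 ^ n) (h / 2 ^ n)) as (a' & c' & A & B & D); auto.
  { apply (cont_on_box_sub f a b c d); auto. }
  exists (a', c'); intros _; unfold good, Bn; cbn [fst snd].
  rewrite Hpw, Hph.
  specialize (Hw0 n); specialize (Hh0 n).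
  repeat split; try exact D; destruct A, B; lra. }
pose (nxt := fun n p => proj1_sig (constructive_indefinite_description _ (Hstep n p))).
pose (sq := fix sq n := match n with O => (a, c) | S n => nxt n (sq n) end).
assert (Hgood : forall n, good n (sq n)).
{ induction n as [|n IH].
  - unfold good; simpl; unfold w, h; lra.
  - simpl; unfold nxt; destruct (constructive_indefinite_description _ (Hstep n (sq n))) as [p Hp].
    simpl; apply Hp, IH. }
assert (Hnx : forall n, Bn n (sq n) <= 4 * Bn (S n) (sq (S n))
  /\ fst (sq n) <= fst (sq (S n)) <= fst (sq n) + w / 2 ^ n - w / 2 ^ S n
  /\ snd (sq n) <= snd (sq (S n)) <= snd (sq n) + h / 2 ^ n - h / 2 ^ S n).
{ intros n; change (sq (S n)) with (nxt n (sq n)); unfold nxt.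
  destruct (constructive_indefinite_description _ (Hstep n (sq n))) as [p Hp].
  cbn [proj1_sig]; destruct (Hp (Hgood n)) as (_ & H1 & H2 & H3); auto. }
assert (HB : forall n, Cmod (box_int f a b c d) <= 4 ^ n * Bn n (sq n)).
{ induction n as [|n IH].
  - unfold Bn; simpl; replace (a + w / 1) with b by (unfold w; field).
    replace (c + h / 1) with d by (unfold h; field); lra.
  - apply Rle_trans with (1 := IH); simpl.
    assert (0 < 4 ^ n) by (apply pow_lt; lra).
    destruct (Hnx n) as [H1 _]; simpl in H1.
    apply Rle_trans with (4 ^ n * (4 * Bn (S n) (nxt n (sq n)))); [|right; ring].
    apply Rmult_le_compat_l; lra. }
destruct (nested_lim (fun n => fst (sq n)) w Hw) as [x Hx]; [intros n; apply Hnx|].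
destruct (nested_lim (fun n => snd (sq n)) h Hh) as [y Hy]; [intros n; apply Hnx|].
assert (Hxab : a <= x <= b).
{ specialize (Hx 0%nat); simpl in Hx; unfold w in Hx; lra. }
assert (Hycd : c <= y <= d).
{ specialize (Hy 0%nat); simpl in Hy; unfold h in Hy; lra. }
destruct (Hf x y Hxab Hycd) as [l Hl].
apply Cmod_eq_0, Rle_antisym; [|apply Cmod_ge_0].
apply Rnot_lt_le; intros Hpos.
set (be := Cmod (box_int f a b c d)) in *.
(* Bisection costs a factor [4 ^ n], while the n-th box contributes [2 e] times a product of two
   lengths [(w + h) / 2 ^ n]; the powers cancel and [2 (w + h)^2 e] remains. The summand 1 keeps [K]
   positive for a degenerate box. *)
set (K := 2 * (w + h) * (w + h) + 1).
assert (HK : 0 < K) by (unfold K; nra).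
set (e := be / (2 * K)).
assert (He : 0 < e) by (apply Rdiv_lt_0_compat; lra).
destruct (proj1 (is_Cderive_eps _ _ _) Hl e He) as [dl [Hdl HD]].
destruct (half_pow_lim (w + h) dl Hdl) as [n Hn].
assert (Hp2 : 0 < 2 ^ n) by (apply pow_lt; lra).
destruct (Hgood n) as (G1 & G2 & G3 & G4).
assert (Hs := box_int_small f (f (x, y)) l (x, y) (fst (sq n)) (fst (sq n) + w / 2 ^ n)
  (snd (sq n)) (snd (sq n) + h / 2 ^ n) (e * ((w + h) / 2 ^ n))).
assert (Hs' : Bn n (sq n) <= 2 * (e * ((w + h) / 2 ^ n)) * (w / 2 ^ n + h / 2 ^ n)).
{ unfold Bn; eapply Rle_trans; [apply Hs|right; ring].
  - specialize (Hw0 n); lra.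
  - specialize (Hh0 n); lra.
  - apply (cont_on_box_sub f a b c d); auto.
  - intros x' y' Hx' Hy'.
    assert (Hd' : Cmod ((x', y') - (x, y))%C <= (w + h) / 2 ^ n).
    { apply Rle_trans with (1 := Cmod_le_ReIm _); simpl.
      specialize (Hx n); specialize (Hy n); simpl in Hx, Hy.
      replace ((w + h) / 2 ^ n) with (w / 2 ^ n + h / 2 ^ n) by (field; lra).
      apply Rplus_le_compat; apply Rabs_le; lra. }
    specialize (HD ((x', y') - (x, y))%C (Rle_lt_trans _ _ _ Hd' Hn)).
    assert (E1 : forall z z' : C, (z + (z' - z))%C = z') by (intros; ring).
    assert (E2 : forall u v z' z : C, (v - (u + l * (z' - z)) = v - u - (z' - z) * l)%C)
      by (intros; ring).
    rewrite E1 in HD; rewrite E2.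
    apply Rle_trans with (1 := HD), Rmult_le_compat_l; lra. }
specialize (HB n).
assert (H4 : 4 ^ n = 2 ^ n * 2 ^ n).
{ replace 4 with (2 * 2) by ring; apply Rpow_mult_distr. }
assert (H5 : be <= e * (2 * (w + h) * (w + h))).
{ apply Rle_trans with (1 := HB).
  apply Rle_trans with (4 ^ n * (2 * (e * ((w + h) / 2 ^ n)) * (w / 2 ^ n + h / 2 ^ n))).
  - apply Rmult_le_compat_l; [apply pow_le; lra|exact Hs'].
  - right; rewrite H4; field; lra. }
assert (H6 : e * (2 * (w + h) * (w + h)) <= e * K) by (apply Rmult_le_compat_l; unfold K; lra).
replace (e * K) with (be / 2) in H6 by (unfold e; field; lra).
lra.
Qed.

(** * The identity theorem *)

Lemma CRInt_norm_abs (f : R -> C) (a b M : R) (l : C) :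
  (forall x, Rmin a b <= x <= Rmax a b -> Cmod (f x) <= M) ->
  is_CRInt f a b l -> Cmod l <= M * Rabs (b - a).
Proof.
intros H Hl; destruct (Rle_lt_dec a b) as [L|L].
- rewrite Rabs_pos_eq by lra; rewrite Rmin_left, Rmax_right in H by exact L.
  exact (CRInt_norm_const f a b M l L H Hl).
- rewrite Rabs_left by lra; rewrite Rmin_right, Rmax_left in H by lra.
  rewrite <- Cmod_opp; replace (- (b - a)) with (a - b) by ring.
  apply (CRInt_norm_const f b a M (- l)%C); [lra|exact H|].
  exact (is_RInt_swap (V := C_R_NormedModule) f b a l Hl).
Qed.

Lemma CRInt_swap (f : R -> C) (a b : R) : ex_CRInt f b a ->
  CRInt f a b = (- CRInt f b a)%C.
Proof.
intros H; symmetry; exact (opp_RInt_swap (V := C_R_CompleteNormedModule) f b a H).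
Qed.

Lemma is_CRInt_cst (c : C) (a b : R) : is_CRInt (fun _ => c) a b (RtoC (b - a) * c)%C.
Proof.
replace (RtoC (b - a) * c)%C with (scal (b - a) c).
- exact (is_RInt_const (V := C_R_NormedModule) a b c).
- destruct c as [c1 c2]; apply C_ext;
    [change ((b - a) * c1 = (b - a) * c1 - 0 * c2)
    |change ((b - a) * c2 = (b - a) * c2 + 0 * c1)]; ring.
Qed.

Section HalfPlane.

Variable g : C -> C.
Hypothesis Hg : forall z, 0 < Re z -> holomorphic_at g z.
Hypothesis Hg0 : forall x : R, 0 < x -> g (RtoC x) = 0%C.

(** The path of integration runs along the real axis and then vertically; the first leg contributes
    nothing because [g] vanishes on the positive axis. For the same reason Goursat's theorem on a
    box resting on the axis gives the increments of [F] along horizontal segments. *)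
Let F (z : C) : C := (Ci * CRInt (fun s => g (Re z, s)) 0 (Im z))%C.

Let g_cont (x y : R) : 0 < x -> CCcontinuous g (x, y).
Proof. intros Hx; apply holomorphic_at_continuous, Hg; exact Hx. Qed.

Let ex_ver (x a b : R) : 0 < x -> ex_CRInt (fun s => g (x, s)) a b.
Proof.
intros Hx; apply ex_CRInt_continuous; intros s _; apply Ccontinuous_ver, g_cont, Hx.
Qed.

Let ex_hor (a b y : R) : 0 < a -> 0 < b -> ex_CRInt (fun s => g (s, y)) a b.
Proof.
intros Ha Hb; apply ex_CRInt_continuous; intros s Hs; apply Ccontinuous_hor, g_cont.
assert (0 < Rmin a b) by (apply Rmin_glb_lt; assumption); lra.
Qed.

Let int_axis (a b : R) : 0 < a -> a <= b -> CRInt (fun s => g (s, 0)) a b = RtoC 0.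
Proof.
intros Ha Hab; apply CRInt_unique.
apply (is_CRInt_ext (fun _ => RtoC 0)).
- intros x Hx; rewrite Rmin_left in Hx by exact Hab; symmetry; apply Hg0; lra.
- generalize (is_CRInt_cst (RtoC 0) a b); rewrite Cmult_0_r; auto.
Qed.

Let F_hor_le (x x' y : R) : 0 < x -> x <= x' ->
  (F (x', y) - F (x, y))%C = CRInt (fun s => g (s, y)) x x'.
Proof.
intros Hx Hxx; unfold F; cbn [Re Im fst snd].
destruct (Rle_lt_dec 0 y) as [Hy|Hy].
- assert (G := Goursat_box g x x' 0 y Hxx Hy).
  unfold box_int in G; rewrite int_axis in G by assumption.
  match type of G with (?P -> _) => assert (HP : P) end.
  { intros u v Hu _; apply Hg; simpl; lra. }
  specialize (G HP).
  set (A := CRInt (fun s => g (x', s)) 0 y : C) in *.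
  set (B := CRInt (fun s => g (x, s)) 0 y : C) in *.
  set (D := CRInt (fun s => g (s, y)) x x' : C) in *.
  replace (Ci * A - Ci * B)%C with ((0 + Ci * A - D - Ci * B) + D)%C by ring.
  rewrite G; ring.
- assert (G := Goursat_box g x x' y 0 Hxx (Rlt_le _ _ Hy)).
  unfold box_int in G; rewrite int_axis in G by assumption.
  match type of G with (?P -> _) => assert (HP : P) end.
  { intros u v Hu _; apply Hg; simpl; lra. }
  specialize (G HP).
  rewrite (CRInt_swap (fun s => g (x', s)) y 0), (CRInt_swap (fun s => g (x, s)) y 0)
    in G by (apply ex_ver; lra).
  set (A := CRInt (fun s => g (x', s)) 0 y : C) in *.
  set (B := CRInt (fun s => g (x, s)) 0 y : C) in *.
  set (D := CRInt (fun s => g (s, y)) x x' : C) in *.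
  replace (Ci * A - Ci * B)%C with (D - (D + Ci * - A - 0 - Ci * - B))%C by ring.
  rewrite G; ring.
Qed.

Let F_hor (x x' y : R) : 0 < x -> 0 < x' ->
  (F (x', y) - F (x, y))%C = CRInt (fun s => g (s, y)) x x'.
Proof.
intros Hx Hx'; destruct (Rle_lt_dec x x') as [L|L].
- apply F_hor_le; assumption.
- rewrite CRInt_swap by (apply ex_hor; assumption).
  rewrite <- (F_hor_le x' x y) by lra; ring.
Qed.

Let F_ver (x y y' : R) : 0 < x ->
  (F (x, y') - F (x, y))%C = (Ci * CRInt (fun s => g (x, s)) y y')%C.
Proof.
intros Hx; unfold F; cbn [Re Im fst snd].
assert (E : CRInt (fun s => g (x, s)) 0 y'
  = (CRInt (fun s => g (x, s)) 0 y + CRInt (fun s => g (x, s)) y y')%C).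
{ apply CRInt_unique, is_CRInt_Chasles with y; apply CRInt_correct, ex_ver, Hx. }
rewrite E; ring.
Qed.

Let F_derive (z : C) : 0 < Re z -> is_Cderive F z (g z).
Proof.
destruct z as [x y]; cbn [Re fst]; intros Hx.
apply is_Cderive_eps; intros eps He.
destruct (proj1 (CCcontinuous_eps _ _) (g_cont x y Hx) (eps / 2) ltac:(lra)) as [d [Hd Hw]].
exists (Rmin (d / 2) x); split; [apply Rmin_glb_lt; lra|].
intros [h1 h2] Hh.
assert (Hh1 := Rlt_le_trans _ _ _ Hh (Rmin_l _ _)).
assert (Hh2 := Rlt_le_trans _ _ _ Hh (Rmin_r _ _)).
assert (R1 := re_le_Cmod (h1, h2)); assert (R2 := Im_le_Cmod (h1, h2)); simpl in R1, R2.
assert (Hx' : 0 < x + h1).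
{ assert (Hlt : Rabs h1 < x) by lra; apply Rabs_def2 in Hlt; lra. }
assert (Eh1 : exists x', x' = x + h1) by (eexists; reflexivity).
assert (Eh2 : exists y', y' = y + h2) by (eexists; reflexivity).
destruct Eh1 as [x' Ex'], Eh2 as [y' Ey'].
change ((x, y) + (h1, h2))%C with (x + h1, y + h2); rewrite <- Ex' in *; rewrite <- Ey' in *.
(* The increment is split into a horizontal step at height [y] and a vertical step at abscissa [x'];
   halving the radius [d] keeps both within reach of the continuity of [g]. *)
replace (F (x', y') - F (x, y) - (h1, h2) * g (x, y))%C with
  ((F (x', y) - F (x, y) - RtoC (x' - x) * g (x, y))
   + ((F (x', y') - F (x', y))
      - Ci * (RtoC (y' - y) * g (x, y))))%C.
2:{ generalize (F (x', y)) (F (x, y)) (F (x', y')) (g (x, y)).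
    intros [a1 a2] [b1 b2] [c1 c2] [d1 d2]; subst x' y'; apply C_ext; simpl; ring. }
rewrite F_hor, F_ver by assumption.
assert (A : Cmod (CRInt (fun s => g (s, y)) x (x') - RtoC (x' - x) * g (x, y))%C
  <= eps / 2 * Rabs (x' - x)).
{ apply (CRInt_norm_abs (fun s => g (s, y) - g (x, y))%C).
  - intros s Hs; left; apply Hw.
    change ((s, y) - (x, y))%C with (s - x, y + - y).
    apply Rle_lt_trans with (1 := Cmod_le_ReIm _); simpl.
    replace (y + - y) with 0 by ring; rewrite Rabs_R0.
    assert (Rabs (s - x) <= Rabs h1).
    { destruct (Rle_lt_dec 0 h1).
      - rewrite Rmin_left, Rmax_right in Hs by lra; rewrite !Rabs_pos_eq; lra.
      - rewrite Rmin_right, Rmax_left in Hs by lra; rewrite !Rabs_left1; lra. }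
    lra.
  - apply is_CRInt_minus; [apply CRInt_correct, ex_hor; assumption|apply is_CRInt_cst]. }
assert (B : Cmod (CRInt (fun s => g (x', s)) y (y') - RtoC (y' - y) * g (x, y))%C
  <= eps / 2 * Rabs (y' - y)).
{ apply (CRInt_norm_abs (fun s => g (x', s) - g (x, y))%C).
  - intros s Hs; left; apply Hw.
    change ((x', s) - (x, y))%C with (x' + - x, s + - y).
    apply Rle_lt_trans with (1 := Cmod_le_ReIm _); simpl.
    replace (x' + - x) with h1 by (rewrite Ex'; ring).
    assert (Rabs (s + - y) <= Rabs h2).
    { destruct (Rle_lt_dec 0 h2).
      - rewrite Rmin_left, Rmax_right in Hs by lra; rewrite !Rabs_pos_eq; lra.
      - rewrite Rmin_right, Rmax_left in Hs by lra; rewrite !Rabs_left1; lra. }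
    lra.
  - apply is_CRInt_minus; [apply CRInt_correct, ex_ver; assumption|apply is_CRInt_cst]. }
eapply Rle_trans; [apply Cmod_triangle|].
match goal with |- _ + Cmod (?u * ?v - ?u * ?w)%C <= _ =>
  replace (u * v - u * w)%C with (u * (v - w))%C by ring end.
rewrite Cmod_mult, Cmod_Ci, Rmult_1_l.
replace (x' - x) with h1 in * by (rewrite Ex'; ring); replace (y' - y) with h2 in * by (rewrite Ey'; ring).
nra.
Qed.

Let F_real (x : R) : F (RtoC x) = 0%C.
Proof.
unfold F; simpl.
assert (E0 : CRInt (fun s => g (x, s)) 0 0 = RtoC 0)
  by exact (RInt_point (V := C_R_CompleteNormedModule) 0 _).
rewrite E0; ring.
Qed.

(** The Cauchy formula below differentiates under the integral sign, which asks for a continuous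
    derivative. The primitive has one, namely [g], and it vanishes on the axis as [g] does. *)
Lemma half_plane_primitive : exists P : C -> C,
  (forall z, 0 < Re z -> is_Cderive P z (g z)) /\ (forall x : R, P (RtoC x) = 0%C).
Proof. exists F; auto. Qed.

End HalfPlane.

(** * Circle integrals, the Cauchy kernel and its power series *)

Definition Ccis (th : R) : C := (cos th, sin th).

Lemma Cmod_Ccis (th : R) : Cmod (Ccis th) = 1.
Proof.
unfold Cmod, Ccis; simpl; rewrite !Rmult_1_r, Rplus_comm.
change (sqrt ((sin th)² + (cos th)²) = 1); rewrite sin2_cos2; apply sqrt_1.
Qed.

Lemma Ccis_neq_0 (th : R) : Ccis th <> 0%C.
Proof. apply Cmod_gt_0; rewrite Cmod_Ccis; lra. Qed.

Lemma is_deriveC_Ccis (th : R) : is_deriveC Ccis th (Ci * Ccis th)%C.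
Proof.
apply is_deriveC_pair; unfold Ccis; simpl.
- auto_derive; [exact I|ring].
- auto_derive; [exact I|ring].
Qed.

Lemma Ccontinuous_Ccis (th : R) : Ccontinuous Ccis th.
Proof. apply (is_deriveC_continuous _ _ _ (is_deriveC_Ccis th)). Qed.

Lemma Ccis_lip (a b : R) : Cmod (Ccis b - Ccis a) <= Rabs (b - a).
Proof.
rewrite <- (Rmult_1_l (Rabs (b - a))).
apply (CRInt_norm_abs (fun s => Ci * Ccis s)%C a b).
- intros x _; rewrite Cmod_mult, Cmod_Ci, Cmod_Ccis; lra.
- apply is_CRInt_derive; intros x _; [apply is_deriveC_Ccis|].
  apply Ccontinuous_mult; [apply Ccontinuous_const|apply Ccontinuous_Ccis].
Qed.

Lemma is_deriveC_RInt_param (G dG : R -> R -> C) (a b x eta : R) : 0 < eta ->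
  (forall u v, Rabs (u - x) < eta -> is_deriveC (fun u => G u v) u (dG u v)) ->
  (forall u v, Rabs (u - x) < eta -> Ccontinuous (G u) v) ->
  (forall v eps, 0 < eps -> exists d, 0 < d /\ forall u' v',
      Rabs (u' - x) < d -> Rabs (v' - v) < d -> Cmod (dG u' v' - dG x v) < eps) ->
  is_deriveC (fun u => CRInt (G u) a b) x (CRInt (dG x) a b).
Proof.
intros He HD HC H2.
assert (Hx : Rabs (x - x) < eta) by (rewrite Rminus_diag, Rabs_R0; exact He).
assert (Hloc : forall P : R -> Prop, (forall u, Rabs (u - x) < eta -> P u) -> locally x P).
{ intros P HP; exists (mkposreal _ He); exact HP. }
assert (HdC : forall v, Ccontinuous (dG x) v).
{ intros v; apply filterlim_C_Cmod; [apply locally_filter|intros eps].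
  destruct (H2 v eps (cond_pos eps)) as [d [Hd Hd2]].
  exists (mkposreal _ Hd); intros w Hw; apply Hd2; [|exact Hw].
  rewrite Rminus_diag, Rabs_R0; exact Hd. }
assert (Hint : forall u, Rabs (u - x) < eta -> is_CRInt (G u) a b (CRInt (G u) a b)).
{ intros u Hu; apply CRInt_correct, ex_CRInt_continuous; intros v _; apply HC, Hu. }
assert (HintD : is_CRInt (dG x) a b (CRInt (dG x) a b)).
{ apply CRInt_correct, ex_CRInt_continuous; intros v _; apply HdC. }
(* [p] stands for the real or the imaginary part: both are 1-Lipschitz and commute with derivative
   and integral, so the real theorem is applied once for the two. *)
assert (Main : forall p : C -> R,
  (forall z w, Rabs (p z - p w) <= Cmod (z - w)) ->
  (forall u v, Rabs (u - x) < eta -> is_derive (fun u => p (G u v)) u (p (dG u v))) ->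
  (forall (f : R -> C) l, is_CRInt f a b l -> is_RInt (fun s => p (f s)) a b (p l)) ->
  is_derive (fun u => p (CRInt (G u) a b)) x (p (CRInt (dG x) a b))).
{ intros p Hp HpD HpI.
  assert (HpE : forall u v, Rabs (u - x) < eta -> Derive (fun u : R => p (G u v)) u = p (dG u v))
    by (intros; apply is_derive_unique, HpD; assumption).
  rewrite <- (is_RInt_unique _ _ _ _ (HpI _ _ HintD)).
  apply (is_derive_ext_loc (fun u => RInt (fun v => p (G u v)) a b)).
  { apply Hloc; intros u Hu; apply is_RInt_unique, HpI, Hint, Hu. }
  rewrite (RInt_ext (fun s => p (dG x s)) (fun t => Derive (fun u => p (G u t)) x)).
  2:{ intros v _; symmetry; apply is_derive_unique, HpD, Hx. }
  apply is_derive_RInt_param.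
  - apply Hloc; intros u Hu v _; eexists; apply HpD, Hu.
  - intros v _ eps.
    destruct (H2 v eps (cond_pos eps)) as [d [Hd Hd2]].
    assert (Hm : 0 < Rmin d eta) by (apply Rmin_glb_lt; assumption).
    exists (mkposreal _ Hm); intros u' v' Hu' Hv'; simpl in Hu', Hv'.
    rewrite !HpE; [|exact Hx|exact (Rlt_le_trans _ _ _ Hu' (Rmin_r _ _))].
    apply Rle_lt_trans with (1 := Hp _ _), Hd2.
    + apply Rlt_le_trans with (1 := Hu'), Rmin_l.
    + apply Rlt_le_trans with (1 := Hv'), Rmin_l.
  - apply Hloc; intros u Hu; eexists; apply HpI, Hint, Hu. }
apply is_deriveC_pair; apply Main.
- intros z w; apply (re_le_Cmod (z - w)).
- intros u v Hu; apply is_deriveC_Re, HD, Hu.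
- intros f l; apply is_CRInt_Re.
- intros z w; apply (Im_le_Cmod (z - w)).
- intros u v Hu; apply is_deriveC_Im, HD, Hu.
- intros f l; apply is_CRInt_Im.
Qed.

Lemma Ccontinuous_bounded (f : R -> C) (a b : R) : a <= b ->
  (forall x, Ccontinuous f x) ->
  exists B, 0 <= B /\ forall x, a <= x <= b -> Cmod (f x) <= B.
Proof.
intros Hab Hf.
assert (Hc : forall x, a <= x <= b -> continuity_pt (fun x => Cmod (f x)) x).
{ intros x _; apply continuity_pt_filterlim.
  apply filterlim_locally; intros eps.
  generalize (proj1 (filterlim_C_Cmod _ _ _) (Hf x) eps); apply filter_imp; intros y Hy.
  change (Rabs (Cmod (f y) - Cmod (f x)) < eps).
  apply Rle_lt_trans with (2 := Hy); apply Rabs_le.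
  assert (T1 := Cmod_triangle_inv (f x) (f y - f x)%C).
  assert (T2 := Cmod_triangle (f x) (f y - f x)%C).
  replace (f x + (f y - f x))%C with (f y) in T1, T2 by ring; lra. }
destruct (continuity_ab_maj (fun x => Cmod (f x)) a b Hab Hc) as [M [HM _]].
exists (Cmod (f M)); split; [apply Cmod_ge_0|exact HM].
Qed.

(** The Cauchy kernel in the angle variable: with zeta = e^(i th), the form d zeta / (i (zeta - q))
    is [Ckernel q th] d th. The normalizing constant is therefore [2 * PI], without a factor i. *)
Definition Ckernel (q : C) (th : R) : C := (Ccis th / (Ccis th - q))%C.

Lemma Ccis_minus_neq_0 (q : C) (th : R) : Cmod q < 1 -> (Ccis th - q)%C <> 0%C.
Proof.
intros Hq E.
assert (E2 : Ccis th = q).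
{ replace (Ccis th) with ((Ccis th - q) + q)%C by ring; rewrite E; ring. }
rewrite <- E2, Cmod_Ccis in Hq; lra.
Qed.

Lemma Cmod_Ckernel (q : C) (th : R) : Cmod q < 1 -> Cmod (Ckernel q th) <= / (1 - Cmod q).
Proof.
intros Hq; unfold Ckernel; rewrite Cmod_div by (apply Ccis_minus_neq_0, Hq).
rewrite Cmod_Ccis; unfold Rdiv; rewrite Rmult_1_l.
apply Rinv_le_contravar; [lra|].
assert (T := Cmod_triangle_inv (Ccis th) (- q)%C).
rewrite Cmod_Ccis, Cmod_opp in T; exact T.
Qed.

Lemma Ccontinuous_inv (f : R -> C) (x : R) :
  Ccontinuous f x -> f x <> 0%C -> Ccontinuous (fun s => / f s)%C x.
Proof.
intros Hf H0.
apply (Ccontinuous_comp Cinv f x Hf).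
apply CCcontinuous_eps; intros eps He.
set (z := f x) in *; assert (Hz : 0 < Cmod z) by (apply Cmod_gt_0, H0).
exists (Rmin (Cmod z / 2) (eps * (Cmod z * Cmod z) / 2)); split.
{ apply Rmin_glb_lt; [lra|]; apply Rdiv_lt_0_compat; [|lra].
  repeat apply Rmult_lt_0_compat; assumption. }
intros w Hw.
assert (H1 := Rlt_le_trans _ _ _ Hw (Rmin_l _ _)).
assert (H2 := Rlt_le_trans _ _ _ Hw (Rmin_r _ _)).
assert (T := Cmod_triangle_inv z (w - z)%C).
replace (z + (w - z))%C with w in T by ring.
assert (Hw0 : w <> 0%C) by (apply Cmod_gt_0; lra).
replace (/ w - / z)%C with ((z - w) / (w * z))%C by (field; split; assumption).
rewrite Cmod_div by (apply Cmult_neq_0; assumption).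
rewrite Cmod_mult, (Cmod_minus_sym z w).
apply Rmult_lt_reg_r with (Cmod w * Cmod z); [apply Rmult_lt_0_compat; lra|].
unfold Rdiv; rewrite Rmult_assoc, Rinv_l, Rmult_1_r
  by (apply Rgt_not_eq, Rmult_lt_0_compat; lra).
apply Rlt_le_trans with (1 := H2).
replace (eps * (Cmod z * Cmod z) / 2) with (eps * (Cmod z / 2 * Cmod z)) by field.
apply Rmult_le_compat_l; [lra|]; apply Rmult_le_compat_r; lra.
Qed.

Lemma Ccontinuous_Ckernel (q : C) (th : R) : Cmod q < 1 -> Ccontinuous (Ckernel q) th.
Proof.
intros Hq; apply Ccontinuous_mult; [apply Ccontinuous_Ccis|].
apply (Ccontinuous_inv (fun s => Ccis s - q)%C).
- apply Ccontinuous_minus; [apply Ccontinuous_Ccis|apply Ccontinuous_const].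
- apply Ccis_minus_neq_0, Hq.
Qed.

(* [krem W q n] is the remainder after n terms of the power series
   in q of the integral of W against the Cauchy kernel. *)
Definition kterm (q : C) (n : nat) (th : R) : C := ((q / Ccis th) ^ n)%C.
Definition krem (W : R -> C) (q : C) (n : nat) : C :=
  CRInt (fun th => W th * (kterm q n th * Ckernel q th))%C 0 (2 * PI).
Definition kcoef (W : R -> C) (n : nat) : C :=
  CRInt (fun th => W th * (/ Ccis th) ^ n)%C 0 (2 * PI).

Lemma Ccontinuous_pow (f : R -> C) (n : nat) (x : R) :
  Ccontinuous f x -> Ccontinuous (fun s => f s ^ n)%C x.
Proof.
intros Hf; induction n as [|n IH].
- apply Ccontinuous_const.
- apply (Ccontinuous_mult f (fun s => f s ^ n)%C); assumption.
Qed.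

Lemma Ccontinuous_kterm (q : C) (n : nat) (th : R) : Ccontinuous (kterm q n) th.
Proof.
apply Ccontinuous_pow, Ccontinuous_mult; [apply Ccontinuous_const|].
apply Ccontinuous_inv; [apply Ccontinuous_Ccis|apply Ccis_neq_0].
Qed.

(** One step of the geometric series, from [Ckernel q th = 1 + q / Ccis th * Ckernel q th]. The
    expansion stays finite, with an exact remainder, in place of an exchange of sum and integral. *)
Lemma krem_succ (W : R -> C) (q : C) (n : nat) : Cmod q < 1 ->
  (forall x, Ccontinuous W x) ->
  krem W q n = (q ^ n * kcoef W n + krem W q (S n))%C.
Proof.
intros Hq HW; unfold krem, kcoef.
assert (Hi : forall x, Ccontinuous (fun th => / Ccis th)%C x).
{ intros x; apply Ccontinuous_inv; [apply Ccontinuous_Ccis|apply Ccis_neq_0]. }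
apply CRInt_unique.
apply (is_CRInt_ext (fun th => q ^ n * (W th * (/ Ccis th) ^ n)
   + W th * (kterm q (S n) th * Ckernel q th))%C).
- intros th _; unfold kterm, Ckernel; unfold Cdiv; rewrite !Cpow_mult_l; simpl.
  field; split; [apply Ccis_minus_neq_0, Hq|apply Ccis_neq_0].
- apply is_CRInt_plus.
  + apply is_CRInt_Cmult, CRInt_correct, ex_CRInt_continuous; intros x _.
    apply Ccontinuous_mult; [apply HW|apply Ccontinuous_pow, Hi].
  + apply CRInt_correct, ex_CRInt_continuous; intros x _.
    apply Ccontinuous_mult; [apply HW|].
    apply Ccontinuous_mult; [apply Ccontinuous_kterm|apply Ccontinuous_Ckernel, Hq].
Qed.

Lemma krem_bound (W : R -> C) (q : C) (n : nat) (B : R) : Cmod q < 1 ->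
  (forall x, Ccontinuous W x) ->
  (forall x, 0 <= x <= 2 * PI -> Cmod (W x) <= B) ->
  Cmod (krem W q n) <= B * (Cmod q ^ n * / (1 - Cmod q)) * (2 * PI).
Proof.
intros Hq HW HB; unfold krem; pose proof PI_RGT_0.
replace (2 * PI) with (2 * PI - 0) at 2 by ring.
apply (CRInt_norm_const (fun th => W th * (kterm q n th * Ckernel q th))%C 0 (2 * PI));
  [lra| |apply CRInt_correct, ex_CRInt_continuous].
- intros x Hx; rewrite !Cmod_mult; unfold kterm; rewrite Cmod_pow, Cmod_div by apply Ccis_neq_0.
  rewrite Cmod_Ccis, Rdiv_1_r.
  pose proof (Cmod_ge_0 q); pose proof (pow_le (Cmod q) n (Cmod_ge_0 q)).
  apply Rmult_le_compat; [apply Cmod_ge_0| |apply HB, Hx|].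
  + apply Rmult_le_pos; [assumption|apply Cmod_ge_0].
  + apply Rmult_le_compat_l; [assumption|apply Cmod_Ckernel, Hq].
- intros x _; apply Ccontinuous_mult; [apply HW|].
  apply Ccontinuous_mult; [apply Ccontinuous_kterm|apply Ccontinuous_Ckernel, Hq].
Qed.

Lemma krem_lim (W : R -> C) (q : C) : Cmod q < 1 ->
  (forall x, Ccontinuous W x) -> forall eps, 0 < eps ->
  exists n, forall m, (n <= m)%nat -> Cmod (krem W q m) < eps.
Proof.
intros Hq HW eps He; pose proof PI_RGT_0; pose proof (Cmod_ge_0 q).
destruct (Ccontinuous_bounded W 0 (2 * PI) ltac:(lra) HW) as [B [HB0 HB]].
set (K := B * / (1 - Cmod q) * (2 * PI) + 1).
assert (HK : 0 < K).
{ assert (0 < / (1 - Cmod q)) by (apply Rinv_0_lt_compat; lra).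
  unfold K; apply Rplus_le_lt_0_compat; [|lra].
  apply Rmult_le_pos; [apply Rmult_le_pos|]; lra. }
destruct (pow_lt_1_zero (Cmod q) ltac:(rewrite Rabs_pos_eq; lra) (eps / K)
  ltac:(apply Rdiv_lt_0_compat; assumption)) as [n Hn].
exists n; intros m Hm; specialize (Hn m Hm).
pose proof (pow_le (Cmod q) m (Cmod_ge_0 q)) as Hp.
rewrite Rabs_pos_eq in Hn by exact Hp.
apply Rle_lt_trans with (1 := krem_bound W q m B Hq HW HB).
apply Rle_lt_trans with (Cmod q ^ m * K).
- unfold K; apply Rle_trans with (Cmod q ^ m * (B * / (1 - Cmod q) * (2 * PI))); [right; ring|].
  apply Rmult_le_compat_l; lra.
- apply Rmult_lt_compat_r with (r := K) in Hn; [|exact HK].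
  replace (eps / K * K) with eps in Hn by (field; lra); exact Hn.
Qed.

Lemma krem_eq_0 (W : R -> C) (q : C) (n : nat) : Cmod q < 1 ->
  (forall x, Ccontinuous W x) ->
  (forall m, (n <= m)%nat -> kcoef W m = 0%C) -> krem W q n = 0%C.
Proof.
intros Hq HW Hc.
assert (Hk : forall k, krem W q n = krem W q (n + k)%nat).
{ induction k as [|k IH]; [f_equal; lia|].
  rewrite IH, (krem_succ W q (n + k)), Hc, Nat.add_succ_r by (assumption || lia); ring. }
apply Cmod_eq_0, Rle_antisym; [|apply Cmod_ge_0].
apply Rnot_lt_le; intros Hpos.
destruct (krem_lim W q Hq HW _ Hpos) as [N HN].
specialize (HN (n + N)%nat ltac:(lia)); rewrite <- Hk in HN; lra.
Qed.

Lemma kcoef_const (n : nat) :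
  kcoef (fun _ => RtoC 1) n = match n with O => RtoC (2 * PI) | _ => RtoC 0 end.
Proof.
unfold kcoef; apply CRInt_unique; destruct n as [|n].
- apply (is_CRInt_ext (fun _ => RtoC 1)); [intros; simpl; ring|].
  generalize (is_CRInt_cst (RtoC 1) 0 (2 * PI)); rewrite Rminus_0_r, Cmult_1_r; auto.
- assert (Hn : RtoC (INR (S n)) <> 0%C).
  { intros E; apply RtoC_inj in E; revert E; apply not_0_INR; lia. }
  set (f := fun th : R => Cexp (RtoC (- INR (S n) * th) * Ci)%C).
  assert (Ef : forall th : R, f th = ((/ Ccis th) ^ S n)%C).
  { intros th; unfold f.
    assert (Ei : (/ Ccis th)%C = Cexp (0, - th)).
    { assert (E1 : (Ccis th * Cexp (0, - th)%R)%C = 1%C).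
      { apply C_ext; unfold Ccis, Cexp; simpl; rewrite exp_0, cos_neg, sin_neg.
        - ring_simplify; generalize (sin2_cos2 th); unfold Rsqr; simpl; lra.
        - ring. }
      transitivity (/ Ccis th * (Ccis th * Cexp (0, - th)%R))%C.
      - rewrite E1; ring.
      - field; apply Ccis_neq_0. }
    rewrite Ei; generalize (S n) as m; induction m as [|m IH].
    - simpl; replace (RtoC (- 0 * th) * Ci)%C with (RtoC 0); [apply Cexp_0|].
      apply C_ext; simpl; ring.
    - rewrite Cpow_S, <- IH, <- Cexp_plus, S_INR; f_equal.
      apply C_ext; simpl; ring. }
  apply (is_CRInt_ext (fun th => Ci / RtoC (INR (S n)) * (RtoC (- INR (S n)) * Ci * f th))%C).
  { intros th _; rewrite Ef, RtoC_opp, Cmult_1_l.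
    replace (Ci / RtoC (INR (S n)) * (- RtoC (INR (S n)) * Ci * (/ Ccis th) ^ S n))%C
      with (- (Ci * Ci) * (/ Ccis th) ^ S n)%C by (field; exact Hn).
    replace (Ci * Ci)%C with (- (1))%C by (apply C_ext; simpl; ring); ring. }
  assert (Hd : forall x, is_deriveC f x (RtoC (- INR (S n)) * Ci * f x)%C).
  { intros x; apply is_deriveC_Cexp.
    apply is_deriveC_pair; simpl; auto_derive; auto; ring. }
  replace (RtoC 0) with (Ci / RtoC (INR (S n)) * (f (2 * PI)%R - f 0%R))%C.
  + apply is_CRInt_Cmult, is_CRInt_derive; intros x _; [apply Hd|].
    apply Ccontinuous_mult; [apply Ccontinuous_const|].
    apply (is_deriveC_continuous _ _ _ (Hd x)).
  + rewrite !Ef; unfold Ccis; rewrite cos_2PI, sin_2PI, cos_0, sin_0; ring.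
Qed.

Lemma krem_const (q : C) : Cmod q < 1 -> krem (fun _ => RtoC 1) q 0 = RtoC (2 * PI).
Proof.
intros Hq; rewrite krem_succ, kcoef_const by (assumption || (intros; apply Ccontinuous_const)).
rewrite krem_eq_0; [simpl; ring|exact Hq|intros; apply Ccontinuous_const|].
intros [|m] Hm; [lia|apply kcoef_const].
Qed.

Section Cauchy.

Variables F g : C -> C.
Hypothesis HF : forall z, 0 < Re z -> is_Cderive F z (g z).
Hypothesis Hg : forall z, 0 < Re z -> CCcontinuous g z.
Variables (x0 r : R) (q : C).
Hypothesis Hr : 0 < r < x0.
Hypothesis Hq : Cmod q < 1.

(** Linear homotopy from the constant path at [x0 + r q] ([lam = 0]) to the circle ([lam = 1]). The
    integral of [F] along it against the fixed kernel turns out to be independent of [lam]; its two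
    ends are the two sides of the Cauchy formula. *)
Let p (lam th : R) : C := (RtoC x0 + RtoC r * (q + RtoC lam * (Ccis th - q)))%C.
(** Room beyond the interval from 0 to 1, since a two-sided derivative in [lam] is taken at the ends
    as well. Moving [lam] by less than [eta] moves the path by less than [2 r eta = x0 - r], so it
    stays in the right half-plane. *)
Let eta := (x0 - r) / (2 * r).

Let eta_pos : 0 < eta.
Proof. apply Rdiv_lt_0_compat; lra. Qed.

Let p_pos (l0 lam th : R) : 0 <= l0 <= 1 -> Rabs (lam - l0) < eta -> 0 < Re (p lam th).
Proof.
intros H0 H.
set (v := (q + RtoC lam * (Ccis th - q))%C).
assert (Hv : Cmod v <= 1 + 2 * Rabs (lam - l0)).
{ replace v with (RtoC (1 - l0) * q + RtoC l0 * Ccis th + RtoC (lam - l0) * (Ccis th - q))%C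
    by (unfold v; rewrite !RtoC_minus; ring).
  assert (T1 := Cmod_triangle (RtoC (1 - l0) * q + RtoC l0 * Ccis th) (RtoC (lam - l0) * (Ccis th - q))).
  assert (T2 := Cmod_triangle (RtoC (1 - l0) * q) (RtoC l0 * Ccis th)).
  assert (T3 := Cmod_triangle_minus (Ccis th) q).
  rewrite !Cmod_mult, !Cmod_R in *; rewrite Cmod_Ccis in *.
  rewrite (Rabs_pos_eq (1 - l0)), (Rabs_pos_eq l0) in * by lra.
  pose proof (Cmod_ge_0 q); pose proof (Rabs_pos (lam - l0)); nra. }
assert (Hre : - Cmod v <= Re v).
{ pose proof (re_le_Cmod v); pose proof (Rle_abs (- Re v)); rewrite Rabs_Ropp in *; lra. }
replace (Re (p lam th)) with (x0 + r * Re v) by (unfold p; fold v; simpl; ring).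
assert (E : r * (2 * eta) = x0 - r) by (unfold eta; field; lra).
assert (r * (2 * Rabs (lam - l0)) < r * (2 * eta)) by (apply Rmult_lt_compat_l; lra).
nra.
Qed.

Let p_deriv_th (lam th : R) : is_deriveC (p lam) th (RtoC (r * lam) * (Ci * Ccis th))%C.
Proof. apply is_deriveC_pair; unfold p; simpl; auto_derive; auto; ring. Qed.

Let p_deriv_lam (lam th : R) : is_deriveC (fun l => p l th) lam (RtoC r * (Ccis th - q))%C.
Proof. apply is_deriveC_pair; unfold p; simpl; auto_derive; auto; ring. Qed.

(** Differentiation in [lam] produces the factor [Ccis th - q], which cancels the pole of the
    kernel. Times [Ci * lam], what is left is the derivative in [th] of [F (p lam th)] around a
    closed loop. At [lam = 0], where [lam] cannot be divided out, the path is constant and the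
    integral of [Ccis] vanishes by itself. *)
Let dphi_zero (lam : R) : 0 <= lam <= 1 ->
  is_CRInt (fun th => RtoC r * Ccis th * g (p lam th))%C 0 (2 * PI) (RtoC 0).
Proof.
intros Hl.
assert (Hp : forall th, 0 < Re (p lam th)).
{ intros th; apply (p_pos lam); [exact Hl|]; rewrite Rminus_diag, Rabs_R0; exact eta_pos. }
destruct (Req_dec lam 0) as [E|E].
- subst lam.
  apply (is_CRInt_ext (fun th => RtoC r * - Ci * g (p 0 0) * (Ci * Ccis th))%C).
  + intros th _; replace (p 0 th) with (p 0 0) by (unfold p; ring).
    replace (RtoC r * - Ci * g (p 0 0) * (Ci * Ccis th))%C
      with (- (Ci * Ci) * (RtoC r * Ccis th * g (p 0%R 0%R)))%C by ring.
    replace (Ci * Ci)%C with (- (1))%C by (apply C_ext; simpl; ring); ring.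
  + replace (RtoC 0) with (RtoC r * - Ci * g (p 0%R 0%R) * (Ccis (2 * PI)%R - Ccis 0%R))%C.
    * apply is_CRInt_Cmult, is_CRInt_derive; intros x _; [apply is_deriveC_Ccis|].
      apply Ccontinuous_mult; [apply Ccontinuous_const|apply Ccontinuous_Ccis].
    * unfold Ccis; rewrite cos_2PI, sin_2PI, cos_0, sin_0; ring.
- assert (Hl0 : RtoC lam <> 0%C) by (intros A; apply RtoC_inj in A; contradiction).
  apply (is_CRInt_ext (fun th => - Ci / RtoC lam * (RtoC (r * lam) * (Ci * Ccis th) * g (p lam th)))%C).
  + intros th _; rewrite RtoC_mult.
    replace (- Ci / RtoC lam * (RtoC r * RtoC lam * (Ci * Ccis th) * g (p lam th)))%C
      with (- (Ci * Ci) * (RtoC r * Ccis th * g (p lam th)))%C by (field; exact Hl0).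
    replace (Ci * Ci)%C with (- (1))%C by (apply C_ext; simpl; ring); ring.
  + replace (RtoC 0) with (- Ci / RtoC lam * (F (p lam (2 * PI)%R) - F (p lam 0%R)))%C.
    * apply is_CRInt_Cmult, (is_CRInt_derive (fun th => F (p lam th))); intros x _.
      -- apply (is_deriveC_path F (p lam)); [apply HF, Hp|apply p_deriv_th].
      -- apply Ccontinuous_mult.
         ++ apply Ccontinuous_mult; [apply Ccontinuous_const|].
            apply Ccontinuous_mult; [apply Ccontinuous_const|apply Ccontinuous_Ccis].
         ++ apply Ccontinuous_comp; [|apply Hg, Hp].
            apply (is_deriveC_continuous _ _ _ (p_deriv_th lam x)).
    * replace (p lam (2 * PI)) with (p lam 0); [ring|].
      unfold p, Ccis; rewrite cos_2PI, sin_2PI, cos_0, sin_0; reflexivity.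
Qed.

Let phi (lam : R) : C := CRInt (fun th => F (p lam th) * Ckernel q th)%C 0 (2 * PI).

Let phi_deriv (lam : R) : 0 <= lam <= 1 -> is_deriveC phi lam (RtoC 0).
Proof.
intros Hl; rewrite <- (CRInt_unique _ _ _ _ (dphi_zero lam Hl)).
apply (is_deriveC_RInt_param (fun l th => F (p l th) * Ckernel q th)%C
  (fun l th => RtoC r * Ccis th * g (p l th))%C 0 (2 * PI) lam eta eta_pos).
- intros u v Hu; assert (Hp := p_pos lam u v Hl Hu).
  replace (RtoC r * Ccis v * g (p u v))%C
    with (RtoC r * (Ccis v - q) * g (p u v) * Ckernel q v + F (p u v) * 0)%C.
  2:{ unfold Ckernel; field; apply Ccis_minus_neq_0, Hq. }
  apply (is_deriveC_mult (fun l => F (p l v)) (fun _ => Ckernel q v)).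
  + apply (is_deriveC_path F (fun l => p l v)); [apply HF, Hp|apply p_deriv_lam].
  + apply (@is_derive_const R_AbsRing C_R_NormedModule).
- intros u v Hu; assert (Hp := p_pos lam u v Hl Hu).
  apply Ccontinuous_mult; [|apply Ccontinuous_Ckernel, Hq].
  apply (Ccontinuous_comp F (p u)).
  + apply (is_deriveC_continuous _ _ _ (p_deriv_th u v)).
  + apply (is_Cderive_continuous _ _ _ (HF _ Hp)).
- intros v eps He.
  assert (Hp : 0 < Re (p lam v)).
  { apply (p_pos lam); [exact Hl|]; rewrite Rminus_diag, Rabs_R0; exact eta_pos. }
  destruct (proj1 (CCcontinuous_eps _ _) (Hg _ Hp) (eps / (2 * r))) as [d [Hd Hw]].
  { apply Rdiv_lt_0_compat; lra. }
  set (gz := Cmod (g (p lam v))); assert (Hgz : 0 <= gz) by apply Cmod_ge_0.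
  set (d1 := d / (3 * r)); assert (Hd1 : 0 < d1) by (apply Rdiv_lt_0_compat; lra).
  set (d2 := eps / (2 * r * (gz + 1))); assert (Hd2 : 0 < d2) by (apply Rdiv_lt_0_compat; nra).
  exists (Rmin d1 d2); split; [apply Rmin_glb_lt; assumption|].
  intros u' v' Hu Hv.
  assert (Hu1 := Rlt_le_trans _ _ _ Hu (Rmin_l _ _)).
  assert (Hv1 := Rlt_le_trans _ _ _ Hv (Rmin_l _ _)).
  assert (Hv2 := Rlt_le_trans _ _ _ Hv (Rmin_r _ _)).
  assert (Hlip := Ccis_lip v v').
  assert (Hdp : Cmod (p u' v' - p lam v) < d).
  { replace (p u' v' - p lam v)%C with
      (RtoC r * (RtoC (u' - lam) * (Ccis v' - q) + RtoC lam * (Ccis v' - Ccis v)))%C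
      by (unfold p; rewrite RtoC_minus; ring).
    rewrite Cmod_mult, (Cmod_RtoC_pos r) by lra.
    assert (T1 := Cmod_triangle (RtoC (u' - lam) * (Ccis v' - q)) (RtoC lam * (Ccis v' - Ccis v))).
    assert (T3 := Cmod_triangle_minus (Ccis v') q).
    rewrite !Cmod_mult, !Cmod_R in T1; rewrite Cmod_Ccis in T3.
    rewrite (Rabs_pos_eq lam) in T1 by lra.
    assert (E : r * (3 * d1) = d) by (unfold d1; field; lra).
    rewrite <- E; apply Rmult_lt_compat_l; [lra|].
    pose proof (Rabs_pos (u' - lam)); pose proof (Cmod_ge_0 (Ccis v' - Ccis v)).
    assert (Rabs (u' - lam) * Cmod (Ccis v' - q) <= Rabs (u' - lam) * 2)
      by (apply Rmult_le_compat_l; lra).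
    assert (lam * Cmod (Ccis v' - Ccis v) <= 1 * Cmod (Ccis v' - Ccis v))
      by (apply Rmult_le_compat_r; lra).
    lra. }
  specialize (Hw _ Hdp).
  replace (RtoC r * Ccis v' * g (p u' v') - RtoC r * Ccis v * g (p lam v))%C with
    (RtoC r * (Ccis v' * (g (p u' v') - g (p lam v)) + (Ccis v' - Ccis v) * g (p lam v)))%C by ring.
  rewrite Cmod_mult, (Cmod_RtoC_pos r) by lra.
  assert (T := Cmod_triangle (Ccis v' * (g (p u' v') - g (p lam v))) ((Ccis v' - Ccis v) * g (p lam v))).
  rewrite !Cmod_mult, Cmod_Ccis in T; fold gz in T.
  assert (A1 : Cmod (Ccis v' - Ccis v) * gz <= d2 * (gz + 1)).
  { pose proof (Cmod_ge_0 (Ccis v' - Ccis v)); apply Rmult_le_compat; lra. }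
  assert (E1 : r * (d2 * (gz + 1)) = eps / 2) by (unfold d2; field; lra).
  assert (E2 : r * (eps / (2 * r)) = eps / 2) by (field; lra).
  apply Rle_lt_trans with (r * (Cmod (g (p u' v') - g (p lam v)) + d2 * (gz + 1))).
  { apply Rmult_le_compat_l; lra. }
  rewrite Rmult_plus_distr_l, E1.
  assert (r * Cmod (g (p u' v') - g (p lam v)) < r * (eps / (2 * r))) by (apply Rmult_lt_compat_l; lra).
  lra.
Qed.

Lemma Cauchy_formula :
  krem (fun th => F (RtoC x0 + RtoC r * Ccis th)%C) q 0 = (RtoC (2 * PI) * F (RtoC x0 + RtoC r * q)%C)%C.
Proof.
assert (E : phi 0 = phi 1).
{ apply (@eq_is_derive C_R_NormedModule); [|lra]; intros t Ht; apply phi_deriv, Ht. }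
unfold phi in E.
rewrite <- krem_const with q by exact Hq.
transitivity (CRInt (fun th => F (p 1%R th) * Ckernel q th)%C 0 (2 * PI)).
- unfold krem; apply (RInt_ext (V := C_R_CompleteNormedModule)); intros th _.
  unfold p, kterm; simpl; rewrite Cmult_1_l, Cmult_1_l.
  replace (q + (Ccis th - q))%C with (Ccis th) by ring; reflexivity.
- rewrite <- E; unfold krem; rewrite Cmult_comm, <- CRInt_Cmult.
  + apply (RInt_ext (V := C_R_CompleteNormedModule)); intros th _.
    unfold p, kterm; simpl; rewrite Cmult_0_l, Cplus_0_r, !Cmult_1_l; reflexivity.
  + apply ex_CRInt_continuous; intros x _.
    apply Ccontinuous_mult; [apply Ccontinuous_const|].
    apply Ccontinuous_mult; [apply Ccontinuous_kterm|apply Ccontinuous_Ckernel, Hq].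
Qed.

End Cauchy.

(** By the Cauchy formula the values on the disc are governed by the coefficients [kcoef W n], and
    vanishing on a real radius kills these one after the other. *)
Lemma disk_identity (F g : C -> C) (x0 r : R) :
  (forall z, 0 < Re z -> is_Cderive F z (g z)) ->
  (forall z, 0 < Re z -> CCcontinuous g z) -> 0 < r < x0 ->
  (forall x : R, 0 < x -> F (RtoC x) = 0%C) ->
  forall q : C, Cmod q < 1 -> F (RtoC x0 + RtoC r * q)%C = 0%C.
Proof.
intros HF Hg Hr H0 q Hq; pose proof PI_RGT_0.
set (W := fun th => F (RtoC x0 + RtoC r * Ccis th)%C).
assert (HW : forall x, Ccontinuous W x).
{ intros x; apply (Ccontinuous_comp F (fun th => RtoC x0 + RtoC r * Ccis th)%C).
  - apply Ccontinuous_plus; [apply Ccontinuous_const|].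
    apply Ccontinuous_mult; [apply Ccontinuous_const|apply Ccontinuous_Ccis].
  - eapply is_Cderive_continuous, HF.
    replace (Re (RtoC x0 + RtoC r * Ccis x)) with (x0 + r * cos x) by (unfold Ccis; simpl; ring).
    pose proof (COS_bound x); nra. }
destruct (Ccontinuous_bounded W 0 (2 * PI) ltac:(lra) HW) as [B [HB0 HB]].
assert (Hreal : forall t, 0 < t < 1 -> krem W (RtoC t) 0 = 0%C).
{ intros t Ht; unfold W.
  assert (Ht1 : Cmod (RtoC t) < 1) by (rewrite Cmod_RtoC_pos; lra).
  rewrite (Cauchy_formula F g HF Hg x0 r (RtoC t) Hr Ht1).
  rewrite <- RtoC_mult, <- RtoC_plus, H0 by nra; ring. }
assert (Hc : forall n m, (m < n)%nat -> kcoef W m = 0%C).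
{ induction n as [|n IH]; [lia|]; intros m Hm.
  destruct (Nat.eq_dec m n) as [->|Hne]; [|apply IH; lia].
  assert (Hk : forall t k, 0 < t < 1 -> (k <= n)%nat -> krem W (RtoC t) k = 0%C).
  { intros t k Ht; induction k as [|k IHk]; intros Hk; [apply Hreal, Ht|].
    assert (Ht1 : Cmod (RtoC t) < 1) by (rewrite Cmod_RtoC_pos; lra).
    specialize (IHk ltac:(lia)); rewrite krem_succ, IH in IHk by (assumption || lia).
    rewrite <- IHk; ring. }
  (* With the coefficients of index below [n] gone, [t ^ n * kcoef W n] is minus the next remainder,
     which is of order [t ^ (n + 1)]; letting [t] tend to 0 then forces [kcoef W n = 0]. *)
  assert (Hb : forall t, 0 < t <= / 2 -> Cmod (kcoef W n) <= B * 4 * PI * t).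
  { intros t Ht.
    assert (Ht1 : Cmod (RtoC t) < 1) by (rewrite Cmod_RtoC_pos; lra).
    assert (K0 := Hk t n ltac:(lra) (Nat.le_refl n)).
    rewrite krem_succ in K0 by assumption.
    assert (K1 := krem_bound W (RtoC t) (S n) B Ht1 HW HB).
    assert (E : Cmod (RtoC t ^ n * kcoef W n)%C = Cmod (krem W (RtoC t) (S n))).
    { rewrite <- (Cmod_opp (krem W (RtoC t) (S n))); f_equal.
      replace (RtoC t ^ n * kcoef W n)%C with
        ((RtoC t ^ n * kcoef W n + krem W (RtoC t) (S n)) - krem W (RtoC t) (S n))%C by ring.
      rewrite K0; ring. }
    rewrite Cmod_mult, Cmod_pow, Cmod_RtoC_pos in E by lra.
    rewrite Cmod_RtoC_pos in K1 by lra.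
    assert (Hp : 0 < t ^ n) by (apply pow_lt; lra).
    apply Rmult_le_reg_l with (1 := Hp); rewrite E.
    apply Rle_trans with (1 := K1); simpl.
    assert (Hi : / (1 - t) <= 2).
    { apply Rle_trans with (/ (/ 2)); [apply Rinv_le_contravar; lra|rewrite Rinv_inv; lra]. }
    apply Rle_trans with (B * (t * t ^ n * 2) * (2 * PI)); [|right; ring].
    apply Rmult_le_compat_r; [lra|]; apply Rmult_le_compat_l; [exact HB0|].
    apply Rmult_le_compat_l; [nra|exact Hi]. }
  apply Cmod_eq_0, Rle_antisym; [|apply Cmod_ge_0].
  apply Rnot_lt_le; intros Hpos.
  set (K := B * 4 * PI + 1); assert (HK : 0 < K) by (unfold K; nra).
  set (c := Cmod (kcoef W n)) in *.
  assert (Hck : 0 < c / (2 * K)) by (apply Rdiv_lt_0_compat; lra).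
  specialize (Hb (Rmin (/ 2) (c / (2 * K)))).
  assert (Hm1 := Rmin_l (/ 2) (c / (2 * K))); assert (Hm2 := Rmin_r (/ 2) (c / (2 * K))).
  assert (Hm0 : 0 < Rmin (/ 2) (c / (2 * K))) by (apply Rmin_glb_lt; lra).
  specialize (Hb ltac:(lra)).
  assert (K * (c / (2 * K)) = c / 2) by (field; lra).
  assert (K * Rmin (/ 2) (c / (2 * K)) <= K * (c / (2 * K))) by (apply Rmult_le_compat_l; lra).
  assert (B * 4 * PI * Rmin (/ 2) (c / (2 * K)) <= K * Rmin (/ 2) (c / (2 * K)))
    by (apply Rmult_le_compat_r; [lra|unfold K; lra]).
  lra. }
assert (E : krem W q 0 = 0%C).
{ apply krem_eq_0; auto; intros m _; apply (Hc (S m)); lia. }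
unfold W in E; rewrite (Cauchy_formula F g HF Hg x0 r q Hr Hq) in E.
apply Cmod_eq_0; apply (f_equal Cmod) in E; rewrite Cmod_mult, Cmod_0 in E.
apply Rmult_integral in E; destruct E as [E|E]; [|exact E].
rewrite Cmod_RtoC_pos in E by lra; lra.
Qed.

Lemma half_plane_identity (g : C -> C) :
  (forall z, 0 < Re z -> holomorphic_at g z) ->
  (forall x : R, 0 < x -> g (RtoC x) = 0%C) ->
  forall z, 0 < Re z -> g z = 0%C.
Proof.
intros Hg H0 z Hz.
destruct (half_plane_primitive g Hg H0) as [P [HP HP0]].
(* The disc about [x0] with the origin on its boundary contains [z] exactly when |z|^2 < 2 x0 Re z;
   this choice gives x0 Re z = |z|^2 + Re z. *)
set (x0 := Cmod z ^ 2 / Re z + 1).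
assert (Hzm := Cmod_ge_0 z).
assert (Hx0 : 1 <= x0).
{ unfold x0; assert (0 <= Cmod z ^ 2 / Re z) by (apply Rdiv_le_0_compat; [nra|exact Hz]); lra. }
assert (Hlt : Cmod (z - RtoC x0) < x0).
{ apply Rsqr_incrst_0; [|apply Cmod_ge_0|lra].
  unfold Rsqr; replace (Cmod (z - RtoC x0) * Cmod (z - RtoC x0)) with (Cmod (z - RtoC x0) ^ 2) by ring.
  rewrite Cmod2_alt.
  replace (Re (z - RtoC x0)) with (Re z - x0) by (destruct z; simpl; ring).
  replace (Im (z - RtoC x0)) with (Im z) by (destruct z; simpl; ring).
  assert (E := Cmod2_alt z).
  assert (E2 : x0 * Re z = Cmod z ^ 2 + Re z) by (unfold x0; field; lra).
  nra. }
set (d := Cmod (z - RtoC x0)) in *.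
assert (Hd0 : 0 <= d) by apply Cmod_ge_0.
set (r := (d + x0) / 2).
assert (Hr : 0 < r < x0) by (unfold r; lra).
assert (Hr0 : RtoC r <> 0%C) by (intros E; apply RtoC_inj in E; lra).
assert (Hloc : forall w, Cmod (w - z) < r - d -> P w = 0%C).
{ intros w Hw.
  replace w with (RtoC x0 + RtoC r * ((w - RtoC x0) / RtoC r))%C by (field; exact Hr0).
  apply (disk_identity P g); auto.
  - intros u Hu; apply holomorphic_at_continuous, Hg, Hu.
  - rewrite Cmod_div, (Cmod_RtoC_pos r) by (assumption || lra).
    apply Rmult_lt_reg_r with r; [lra|].
    unfold Rdiv; rewrite Rmult_assoc, Rinv_l, Rmult_1_r, Rmult_1_l by lra.
    assert (T := Cmod_triangle (w - z) (z - RtoC x0)).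
    replace (w - z + (z - RtoC x0))%C with (w - RtoC x0)%C in T by ring.
    fold d in T; lra. }
(* The primitive vanishes near [z], hence so does its derivative [g z]; a small real increment [t]
   inside both radii is enough to see it. *)
apply Cmod_eq_0, Rle_antisym; [|apply Cmod_ge_0].
apply Rnot_lt_le; intros Hpos.
destruct (proj1 (is_Cderive_eps _ _ _) (HP z Hz) (Cmod (g z) / 2) ltac:(lra)) as [e [He Hh]].
set (t := Rmin e (r - d) / 2).
assert (Ht : 0 < t) by (unfold t; assert (0 < Rmin e (r - d)) by (apply Rmin_glb_lt; unfold r; lra); lra).
assert (Ht1 : t < e) by (unfold t in *; pose proof (Rmin_l e (r - d)); lra).
assert (Ht2 : t < r - d) by (unfold t in *; pose proof (Rmin_r e (r - d)); lra).
assert (Hmt : Cmod (RtoC t) = t) by (apply Cmod_RtoC_pos; lra).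
specialize (Hh (RtoC t) ltac:(lra)).
rewrite (Hloc (z + RtoC t)%C), (Hloc z) in Hh.
- replace (0 - 0 - RtoC t * g z)%C with (- (RtoC t * g z))%C in Hh by ring.
  rewrite Cmod_opp, Cmod_mult, Hmt in Hh; nra.
- replace (z - z)%C with (RtoC 0) by ring; rewrite Cmod_0; unfold r; lra.
- replace (z + RtoC t - z)%C with (RtoC t) by ring; lra.
Qed.

(** * From the half-plane to the exterior of the unit disc *)

Lemma Cexp_sub_le (a b : C) (M : R) :
  (forall x, 0 <= x <= 1 -> Re a + x * Re b <= M) ->
  Cmod (Cexp (a + b) - Cexp a) <= Cmod b * exp M.
Proof.
intros H.
set (f := fun x : R => Cexp (a + RtoC x * b)%C).
assert (Hd : forall x, is_deriveC f x (b * f x)%C).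
{ intros x; apply is_deriveC_Cexp.
  apply is_deriveC_pair; simpl; auto_derive; auto; unfold Re, Im; ring. }
replace (Cexp (a + b) - Cexp a)%C with (f 1 - f 0)%C
  by (unfold f; f_equal; [f_equal; ring|f_equal; f_equal; ring]).
replace (Cmod b * exp M) with (Cmod b * exp M * (1 - 0)) by ring.
apply (CRInt_norm_const (fun x => b * f x)%C 0 1); [lra| |].
- intros x Hx; rewrite Cmod_mult; apply Rmult_le_compat_l; [apply Cmod_ge_0|].
  unfold f; rewrite Cmod_Cexp.
  replace (Re (a + RtoC x * b)) with (Re a + x * Re b) by (simpl; unfold Re; ring).
  destruct (H x Hx) as [L|L]; [left; apply exp_increasing, L|rewrite L; apply Rle_refl].
- apply is_CRInt_derive; intros x _; [apply Hd|].
  apply Ccontinuous_mult; [apply Ccontinuous_const|apply (is_deriveC_continuous _ _ _ (Hd x))].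
Qed.

(** The bound uses the real part along the segment instead of [Cmod b]. It will be applied with
    [b = - h s], [s] ranging over the half-line, where the segment keeps the real part below that of
    the Gaussian; the constant then does not depend on [h]. *)
Lemma Cexp_taylor (a b : C) (M : R) :
  (forall x, 0 <= x <= 1 -> Re a + x * Re b <= M) ->
  Cmod (Cexp (a + b) - Cexp a - b * Cexp a) <= Cmod b ^ 2 * exp M.
Proof.
intros H.
set (f := fun x : R => Cexp (a + RtoC x * b)%C).
assert (Hd : forall x, is_deriveC f x (b * f x)%C).
{ intros x; apply is_deriveC_Cexp.
  apply is_deriveC_pair; simpl; auto_derive; auto; unfold Re, Im; ring. }
assert (E0 : f 0 = Cexp a) by (unfold f; f_equal; ring).
assert (E1 : f 1 = Cexp (a + b)%C) by (unfold f; f_equal; ring).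
rewrite <- E0, <- E1.
replace (Cmod b ^ 2 * exp M) with (Cmod b * (Cmod b * exp M) * (1 - 0)) by ring.
apply (CRInt_norm_const (fun x => b * f x - b * f 0%R)%C 0 1); [lra| |].
- intros x Hx; replace (b * f x - b * f 0%R)%C with (b * (f x - f 0%R))%C by ring.
  rewrite Cmod_mult; apply Rmult_le_compat_l; [apply Cmod_ge_0|].
  rewrite E0; unfold f.
  apply Rle_trans with (Cmod (RtoC x * b) * exp M).
  + apply Cexp_sub_le; intros y Hy.
    replace (Re (RtoC x * b)) with (x * Re b) by (simpl; unfold Re; ring).
    specialize (H (y * x) ltac:(nra)); lra.
  + rewrite Cmod_mult, Cmod_RtoC_pos by lra.
    apply Rmult_le_compat_r; [left; apply exp_pos|].
    pose proof (Cmod_ge_0 b); nra.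
- apply is_CRInt_minus.
  + apply is_CRInt_derive; intros x _; [apply Hd|].
    apply Ccontinuous_mult; [apply Ccontinuous_const|apply (is_deriveC_continuous _ _ _ (Hd x))].
  + generalize (is_CRInt_cst (b * f 0%R)%C 0 1); rewrite Rminus_0_r, Cmult_1_l; auto.
Qed.

Lemma is_Cderive_Cexp (z : C) : is_Cderive Cexp z (Cexp z).
Proof.
apply (is_Cderive_quad _ _ _ (exp (Re z + 1)) 1 Rlt_0_1); intros h Hh.
rewrite Rmult_comm; apply Cexp_taylor; intros x Hx.
pose proof (re_le_Cmod h); pose proof (Rle_abs (Re h)); pose proof (Rabs_pos (Re h)); nra.
Qed.

Lemma is_Cderive_comp (f g : C -> C) (z l v : C) :
  is_Cderive f (g z) l -> is_Cderive g z v ->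
  is_Cderive (fun s => f (g s)) z (v * l)%C.
Proof.
intros Hf Hg; apply is_Cderive_eps; intros eps He.
set (M := Cmod v + 1); assert (HM : 0 < M) by (unfold M; pose proof (Cmod_ge_0 v); lra).
assert (Hl := Cmod_ge_0 l).
set (e1 := eps / (2 * M)); assert (He1 : 0 < e1) by (apply Rdiv_lt_0_compat; lra).
set (e2 := Rmin 1 (eps / (2 * (Cmod l + 1)))).
assert (He2 : 0 < e2) by (apply Rmin_glb_lt; [lra|apply Rdiv_lt_0_compat; lra]).
destruct (proj1 (is_Cderive_eps _ _ _) Hf e1 He1) as [d1 [Hd1 H1]].
destruct (proj1 (is_Cderive_eps _ _ _) Hg e2 He2) as [d2 [Hd2 H2]].
exists (Rmin d2 (d1 / M)); split.
{ apply Rmin_glb_lt; [exact Hd2|apply Rdiv_lt_0_compat; assumption]. }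
intros h Hh.
specialize (H2 h (Rlt_le_trans _ _ _ Hh (Rmin_l _ _))).
assert (Hh' := Rlt_le_trans _ _ _ Hh (Rmin_r _ _)).
set (k := (g (z + h)%C - g z)%C) in *.
assert (H0 := Cmod_ge_0 h).
assert (Hk : Cmod k <= M * Cmod h).
{ assert (T := Cmod_triangle (k - h * v)%C (h * v)%C).
  replace (k - h * v + h * v)%C with k in T by ring.
  rewrite Cmod_mult in T.
  assert (e2 <= 1) by apply Rmin_l; unfold M; nra. }
assert (Hkd : Cmod k < d1).
{ apply Rle_lt_trans with (1 := Hk).
  apply Rmult_lt_compat_l with (r := M) in Hh'; [|exact HM].
  replace (M * (d1 / M)) with d1 in Hh' by (field; lra); exact Hh'. }
specialize (H1 k Hkd).
replace (g z + k)%C with (g (z + h)%C) in H1 by (unfold k; ring).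
assert (T := Cmod_triangle (f (g (z + h)%C) - f (g z) - k * l)%C ((k - h * v) * l)%C).
replace (f (g (z + h)%C) - f (g z) - k * l + (k - h * v) * l)%C
  with (f (g (z + h)%C) - f (g z) - h * (v * l))%C in T by ring.
rewrite Cmod_mult in T.
assert (A : e1 * Cmod k <= eps / 2 * Cmod h).
{ apply Rle_trans with (e1 * (M * Cmod h)); [apply Rmult_le_compat_l; lra|].
  right; unfold e1; field; lra. }
assert (B : Cmod (k - h * v) * Cmod l <= eps / 2 * Cmod h).
{ apply Rle_trans with (e2 * Cmod h * Cmod l); [apply Rmult_le_compat_r; assumption|].
  assert (E2 : e2 <= eps / (2 * (Cmod l + 1))) by apply Rmin_r.
  apply Rle_trans with (eps / (2 * (Cmod l + 1)) * Cmod h * (Cmod l + 1)).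
  - apply Rmult_le_compat; [apply Rmult_le_pos; lra|lra| |lra].
    apply Rmult_le_compat_r; assumption.
  - right; field; lra. }
lra.
Qed.

Lemma Cexp_surj (Q : C) : Q <> 0%C -> exists z : C, Q = Cexp z /\ Re z = ln (Cmod Q).
Proof.
intros H0; assert (Hm : 0 < Cmod Q) by (apply Cmod_gt_0, H0).
set (m := Cmod Q) in *.
assert (E2 := Cmod2_alt Q); fold m in E2.
assert (Hre : -1 <= Re Q / m <= 1).
{ pose proof (re_le_Cmod Q) as A; fold m in A; apply Rabs_le_between in A.
  split; apply Rmult_le_reg_r with m; try exact Hm; unfold Rdiv;
    rewrite Rmult_assoc, Rinv_l by lra; lra. }
assert (Hs : sin (acos (Re Q / m)) = Rabs (Im Q) / m).
{ rewrite sin_acos by exact Hre.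
  replace (1 - (Re Q / m)²) with ((Im Q / m)²).
  - rewrite sqrt_Rsqr_abs; unfold Rdiv; rewrite Rabs_mult, (Rabs_pos_eq (/ m)); [reflexivity|].
    left; apply Rinv_0_lt_compat, Hm.
  - unfold Rsqr; apply Rmult_eq_reg_r with (m ^ 2); [|apply pow_nonzero; lra].
    field_simplify; [|lra|lra]; rewrite E2; ring. }
destruct (Rle_lt_dec 0 (Im Q)) as [L|L].
- exists (ln m, acos (Re Q / m)); split; [|reflexivity].
  apply C_ext; unfold Cexp; simpl; rewrite exp_ln by exact Hm.
  + rewrite cos_acos by exact Hre; field; lra.
  + rewrite Hs, Rabs_pos_eq by exact L; field; lra.
- exists (ln m, - acos (Re Q / m)); split; [|reflexivity].
  apply C_ext; unfold Cexp; simpl; rewrite exp_ln by exact Hm.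
  + rewrite cos_neg, cos_acos by exact Hre; field; lra.
  + rewrite sin_neg, Hs, Rabs_left by exact L; field; lra.
Qed.

Theorem exterior_identity (f g : C -> C) :
  (forall Q, 1 < Cmod Q -> holomorphic_at f Q) ->
  (forall Q, 1 < Cmod Q -> holomorphic_at g Q) ->
  (forall x : R, 1 < x -> f (RtoC x) = g (RtoC x)) ->
  forall Q, 1 < Cmod Q -> f Q = g Q.
Proof.
intros Hf Hg H Q HQ.
assert (HQ0 : Q <> 0%C) by (apply Cmod_gt_0; lra).
destruct (Cexp_surj Q HQ0) as [z [Ez Hz]].
assert (Hz0 : 0 < Re z) by (rewrite Hz, <- ln_1; apply ln_increasing; lra).
assert (Hexp : forall w, 0 < Re w -> 1 < Cmod (Cexp w)).
{ intros w Hw; rewrite Cmod_Cexp, <- exp_0; apply exp_increasing, Hw. }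
assert (E : (f (Cexp z) - g (Cexp z))%C = 0%C).
{ apply (half_plane_identity (fun z => f (Cexp z) - g (Cexp z))%C); [| |exact Hz0].
  - intros w Hw.
    destruct (Hf _ (Hexp w Hw)) as [lf Hlf]; destruct (Hg _ (Hexp w Hw)) as [lg Hlg].
    exists (minus (Cexp w * lf)%C (Cexp w * lg)%C).
    apply (@is_derive_minus C_AbsRing C_NormedModule (fun z => f (Cexp z)) (fun z => g (Cexp z)));
      apply is_Cderive_comp; auto; apply is_Cderive_Cexp.
  - intros x Hx; rewrite Cexp_RtoC, H; [ring|].
    rewrite <- exp_0; apply exp_increasing, Hx. }
rewrite Ez; replace (f (Cexp z)) with ((f (Cexp z) - g (Cexp z)) + g (Cexp z))%C by ring.
rewrite E; ring.
Qed.

(** * Laplace transforms of Gaussian moments *)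

(** Integrating this gives, up to sign, the k-th derivative in [z] of the Laplace transform of a
    Gaussian. The parameter [ga] is complex since a Mordell integral has [ga = c / t]; after
    rescaling only the real value [c] remains. *)
Definition lgf (ga : C) (k : nat) (z : C) (s : R) : C :=
  (RtoC (s ^ k) * Cexp (- (ga * RtoC (s ^ 2)) - z * RtoC s))%C.

Definition LG (ga : C) (k : nat) (z : C) : C := CInt0oo (lgf ga k z).

Definition lgM (ga : C) (k : nat) : R := exp (INR (k + 1) ^ 2 / (4 * Re ga)).

(** [s ^ k] is at most [exp (k s)], and completing the square in [(k + 1) s - g s^2] gives the
    maximum [(k + 1)^2 / (4 g)]; the extra 1 buys the factor [exp (- s)]. *)
Lemma gauss_moment_le (g : R) (k : nat) (s : R) : 0 < g -> 0 <= s ->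
  s ^ k * exp (- g * s ^ 2) <= exp (INR (k + 1) ^ 2 / (4 * g)) * exp (- 1 * s).
Proof.
intros Hg Hs.
assert (H1 : s ^ k <= exp (INR k * s)).
{ induction k as [|k IH]; [simpl; rewrite Rmult_0_l, exp_0; lra|].
  rewrite S_INR; replace ((INR k + 1) * s) with (s + INR k * s) by ring.
  rewrite exp_plus; simpl; apply Rmult_le_compat; auto using pow_le.
  pose proof (exp_ineq1_le s); lra. }
apply Rle_trans with (exp (INR k * s) * exp (- g * s ^ 2)).
{ apply Rmult_le_compat_r; [left; apply exp_pos|exact H1]. }
rewrite <- !exp_plus, plus_INR; change (INR 1) with 1.
set (m := INR k).
assert (E : (m + 1) ^ 2 / (4 * g) + -1 * s - (m * s + - g * s ^ 2)
  = g * (s - (m + 1) / (2 * g)) ^ 2) by (field; lra).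
assert (0 <= g * (s - (m + 1) / (2 * g)) ^ 2) by (apply Rmult_le_pos; [lra|apply pow2_ge_0]).
destruct (Rle_lt_or_eq_dec (m * s + - g * s ^ 2) ((m + 1) ^ 2 / (4 * g) + -1 * s)) as [L|L]; [lra| |].
- left; apply exp_increasing, L.
- rewrite L; apply Rle_refl.
Qed.

Lemma lgf_exponent_Re (ga z : C) (s : R) :
  Re (- (ga * RtoC (s ^ 2)) - z * RtoC s) = - Re ga * s ^ 2 - Re z * s.
Proof. destruct ga, z; simpl; ring. Qed.

Lemma exp_le (x y : R) : x <= y -> exp x <= exp y.
Proof. intros [L|L]; [left; apply exp_increasing, L|rewrite L; apply Rle_refl]. Qed.

Lemma lgf_bound (ga : C) (k : nat) (z : C) (s : R) : 0 < Re ga -> 0 <= Re z -> 0 <= s ->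
  Cmod (lgf ga k z s) <= lgM ga k * exp (- 1 * s).
Proof.
intros Hg Hz Hs; unfold lgf; rewrite Cmod_mult, Cmod_Cexp, lgf_exponent_Re.
rewrite Cmod_RtoC_pos by (apply pow_le, Hs).
apply Rle_trans with (2 := gauss_moment_le (Re ga) k s Hg Hs).
apply Rmult_le_compat_l; [apply pow_le, Hs|apply exp_le; nra].
Qed.

Lemma lgf_derive_exp (ga z : C) (s : R) :
  is_deriveC (fun s => Cexp (- (ga * RtoC (s ^ 2)) - z * RtoC s)%C) s
    ((- (2 * ga * RtoC s) - z) * Cexp (- (ga * RtoC (s ^ 2)) - z * RtoC s))%C.
Proof.
apply is_deriveC_Cexp; destruct ga, z.
apply is_deriveC_pair; simpl; auto_derive; auto; ring.
Qed.

Lemma lgf_continuous (ga : C) (k : nat) (z : C) (s : R) : Ccontinuous (lgf ga k z) s.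
Proof.
apply Ccontinuous_mult.
- apply (is_deriveC_continuous _ _ (RtoC (INR k * s ^ pred k))).
  apply is_deriveC_pair; simpl; auto_derive; auto; ring.
- apply (is_deriveC_continuous _ _ _ (lgf_derive_exp ga z s)).
Qed.

Lemma LG_correct (ga : C) (k : nat) (z : C) : 0 < Re ga -> 0 <= Re z ->
  is_CInt (lgf ga k z) (LG ga k z).
Proof.
intros Hg Hz.
destruct (is_CInt_dominated (lgf ga k z) (lgM ga k) 1 Rlt_0_1) as [l [Hl _]].
- intros b _; apply ex_CRInt_continuous; intros; apply lgf_continuous.
- intros s Hs; replace (- (1) * s) with (-1 * s) by ring; apply lgf_bound; lra.
- unfold LG; rewrite (is_CInt_CInt0oo _ _ Hl); exact Hl.
Qed.

Lemma LG_bound (ga : C) (k : nat) (z : C) : 0 < Re ga -> 0 <= Re z ->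
  Cmod (LG ga k z) <= lgM ga k.
Proof.
intros Hg Hz; rewrite <- (Rdiv_1_r (lgM ga k)).
apply (is_CInt_le _ _ _ 1 Rlt_0_1 (LG_correct ga k z Hg Hz)).
intros s Hs; apply lgf_bound; lra.
Qed.

Lemma lgf_lim (ga : C) (k : nat) (z : C) : 0 < Re ga -> 0 <= Re z ->
  filterlim (lgf ga k z) (Rbar_locally p_infty) (@locally C_UniformSpace (RtoC 0)).
Proof.
intros Hg Hz; apply filterlim_C_Cmod; [apply Rbar_locally_filter|intros eps].
assert (HM : 0 < lgM ga k) by apply exp_pos.
assert (He : 0 < eps / lgM ga k) by (apply Rdiv_lt_0_compat; [apply eps|exact HM]).
destruct (proj1 (filterlim_locally _ _) (exp_decay_lim 1 Rlt_0_1) (mkposreal _ He)) as [B HB].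
exists (Rmax B 0); intros s Hs.
assert (Hs1 := Rle_lt_trans _ _ _ (Rmax_l _ _) Hs).
assert (Hs2 := Rle_lt_trans _ _ _ (Rmax_r _ _) Hs).
specialize (HB s Hs1); simpl in HB.
change (Rabs (exp (- (1) * s) - 0) < eps / lgM ga k) in HB.
rewrite Rminus_0_r, Rabs_pos_eq in HB by (left; apply exp_pos).
replace (lgf ga k z s - 0)%C with (lgf ga k z s) by ring.
apply Rle_lt_trans with (1 := lgf_bound ga k z s Hg Hz (Rlt_le _ _ Hs2)).
apply Rmult_lt_compat_l with (r := lgM ga k) in HB; [|exact HM].
replace (lgM ga k * (eps / lgM ga k)) with (eps : R) in HB by (field; lra); exact HB.
Qed.

Lemma LG_rec_0 (ga z : C) : 0 < Re ga -> 0 <= Re z ->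
  (2 * ga * LG ga 1 z + z * LG ga 0 z = 1)%C.
Proof.
intros Hg Hz.
assert (H1 := is_CInt_plus _ _ _ _
  (is_CInt_Cmult (2 * ga)%C _ _ (LG_correct ga 1 z Hg Hz))
  (is_CInt_Cmult z _ _ (LG_correct ga 0 z Hg Hz))).
assert (H2 : is_CInt (fun s => - (1) * ((- (2 * ga * RtoC s) - z) * Cexp (- (ga * RtoC (s ^ 2)) - z * RtoC s)))%C
   (- (1) * - Cexp (- (ga * RtoC (0 ^ 2)) - z * RtoC 0))%C).
{ apply is_CInt_Cmult.
  apply (is_CInt_derive (fun s => Cexp (- (ga * RtoC (s ^ 2)) - z * RtoC s)%C)).
  - intros x; apply lgf_derive_exp.
  - intros x; apply Ccontinuous_mult.
    + apply (is_deriveC_continuous _ _ (- (2 * ga))%C); destruct ga, z.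
      apply is_deriveC_pair; simpl; auto_derive; auto; ring.
    + apply (is_deriveC_continuous _ _ _ (lgf_derive_exp ga z x)).
  - generalize (lgf_lim ga 0 z Hg Hz); apply filterlim_ext; intros s; unfold lgf; simpl; ring. }
rewrite (fun H => is_CInt_unique _ _ _ H1 (is_CInt_ext _ _ _ H H2)).
2:{ intros s _; unfold lgf; rewrite pow_1, pow_O; ring. }
replace (- (ga * RtoC (0 ^ 2)) - z * RtoC 0)%C with (RtoC 0)
  by (apply C_ext; destruct ga, z; simpl; ring).
rewrite Cexp_0; ring.
Qed.

Lemma LG_rec_S (ga z : C) (k : nat) : 0 < Re ga -> 0 <= Re z ->
  (2 * ga * LG ga (S (S k)) z + z * LG ga (S k) z = RtoC (INR (S k)) * LG ga k z)%C.
Proof.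
intros Hg Hz.
assert (H1 := is_CInt_minus _ _ _ _
  (is_CInt_plus _ _ _ _
    (is_CInt_Cmult (2 * ga)%C _ _ (LG_correct ga (S (S k)) z Hg Hz))
    (is_CInt_Cmult z _ _ (LG_correct ga (S k) z Hg Hz)))
  (is_CInt_Cmult (RtoC (INR (S k))) _ _ (LG_correct ga k z Hg Hz))).
set (E := fun s : R => Cexp (- (ga * RtoC (s ^ 2)) - z * RtoC s)%C).
set (df := fun s : R => (RtoC (INR (S k) * s ^ k) * E s + RtoC (s ^ S k) * ((- (2 * ga * RtoC s) - z) * E s))%C).
assert (H2 : is_CInt (fun s => - (1) * df s)%C (- (1) * - lgf ga (S k) z 0)%C).
{ apply is_CInt_Cmult, is_CInt_derive.
  - intros x; unfold lgf, df.
    apply (is_deriveC_mult (fun s => RtoC (s ^ S k)) E).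
    + apply is_deriveC_pair; simpl; auto_derive; auto; try ring.
      change (Init.Nat.pred (S k)) with k; simpl; destruct k; simpl; ring.
    + apply lgf_derive_exp.
  - assert (HE : forall x, Ccontinuous E x).
    { intros x; apply (is_deriveC_continuous _ _ _ (lgf_derive_exp ga z x)). }
    assert (Hp : forall a m x, Ccontinuous (fun s : R => RtoC (a * s ^ m)) x).
    { intros a m x; apply (is_deriveC_continuous _ _ (RtoC (a * (INR m * x ^ pred m)))).
      apply is_deriveC_pair; simpl; auto_derive; auto; ring. }
    intros x; apply Ccontinuous_plus; (apply Ccontinuous_mult; [|auto]).
    + apply Hp.
    + apply (@continuous_ext R_UniformSpace C_UniformSpace (fun s : R => RtoC (1 * s ^ S k)));
        [intros; f_equal; ring|apply Hp].
    + apply Ccontinuous_mult; [|apply HE].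
      apply (is_deriveC_continuous _ _ (- (2 * ga))%C); destruct ga, z.
      apply is_deriveC_pair; simpl; auto_derive; auto; ring.
  - apply lgf_lim; assumption. }
assert (H3 := fun H => is_CInt_unique _ _ _ H1 (is_CInt_ext _ _ _ H H2)).
match type of H3 with (?P -> _) => assert (HP : P) end.
{ intros s _; unfold df, E, lgf; rewrite RtoC_mult, <- !tech_pow_Rmult, !RtoC_mult; ring. }
specialize (H3 HP).
replace (lgf ga (S k) z 0) with (RtoC 0) in H3 by (unfold lgf; simpl; rewrite Rmult_0_l; ring).
match type of H3 with (?a - ?b)%C = _ => replace a with ((a - b) + b)%C by ring; rewrite H3 end.
ring.
Qed.

Lemma lgf_succ (ga z : C) (k : nat) (s : R) : lgf ga (S k) z s = (RtoC s * lgf ga k z s)%C.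
Proof. unfold lgf; rewrite <- tech_pow_Rmult, RtoC_mult; ring. Qed.

Lemma lgf_base_bound (ga : C) (k : nat) (s : R) : 0 < Re ga -> 0 <= s ->
  s ^ k * exp (- Re ga * s ^ 2) <= lgM ga k * exp (- (1) * s).
Proof.
intros Hg Hs; unfold lgM; replace (- (1) * s) with (-1 * s) by ring.
apply gauss_moment_le; assumption.
Qed.

Lemma lgf_shift (ga z h : C) (s : R) :
  Cexp (- (ga * RtoC (s ^ 2)) - (z + h) * RtoC s)
  = Cexp ((- (ga * RtoC (s ^ 2)) - z * RtoC s) + - (h * RtoC s)).
Proof. f_equal; ring. Qed.

Lemma lg_segment (ga z h : C) (s : R) : 0 <= Re z -> 0 <= Re (z + h) -> 0 <= s ->
  forall x, 0 <= x <= 1 ->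
  Re (- (ga * RtoC (s ^ 2)) - z * RtoC s) + x * Re (- (h * RtoC s)) <= - Re ga * s ^ 2.
Proof.
intros Hz Hzh Hs x Hx; rewrite lgf_exponent_Re.
replace (Re (- (h * RtoC s))) with (- (Re h * s)) by (destruct h; simpl; ring).
replace (Re (z + h)) with (Re z + Re h) in Hzh by reflexivity.
assert (0 <= s * (Re z + x * Re h)); [|lra].
apply Rmult_le_pos; [exact Hs|].
replace (Re z + x * Re h) with ((1 - x) * Re z + x * (Re z + Re h)) by ring.
apply Rplus_le_le_0_compat; apply Rmult_le_pos; lra.
Qed.

Lemma LG_lip (ga : C) (k : nat) (z h : C) : 0 < Re ga -> 0 <= Re z -> 0 <= Re (z + h) ->
  Cmod (LG ga k (z + h) - LG ga k z) <= Cmod h * lgM ga (S k).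
Proof.
intros Hg Hz Hzh; rewrite <- (Rdiv_1_r (Cmod h * _)).
apply (is_CInt_le _ _ _ 1 Rlt_0_1
  (is_CInt_minus _ _ _ _ (LG_correct ga k (z + h)%C Hg Hzh) (LG_correct ga k z Hg Hz))).
intros s Hs; unfold lgf; rewrite lgf_shift.
match goal with |- Cmod (?a * ?u - ?a * ?v) <= _ =>
  replace (a * u - a * v)%C with (a * (u - v))%C by ring end.
rewrite Cmod_mult, Cmod_RtoC_pos by (apply pow_le; lra).
apply Rle_trans with (s ^ k * (Cmod (- (h * RtoC s)) * exp (- Re ga * s ^ 2))).
- apply Rmult_le_compat_l; [apply pow_le; lra|].
  apply Cexp_sub_le, lg_segment; try assumption; lra.
- rewrite Cmod_opp, Cmod_mult, Cmod_RtoC_pos by lra.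
  replace (s ^ k * (Cmod h * s * exp (- Re ga * s ^ 2)))
    with (Cmod h * (s ^ S k * exp (- Re ga * s ^ 2))) by (simpl; ring).
  rewrite (Rmult_assoc (Cmod h)); apply Rmult_le_compat_l; [apply Cmod_ge_0|].
  apply lgf_base_bound; lra.
Qed.

Lemma LG_taylor (ga : C) (k : nat) (z h : C) : 0 < Re ga -> 0 <= Re z -> 0 <= Re (z + h) ->
  Cmod (LG ga k (z + h) - LG ga k z + h * LG ga (S k) z) <= Cmod h ^ 2 * lgM ga (S (S k)).
Proof.
intros Hg Hz Hzh; rewrite <- (Rdiv_1_r (Cmod h ^ 2 * _)).
apply (is_CInt_le _ _ _ 1 Rlt_0_1
  (is_CInt_plus _ _ _ _
    (is_CInt_minus _ _ _ _ (LG_correct ga k (z + h)%C Hg Hzh) (LG_correct ga k z Hg Hz))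
    (is_CInt_Cmult h _ _ (LG_correct ga (S k) z Hg Hz)))).
intros s Hs; rewrite lgf_succ; unfold lgf; rewrite lgf_shift.
set (a := (- (ga * RtoC (s ^ 2)) - z * RtoC s)%C); set (b := (- (h * RtoC s))%C).
replace (RtoC (s ^ k) * Cexp (a + b) - RtoC (s ^ k) * Cexp a + h * (RtoC s * (RtoC (s ^ k) * Cexp a)))%C
  with (RtoC (s ^ k) * (Cexp (a + b) - Cexp a - b * Cexp a))%C by (unfold b; ring).
rewrite Cmod_mult, Cmod_RtoC_pos by (apply pow_le; lra).
apply Rle_trans with (s ^ k * (Cmod b ^ 2 * exp (- Re ga * s ^ 2))).
- apply Rmult_le_compat_l; [apply pow_le; lra|].
  apply Cexp_taylor, lg_segment; try assumption; lra.
- unfold b; rewrite Cmod_opp, Cmod_mult, Cmod_RtoC_pos by lra.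
  replace (s ^ k * ((Cmod h * s) ^ 2 * exp (- Re ga * s ^ 2)))
    with (Cmod h ^ 2 * (s ^ S (S k) * exp (- Re ga * s ^ 2))) by (simpl; ring).
  rewrite (Rmult_assoc (Cmod h ^ 2)); apply Rmult_le_compat_l; [apply pow2_ge_0|].
  apply lgf_base_bound; lra.
Qed.

(* The remainder of the asymptotic expansion of [LG ga 0] at infinity
   to third order, multiplied by z^4. *)
Definition LGr (ga z : C) : C :=
  (12 * ga ^ 2 * LG ga 0 z - 48 * ga ^ 3 * LG ga 2 z + 16 * ga ^ 4 * LG ga 4 z)%C.

(** Cleared of denominators, this is 1/z - 2 ga / z^3 + O(z^-4), from repeated use of the recursion.
    The order suits the summation over z = n w: a second-order Taylor remainder in w costs n^2, and
    n^2 / n^4 is still summable. *)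
Lemma LG_expansion (ga z : C) : 0 < Re ga -> 0 <= Re z ->
  (z ^ 4 * LG ga 0 z = z ^ 3 - 2 * ga * z + LGr ga z)%C.
Proof.
intros Hg Hz.
assert (E0 := LG_rec_0 ga z Hg Hz).
assert (E1 := LG_rec_S ga z 0 Hg Hz).
assert (E2 := LG_rec_S ga z 1 Hg Hz).
assert (E3 := LG_rec_S ga z 2 Hg Hz).
change (INR 1) with 1 in E1; change (INR 2) with 2 in E2; change (INR 3) with (1 + 1 + 1) in E3.
replace (1 + 1 + 1) with 3 in E3 by ring.
unfold LGr.
set (a0 := LG ga 0 z) in *; set (a1 := LG ga 1 z) in *; set (a2 := LG ga 2 z) in *;
set (a3 := LG ga 3 z) in *; set (a4 := LG ga 4 z) in *.
assert (F0 : (z * a0 = 1 - 2 * ga * a1)%C) by (rewrite <- E0; ring).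
assert (F1 : (z * a1 = a0 - 2 * ga * a2)%C).
{ replace a0 with (RtoC 1 * a0)%C at 1 by ring; rewrite <- E1; ring. }
assert (F2 : (z * a2 = 2 * a1 - 2 * ga * a3)%C) by (rewrite <- E2; ring).
assert (F3 : (z * a3 = 3 * a2 - 2 * ga * a4)%C) by (rewrite <- E3; ring).
replace (z ^ 4 * a0)%C with (z * (z * (z * (z * a0))))%C by ring.
rewrite F0.
replace (z * (1 - 2 * ga * a1))%C with (z - 2 * ga * (z * a1))%C by ring.
rewrite F1.
replace (z * (z - 2 * ga * (a0 - 2 * ga * a2)))%C
  with (z ^ 2 - 2 * ga * (z * a0) + 4 * ga ^ 2 * (z * a2))%C by ring.
rewrite F0, F2.
replace (z * (z ^ 2 - 2 * ga * (1 - 2 * ga * a1) + 4 * ga ^ 2 * (2 * a1 - 2 * ga * a3)))%C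
  with (z ^ 3 - 2 * ga * z + 12 * ga ^ 2 * (z * a1) - 8 * ga ^ 3 * (z * a3))%C by ring.
rewrite F1, F3; ring.
Qed.

(** * Complex series, limits and derivatives *)

Fixpoint csum (a : nat -> C) (n : nat) : C :=
  match n with O => RtoC 0 | S n => (csum a n + a n)%C end.

Definition is_Cseries (a : nat -> C) (l : C) : Prop :=
  is_series (fun n => Re (a n)) (Re l) /\ is_series (fun n => Im (a n)) (Im l).

Lemma is_Cseries_unique (a : nat -> C) (l : C) : is_Cseries a l -> Cseries a = l.
Proof.
intros [H1 H2]; apply C_ext; unfold Cseries; simpl; apply is_series_unique; assumption.
Qed.

Lemma is_Cseries_ext (a b : nat -> C) (l : C) :
  (forall n, a n = b n) -> is_Cseries a l -> is_Cseries b l.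
Proof.
intros E [H1 H2]; split; [revert H1|revert H2]; apply is_series_ext; intros n; rewrite E; reflexivity.
Qed.

Lemma is_Cseries_plus (a b : nat -> C) (la lb : C) :
  is_Cseries a la -> is_Cseries b lb -> is_Cseries (fun n => a n + b n)%C (la + lb)%C.
Proof.
intros [H1 H2] [G1 G2]; split.
- exact (is_series_plus (V := R_NormedModule) _ _ _ _ H1 G1).
- exact (is_series_plus (V := R_NormedModule) _ _ _ _ H2 G2).
Qed.

Lemma is_Cseries_minus (a b : nat -> C) (la lb : C) :
  is_Cseries a la -> is_Cseries b lb -> is_Cseries (fun n => a n - b n)%C (la - lb)%C.
Proof.
intros [H1 H2] [G1 G2]; split.
- exact (is_series_minus (V := R_NormedModule) _ _ _ _ H1 G1).
- exact (is_series_minus (V := R_NormedModule) _ _ _ _ H2 G2).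
Qed.

Lemma is_Cseries_Cmult (c : C) (a : nat -> C) (l : C) :
  is_Cseries a l -> is_Cseries (fun n => c * a n)%C (c * l)%C.
Proof.
intros [H1 H2]; split.
- exact (is_series_minus (V := R_NormedModule) _ _ _ _
    (is_series_scal (V := R_NormedModule) (Re c) _ _ H1)
    (is_series_scal (V := R_NormedModule) (Im c) _ _ H2)).
- exact (is_series_plus (V := R_NormedModule) _ _ _ _
    (is_series_scal (V := R_NormedModule) (Re c) _ _ H2)
    (is_series_scal (V := R_NormedModule) (Im c) _ _ H1)).
Qed.

Lemma is_Cseries_RtoC (a : nat -> R) (l : R) :
  is_series a l -> is_Cseries (fun n => RtoC (a n)) (RtoC l).
Proof.
intros H; split; [exact H|]; simpl.
generalize (is_series_scal (V := R_NormedModule) 0 _ _ H).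
change (@scal R_Ring R_NormedModule 0 l) with (0 * l); rewrite Rmult_0_l.
apply is_series_ext; intros n; change (0 * a n = 0); ring.
Qed.

Lemma is_Cseries_dominated (a : nat -> C) (b : nat -> R) :
  (forall n, Cmod (a n) <= b n) -> ex_series b ->
  is_Cseries a (Cseries a) /\ Cmod (Cseries a) <= 2 * Series b.
Proof.
intros H Hb.
assert (H1 : forall n, Rabs (Re (a n)) <= b n) by (intros n; apply Rle_trans with (1 := re_le_Cmod _), H).
assert (H2 : forall n, Rabs (Im (a n)) <= b n) by (intros n; apply Rle_trans with (1 := Im_le_Cmod _), H).
assert (X : forall u : nat -> R, (forall n, Rabs (u n) <= b n) ->
  is_series u (Series u) /\ Rabs (Series u) <= Series b).
{ intros u Hu.
  assert (Ha : ex_series (fun n => Rabs (u n))).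
  { apply (@ex_series_le R_AbsRing R_CompleteNormedModule _ b); [|exact Hb].
    intros n; change (Rabs (Rabs (u n)) <= b n); rewrite Rabs_Rabsolu; apply Hu. }
  split; [apply Series_correct, ex_series_Rabs, Ha|].
  apply Rle_trans with (1 := Series_Rabs u Ha).
  apply Series_le; [|exact Hb]; intros n; split; [apply Rabs_pos|apply Hu]. }
destruct (X _ H1) as [A1 B1]; destruct (X _ H2) as [A2 B2].
split; [split; assumption|].
apply Rle_trans with (1 := Cmod_le_ReIm _); simpl; lra.
Qed.

Lemma csum_lim (a : nat -> C) (l : C) : is_Cseries a l -> forall eps, 0 < eps ->
  exists N, forall n, (N <= n)%nat -> Cmod (csum a n - l) < eps.
Proof.
intros [H1 H2] eps He.
assert (Hc : forall n, Re (csum a (S n)) = sum_n (fun k => Re (a k)) n /\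
                       Im (csum a (S n)) = sum_n (fun k => Im (a k)) n).
{ induction n as [|n [IH1 IH2]].
  - rewrite !sum_O; simpl; split; unfold Re, Im; ring.
  - rewrite !sum_Sn, <- IH1, <- IH2; split; reflexivity. }
assert (He2 : 0 < eps / 2) by lra.
assert (G1 := proj1 (filterlim_locally _ _) H1 (mkposreal _ He2)).
assert (G2 := proj1 (filterlim_locally _ _) H2 (mkposreal _ He2)).
destruct (filter_and _ _ G1 G2) as [N HN].
exists (S N); intros [|n] Hn; [lia|].
destruct (HN n ltac:(lia)) as [A B].
destruct (Hc n) as [E1 E2].
change (Rabs (sum_n (fun k => Re (a k)) n - Re l) < eps / 2) in A.
change (Rabs (sum_n (fun k => Im (a k)) n - Im l) < eps / 2) in B.
rewrite <- E1 in A; rewrite <- E2 in B.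
apply Rle_lt_trans with (1 := Cmod_le_ReIm _).
change (Rabs (Re (csum a (S n)) - Re l) + Rabs (Im (csum a (S n)) - Im l) < eps); lra.
Qed.

Lemma ex_series_inv_sq : ex_series (fun n => / (INR n + 1) ^ 2).
Proof.
(* Telescoping majorant: 1 / (n + 1)^2 is at most twice 1 / (n + 1) - 1 / (n + 2). *)
assert (Ht : is_series (fun n => 2 * (/ (INR n + 1) - / (INR (S n) + 1))) 2).
{ assert (Hs : forall n, sum_n (fun n => 2 * (/ (INR n + 1) - / (INR (S n) + 1))) n
      = 2 - 2 * / (INR (S n) + 1)).
  { induction n as [|n IH].
    - rewrite sum_O; simpl; field.
    - rewrite sum_Sn, IH; unfold plus; simpl; ring. }
  unfold is_series; apply (filterlim_ext (fun n => 2 - 2 * / (INR (S n) + 1))); [intros n; rewrite Hs; reflexivity|].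
  assert (L : is_lim_seq (fun n => 2 - 2 * / (INR (S n) + 1)) (2 - 2 * 0)).
  { apply is_lim_seq_minus'; [apply is_lim_seq_const|].
    apply (is_lim_seq_scal_l _ 2 0).
    apply (is_lim_seq_inv _ p_infty); [|discriminate].
    apply is_lim_seq_plus with p_infty 1; [|apply is_lim_seq_const|reflexivity].
    apply (is_lim_seq_incr_1 (fun n => INR n)), is_lim_seq_INR. }
  rewrite Rmult_0_r, Rminus_0_r in L; exact L. }
apply (@ex_series_le R_AbsRing R_CompleteNormedModule _
  (fun n => 2 * (/ (INR n + 1) - / (INR (S n) + 1)))); [|exists 2; exact Ht].
intros n; rewrite S_INR; pose proof (pos_INR n).
change (Rabs (/ (INR n + 1) ^ 2) <= 2 * (/ (INR n + 1) - / (INR n + 1 + 1))).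
rewrite Rabs_pos_eq by (left; apply Rinv_0_lt_compat, pow_lt; lra).
replace (2 * (/ (INR n + 1) - / (INR n + 1 + 1))) with (2 * / ((INR n + 1) * (INR n + 1 + 1)))
  by (field; lra).
replace (2 * / ((INR n + 1) * (INR n + 1 + 1))) with (/ ((INR n + 1) * (INR n + 1 + 1) / 2))
  by (field; lra).
apply Rinv_le_contravar; nra.
Qed.

Lemma filterlim_Cmult {T : Type} (F : (T -> Prop) -> Prop) {FF : Filter F}
  (f g : T -> C) (a b : C) :
  filterlim f F (@locally C_UniformSpace a) -> filterlim g F (@locally C_UniformSpace b) ->
  filterlim (fun x => f x * g x)%C F (@locally C_UniformSpace (a * b)%C).
Proof.
intros Hf Hg; apply filterlim_C_Cmod; [exact FF|intros eps].
set (K := 1 + Cmod a + Cmod b).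
assert (HK : 0 < K) by (unfold K; pose proof (Cmod_ge_0 a); pose proof (Cmod_ge_0 b); lra).
set (d := Rmin 1 (eps / (2 * K))).
assert (Hd : 0 < d) by (apply Rmin_glb_lt; [lra|apply Rdiv_lt_0_compat; [apply eps|lra]]).
generalize (filter_and _ _ (proj1 (filterlim_C_Cmod _ _ _) Hf (mkposreal _ Hd))
  (proj1 (filterlim_C_Cmod _ _ _) Hg (mkposreal _ Hd))).
apply filter_imp; intros x [A B]; simpl in A, B.
replace (f x * g x - a * b)%C with ((f x - a) * (g x - b) + (a * (g x - b) + b * (f x - a)))%C by ring.
assert (T1 := Cmod_triangle ((f x - a) * (g x - b)) (a * (g x - b) + b * (f x - a))).
assert (T2 := Cmod_triangle (a * (g x - b)) (b * (f x - a))).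
rewrite !Cmod_mult in T1; rewrite !Cmod_mult in T2.
assert (d1 : d <= 1) by apply Rmin_l; assert (d2 : d <= eps / (2 * K)) by apply Rmin_r.
assert (dK : d * K <= eps / 2).
{ apply Rle_trans with (eps / (2 * K) * K); [apply Rmult_le_compat_r; lra|right; field; lra]. }
pose proof (Cmod_ge_0 a); pose proof (Cmod_ge_0 b);
pose proof (Cmod_ge_0 (f x - a)); pose proof (Cmod_ge_0 (g x - b)).
assert (Cmod (f x - a) * Cmod (g x - b) <= d * 1) by (apply Rmult_le_compat; lra).
assert (Cmod a * Cmod (g x - b) <= Cmod a * d) by (apply Rmult_le_compat_l; lra).
assert (Cmod b * Cmod (f x - a) <= Cmod b * d) by (apply Rmult_le_compat_l; lra).
generalize (cond_pos eps); unfold K in dK; intros; nra.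
Qed.

Lemma filterlim_Cplus {T : Type} (F : (T -> Prop) -> Prop) {FF : Filter F}
  (f g : T -> C) (a b : C) :
  filterlim f F (@locally C_UniformSpace a) -> filterlim g F (@locally C_UniformSpace b) ->
  filterlim (fun x => f x + g x)%C F (@locally C_UniformSpace (a + b)%C).
Proof.
intros Hf Hg; exact (filterlim_comp_2 _ _ _ Hf Hg (@filterlim_plus R_AbsRing C_R_NormedModule a b)).
Qed.

Lemma is_Cderive_plus (f g : C -> C) (z lf lg : C) :
  is_Cderive f z lf -> is_Cderive g z lg -> is_Cderive (fun z => f z + g z)%C z (lf + lg)%C.
Proof. apply (@is_derive_plus C_AbsRing C_NormedModule). Qed.

Lemma is_Cderive_mult (f g : C -> C) (z lf lg : C) :
  is_Cderive f z lf -> is_Cderive g z lg ->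
  is_Cderive (fun z => f z * g z)%C z (lf * g z + f z * lg)%C.
Proof.
intros Hf Hg; apply is_Cderive_eps; intros eps He.
set (K := 1 + Cmod (g z) + Cmod lf + Cmod (f z)).
assert (HK : 1 <= K).
{ unfold K; pose proof (Cmod_ge_0 (g z)); pose proof (Cmod_ge_0 lf); pose proof (Cmod_ge_0 (f z)); lra. }
set (e := Rmin 1 (eps / K)).
assert (He' : 0 < e) by (apply Rmin_glb_lt; [lra|apply Rdiv_lt_0_compat; lra]).
assert (eK : e * K <= eps).
{ apply Rle_trans with (eps / K * K); [apply Rmult_le_compat_r; [lra|apply Rmin_r]|right; field; lra]. }
assert (e1 : e <= 1) by apply Rmin_l.
destruct (proj1 (is_Cderive_eps _ _ _) Hf e He') as [d1 [Hd1 H1]].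
destruct (proj1 (is_Cderive_eps _ _ _) Hg e He') as [d2 [Hd2 H2]].
destruct (proj1 (CCcontinuous_eps _ _) (is_Cderive_continuous _ _ _ Hg) e He') as [d3 [Hd3 H3]].
exists (Rmin d1 (Rmin d2 d3)); split; [repeat apply Rmin_glb_lt; assumption|].
intros h Hh.
assert (h1 := Rlt_le_trans _ _ _ Hh (Rmin_l _ _)).
assert (h23 := Rlt_le_trans _ _ _ Hh (Rmin_r _ _)).
specialize (H1 h h1); specialize (H2 h (Rlt_le_trans _ _ _ h23 (Rmin_l _ _))).
specialize (H3 (z + h)%C); replace (z + h - z)%C with h in H3 by ring.
specialize (H3 (Rlt_le_trans _ _ _ h23 (Rmin_r _ _))).
set (F' := f (z + h)%C) in *; set (G' := g (z + h)%C) in *.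
replace (F' * G' - f z * g z - h * (lf * g z + f z * lg))%C with
  ((F' - f z - h * lf) * (g z + (G' - g z)) + (h * lf * (G' - g z) + f z * (G' - g z - h * lg)))%C by ring.
eapply Rle_trans; [apply Cmod_triangle|].
assert (T1 := Cmod_triangle (h * lf * (G' - g z)) (f z * (G' - g z - h * lg))).
assert (T2 := Cmod_triangle (g z) (G' - g z)).
rewrite !Cmod_mult in *.
set (x := Cmod h) in *; assert (Hx : 0 <= x) by apply Cmod_ge_0.
pose proof (Cmod_ge_0 (g z)); pose proof (Cmod_ge_0 lf); pose proof (Cmod_ge_0 (f z)).
pose proof (Cmod_ge_0 (F' - f z - h * lf)); pose proof (Cmod_ge_0 (G' - g z)).
assert (A : Cmod (F' - f z - h * lf) * Cmod (g z + (G' - g z)) <= e * x * (Cmod (g z) + 1)).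
{ apply Rmult_le_compat; try apply Cmod_ge_0; lra. }
assert (B : x * Cmod lf * Cmod (G' - g z) <= x * Cmod lf * e).
{ apply Rmult_le_compat_l; [apply Rmult_le_pos; assumption|lra]. }
assert (D : Cmod (f z) * Cmod (G' - g z - h * lg) <= Cmod (f z) * (e * x)).
{ apply Rmult_le_compat_l; assumption. }
assert (E : e * x * (Cmod (g z) + 1) + (x * Cmod lf * e + Cmod (f z) * (e * x)) = e * K * x) by (unfold K; ring).
assert (e * K * x <= eps * x) by (apply Rmult_le_compat_r; assumption).
lra.
Qed.

Lemma is_Cderive_const (c z : C) : is_Cderive (fun _ => c) z (RtoC 0).
Proof. apply (@is_derive_const C_AbsRing C_NormedModule). Qed.

Lemma is_Cderive_id (z : C) : is_Cderive (fun z => z) z (RtoC 1).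
Proof.
apply (is_Cderive_quad _ _ _ 0 1 Rlt_0_1); intros h _.
replace (z + h - z - h * 1)%C with (RtoC 0) by ring; rewrite Cmod_0; lra.
Qed.

Lemma is_Cderive_inv (z : C) : z <> 0%C -> is_Cderive Cinv z (- / (z * z))%C.
Proof.
intros Hz; assert (Hm : 0 < Cmod z) by (apply Cmod_gt_0, Hz).
apply (is_Cderive_quad _ _ _ (2 / (Cmod z ^ 3)) (Cmod z / 2)); [lra|].
intros h Hh.
assert (T := Cmod_triangle_inv z h).
assert (Hzh : (z + h)%C <> 0%C) by (apply Cmod_gt_0; lra).
replace (/ (z + h) - / z - h * - / (z * z))%C with (h * h * / ((z + h) * (z * z)))%C
  by (field; split; assumption).
rewrite !Cmod_mult, Cmod_inv by (repeat apply Cmult_neq_0; assumption).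
rewrite !Cmod_mult.
replace (2 / Cmod z ^ 3 * Cmod h ^ 2) with (Cmod h * Cmod h * / (Cmod z / 2 * (Cmod z * Cmod z)))
  by (field; lra).
apply Rmult_le_compat_l; [pose proof (Cmod_ge_0 h); nra|].
apply Rinv_le_contravar; [repeat apply Rmult_lt_0_compat; lra|].
apply Rmult_le_compat_r; nra.
Qed.

Lemma holomorphic_plus (f g : C -> C) (z : C) :
  holomorphic_at f z -> holomorphic_at g z -> holomorphic_at (fun z => f z + g z)%C z.
Proof. intros [a Ha] [b Hb]; eexists; exact (is_Cderive_plus _ _ _ _ _ Ha Hb). Qed.

Lemma holomorphic_mult (f g : C -> C) (z : C) :
  holomorphic_at f z -> holomorphic_at g z -> holomorphic_at (fun z => f z * g z)%C z.
Proof. intros [a Ha] [b Hb]; eexists; exact (is_Cderive_mult _ _ _ _ _ Ha Hb). Qed.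

Lemma holomorphic_const (c z : C) : holomorphic_at (fun _ => c) z.
Proof. eexists; apply is_Cderive_const. Qed.

Lemma holomorphic_id (z : C) : holomorphic_at (fun z => z) z.
Proof. eexists; apply is_Cderive_id. Qed.

Lemma holomorphic_inv (z : C) : z <> 0%C -> holomorphic_at Cinv z.
Proof. intros H; eexists; apply is_Cderive_inv, H. Qed.

Lemma holomorphic_comp (f g : C -> C) (z : C) :
  holomorphic_at f (g z) -> holomorphic_at g z -> holomorphic_at (fun z => f (g z)) z.
Proof. intros [a Ha] [b Hb]; eexists; exact (is_Cderive_comp _ _ _ _ _ Ha Hb). Qed.

Lemma holomorphic_pow (f : C -> C) (n : nat) (z : C) :
  holomorphic_at f z -> holomorphic_at (fun z => f z ^ n)%C z.
Proof.
intros H; induction n as [|n IH]; [exact (holomorphic_const (RtoC 1) z)|].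
apply (holomorphic_mult f (fun z => f z ^ n)%C); assumption.
Qed.

Lemma holomorphic_ext_loc (f g : C -> C) (z : C) (d : R) : 0 < d ->
  (forall w, Cmod (w - z) < d -> f w = g w) -> holomorphic_at f z -> holomorphic_at g z.
Proof.
intros Hd H [l Hl]; exists l; apply is_Cderive_eps; intros eps He.
destruct (proj1 (is_Cderive_eps _ _ _) Hl eps He) as [e [He' Hh]].
exists (Rmin d e); split; [apply Rmin_glb_lt; assumption|].
intros h Hlt; rewrite <- !H.
- apply Hh, Rlt_le_trans with (1 := Hlt), Rmin_r.
- replace (z - z)%C with (RtoC 0) by ring; rewrite Cmod_0; exact Hd.
- replace (z + h - z)%C with h by ring; apply Rlt_le_trans with (1 := Hlt), Rmin_l.
Qed.

Lemma holomorphic_ext (f g : C -> C) (z : C) :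
  (forall w, f w = g w) -> holomorphic_at f z -> holomorphic_at g z.
Proof. intros H; apply (holomorphic_ext_loc f g z 1 Rlt_0_1); auto. Qed.

(** The quadratic remainders of the terms add up to one for the sum, the constants [b n] being
    summable. The factor 2 in the proof comes from bounding real and imaginary parts separately. *)
Lemma holomorphic_series (f : nat -> C -> C) (df : nat -> C) (b : nat -> R) (z : C) (d : R) :
  0 < d -> ex_series b ->
  (forall w, Cmod (w - z) < d -> is_Cseries (fun n => f n w) (Cseries (fun n => f n w))) ->
  is_Cseries df (Cseries df) ->
  (forall n h, Cmod h < d -> Cmod (f n (z + h)%C - f n z - h * df n)%C <= b n * Cmod h ^ 2) ->
  holomorphic_at (fun w => Cseries (fun n => f n w)) z.
Proof.
intros Hd Hb Hf Hdf Hq; exists (Cseries df).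
apply (is_Cderive_quad _ _ _ (2 * Series b) d Hd); intros h Hh.
assert (Hz : Cmod (z - z) < d) by (replace (z - z)%C with (RtoC 0) by ring; rewrite Cmod_0; exact Hd).
assert (Hzh : Cmod (z + h - z) < d) by (replace (z + h - z)%C with h by ring; exact Hh).
assert (H1 := is_Cseries_minus _ _ _ _ (is_Cseries_minus _ _ _ _ (Hf _ Hzh) (Hf _ Hz))
  (is_Cseries_Cmult h _ _ Hdf)).
rewrite <- (is_Cseries_unique _ _ H1).
destruct (is_Cseries_dominated (fun n => f n (z + h)%C - f n z - h * df n)%C
  (fun n => b n * Cmod h ^ 2)) as [_ H2].
- intros n; apply Hq, Hh.
- apply ex_series_scal_r, Hb.
- rewrite Series_scal_r in H2; lra.
Qed.

(** * Sums of Laplace-Gauss integrals over an arithmetic progression *)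

(** Each derivative in [z] raises every moment in [LGr] by one, so this bounds the j-th derivative
    of [LGr] on the closed right half-plane. *)
Definition LGK (ga : C) (j : nat) : R :=
  12 * Cmod ga ^ 2 * lgM ga j + 48 * Cmod ga ^ 3 * lgM ga (j + 2)
  + 16 * Cmod ga ^ 4 * lgM ga (j + 4).

Definition dLGr (ga z : C) : C :=
  (- (12 * ga ^ 2 * LG ga 1 z - 48 * ga ^ 3 * LG ga 3 z + 16 * ga ^ 4 * LG ga 5 z))%C.

Lemma Cmod_comb3 (ga u v w : C) (A B D : R) :
  Cmod u <= A -> Cmod v <= B -> Cmod w <= D ->
  Cmod (12 * ga ^ 2 * u - 48 * ga ^ 3 * v + 16 * ga ^ 4 * w)
  <= 12 * Cmod ga ^ 2 * A + 48 * Cmod ga ^ 3 * B + 16 * Cmod ga ^ 4 * D.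
Proof.
intros H1 H2 H3.
assert (T1 := Cmod_triangle (12 * ga ^ 2 * u - 48 * ga ^ 3 * v) (16 * ga ^ 4 * w)).
assert (T2 := Cmod_triangle_minus (12 * ga ^ 2 * u) (48 * ga ^ 3 * v)).
rewrite !Cmod_mult, !Cmod_pow in *.
rewrite (Cmod_RtoC_pos 12), (Cmod_RtoC_pos 48), (Cmod_RtoC_pos 16) in * by lra.
assert (Hg := Cmod_ge_0 ga).
assert (12 * Cmod ga ^ 2 * Cmod u <= 12 * Cmod ga ^ 2 * A)
  by (apply Rmult_le_compat_l; [apply Rmult_le_pos; [lra|apply pow_le, Hg]|exact H1]).
assert (48 * Cmod ga ^ 3 * Cmod v <= 48 * Cmod ga ^ 3 * B)
  by (apply Rmult_le_compat_l; [apply Rmult_le_pos; [lra|apply pow_le, Hg]|exact H2]).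
assert (16 * Cmod ga ^ 4 * Cmod w <= 16 * Cmod ga ^ 4 * D)
  by (apply Rmult_le_compat_l; [apply Rmult_le_pos; [lra|apply pow_le, Hg]|exact H3]).
lra.
Qed.

Lemma LGr_bound (ga z : C) : 0 < Re ga -> 0 <= Re z -> Cmod (LGr ga z) <= LGK ga 0.
Proof. intros; apply Cmod_comb3; apply LG_bound; assumption. Qed.

Lemma dLGr_bound (ga z : C) : 0 < Re ga -> 0 <= Re z -> Cmod (dLGr ga z) <= LGK ga 1.
Proof.
intros; unfold dLGr; rewrite Cmod_opp; apply Cmod_comb3; apply LG_bound; assumption.
Qed.

Lemma LGr_lip (ga z h : C) : 0 < Re ga -> 0 <= Re z -> 0 <= Re (z + h) ->
  Cmod (LGr ga (z + h) - LGr ga z) <= Cmod h * LGK ga 1.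
Proof.
intros Hg Hz Hzh; unfold LGr, LGK.
match goal with |- Cmod ?x <= _ => replace x with
  (12 * ga ^ 2 * (LG ga 0 (z + h)%C - LG ga 0 z)
   - 48 * ga ^ 3 * (LG ga 2 (z + h)%C - LG ga 2 z)
   + 16 * ga ^ 4 * (LG ga 4 (z + h)%C - LG ga 4 z))%C by ring end.
eapply Rle_trans; [apply Cmod_comb3; apply LG_lip; assumption|right; simpl; ring].
Qed.

Lemma LGr_taylor (ga z h : C) : 0 < Re ga -> 0 <= Re z -> 0 <= Re (z + h) ->
  Cmod (LGr ga (z + h) - LGr ga z - h * dLGr ga z) <= Cmod h ^ 2 * LGK ga 2.
Proof.
intros Hg Hz Hzh; unfold LGr, dLGr, LGK.
match goal with |- Cmod ?x <= _ => replace x with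
  (12 * ga ^ 2 * (LG ga 0 (z + h)%C - LG ga 0 z + h * LG ga 1 z)
   - 48 * ga ^ 3 * (LG ga 2 (z + h)%C - LG ga 2 z + h * LG ga 3 z)
   + 16 * ga ^ 4 * (LG ga 4 (z + h)%C - LG ga 4 z + h * LG ga 5 z))%C by ring end.
eapply Rle_trans; [apply Cmod_comb3; apply LG_taylor; assumption|right; simpl; ring].
Qed.

Lemma LGK_pos (ga : C) (j : nat) : 0 <= LGK ga j.
Proof.
unfold LGK, lgM; assert (Hg := Cmod_ge_0 ga).
repeat apply Rplus_le_le_0_compat; (apply Rmult_le_pos; [|left; apply exp_pos]);
  (apply Rmult_le_pos; [lra|apply pow_le, Hg]).
Qed.

Definition nk (al N : R) (k : nat) : R := al + N * INR k.

Section Progression.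

Variables al N : R.
Hypothesis Hal : 0 < al.
Hypothesis HN : 0 < N.

Lemma nk_pos (k : nat) : 0 < nk al N k.
Proof. unfold nk; pose proof (pos_INR k); nra. Qed.

(** One constant for the three exponents 2, 3, 4, all of which are compared with the same majorant 1
    / (k + 1)^2. *)
Definition nkD : R := / Rmin al N ^ 2 + / Rmin al N ^ 3 + / Rmin al N ^ 4.

Let dl : 0 < Rmin al N.
Proof. apply Rmin_glb_lt; assumption. Qed.

Lemma nkD_pos : 0 < nkD.
Proof.
unfold nkD; repeat apply Rplus_lt_0_compat; apply Rinv_0_lt_compat, pow_lt, dl.
Qed.

Lemma nk_inv_le (j k : nat) : (2 <= j <= 4)%nat ->
  / nk al N k ^ j <= nkD * / (INR k + 1) ^ 2.
Proof.
intros Hj; pose proof (pos_INR k) as Hk.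
assert (Hl := Rmin_l al N); assert (Hr := Rmin_r al N); assert (dl' := dl).
set (d := Rmin al N) in *.
assert (H1 : d * (INR k + 1) <= nk al N k).
{ unfold nk; nra. }
assert (H0 : 0 < d * (INR k + 1)) by (apply Rmult_lt_0_compat; [exact dl'|lra]).
apply Rle_trans with (/ (d * (INR k + 1)) ^ j).
{ apply Rinv_le_contravar; [apply pow_lt, H0|apply pow_incr; lra]. }
rewrite Rpow_mult_distr, Rinv_mult.
apply Rmult_le_compat.
- left; apply Rinv_0_lt_compat, pow_lt, dl'.
- left; apply Rinv_0_lt_compat, pow_lt; lra.
- unfold nkD; fold d.
  assert (0 < / d ^ 2) by (apply Rinv_0_lt_compat, pow_lt, dl').
  assert (0 < / d ^ 3) by (apply Rinv_0_lt_compat, pow_lt, dl').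
  assert (0 < / d ^ 4) by (apply Rinv_0_lt_compat, pow_lt, dl').
  assert (j = 2 \/ j = 3 \/ j = 4)%nat as [->|[->| ->]] by lia; lra.
- apply Rinv_le_contravar; [apply pow_lt; lra|apply Rle_pow; [lra|lia]].
Qed.

Variable ga : C.
Hypothesis Hga : 0 < Re ga.

Let tt (w : C) (k : nat) : C := (LGr ga (RtoC (nk al N k) * w) * RtoC (/ nk al N k ^ 4))%C.

(** The remainders of the expansion at [nk al N k * w], with the factor w^-4 taken out of the sum.
    In this form the sum makes sense on the closed half-plane. *)
Definition Tser (w : C) : C :=
  Cseries (fun k => LGr ga (RtoC (nk al N k) * w) * RtoC (/ nk al N k ^ 4))%C.

Let Re_nk (w : C) (k : nat) : 0 <= Re w -> 0 <= Re (RtoC (nk al N k) * w).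
Proof.
intros H; replace (Re (RtoC (nk al N k) * w)) with (nk al N k * Re w)
  by (destruct w; simpl; ring).
apply Rmult_le_pos; [left; apply nk_pos|exact H].
Qed.

Let inv_pos (j k : nat) : 0 <= / nk al N k ^ j.
Proof. left; apply Rinv_0_lt_compat, pow_lt, nk_pos. Qed.

Let ex_b (K : R) : ex_series (fun k => K * (nkD * / (INR k + 1) ^ 2)).
Proof.
exact (ex_series_scal (V := R_NormedModule) K _
  (ex_series_scal (V := R_NormedModule) nkD _ ex_series_inv_sq)).
Qed.

Lemma Tser_correct (w : C) : 0 <= Re w -> is_Cseries (tt w) (Tser w).
Proof.
intros Hw; apply (is_Cseries_dominated (tt w) (fun k => LGK ga 0 * (nkD * / (INR k + 1) ^ 2)));
  [|apply ex_b].
intros k; unfold tt; rewrite Cmod_mult, (Cmod_RtoC_pos (/ _)) by apply inv_pos.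
apply Rmult_le_compat; [apply Cmod_ge_0|apply inv_pos| |apply nk_inv_le; lia].
apply LGr_bound; [exact Hga|apply Re_nk, Hw].
Qed.

(** Valid up to the imaginary axis: this gives the boundary limits, while [Tser_holomorphic] covers
    the open half-plane. *)
Lemma Tser_lip : exists K, 0 <= K /\ forall w h, 0 <= Re w -> 0 <= Re (w + h) ->
  Cmod (Tser (w + h) - Tser w) <= K * Cmod h.
Proof.
exists (2 * Series (fun k => LGK ga 1 * (nkD * / (INR k + 1) ^ 2))).
assert (Hb : forall k, 0 <= LGK ga 1 * (nkD * / (INR k + 1) ^ 2)).
{ intros k; apply Rmult_le_pos; [apply LGK_pos|]; apply Rmult_le_pos; [left; apply nkD_pos|].
  left; apply Rinv_0_lt_compat, pow_lt; pose proof (pos_INR k); lra. }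
split.
{ apply Rmult_le_pos; [lra|]; apply Rle_trans with (Series (fun _ => 0)).
  - right; symmetry; rewrite (Series_ext _ (fun n => 0 * 0)) by (intros; ring).
    rewrite Series_scal_l; ring.
  - apply Series_le; [|apply ex_b]; intros n; split; [lra|apply Hb]. }
intros w h Hw Hwh.
assert (H1 := is_Cseries_minus _ _ _ _ (Tser_correct _ Hwh) (Tser_correct _ Hw)).
rewrite <- (is_Cseries_unique _ _ H1).
destruct (is_Cseries_dominated (fun k => tt (w + h)%C k - tt w k)%C
  (fun k => LGK ga 1 * (nkD * / (INR k + 1) ^ 2) * Cmod h)) as [_ H2].
- intros k; unfold tt.
  replace (RtoC (nk al N k) * (w + h))%C with (RtoC (nk al N k) * w + RtoC (nk al N k) * h)%C by ring.
  match goal with |- Cmod (?a * ?c - ?b * ?c)%C <= _ =>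
    replace (a * c - b * c)%C with ((a - b) * c)%C by ring end.
  rewrite Cmod_mult, (Cmod_RtoC_pos (/ _)) by apply inv_pos.
  apply Rle_trans with (Cmod (RtoC (nk al N k) * h) * LGK ga 1 * / nk al N k ^ 4).
  + apply Rmult_le_compat_r; [apply inv_pos|]; apply LGr_lip; auto.
    replace (RtoC (nk al N k) * w + RtoC (nk al N k) * h)%C with (RtoC (nk al N k) * (w + h))%C by ring.
    auto.
  + rewrite Cmod_mult, Cmod_RtoC_pos by (left; apply nk_pos).
    assert (Hn := nk_pos k).
    replace (nk al N k * Cmod h * LGK ga 1 * / nk al N k ^ 4)
      with (LGK ga 1 * / nk al N k ^ 3 * Cmod h) by (field; lra).
    apply Rmult_le_compat_r; [apply Cmod_ge_0|].
    apply Rmult_le_compat_l; [apply LGK_pos|apply nk_inv_le; lia].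
- apply ex_series_scal_r, ex_b.
- rewrite Series_scal_r in H2; lra.
Qed.

Lemma Tser_holomorphic (w : C) : 0 < Re w -> holomorphic_at Tser w.
Proof.
intros Hw; unfold Tser.
assert (Hpos : forall v : C, Cmod v < Re w -> 0 <= Re (w + v)).
{ intros v Hv; replace (Re (w + v)) with (Re w + Re v) by reflexivity.
  pose proof (re_le_Cmod v); pose proof (Rle_abs (- Re v)); rewrite Rabs_Ropp in *; lra. }
apply (holomorphic_series (fun k w => tt w k)
  (fun k => RtoC (nk al N k) * dLGr ga (RtoC (nk al N k) * w) * RtoC (/ nk al N k ^ 4))%C
  (fun k => LGK ga 2 * (nkD * / (INR k + 1) ^ 2)) w (Re w) Hw).
- apply ex_b.
- intros u Hu; apply Tser_correct.
  replace u with (w + (u - w))%C by ring; apply Hpos, Hu.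
- apply (is_Cseries_dominated _ (fun k => LGK ga 1 * (nkD * / (INR k + 1) ^ 2))); [|apply ex_b].
  intros k; rewrite !Cmod_mult, (Cmod_RtoC_pos (/ _)) by apply inv_pos.
  rewrite Cmod_RtoC_pos by (left; apply nk_pos); assert (Hn := nk_pos k).
  match goal with |- ?a * ?b * _ <= _ => replace (a * b * / nk al N k ^ 4)
    with (b * / nk al N k ^ 3) by (field; lra) end.
  apply Rmult_le_compat; [apply Cmod_ge_0|apply inv_pos| |apply nk_inv_le; lia].
  apply dLGr_bound; [exact Hga|apply Re_nk; lra].
- intros k h Hh; unfold tt; assert (Hn := nk_pos k).
  replace (RtoC (nk al N k) * (w + h))%C with (RtoC (nk al N k) * w + RtoC (nk al N k) * h)%C by ring.
  match goal with |- Cmod (?a * ?c - ?b * ?c - ?h * (?n * ?d * ?c))%C <= _ =>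
    replace (a * c - b * c - h * (n * d * c))%C with ((a - b - n * h * d) * c)%C by ring end.
  rewrite Cmod_mult, (Cmod_RtoC_pos (/ _)) by apply inv_pos.
  apply Rle_trans with (Cmod (RtoC (nk al N k) * h) ^ 2 * LGK ga 2 * / nk al N k ^ 4).
  + apply Rmult_le_compat_r; [apply inv_pos|]; apply LGr_taylor; auto.
    * apply Re_nk; lra.
    * replace (RtoC (nk al N k) * w + RtoC (nk al N k) * h)%C with (RtoC (nk al N k) * (w + h))%C by ring.
      auto.
  + rewrite Cmod_mult, Cmod_RtoC_pos by (left; apply nk_pos).
    replace ((nk al N k * Cmod h) ^ 2 * LGK ga 2 * / nk al N k ^ 4)
      with (LGK ga 2 * / nk al N k ^ 2 * Cmod h ^ 2) by (field; lra).
    apply Rmult_le_compat_r; [apply pow2_ge_0|].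
    apply Rmult_le_compat_l; [apply LGK_pos|apply nk_inv_le; lia].
Qed.

Lemma ex_series_nk_inv (j : nat) : (2 <= j <= 4)%nat -> ex_series (fun k => / nk al N k ^ j).
Proof.
intros Hj; apply (@ex_series_le R_AbsRing R_CompleteNormedModule _ (fun k => 1 * (nkD * / (INR k + 1) ^ 2)));
  [|apply ex_b].
intros k; change (Rabs (/ nk al N k ^ j) <= 1 * (nkD * / (INR k + 1) ^ 2)).
rewrite Rabs_pos_eq, Rmult_1_l by apply inv_pos; apply nk_inv_le, Hj.
Qed.

End Progression.

(** The series S after its terms have been expanded at infinity: holomorphy inside and continuity at
    the nonzero points of the axis can be read off a finite formula, and [Sfun_series] ties it to
    the series. The sum in [k1] must run over pairs, each half being a divergent harmonic series;
    the sum in [k3] can be split. *)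
Definition Sfun (c al N : R) (w : C) : C :=
  let be := N - al in
  let k1 := Series (fun k => / nk al N k - / nk be N k) in
  let k3 := - (2 * c) * (Series (fun k => / nk al N k ^ 3) - Series (fun k => / nk be N k ^ 3)) in
  (RtoC k1 * / w
   + (RtoC k3 * (/ w) ^ 3
      + (Tser al N (RtoC c) w + RtoC (-1) * Tser be N (RtoC c) w) * (/ w) ^ 4))%C.

Section Pairs.

Variables c al N : R.
Hypothesis Hc : 0 < c.
Hypothesis Hal : 0 < al < N.

Let HN : 0 < N. Proof. lra. Qed.
Let Hal1 : 0 < al. Proof. lra. Qed.
Let Hal2 : 0 < N - al. Proof. lra. Qed.
Let Hcre : 0 < Re (RtoC c). Proof. exact Hc. Qed.

Lemma ex_series_nk_diff : ex_series (fun k => / nk al N k - / nk (N - al) N k).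
Proof.
assert (H1 := ex_series_nk_inv al N Hal1 HN 2 ltac:(lia)).
assert (H2 := ex_series_nk_inv (N - al) N Hal2 HN 2 ltac:(lia)).
apply (@ex_series_le R_AbsRing R_CompleteNormedModule _
  (fun k => N * (/ nk al N k ^ 2 + / nk (N - al) N k ^ 2))).
- intros k; change (Rabs (/ nk al N k - / nk (N - al) N k) <= N * (/ nk al N k ^ 2 + / nk (N - al) N k ^ 2)).
  assert (P1 := nk_pos al N Hal1 HN k); assert (P2 := nk_pos (N - al) N Hal2 HN k).
  set (x := nk al N k) in *; set (y := nk (N - al) N k) in *.
  assert (Hd : Rabs (y - x) <= N) by (apply Rabs_le; unfold x, y, nk; lra).
  replace (/ x - / y) with ((y - x) * (/ x * / y)) by (field; lra).
  assert (Hx : 0 < / x) by (apply Rinv_0_lt_compat, P1).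
  assert (Hy : 0 < / y) by (apply Rinv_0_lt_compat, P2).
  rewrite Rabs_mult, (Rabs_pos_eq (/ x * / y)) by nra.
  rewrite <- !pow_inv; apply Rmult_le_compat; [apply Rabs_pos|nra|exact Hd|nra].
- exact (ex_series_scal (V := R_NormedModule) N _ (ex_series_plus (V := R_NormedModule) _ _ H1 H2)).
Qed.

Let is_Cser3 (a : R) : 0 < a -> is_Cseries (fun k => RtoC (/ nk a N k ^ 3)) (RtoC (Series (fun k => / nk a N k ^ 3))).
Proof.
intros Ha; apply is_Cseries_RtoC, Series_correct, ex_series_nk_inv; [exact Ha|exact HN|lia].
Qed.

Lemma Sfun_series (w : C) : 0 <= Re w -> w <> 0%C ->
  is_Cseries (fun k => LG (RtoC c) 0 (RtoC (nk al N k) * w) - LG (RtoC c) 0 (RtoC (nk (N - al)%R N k) * w))%C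
    (Sfun c al N w).
Proof.
intros Hw Hw0; unfold Sfun; cbv zeta.
assert (S1 := is_Cseries_Cmult (/ w)%C _ _ (is_Cseries_RtoC _ _ (Series_correct _ ex_series_nk_diff))).
assert (S2 := is_Cseries_Cmult (RtoC (- (2 * c)) * (/ w) ^ 3)%C _ _
  (is_Cseries_minus _ _ _ _ (is_Cser3 al Hal1) (is_Cser3 (N - al) Hal2))).
assert (S3 := is_Cseries_Cmult ((/ w) ^ 4)%C _ _
  (is_Cseries_minus _ _ _ _ (Tser_correct al N Hal1 HN (RtoC c) Hcre w Hw)
                            (Tser_correct (N - al) N Hal2 HN (RtoC c) Hcre w Hw))).
assert (S := is_Cseries_plus _ _ _ _ S1 (is_Cseries_plus _ _ _ _ S2 S3)).
match type of S with is_Cseries _ ?l => match goal with |- is_Cseries _ ?l' =>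
  replace l' with l end end.
2:{ rewrite !RtoC_mult, !RtoC_opp, RtoC_minus; ring. }
revert S; apply is_Cseries_ext; intros k.
assert (X : forall a, 0 < a -> LG (RtoC c) 0 (RtoC (nk a N k) * w)
  = (/ w * RtoC (/ nk a N k) + (RtoC (- (2 * c)) * (/ w) ^ 3 * RtoC (/ nk a N k ^ 3)
     + (/ w) ^ 4 * (LGr (RtoC c) (RtoC (nk a N k) * w) * RtoC (/ nk a N k ^ 4))))%C).
{ intros a Ha; assert (Hn := nk_pos a N Ha HN k); set (n := nk a N k) in *.
  assert (Hn0 : RtoC n <> 0%C) by (intros E; apply RtoC_inj in E; lra).
  set (z := (RtoC n * w)%C).
  assert (Hz0 : z <> 0%C) by (apply Cmult_neq_0; assumption).
  assert (Hz : 0 <= Re z).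
  { unfold z; replace (Re (RtoC n * w)) with (n * Re w) by (destruct w; simpl; ring); nra. }
  assert (E := LG_expansion (RtoC c) z Hcre Hz).
  assert (E2 : LG (RtoC c) 0 z = ((z ^ 3 - 2 * RtoC c * z + LGr (RtoC c) z) * (/ z) ^ 4)%C).
  { rewrite <- E; field; exact Hz0. }
  rewrite E2, RtoC_opp, RtoC_mult.
  rewrite !RtoC_inv, !RtoC_pow by (try apply pow_nonzero; lra).
  unfold z; field; split; assumption. }
rewrite (X al Hal1), (X (N - al) Hal2), RtoC_minus; ring.
Qed.

Lemma Sfun_holomorphic (w : C) : 0 < Re w -> holomorphic_at (Sfun c al N) w.
Proof.
intros Hw.
assert (Hw0 : w <> 0%C) by (intros E; rewrite E in Hw; simpl in Hw; lra).
assert (Hi : forall n, holomorphic_at (fun w => (/ w) ^ n)%C w).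
{ intros n; apply (holomorphic_pow Cinv), holomorphic_inv, Hw0. }
assert (Hm : forall (a : C) (f : C -> C), holomorphic_at f w -> holomorphic_at (fun w => a * f w)%C w).
{ intros a f Hf; apply (holomorphic_mult (fun _ => a) f); [apply holomorphic_const|exact Hf]. }
unfold Sfun; cbv zeta.
apply (holomorphic_plus (fun w => _ * / w)%C); [apply Hm, holomorphic_inv, Hw0|].
apply (holomorphic_plus (fun w => _ * (/ w) ^ 3)%C); [apply Hm, Hi|].
apply (holomorphic_mult (fun w => Tser al N (RtoC c) w + RtoC (-1) * Tser (N - al)%R N (RtoC c) w)%C
  (fun w => (/ w) ^ 4)%C); [|apply Hi].
apply (holomorphic_plus (Tser al N (RtoC c))); [|apply Hm]; apply Tser_holomorphic; assumption.
Qed.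

Lemma Tser_filterlim (a : R) {T : Type} (F : (T -> Prop) -> Prop) {FF : Filter F} (f : T -> C) (w : C) :
  0 < a -> (forall x, 0 <= Re (f x)) -> 0 <= Re w ->
  filterlim f F (@locally C_UniformSpace w) ->
  filterlim (fun x => Tser a N (RtoC c) (f x)) F (@locally C_UniformSpace (Tser a N (RtoC c) w)).
Proof.
intros Ha Hf Hw H; apply filterlim_C_Cmod; [exact FF|intros eps].
destruct (Tser_lip a N Ha HN (RtoC c) Hcre) as [K [HK HL]].
assert (He : 0 < eps / (K + 1)) by (apply Rdiv_lt_0_compat; [apply eps|lra]).
generalize (proj1 (filterlim_C_Cmod _ _ _) H (mkposreal _ He)); apply filter_imp; intros x Hx; simpl in Hx.
specialize (HL w (f x - w)%C Hw); replace (w + (f x - w))%C with (f x) in HL by ring.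
apply Rle_lt_trans with (1 := HL (Hf x)).
apply Rle_lt_trans with (K * (eps / (K + 1))); [apply Rmult_le_compat_l; lra|].
apply Rmult_lt_reg_r with (K + 1); [lra|].
replace (K * (eps / (K + 1)) * (K + 1)) with (K * eps) by (field; lra).
generalize (cond_pos eps); nra.
Qed.

Lemma Sfun_filterlim {T : Type} (F : (T -> Prop) -> Prop) {FF : Filter F} (f : T -> C) (w : C) :
  (forall x, 0 <= Re (f x)) -> 0 <= Re w -> w <> 0%C ->
  filterlim f F (@locally C_UniformSpace w) ->
  filterlim (fun x => Sfun c al N (f x)) F (@locally C_UniformSpace (Sfun c al N w)).
Proof.
intros Hf Hw Hw0 H.
assert (Hi : filterlim (fun x => / f x)%C F (@locally C_UniformSpace (/ w)%C)).
{ apply (filterlim_comp _ _ _ f Cinv F (@locally C_UniformSpace w)); [exact H|].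
  apply holomorphic_at_continuous, holomorphic_inv, Hw0. }
assert (Hp : forall n, filterlim (fun x => (/ f x) ^ n)%C F (@locally C_UniformSpace ((/ w) ^ n)%C)).
{ induction n as [|n IH]; [apply (filterlim_const (U := C_UniformSpace) (RtoC 1))|].
  apply (filterlim_Cmult F (fun x => / f x)%C (fun x => (/ f x) ^ n)%C); assumption. }
assert (Hm : forall (a b : C) (g : T -> C), filterlim g F (@locally C_UniformSpace b) ->
  filterlim (fun x => a * g x)%C F (@locally C_UniformSpace (a * b)%C)).
{ intros a b g Hg; apply (filterlim_Cmult F (fun _ => a) g); [|exact Hg].
  apply (filterlim_const (U := C_UniformSpace) a). }
unfold Sfun; cbv zeta.
apply (filterlim_Cplus F (fun x => _ * / f x)%C); [apply Hm, Hi|].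
apply (filterlim_Cplus F (fun x => _ * (/ f x) ^ 3)%C); [apply (Hm _ _ _ (Hp 3%nat))|].
apply (filterlim_Cmult F (fun x => Tser al N (RtoC c) (f x) + RtoC (-1) * Tser (N - al)%R N (RtoC c) (f x))%C
  (fun x => (/ f x) ^ 4)%C); [|apply (Hp 4%nat)].
apply (filterlim_Cplus F (fun x => Tser al N (RtoC c) (f x))); [|apply Hm];
  apply Tser_filterlim; assumption.
Qed.

End Pairs.

(** * Mordell integrals as sums of Laplace-Gauss integrals *)

Lemma is_deriveC_quad (f : R -> C) (x : R) (l : C) (M d : R) : 0 < d -> 0 <= M ->
  (forall h : R, Rabs h < d -> Cmod (f (x + h)%R - f x - RtoC h * l)%C <= M * Rabs h ^ 2) ->
  is_deriveC f x l.
Proof.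
intros Hd HM H; apply is_deriveC_eps; intros eps He.
exists (Rmin d (eps / (M + 1))); split.
- apply Rmin_glb_lt; [exact Hd|apply Rdiv_lt_0_compat; lra].
- intros h Hh; apply Rle_trans with (1 := H h (Rlt_le_trans _ _ _ Hh (Rmin_l _ _))).
  assert (Hh2 := Rlt_le_trans _ _ _ Hh (Rmin_r _ _)).
  assert (H0 := Rabs_pos h).
  assert ((M + 1) * Rabs h <= eps).
  { apply Rmult_lt_compat_l with (r := M + 1) in Hh2; [|lra].
    replace ((M + 1) * (eps / (M + 1))) with eps in Hh2 by (field; lra); lra. }
  simpl; rewrite Rmult_1_r, <- Rmult_assoc; apply Rmult_le_compat_r; [exact H0|]; nra.
Qed.

Lemma Re_scal (n : R) (v : C) : Re (RtoC n * v) = n * Re v.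
Proof. destruct v; simpl; ring. Qed.

Lemma is_deriveC_LG (ga : C) (k : nat) (v : C) (n : R) : 0 < Re ga -> 0 <= Re v -> 0 < n ->
  is_deriveC (fun n => LG ga k (RtoC n * v)%C) n (- (v * LG ga (S k) (RtoC n * v)))%C.
Proof.
intros Hg Hv Hn.
apply (is_deriveC_quad _ _ _ (Cmod v ^ 2 * lgM ga (S (S k))) n Hn).
{ apply Rmult_le_pos; [apply pow2_ge_0|left; apply exp_pos]. }
intros h Hh; apply Rabs_def2 in Hh.
assert (T := LG_taylor ga k (RtoC n * v)%C (RtoC h * v)%C Hg).
rewrite Re_scal in T.
replace (RtoC n * v + RtoC h * v)%C with (RtoC (n + h) * v)%C in T by (rewrite RtoC_plus; ring).
rewrite Re_scal in T.
specialize (T ltac:(apply Rmult_le_pos; lra) ltac:(apply Rmult_le_pos; lra)).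
rewrite Cmod_mult, Cmod_R in T.
match goal with |- Cmod ?x <= _ => match type of T with Cmod ?y <= _ =>
  replace x with y by ring end end.
apply Rle_trans with (1 := T); right; ring.
Qed.

Lemma Re_inv_pos (t : C) : 0 < Re t -> 0 < Re (/ t).
Proof.
intros H; destruct t as [x y]; simpl in *.
apply Rdiv_lt_0_compat; [exact H|]; nra.
Qed.

Lemma RtoC_neq_0 (x : R) : x <> 0 -> RtoC x <> 0%C.
Proof. intros H E; apply H, RtoC_inj, E. Qed.

(* Both sides satisfy the same first-order linear equation in n, whose
   homogeneous solutions exp (t n^2 / 4c) are unbounded. *)
Lemma LG_scaled (c n : R) (t w : C) : 0 < c -> 0 < n -> 0 < Re t -> 0 < Re w -> (w * w)%C = t ->
  LG (RtoC c / t) 0 (RtoC n) = (w * LG (RtoC c) 0 (RtoC n * w))%C.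
Proof.
intros Hc Hn Ht Hw Hwt.
assert (Ht0 : t <> 0%C) by (intros E; rewrite E in Ht; simpl in Ht; lra).
assert (Hc0 : RtoC c <> 0%C) by (apply RtoC_neq_0; lra).
set (ga := (RtoC c / t)%C).
assert (Hga : 0 < Re ga).
{ unfold ga, Cdiv; rewrite Re_scal; apply Rmult_lt_0_compat; [exact Hc|apply Re_inv_pos, Ht]. }
assert (Hcre : 0 < Re (RtoC c)) by exact Hc.
(* The factor 1 gives both terms the shape [LG _ 0 (RtoC x * v)], with [v = 1] and [v = w], so that
   [is_deriveC_LG] serves for both. *)
pose (d := fun x : R => (LG ga 0 (RtoC x * 1) - w * LG (RtoC c) 0 (RtoC x * w))%C).
pose (E := fun x : R => Cexp (- (t / RtoC (4 * c)) * RtoC (x ^ 2))%C).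
assert (H4 : RtoC (4 * c) <> 0%C) by (apply RtoC_neq_0; lra).
assert (HE : forall x, is_deriveC E x (- (t / RtoC (2 * c)) * RtoC x * E x)%C).
{ intros x; apply is_deriveC_Cexp.
  replace (- (t / RtoC (2 * c)) * RtoC x)%C with (- (t / RtoC (4 * c)) * RtoC (2 * x))%C.
  2:{ rewrite !RtoC_mult; field; exact Hc0. }
  generalize (- (t / RtoC (4 * c)))%C; intros [u v].
  apply is_deriveC_pair; simpl; auto_derive; auto; ring. }
assert (Hd : forall x, 0 < x -> is_deriveC d x (t / RtoC (2 * c) * RtoC x * d x)%C).
{ intros x Hx.
  assert (D1 := is_deriveC_LG ga 0 1%C x Hga ltac:(simpl; lra) Hx).
  assert (D2 := is_deriveC_LG (RtoC c) 0 w x Hcre ltac:(lra) Hx).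
  assert (D3 := is_deriveC_mult (fun _ => w) _ x _ _ (@is_derive_const R_AbsRing C_R_NormedModule w x) D2).
  assert (D := @is_derive_minus R_AbsRing C_R_NormedModule _ _ x _ _ D1 D3).
  cbv beta in D.
  replace (t / RtoC (2 * c) * RtoC x * d x)%C with
    (- (1 * LG ga 1 (RtoC x * 1)) - (0 * LG (RtoC c) 0 (RtoC x * w) + w * - (w * LG (RtoC c) 1 (RtoC x * w))))%C.
  { exact D. }
  unfold d.
  assert (R1 := LG_rec_0 ga (RtoC x * 1)%C Hga ltac:(rewrite Re_scal; simpl; lra)).
  assert (R2 := LG_rec_0 (RtoC c) (RtoC x * w)%C Hcre ltac:(rewrite Re_scal; nra)).
  set (a0 := LG ga 0 (RtoC x * 1)%C) in *; set (a1 := LG ga 1 (RtoC x * 1)%C) in *.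
  set (b0 := LG (RtoC c) 0 (RtoC x * w)%C) in *; set (b1 := LG (RtoC c) 1 (RtoC x * w)%C) in *.
  assert (A1 : a1 = ((1 - RtoC x * a0) * (t / (2 * RtoC c)))%C).
  { rewrite <- R1; unfold ga; field; split; assumption. }
  assert (B1 : b1 = ((1 - RtoC x * w * b0) / (2 * RtoC c))%C).
  { rewrite <- R2; field; exact Hc0. }
  rewrite A1, B1, <- Hwt, RtoC_mult; field; exact Hc0. }
assert (HdE : forall x, 0 < x -> is_deriveC (fun x => d x * E x)%C x (RtoC 0)).
{ intros x Hx; assert (D := is_deriveC_mult _ _ _ _ _ (Hd x Hx) (HE x)).
  replace (RtoC 0) with (t / RtoC (2 * c) * RtoC x * d x * E x + d x * (- (t / RtoC (2 * c)) * RtoC x * E x))%C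
    by ring; exact D. }
assert (Hconst : forall x, n < x -> (d n * E n)%C = (d x * E x)%C).
{ intros x Hx; apply (@eq_is_derive C_R_NormedModule (fun x => d x * E x)%C); [|exact Hx].
  intros y Hy; apply HdE; lra. }
set (K := lgM ga 0 + Cmod w * lgM (RtoC c) 0).
assert (HK : 0 < K).
{ unfold K; apply Rplus_lt_le_0_compat; [apply exp_pos|].
  apply Rmult_le_pos; [apply Cmod_ge_0|left; apply exp_pos]. }
assert (Hdb : forall x, 0 < x -> Cmod (d x) <= K).
{ intros x Hx; unfold d; eapply Rle_trans; [apply Cmod_triangle_minus|].
  rewrite Cmod_mult; apply Rplus_le_compat.
  - apply LG_bound; [exact Hga|rewrite Re_scal; simpl; lra].
  - apply Rmult_le_compat_l; [apply Cmod_ge_0|]; apply LG_bound; [exact Hcre|rewrite Re_scal; nra]. }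
set (r := Re t / (4 * c)); assert (Hr : 0 < r) by (apply Rdiv_lt_0_compat; lra).
assert (HEb : forall x, Cmod (E x) = exp (- r * x ^ 2)).
{ intros x; unfold E; rewrite Cmod_Cexp; f_equal.
  replace (- (t / RtoC (4 * c)) * RtoC (x ^ 2))%C with (RtoC (- (x ^ 2 / (4 * c))) * t)%C.
  - rewrite Re_scal; unfold r; field; lra.
  - rewrite RtoC_opp, RtoC_div by lra; field; exact H4. }
assert (Hz : Cmod (d n * E n) = 0).
{ apply Rle_antisym; [|apply Cmod_ge_0]; apply Rnot_lt_le; intros Hpos.
  set (e := Cmod (d n * E n)) in *.
  destruct (proj1 (filterlim_locally _ _) (exp_decay_lim r Hr) (mkposreal (e / K) (Rdiv_lt_0_compat _ _ Hpos HK))) as [B HB].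
  set (x := Rmax (Rmax B n) 1 + 1).
  assert (x1 : Rmax B n <= Rmax (Rmax B n) 1) by apply Rmax_l.
  assert (x2 : 1 <= Rmax (Rmax B n) 1) by apply Rmax_r.
  assert (x3 := Rmax_l B n); assert (x4 := Rmax_r B n).
  specialize (HB x ltac:(unfold x; lra)); simpl in HB.
  change (Rabs (exp (- r * x) - 0) < e / K) in HB.
  rewrite Rminus_0_r, Rabs_pos_eq in HB by (left; apply exp_pos).
  assert (A : e <= K * exp (- r * x)).
  { unfold e; rewrite (Hconst x) by (unfold x; lra); rewrite Cmod_mult, HEb.
    apply Rmult_le_compat; [apply Cmod_ge_0|left; apply exp_pos|apply Hdb; unfold x; lra|].
    apply exp_le; assert (x <= x ^ 2) by (unfold x in *; nra); nra. }
  apply Rmult_lt_compat_l with (r := K) in HB; [|exact HK].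
  replace (K * (e / K)) with e in HB by (field; lra); lra. }
rewrite Cmod_mult in Hz; apply Rmult_integral in Hz; destruct Hz as [Hz|Hz].
- apply Cmod_eq_0 in Hz; unfold d in Hz; rewrite Cmult_1_r in Hz.
  replace (LG ga 0 (RtoC n)) with ((LG ga 0 (RtoC n) - w * LG (RtoC c) 0 (RtoC n * w))
    + w * LG (RtoC c) 0 (RtoC n * w))%C by ring.
  rewrite Hz; ring.
- rewrite HEb in Hz; pose proof (exp_pos (- r * n ^ 2)); lra.
Qed.

(** Common form of the kernels: [JS P a] has [al = a] and [N = 2 P], [W3] has [al = 2] and [N = 6].
    It equals (e^(- al u) - e^(- (N - al) u)) / (1 - e^(- N u)), whose geometric expansion has the
    exponents [al + N k] and [N - al + N k]. *)
Definition hfun (al N u : R) : R := sinh ((N / 2 - al) * u) / sinh (N / 2 * u).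

Lemma sinh_pos (x : R) : 0 < x -> 0 < sinh x.
Proof.
intros H; unfold sinh; assert (exp (- x) < exp x) by (apply exp_increasing; lra); lra.
Qed.

Lemma hfun_eq (al N u : R) : 0 < N -> 0 < u ->
  hfun al N u * (1 - exp (- (N * u))) = exp (- (al * u)) - exp (- ((N - al) * u)).
Proof.
intros HN Hu; unfold hfun.
assert (Hs : 0 < sinh (N / 2 * u)) by (apply sinh_pos; nra).
replace (1 - exp (- (N * u))) with (2 * exp (- (N / 2 * u)) * sinh (N / 2 * u)).
- replace (exp (- (al * u)) - exp (- ((N - al) * u)))
    with (2 * exp (- (N / 2 * u)) * sinh ((N / 2 - al) * u)).
  + field; lra.
  + unfold sinh.
    replace (2 * exp (- (N / 2 * u)) * ((exp ((N / 2 - al) * u) - exp (- ((N / 2 - al) * u))) / 2))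
      with (exp (- (N / 2 * u)) * exp ((N / 2 - al) * u) - exp (- (N / 2 * u)) * exp (- ((N / 2 - al) * u))) by field.
    rewrite <- !exp_plus; f_equal; [|f_equal]; f_equal; field.
- unfold sinh.
  replace (2 * exp (- (N / 2 * u)) * ((exp (N / 2 * u) - exp (- (N / 2 * u))) / 2))
    with (exp (- (N / 2 * u)) * exp (N / 2 * u) - exp (- (N / 2 * u)) * exp (- (N / 2 * u))) by field.
  rewrite <- !exp_plus, <- exp_0; f_equal; [|f_equal]; f_equal; field.
Qed.

(** With [x] and [y] the two exponentials the quotient is [(x - y) / (1 - x y)], and both lie
    between 0 and 1. *)
Lemma hfun_bound (al N u : R) : 0 < al < N -> 0 < u -> Rabs (hfun al N u) <= 1.
Proof.
intros Ha Hu; assert (E := hfun_eq al N u ltac:(lra) Hu).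
set (x := exp (- (al * u))) in *; set (y := exp (- ((N - al) * u))) in *.
assert (Exy : exp (- (N * u)) = x * y) by (unfold x, y; rewrite <- exp_plus; f_equal; ring).
assert (Hx : 0 < x < 1) by (split; [apply exp_pos|unfold x; rewrite <- exp_0; apply exp_increasing; nra]).
assert (Hy : 0 < y < 1) by (split; [apply exp_pos|unfold y; rewrite <- exp_0; apply exp_increasing; nra]).
rewrite Exy in E; assert (Hxy : 0 < 1 - x * y) by nra.
apply Rabs_le; split; apply Rmult_le_reg_r with (1 := Hxy); rewrite ?E; nra.
Qed.

Lemma slope_continuous (f : R -> R) (l : R) : f 0 = 0 -> is_derive f 0 l ->
  (forall x, x <> 0 -> continuous f x) ->
  forall x, continuous (fun x => if Req_EM_T x 0 then l else f x / x) x.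
Proof.
intros H0 Hd Hc x; destruct (Req_dec x 0) as [->|Hx].
- apply filterlim_locally; intros eps.
  destruct Hd as [_ Hd].
  assert (He : 0 < eps / 2) by (generalize (cond_pos eps); lra).
  destruct (Hd 0 (fun P HP => HP) (mkposreal _ He)) as [d Hd'].
  exists d; intros y Hy; specialize (Hd' y Hy).
  destruct (Req_EM_T 0 0) as [_|]; [|contradiction].
  change (Rabs ((if Req_EM_T y 0 then l else f y / y) - l) < eps).
  destruct (Req_EM_T y 0) as [->|Hy0].
  + rewrite Rminus_diag, Rabs_R0; apply eps.
  + change (Rabs (f y - f 0 - (y - 0) * l) <= eps / 2 * Rabs (y - 0)) in Hd'.
    rewrite H0, !Rminus_0_r in Hd'.
    replace (f y / y - l) with ((f y - y * l) / y) by (field; exact Hy0).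
    assert (Hp : 0 < Rabs y) by (apply Rabs_pos_lt, Hy0).
    unfold Rdiv; rewrite Rabs_mult, Rabs_inv.
    apply Rle_lt_trans with (eps / 2 * Rabs y * / Rabs y).
    * apply Rmult_le_compat_r; [left; apply Rinv_0_lt_compat, Hp|exact Hd'].
    * rewrite Rmult_assoc, Rinv_r by lra; generalize (cond_pos eps); lra.
- apply (continuous_ext_loc _ (fun x => f x / x)).
  + assert (Hp : 0 < Rabs x) by (apply Rabs_pos_lt, Hx).
    exists (mkposreal _ Hp); intros y Hy.
    destruct (Req_EM_T y 0) as [->|]; [|reflexivity].
    change (Rabs (0 - x) < Rabs x) in Hy; rewrite Rminus_0_l, Rabs_Ropp in Hy; lra.
  + apply (continuous_mult (K := R_AbsRing) f (fun x => / x)); [apply Hc, Hx|].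
    apply (continuous_Rinv x Hx).
Qed.

Lemma sinh_slope_continuous (a x : R) :
  continuous (fun x => if Req_EM_T x 0 then a else sinh (a * x) / x) x.
Proof.
apply (slope_continuous (fun x => sinh (a * x))).
- rewrite Rmult_0_r; apply sinh_0.
- unfold sinh; auto_derive; [exact I|]; rewrite Rmult_0_r, Ropp_0, exp_0; field.
- intros y _; apply (@ex_derive_continuous R_AbsRing R_NormedModule).
  unfold sinh; auto_derive; exact I.
Qed.

(** Dividing both hyperbolic sines by [u] removes the singularity at 0; this provides integrability
    on the intervals that start there. *)
Lemma hfun_ext_continuous (al N : R) : 0 < N -> exists h : R -> R,
  (forall u, 0 < u -> h u = hfun al N u) /\ forall u, continuous h u.
Proof.
intros HN.
pose (p := fun a x => if Req_EM_T x 0 then a else sinh (a * x) / x).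
exists (fun u => p (N / 2 - al) u / p (N / 2) u); split.
- intros u Hu; unfold p, hfun; destruct (Req_EM_T u 0); [lra|].
  field; split; [|lra]; apply Rgt_not_eq, sinh_pos; nra.
- intros u; apply (continuous_mult (K := R_AbsRing) (p (N / 2 - al)) (fun u => / p (N / 2) u)).
  + apply sinh_slope_continuous.
  + apply (continuous_comp (p (N / 2)) Rinv); [apply sinh_slope_continuous|].
    apply continuous_Rinv; unfold p; destruct (Req_EM_T u 0) as [|Hu]; [lra|].
    intros E; apply Rmult_integral in E; destruct E as [E|E].
    * destruct (Rtotal_order u 0) as [L|[L|L]]; [|contradiction|].
      -- assert (P := sinh_pos (N / 2 * - u) ltac:(nra)).
         replace (N / 2 * - u) with (- (N / 2 * u)) in P by ring.
         unfold sinh in P, E; rewrite Ropp_involutive in P; lra.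
      -- assert (P := sinh_pos (N / 2 * u) ltac:(nra)); lra.
    * apply (Rinv_neq_0_compat u Hu E).
Qed.

Lemma mordell_int (c al N : R) (t w : C) : 0 < c -> 0 < al < N ->
  0 < Re t -> 0 < Re w -> (w * w)%C = t ->
  is_CInt (fun u => Cexp (- RtoC (c * u ^ 2) / t) * RtoC (hfun al N u))%C
    (w * Sfun c al N w)%C.
Proof.
intros Hc Ha Ht Hw Hwt.
assert (Ht0 : t <> 0%C) by (intros E; rewrite E in Ht; simpl in Ht; lra).
assert (Hw0 : w <> 0%C) by (intros E; rewrite E in Hw; simpl in Hw; lra).
set (ga := (RtoC c / t)%C).
assert (Hga : 0 < Re ga).
{ unfold ga, Cdiv; rewrite Re_scal; apply Rmult_lt_0_compat; [exact Hc|apply Re_inv_pos, Ht]. }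
destruct (hfun_ext_continuous al N ltac:(lra)) as [h [Hh1 Hh2]].
assert (El : forall n u, lgf ga 0 (RtoC n) u = (Cexp (- RtoC (c * u ^ 2) / t) * RtoC (exp (- (n * u))))%C).
{ intros n u; unfold lgf; rewrite <- Cexp_RtoC, <- Cexp_plus; simpl (u ^ 0); rewrite Cmult_1_l.
  f_equal; unfold ga; rewrite RtoC_opp, !RtoC_mult; field; exact Ht0. }
(* What remains of the integrand after [K] terms of the geometric expansion. Its integral is at most
   [1 / (N K)] in modulus, which lets the partial sums converge to the integral of [g 0]. *)
pose (g := fun (K : nat) u => (lgf ga 0 (RtoC (N * INR K)) u * RtoC (hfun al N u))%C).
assert (Hex : forall K b, 0 <= b -> ex_CRInt (g K) 0 b).
{ intros K b Hb.
  destruct (ex_CRInt_continuous (fun u => lgf ga 0 (RtoC (N * INR K)) u * RtoC (h u))%C 0 b) as [l Hl].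
  - intros x _; apply Ccontinuous_mult; [apply lgf_continuous|].
    apply Ccontinuous_pair; [apply Hh2|apply continuous_const].
  - exists l; revert Hl; apply is_CRInt_ext; intros x [Hx _]; rewrite Rmin_left in Hx by exact Hb.
    unfold g; rewrite Hh1 by exact Hx; reflexivity. }
assert (Hhb : forall K u, 0 < u -> Cmod (g K u) <= Cmod (lgf ga 0 (RtoC (N * INR K)) u)).
{ intros K u Hu; unfold g; rewrite Cmod_mult, Cmod_R.
  pose proof (hfun_bound al N u Ha Hu); pose proof (Cmod_ge_0 (lgf ga 0 (RtoC (N * INR K)) u)); nra. }
assert (HNK : forall K, 0 <= N * INR K) by (intros K; apply Rmult_le_pos; [lra|apply pos_INR]).
assert (HI : forall K, exists l, is_CInt (g K) l).
{ intros K; destruct (is_CInt_dominated (g K) (lgM ga 0) 1 Rlt_0_1 (Hex K)) as [l [Hl _]].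
  - intros s Hs; apply Rle_trans with (1 := Hhb K s Hs).
    apply (lgf_bound ga 0 (RtoC (N * INR K)) s Hga (HNK K)); lra.
  - exists l; exact Hl. }
set (a := fun k => (LG (RtoC c) 0 (RtoC (nk al N k) * w) - LG (RtoC c) 0 (RtoC (nk (N - al)%R N k) * w))%C).
assert (Hlg : forall n, 0 < n -> is_CInt (lgf ga 0 (RtoC n)) (w * LG (RtoC c) 0 (RtoC n * w))%C).
{ intros n Hn; rewrite <- (LG_scaled c n t w) by assumption; apply LG_correct; [exact Hga|simpl; lra]. }
assert (Hstep : forall K l, is_CInt (g (S K)) l -> is_CInt (g K) (l + w * a K)%C).
{ intros K l Hl.
  assert (P1 := nk_pos al N ltac:(lra) ltac:(lra) K).
  assert (P2 := nk_pos (N - al) N ltac:(lra) ltac:(lra) K).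
  assert (X := is_CInt_plus _ _ _ _ Hl (is_CInt_minus _ _ _ _ (Hlg _ P1) (Hlg _ P2))).
  replace (l + w * a K)%C with (l + (w * LG (RtoC c) 0 (RtoC (nk al N K) * w)
     - w * LG (RtoC c) 0 (RtoC (nk (N - al)%R N K) * w)))%C by (unfold a; ring).
  revert X; apply is_CInt_ext; intros s Hs; unfold g; rewrite !El.
  match goal with |- (?e * ?u * ?v + (?e * ?p - ?e * ?q))%C = (?e * ?r * ?v)%C =>
    transitivity (e * (u * v + (p - q)))%C; [ring|]; transitivity (e * (r * v))%C; [f_equal|ring] end.
  rewrite <- !RtoC_mult, <- RtoC_minus, <- RtoC_plus; f_equal.
  assert (E := hfun_eq al N s ltac:(lra) Hs).
  assert (E1 : exp (- (N * INR (S K) * s)) = exp (- (N * INR K * s)) * exp (- (N * s)))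
    by (rewrite <- exp_plus, S_INR; f_equal; ring).
  assert (E2 : exp (- (nk al N K * s)) = exp (- (N * INR K * s)) * exp (- (al * s)))
    by (rewrite <- exp_plus; unfold nk; f_equal; ring).
  assert (E3 : exp (- (nk (N - al) N K * s)) = exp (- (N * INR K * s)) * exp (- ((N - al) * s)))
    by (rewrite <- exp_plus; unfold nk; f_equal; ring).
  rewrite E1, E2, E3, <- Rmult_minus_distr_l, <- E; ring. }
destruct (HI 0%nat) as [I0 HI0].
assert (Hall : forall K l, is_CInt (g K) l -> I0 = (l + w * csum a K)%C).
{ induction K as [|K IH]; intros l Hl.
  - simpl; rewrite Cmult_0_r, Cplus_0_r; apply (is_CInt_unique _ _ _ HI0 Hl).
  - rewrite (IH _ (Hstep K l Hl)); simpl; ring. }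
assert (HIK : forall K l, (1 <= K)%nat -> is_CInt (g K) l -> Cmod l <= 1 / (N * INR K)).
{ intros K l HK Hl.
  assert (HK' : 0 < N * INR K) by (apply Rmult_lt_0_compat; [lra|apply lt_0_INR; lia]).
  apply (is_CInt_le (g K) l 1 (N * INR K) HK' Hl).
  intros s Hs; apply Rle_trans with (1 := Hhb K s Hs).
  unfold lgf; simpl (s ^ 0); rewrite Cmult_1_l, Cmod_Cexp, lgf_exponent_Re, Rmult_1_l.
  apply exp_le; simpl (Re (RtoC _)); pose proof (pow2_ge_0 s); nra. }
assert (HS := Sfun_series c al N Hc Ha w ltac:(lra) Hw0).
assert (Eq : I0 = (w * Sfun c al N w)%C).
{ cut (Cmod (I0 - w * Sfun c al N w) = 0).
  { intros E; apply Cmod_eq_0 in E.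
    replace I0 with ((I0 - w * Sfun c al N w) + w * Sfun c al N w)%C by ring; rewrite E; ring. }
  apply Rle_antisym; [|apply Cmod_ge_0]; apply Rnot_lt_le; intros Hpos.
  set (e := Cmod (I0 - w * Sfun c al N w)) in *.
  assert (Hwm := Cmod_ge_0 w).
  destruct (csum_lim _ _ HS (e / (2 * (Cmod w + 1)))) as [M HM].
  { apply Rdiv_lt_0_compat; lra. }
  destruct (INR_unbounded (2 / (N * e))) as [M2 HM2].
  set (K := (M + M2 + 1)%nat).
  destruct (HI K) as [l Hl].
  specialize (HM K ltac:(unfold K; lia)); fold a in HM.
  assert (B := HIK K l ltac:(unfold K; lia) Hl).
  assert (HKr : 2 / (N * e) < INR K) by (apply Rlt_le_trans with (1 := HM2), le_INR; unfold K; lia).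
  assert (B2 : 1 / (N * INR K) < e / 2).
  { assert (0 < N * e) by (apply Rmult_lt_0_compat; lra).
    assert (HK0 : 0 < INR K) by (apply lt_0_INR; unfold K; lia).
    apply Rmult_lt_compat_r with (r := N * e) in HKr; [|assumption].
    replace (2 / (N * e) * (N * e)) with 2 in HKr by (field; lra).
    apply Rmult_lt_reg_r with (2 * (N * INR K)); [nra|].
    replace (1 / (N * INR K) * (2 * (N * INR K))) with 2 by (field; lra).
    replace (e / 2 * (2 * (N * INR K))) with (INR K * (N * e)) by field; exact HKr. }
  assert (T : e <= Cmod l + Cmod w * Cmod (csum a K - Sfun c al N w)).
  { unfold e; rewrite (Hall K l Hl).
    replace (l + w * csum a K - w * Sfun c al N w)%C with (l + w * (csum a K - Sfun c al N w))%C by ring.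
    rewrite <- Cmod_mult; apply Cmod_triangle. }
  assert (T2 : Cmod w * Cmod (csum a K - Sfun c al N w) <= e / 2).
  { apply Rle_trans with ((Cmod w + 1) * (e / (2 * (Cmod w + 1)))); [|right; field; lra].
    pose proof (Cmod_ge_0 (csum a K - Sfun c al N w)); apply Rmult_le_compat; lra. }
  lra. }
rewrite <- Eq; revert HI0; apply is_CInt_ext; intros s _; unfold g; rewrite El.
change (INR 0) with 0; rewrite Rmult_0_r, Rmult_0_l, Ropp_0, exp_0; ring.
Qed.

(** * Values on the imaginary axis: the Gaussian part *)

Lemma continuous_of_derive (f : R -> R) (x l : R) : is_derive f x l -> continuous f x.
Proof. intros H; apply (@ex_derive_continuous R_AbsRing R_NormedModule); exists l; exact H. Qed.

Definition is_RI (g : R -> R) (l : R) : Prop :=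
  exists I : R -> R, (forall b, 0 <= b -> is_RInt g 0 b (I b)) /\
    filterlim I (Rbar_locally p_infty) (locally l).

Lemma is_CInt_Re (g : R -> C) (l : C) : is_CInt g l -> is_RI (fun s => Re (g s)) (Re l).
Proof.
intros [I [H1 H2]]; exists (fun b => Re (I b)); split.
- intros b Hb; apply is_CRInt_Re, H1, Hb.
- apply filterlim_locally; intros eps.
  generalize (proj1 (filterlim_C_Cmod _ _ _) H2 eps); apply filter_imp; intros b Hb.
  apply Rle_lt_trans with (2 := Hb), (re_le_Cmod (I b - l)%C).
Qed.

Lemma is_CInt_Im (g : R -> C) (l : C) : is_CInt g l -> is_RI (fun s => Im (g s)) (Im l).
Proof.
intros [I [H1 H2]]; exists (fun b => Im (I b)); split.
- intros b Hb; apply is_CRInt_Im, H1, Hb.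
- apply filterlim_locally; intros eps.
  generalize (proj1 (filterlim_C_Cmod _ _ _) H2 eps); apply filter_imp; intros b Hb.
  apply Rle_lt_trans with (2 := Hb), (Im_le_Cmod (I b - l)%C).
Qed.

Lemma is_RI_ext (f g : R -> R) (l : R) : (forall s, f s = g s) -> is_RI f l -> is_RI g l.
Proof.
intros E [I [H1 H2]]; exists I; split; [|exact H2].
intros b Hb; apply (is_RInt_ext f); [intros; apply E|apply H1, Hb].
Qed.

Lemma is_RI_plus (f g : R -> R) (a b : R) :
  is_RI f a -> is_RI g b -> is_RI (fun s => f s + g s) (a + b).
Proof.
intros [I [H1 H2]] [J [G1 G2]]; exists (fun b => I b + J b); split.
- intros x Hx; exact (is_RInt_plus (V := R_NormedModule) _ _ _ _ _ _ (H1 x Hx) (G1 x Hx)).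
- exact (filterlim_comp_2 _ _ _ H2 G2 (@filterlim_plus R_AbsRing R_NormedModule a b)).
Qed.

Lemma is_RI_scal (c : R) (f : R -> R) (a : R) :
  is_RI f a -> is_RI (fun s => c * f s) (c * a).
Proof.
intros [I [H1 H2]]; exists (fun b => c * I b); split.
- intros x Hx; exact (is_RInt_scal (V := R_NormedModule) _ _ _ c _ (H1 x Hx)).
- exact (filterlim_comp _ _ _ I (fun x => c * x) _ _ _ H2
    (@filterlim_scal_r R_AbsRing R_NormedModule c a)).
Qed.

(* The derivative of  c (int_0^x e^{-c s^2} ds)^2
   + int_0^1 e^{-c x^2 (1+s^2)}/(1+s^2) ds  vanishes. *)
Lemma gauss_partial (c x : R) : 0 < c -> 0 <= x ->
  0 <= PI / 4 - c * RInt (fun s => exp (- c * s ^ 2)) 0 x ^ 2 <= exp (- c * x ^ 2).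
Proof.
intros Hc Hx.
set (g := fun s => exp (- c * s ^ 2)).
assert (Hg : forall s, continuous g s).
{ intros s; apply (continuous_of_derive g s (- c * (2 * s) * exp (- c * s ^ 2))).
  unfold g; auto_derive; [exact I|simpl; ring]. }
set (I := fun x => RInt g 0 x).
set (J := fun x => RInt (fun s => exp (- c * x ^ 2 * (1 + s ^ 2)) / (1 + s ^ 2)) 0 1).
assert (Hexg : forall a b, ex_RInt g a b).
{ intros a b; apply (@ex_RInt_continuous R_CompleteNormedModule); intros; apply Hg. }
assert (HI : forall y, is_derive I y (g y)).
{ intros y; apply (is_derive_RInt (V := R_CompleteNormedModule) g I 0 y); [|apply Hg].
  apply filter_forall; intros z; apply RInt_correct, Hexg. }
assert (P : forall s, 0 < 1 + s ^ 2) by (intros s; pose proof (pow2_ge_0 s); lra).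
set (f := fun y s => exp (- c * y ^ 2 * (1 + s ^ 2)) / (1 + s ^ 2)).
assert (Hf : forall y s, is_derive (fun u => f u s) y (- (2 * c * y) * exp (- c * y ^ 2 * (1 + s ^ 2)))).
{ intros y s; unfold f; auto_derive; [exact Logic.I|].
  replace (- c * (y * (y * 1)) * (1 + s * (s * 1))) with (- c * y ^ 2 * (1 + s ^ 2)) by ring.
  field; apply Rgt_not_eq; specialize (P s); simpl in P; lra. }
assert (Hfc : forall y s, continuous (f y) s).
{ intros y s; apply (@ex_derive_continuous R_AbsRing R_NormedModule); unfold f; auto_derive.
  repeat split; try exact Logic.I; apply Rgt_not_eq; specialize (P s); simpl in P; lra. }
assert (HJ : forall y, is_derive J y (- (2 * c) * g y * I y)).
{ intros y.
  replace (- (2 * c) * g y * I y) with (RInt (fun s => Derive (fun u => f u s) y) 0 1).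
  - apply (is_derive_RInt_param f).
    + apply filter_forall; intros z t _; eexists; apply Hf.
    + intros t _.
      apply (continuity_2d_pt_ext (fun u v => - (2 * c * u) * exp (- c * u ^ 2 * (1 + v ^ 2)))).
      { intros u v; symmetry; apply is_derive_unique, Hf. }
      apply continuity_2d_pt_mult.
      * apply (continuity_1d_2d_pt_comp (fun u => - (2 * c * u)) (fun u v => u)).
        -- apply derivable_continuous_pt; reg.
        -- apply continuity_2d_pt_id1.
      * apply (continuity_1d_2d_pt_comp exp (fun u v => - c * u ^ 2 * (1 + v ^ 2))).
        -- apply derivable_continuous_pt; reg.
        -- apply continuity_2d_pt_mult.
           ++ apply (continuity_1d_2d_pt_comp (fun u => - c * u ^ 2) (fun u v => u)).
              ** apply derivable_continuous_pt; reg.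
              ** apply continuity_2d_pt_id1.
           ++ apply (continuity_1d_2d_pt_comp (fun u => 1 + u ^ 2) (fun u v => v)).
              ** apply derivable_continuous_pt; reg.
              ** apply continuity_2d_pt_id2.
    + apply filter_forall; intros z; apply (@ex_RInt_continuous R_CompleteNormedModule).
      intros s _; apply (Hfc z s).
  - rewrite (RInt_ext _ (fun s => scal (- (2 * c) * g y) (y * g (y * s + 0)))).
    2:{ intros s _; transitivity (- (2 * c * y) * exp (- c * y ^ 2 * (1 + s ^ 2))).
        - apply is_derive_unique, Hf.
        - replace (exp (- c * y ^ 2 * (1 + s ^ 2))) with (g y * g (y * s + 0))
            by (unfold g; rewrite <- exp_plus; f_equal; ring).
          change (- (2 * c * y) * (g y * g (y * s + 0)) = - (2 * c) * g y * (y * g (y * s + 0))); ring. }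
    rewrite (RInt_scal (V := R_CompleteNormedModule)).
    + change (- (2 * c) * g y * RInt (fun s => y * g (y * s + 0)) 0 1 = - (2 * c) * g y * I y).
      f_equal; transitivity (RInt g (y * 0 + 0) (y * 1 + 0)).
      * apply (RInt_comp_lin (V := R_CompleteNormedModule) g y 0 0 1), Hexg.
      * unfold I; f_equal; ring.
    + apply (@ex_RInt_continuous R_CompleteNormedModule); intros s _.
      apply (continuous_of_derive _ _ (y * (- c * (2 * (y * s + 0) * y) * exp (- c * (y * s + 0) ^ 2)))).
      unfold g; auto_derive; [exact Logic.I|simpl; ring]. }
assert (HE : c * I x ^ 2 + J x = PI / 4).
{ assert (H0 : c * I 0 ^ 2 + J 0 = PI / 4).
  { unfold I; rewrite RInt_point; unfold zero; simpl.
    assert (EJ : J 0 = PI / 4); [|rewrite EJ; ring].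
    unfold J; apply is_RInt_unique.
    apply (is_RInt_ext (fun s => / (1 + s ^ 2))).
    { intros s _; replace (- c * 0 ^ 2 * (1 + s ^ 2)) with 0 by ring; rewrite exp_0.
      change (/ (1 + s ^ 2) = 1 / (1 + s ^ 2)); unfold Rdiv; ring. }
    replace (PI / 4) with (minus (atan 1) (atan 0)).
    2:{ rewrite atan_1, atan_0; unfold minus, plus, opp; simpl; ring. }
    apply (is_RInt_derive (V := R_CompleteNormedModule) atan).
    - intros s _; generalize (is_derive_atan s); unfold Rsqr; simpl; rewrite Rmult_1_r; auto.
    - intros s _; apply (@ex_derive_continuous R_AbsRing R_NormedModule); auto_derive.
      specialize (P s); simpl in P; lra. }
  destruct Hx as [Hx|Hx]; [|rewrite <- Hx; exact H0].
  rewrite <- H0; symmetry.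
  apply (@eq_is_derive R_NormedModule (fun x => c * I x ^ 2 + J x)); [|exact Hx].
  intros t _; evar_last.
  - apply (is_derive_plus (V := R_NormedModule) (fun x => c * I x ^ 2) J); [|apply HJ].
    apply (is_derive_scal (fun x => I x ^ 2)), (is_derive_pow I 2), HI.
  - unfold plus, zero; simpl; ring. }
fold (I x); replace (PI / 4 - c * I x ^ 2) with (J x) by lra.
assert (HexJ : ex_RInt (fun s => exp (- c * x ^ 2 * (1 + s ^ 2)) / (1 + s ^ 2)) 0 1).
{ apply (@ex_RInt_continuous R_CompleteNormedModule); intros s _; apply (Hfc x s). }
split.
- apply RInt_ge_0; [lra|exact HexJ|].
  intros s _; apply Rdiv_le_0_compat; [left; apply exp_pos|apply P].
- replace (exp (- c * x ^ 2)) with (RInt (fun _ => exp (- c * x ^ 2)) 0 1).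
  + apply RInt_le; [lra|exact HexJ|apply ex_RInt_const|].
    intros s _; specialize (P s); pose proof (pow2_ge_0 s); pose proof (pow2_ge_0 x).
    apply Rle_trans with (exp (- c * x ^ 2 * (1 + s ^ 2)) / 1).
    * apply Rmult_le_compat_l; [left; apply exp_pos|apply Rinv_le_contravar; lra].
    * rewrite Rdiv_1_r; apply exp_le.
      assert (0 <= c * x ^ 2 * s ^ 2) by (apply Rmult_le_pos; [apply Rmult_le_pos|]; lra).
      lra.
  + rewrite RInt_const; unfold scal; simpl; unfold mult; simpl; ring.
Qed.

Lemma LG_zero_Re (c : R) : 0 < c -> Re (LG (RtoC c) 0 0) = / 2 * sqrt (PI / c).
Proof.
intros Hc; pose proof PI_RGT_0.
assert (HL := LG_correct (RtoC c) 0 0%C Hc (Rle_refl 0)).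
apply is_CInt_Re in HL.
assert (Eg : forall s, Re (lgf (RtoC c) 0 0 s) = exp (- c * s ^ 2)).
{ intros s; unfold lgf.
  replace (- (RtoC c * RtoC (s ^ 2)) - 0 * RtoC s)%C with (RtoC (- c * s ^ 2))
    by (rewrite RtoC_mult, RtoC_opp; ring).
  rewrite Cexp_RtoC; simpl; ring. }
apply (is_RI_ext _ _ _ Eg) in HL; destruct HL as [I [HI Hlim]].
set (l := Re (LG (RtoC c) 0 0)) in *.
assert (Hsq : l ^ 2 = PI / (4 * c)).
{ assert (L1 : filterlim (fun b => I b ^ 2) (Rbar_locally p_infty) (locally (l ^ 2))).
  { apply (filterlim_comp _ _ _ I (fun x => x ^ 2) _ (locally l)); [exact Hlim|].
    apply (continuous_of_derive (fun x => x ^ 2) l (2 * l)); auto_derive; auto; ring. }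
  assert (L2 : filterlim (fun b => I b ^ 2) (Rbar_locally p_infty) (locally (PI / (4 * c)))).
  { apply filterlim_locally; intros eps.
    assert (He : 0 < eps * c) by (apply Rmult_lt_0_compat; [apply eps|exact Hc]).
    destruct (proj1 (filterlim_locally _ _) (exp_decay_lim c Hc) (mkposreal _ He)) as [B HB].
    exists (Rmax B 1); intros b Hb.
    assert (Hb1 := Rle_lt_trans _ _ _ (Rmax_l _ _) Hb).
    assert (Hb2 := Rle_lt_trans _ _ _ (Rmax_r _ _) Hb).
    specialize (HB b Hb1); change (Rabs (exp (- c * b) - 0) < eps * c) in HB.
    rewrite Rminus_0_r, Rabs_pos_eq in HB by (left; apply exp_pos).
    assert (G := gauss_partial c b Hc ltac:(lra)).
    rewrite (is_RInt_unique _ _ _ _ (HI b ltac:(lra))) in G.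
    assert (exp (- c * b ^ 2) <= exp (- c * b)) by (apply exp_le;
      assert (0 <= c * (b * (b - 1))) by (apply Rmult_le_pos; [lra|nra]); lra).
    change (Rabs (I b ^ 2 - PI / (4 * c)) < eps).
    replace (I b ^ 2 - PI / (4 * c)) with (- ((PI / 4 - c * I b ^ 2) / c)) by (field; lra).
    rewrite Rabs_Ropp, Rabs_pos_eq by (apply Rdiv_le_0_compat; lra).
    apply Rmult_lt_reg_r with c; [exact Hc|].
    replace ((PI / 4 - c * I b ^ 2) / c * c) with (PI / 4 - c * I b ^ 2) by (field; lra); lra. }
  exact (filterlim_locally_unique _ _ _ L1 L2). }
assert (Hl0 : 0 <= l).
{ apply Rnot_lt_le; intros Hneg.
  assert (He : 0 < - l) by lra.
  destruct (proj1 (filterlim_locally _ _) Hlim (mkposreal _ He)) as [B HB].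
  set (b := Rmax B 0 + 1).
  assert (b1 := Rmax_l B 0); assert (b2 := Rmax_r B 0).
  specialize (HB b ltac:(unfold b; lra)); change (Rabs (I b - l) < - l) in HB.
  assert (0 <= I b).
  { rewrite <- (is_RInt_unique _ _ _ _ (HI b ltac:(unfold b; lra))).
    apply RInt_ge_0; [unfold b; lra|eexists; apply HI; unfold b; lra|].
    intros; left; apply exp_pos. }
  apply Rabs_def2 in HB; lra. }
rewrite <- (sqrt_pow2 l Hl0), Hsq.
replace (PI / (4 * c)) with ((/ 2) ^ 2 * (PI / c)) by (field; lra).
rewrite sqrt_mult; [|apply pow2_ge_0|apply Rdiv_le_0_compat; lra].
rewrite sqrt_pow2 by lra; reflexivity.
Qed.

Lemma is_deriveC_LG_im (c : R) (k : nat) (y : R) : 0 < c ->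
  is_deriveC (fun y => LG (RtoC c) k (RtoC y * Ci)%C) y (- (Ci * LG (RtoC c) (S k) (RtoC y * Ci)))%C.
Proof.
intros Hc.
assert (R0 : forall u, Re (RtoC u * Ci) = 0) by (intros; simpl; ring).
apply (is_deriveC_quad _ _ _ (lgM (RtoC c) (S (S k))) 1 Rlt_0_1); [left; apply exp_pos|].
intros h _.
assert (T := LG_taylor (RtoC c) k (RtoC y * Ci)%C (RtoC h * Ci)%C Hc).
replace (RtoC y * Ci + RtoC h * Ci)%C with (RtoC (y + h) * Ci)%C in T by (rewrite RtoC_plus; ring).
rewrite !R0 in T; specialize (T (Rle_refl 0) (Rle_refl 0)).
rewrite Cmod_mult, Cmod_R, Cmod_Ci, Rmult_1_r in T.
match goal with |- Cmod ?x <= _ => match type of T with Cmod ?y <= _ =>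
  replace x with y by ring end end.
apply Rle_trans with (1 := T); right; ring.
Qed.

(** On the imaginary axis the recursion gives the real part [u] the homogeneous equation u' = - (y /
    2c) u. The constant 1 of [LG_rec_0] enters only the equation for the imaginary part, which is
    therefore a Dawson function. *)
Lemma LG_im_Re (c y : R) : 0 < c ->
  Re (LG (RtoC c) 0 (0, y)) = / 2 * sqrt (PI / c) * exp (- (y ^ 2 / (4 * c))).
Proof.
intros Hc.
pose (f := fun y => Re (LG (RtoC c) 0 (RtoC y * Ci)%C) * exp (y ^ 2 / (4 * c))).
assert (Hf : forall x, is_derive f x 0).
{ intros x.
  assert (D := is_deriveC_Re _ _ _ (is_deriveC_LG_im c 0 x Hc)).
  pose (u := fun y : R => Re (LG (RtoC c) 0 (RtoC y * Ci)%C)).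
  change (is_derive u x (Re (- (Ci * LG (RtoC c) 1 (RtoC x * Ci))))) in D.
  assert (R1 := LG_rec_0 (RtoC c) (RtoC x * Ci)%C Hc ltac:(simpl; lra)).
  assert (E : Re (- (Ci * LG (RtoC c) 1 (RtoC x * Ci))) = - (x / (2 * c)) * u x).
  { apply (f_equal Im) in R1; unfold u.
    destruct (LG (RtoC c) 1 (RtoC x * Ci)%C) as [p q], (LG (RtoC c) 0 (RtoC x * Ci)%C) as [r s].
    simpl in R1 |- *.
    apply Rmult_eq_reg_l with (2 * c); [|lra].
    field_simplify; [|lra]; field_simplify in R1; lra. }
  rewrite E in D.
  assert (D2 : is_derive (fun y => exp (y ^ 2 / (4 * c))) x (x / (2 * c) * exp (x ^ 2 / (4 * c)))).
  { auto_derive; [exact I|]; simpl; unfold Rdiv; field; lra. }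
  assert (M := is_derive_mult u _ x _ _ D D2 Rmult_comm).
  change (is_derive f x (- (x / (2 * c)) * u x * exp (x ^ 2 / (4 * c)) + u x * (x / (2 * c) * exp (x ^ 2 / (4 * c))))) in M.
  replace 0 with (- (x / (2 * c)) * u x * exp (x ^ 2 / (4 * c)) + u x * (x / (2 * c) * exp (x ^ 2 / (4 * c)))) by ring.
  exact M. }
assert (E : f y = f 0).
{ destruct (Rtotal_order y 0) as [L|[->|L]]; [|reflexivity|].
  - apply (@eq_is_derive R_NormedModule f); [intros; apply Hf|exact L].
  - symmetry; apply (@eq_is_derive R_NormedModule f); [intros; apply Hf|exact L]. }
unfold f in E.
replace (RtoC y * Ci)%C with ((0, y) : C) in E by (apply C_ext; simpl; ring).
replace (RtoC 0 * Ci)%C with (RtoC 0) in E by ring.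
rewrite (LG_zero_Re c Hc) in E.
replace (0 ^ 2 / (4 * c)) with 0 in E by (field; lra); rewrite exp_0, Rmult_1_r in E.
rewrite <- E, exp_Ropp; field; apply Rgt_not_eq, exp_pos.
Qed.

(** * Values on the imaginary axis: summation by the Fejer kernel *)

Fixpoint rsum (f : nat -> R) (n : nat) : R :=
  match n with O => 0 | S n => rsum f n + f n end.

Lemma rsum_ext (f g : nat -> R) (n : nat) :
  (forall j, (j < n)%nat -> f j = g j) -> rsum f n = rsum g n.
Proof.
induction n as [|n IH]; intros H; simpl; [reflexivity|].
rewrite IH, H; auto; intros; apply H; lia.
Qed.

Lemma rsum_shift (f : nat -> R) (n : nat) : rsum f (S n) = f 0%nat + rsum (fun j => f (S j)) n.
Proof. induction n as [|n IH]; [simpl; ring|]; simpl in *; rewrite IH; ring. Qed.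

Lemma rsum_rev (f : nat -> R) (n : nat) : rsum f n = rsum (fun j => f (n - S j)%nat) n.
Proof.
induction n as [|n IH]; [reflexivity|].
rewrite (rsum_shift (fun j => f (S n - S j)%nat)); cbn [rsum]; rewrite IH, Rplus_comm.
replace (S n - 1)%nat with n by lia; reflexivity.
Qed.

Lemma rsum_scal (c : R) (f : nat -> R) (n : nat) : rsum (fun j => c * f j) n = c * rsum f n.
Proof. induction n as [|n IH]; simpl; [ring|]; rewrite IH; ring. Qed.

Lemma rsum_plus (f g : nat -> R) (n : nat) : rsum (fun j => f j + g j) n = rsum f n + rsum g n.
Proof. induction n as [|n IH]; simpl; [ring|]; rewrite IH; ring. Qed.

Lemma rsum_sum_f_R0 (f : nat -> R) (n : nat) : rsum f (S n) = sum_f_R0 f n.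
Proof. induction n as [|n IH]; simpl in *; [ring|]; rewrite IH; reflexivity. Qed.

(** Dirichlet kernel of period [PI]: the sum of e^(2 i j x) over |j| <= J. [Fej] is the squared
    modulus of the sum over 0 <= j < K, divided by K, so that positivity is built in; by [Fej_Dir]
    it is the mean of the first K Dirichlet kernels. *)
Definition Dir (J : nat) (x : R) : R := 1 + 2 * rsum (fun j => cos (2 * INR (S j) * x)) J.
Definition fcos (K : nat) (x : R) : R := rsum (fun j => cos (2 * INR j * x)) K.
Definition fsin (K : nat) (x : R) : R := rsum (fun j => sin (2 * INR j * x)) K.
Definition Fej (K : nat) (x : R) : R := / INR K * (fcos K x ^ 2 + fsin K x ^ 2).

Lemma Fej_Dir (K : nat) (x : R) : fcos K x ^ 2 + fsin K x ^ 2 = rsum (fun J => Dir J x) K.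
Proof.
induction K as [|K IH]; [unfold fcos, fsin; simpl; ring|].
cbn [rsum]; rewrite <- IH; unfold Dir.
assert (E : fcos K x * cos (2 * INR K * x) + fsin K x * sin (2 * INR K * x)
  = rsum (fun j => cos (2 * INR (S j) * x)) K).
{ rewrite rsum_rev; unfold fcos, fsin.
  rewrite (Rmult_comm _ (cos _)), (Rmult_comm _ (sin _)), <- !rsum_scal, <- rsum_plus.
  apply rsum_ext; intros j Hj.
  rewrite (Rmult_comm (cos (2 * INR K * x))), (Rmult_comm (sin (2 * INR K * x))), <- cos_minus.
  rewrite <- cos_neg; f_equal.
  replace (S (K - S j)) with (K - j)%nat by lia; rewrite minus_INR by lia; ring. }
unfold fcos, fsin in *; cbn [rsum]; fold (fcos K x) (fsin K x) in *.
generalize (sin2_cos2 (2 * INR K * x)); unfold Rsqr; nra.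
Qed.

Lemma Fej_pos (K : nat) (x : R) : 0 <= Fej K x.
Proof.
unfold Fej; apply Rmult_le_pos.
- destruct K; [simpl; rewrite Rinv_0; lra|]; left; apply Rinv_0_lt_compat, lt_0_INR; lia.
- pose proof (pow2_ge_0 (fcos K x)); pose proof (pow2_ge_0 (fsin K x)); lra.
Qed.

(** Multiplication by [2 sin x] telescopes both trigonometric sums. What results is at most 2 in
    absolute value each time, so the squares add up to at most 8, and division by 4 leaves the
    constant 2. *)
Lemma Fej_sin_le (K : nat) (x : R) : (1 <= K)%nat -> Fej K x * sin x ^ 2 <= 2 / INR K.
Proof.
intros HK.
assert (E1 : forall n, 2 * sin x * fcos n x = sin ((2 * INR n - 1) * x) + sin x).
{ induction n as [|n IH].
  - unfold fcos; simpl; replace ((2 * 0 - 1) * x) with (- x) by ring; rewrite sin_neg; ring.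
  - unfold fcos in *; cbn [rsum]; rewrite Rmult_plus_distr_l, IH.
    replace ((2 * INR (S n) - 1) * x) with (2 * INR n * x + x) by (rewrite S_INR; ring).
    replace ((2 * INR n - 1) * x) with (2 * INR n * x - x) by ring.
    rewrite sin_plus, sin_minus; ring. }
assert (E2 : forall n, 2 * sin x * fsin n x = cos x - cos ((2 * INR n - 1) * x)).
{ induction n as [|n IH].
  - unfold fsin; simpl; replace ((2 * 0 - 1) * x) with (- x) by ring; rewrite cos_neg; ring.
  - unfold fsin in *; cbn [rsum]; rewrite Rmult_plus_distr_l, IH.
    replace ((2 * INR (S n) - 1) * x) with (2 * INR n * x + x) by (rewrite S_INR; ring).
    replace ((2 * INR n - 1) * x) with (2 * INR n * x - x) by ring.
    rewrite cos_plus, cos_minus; ring. }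
specialize (E1 K); specialize (E2 K).
set (y := (2 * INR K - 1) * x) in *.
assert (B : (2 * sin x * fcos K x) ^ 2 + (2 * sin x * fsin K x) ^ 2 <= 8).
{ rewrite E1, E2; pose proof (SIN_bound x); pose proof (SIN_bound y);
  pose proof (COS_bound x); pose proof (COS_bound y); nra. }
assert (Hk : 0 < INR K) by (apply lt_0_INR; lia).
unfold Fej; replace (/ INR K * (fcos K x ^ 2 + fsin K x ^ 2) * sin x ^ 2)
  with (((2 * sin x * fcos K x) ^ 2 + (2 * sin x * fsin K x) ^ 2) / 4 / INR K) by (field; lra).
apply Rmult_le_compat_r; [left; apply Rinv_0_lt_compat, Hk|lra].
Qed.

Lemma continuous_rsum (f : nat -> R -> R) (n : nat) (x : R) :
  (forall j, continuous (f j) x) -> continuous (fun x => rsum (fun j => f j x) n) x.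
Proof.
intros H; induction n as [|n IH]; [apply continuous_const|].
apply (continuous_plus (V := R_NormedModule) (fun x => rsum (fun j => f j x) n) (f n)); auto.
Qed.

Lemma Fej_sum (K : nat) (x : R) : Fej K x = / INR K * rsum (fun J => Dir J x) K.
Proof. unfold Fej; rewrite Fej_Dir; reflexivity. Qed.

Lemma Fej_continuous (K : nat) (nu s : R) : continuous (fun s => Fej K (nu * s)) s.
Proof.
apply (continuous_ext (fun s => / INR K * rsum (fun J => Dir J (nu * s)) K)).
{ intros; symmetry; apply Fej_sum. }
apply (continuous_mult (K := R_AbsRing) (fun _ => / INR K)); [apply continuous_const|].
apply (continuous_rsum (fun J s => Dir J (nu * s))); intros J; unfold Dir.
apply (continuous_plus (V := R_NormedModule) (fun _ => 1)); [apply continuous_const|].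
apply (continuous_mult (K := R_AbsRing) (fun _ => 2)); [apply continuous_const|].
apply (continuous_rsum (fun j s => cos (2 * INR (S j) * (nu * s)))); intros j.
apply (@ex_derive_continuous R_AbsRing R_NormedModule); auto_derive; exact I.
Qed.

Lemma is_RInt_zero (a b : R) : is_RInt (fun _ : R => 0) a b 0.
Proof.
generalize (is_RInt_const (V := R_NormedModule) a b 0).
change (@scal R_Ring R_NormedModule (b - a) 0) with ((b - a) * 0); rewrite Rmult_0_r; auto.
Qed.

Lemma is_RInt_rsum (f : nat -> R -> R) (l : nat -> R) (n : nat) (a b : R) :
  (forall j, is_RInt (f j) a b (l j)) -> is_RInt (fun s => rsum (fun j => f j s) n) a b (rsum l n).
Proof.
intros H; induction n as [|n IH]; simpl.
- apply is_RInt_zero.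
- exact (is_RInt_plus (V := R_NormedModule) _ _ _ _ _ _ IH (H n)).
Qed.

Lemma is_RI_rsum (f : nat -> R -> R) (l : nat -> R) (n : nat) :
  (forall j, is_RI (f j) (l j)) -> is_RI (fun s => rsum (fun j => f j s) n) (rsum l n).
Proof.
intros H; induction n as [|n IH]; simpl.
- exists (fun _ => 0); split; [|apply filterlim_const].
  intros b _; apply is_RInt_zero.
- exact (is_RI_plus _ _ _ _ IH (H n)).
Qed.

Lemma is_RI_unique (f : R -> R) (a b : R) : is_RI f a -> is_RI f b -> a = b.
Proof.
intros [I [H1 H2]] [J [G1 G2]].
apply (filterlim_locally_unique (F := Rbar_locally p_infty) I); [exact H2|].
revert G2; apply filterlim_ext_loc; exists 0; intros x Hx.
rewrite <- (is_RInt_unique _ _ _ _ (H1 x ltac:(lra))).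
symmetry; apply is_RInt_unique, G1; lra.
Qed.

(** The endpoint conditions hold at the multiples of half a period, so that whole periods and the
    initial half-period are both covered. *)
Lemma Fej_int (K : nat) (nu a b : R) : (1 <= K)%nat -> 0 < nu ->
  (forall j, sin (2 * INR (S j) * (nu * a)) = 0) ->
  (forall j, sin (2 * INR (S j) * (nu * b)) = 0) ->
  is_RInt (fun s => Fej K (nu * s)) a b (b - a).
Proof.
intros HK Hn Ha Hb.
assert (Hcst : forall u, is_RInt (fun _ => u) a b ((b - a) * u)).
{ intros u; exact (is_RInt_const (V := R_NormedModule) a b u). }
assert (Hcos : forall j, is_RInt (fun s => cos (2 * INR (S j) * (nu * s))) a b 0).
{ intros j; set (k := 2 * INR (S j) * nu).
  assert (Hk : 0 < k) by (unfold k; apply Rmult_lt_0_compat; [|exact Hn];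
    apply Rmult_lt_0_compat; [lra|apply lt_0_INR; lia]).
  replace 0 with (minus (sin (2 * INR (S j) * (nu * b)) / k) (sin (2 * INR (S j) * (nu * a)) / k)).
  2:{ rewrite Ha, Hb; unfold minus, plus, opp; simpl; field; lra. }
  apply (is_RInt_derive (V := R_CompleteNormedModule) (fun s => sin (2 * INR (S j) * (nu * s)) / k)).
  - intros s _; unfold k in *; clear -Hk Hn; revert Hk; generalize (INR (S j)); intros r Hk.
    auto_derive; [exact I|]; field; split; nra.
  - intros s _; apply (@ex_derive_continuous R_AbsRing R_NormedModule); auto_derive; exact I. }
assert (HD : forall J, is_RInt (fun s => Dir J (nu * s)) a b (b - a)).
{ intros J; unfold Dir.
  replace (b - a) with ((b - a) * 1 + 2 * rsum (fun _ => 0) J).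
  - apply (is_RInt_plus (V := R_NormedModule)); [apply Hcst|].
    apply (is_RInt_scal (V := R_NormedModule)).
    apply (is_RInt_rsum (fun j s => cos (2 * INR (S j) * (nu * s)))); exact Hcos.
  - assert (E : forall n, rsum (fun _ => 0) n = 0)
      by (induction n as [|n IH]; simpl; [|rewrite IH]; ring).
    rewrite E; ring. }
apply (is_RInt_ext (fun s => / INR K * rsum (fun J => Dir J (nu * s)) K)).
{ intros; symmetry; apply Fej_sum. }
replace (b - a) with (/ INR K * rsum (fun _ => b - a) K).
- apply (is_RInt_scal (V := R_NormedModule)).
  apply (is_RInt_rsum (fun J s => Dir J (nu * s))); exact HD.
- assert (E : forall n, rsum (fun _ => b - a) n = INR n * (b - a)).
  { induction n as [|n IH]; [simpl; ring|]; cbn [rsum]; rewrite IH, S_INR; ring. }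
  rewrite E; field; apply not_0_INR; lia.
Qed.

(** The sine transform of a Gaussian ([Dw_is_RI]), a rescaled Dawson function. [LG_rec_0] shows its
    decay like [1 / y], too slow for absolute convergence. *)
Definition Dw (c y : R) : R := - Im (LG (RtoC c) 0 (0, y)).

Lemma Dw_is_RI (c y : R) : 0 < c -> is_RI (fun s => exp (- c * s ^ 2) * sin (y * s)) (Dw c y).
Proof.
intros Hc; assert (HL := is_CInt_Im _ _ (LG_correct (RtoC c) 0 (0, y) Hc (Rle_refl 0))).
apply (is_RI_scal (-1)) in HL; unfold Dw; replace (- Im (LG (RtoC c) 0 (0, y)))
  with (-1 * Im (LG (RtoC c) 0 (0, y))) by ring.
revert HL; apply is_RI_ext; intros s; unfold lgf.
replace (- (RtoC c * RtoC (s ^ 2)) - (0, y) * RtoC s)%C with ((- c * s ^ 2, - (y * s)) : C)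
  by (apply C_ext; simpl; ring).
unfold Cexp; simpl; rewrite sin_neg; ring.
Qed.

Lemma Dw_opp (c y : R) : 0 < c -> Dw c (- y) = - Dw c y.
Proof.
intros Hc; apply (is_RI_unique (fun s => exp (- c * s ^ 2) * sin (- y * s))).
- apply Dw_is_RI, Hc.
- generalize (is_RI_scal (-1) _ _ (Dw_is_RI c y Hc)).
  replace (-1 * Dw c y) with (- Dw c y) by ring; apply is_RI_ext; intros s.
  replace (- y * s) with (- (y * s)) by ring; rewrite sin_neg; ring.
Qed.

Lemma Dw_decay (c : R) : 0 < c -> exists K, forall y, 0 < y -> Rabs (Dw c y) <= K / y.
Proof.
intros Hc; exists (1 + 2 * c * lgM (RtoC c) 1); intros y Hy.
assert (R1 := LG_rec_0 (RtoC c) (0, y) Hc (Rle_refl 0)).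
assert (B := LG_bound (RtoC c) 1 (0, y) Hc (Rle_refl 0)).
unfold Dw; rewrite Rabs_Ropp; apply Rle_trans with (1 := Im_le_Cmod _).
assert (Hm : Cmod (0, y) = y).
{ unfold Cmod; simpl; replace (0 * (0 * 1) + y * (y * 1)) with (y ^ 2) by ring; apply sqrt_pow2; lra. }
assert (E : ((0, y) * LG (RtoC c) 0 (0, y)%R = 1 - 2 * RtoC c * LG (RtoC c) 1 (0, y)%R)%C)
  by (rewrite <- R1; ring).
apply (f_equal Cmod) in E; rewrite Cmod_mult, Hm in E.
assert (T := Cmod_triangle_minus 1 (2 * RtoC c * LG (RtoC c) 1 (0, y)%R)).
rewrite <- E, !Cmod_mult, Cmod_1, !Cmod_RtoC_pos in T by lra.
apply Rmult_le_reg_l with y; [exact Hy|].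
replace (y * ((1 + 2 * c * lgM (RtoC c) 1) / y)) with (1 + 2 * c * lgM (RtoC c) 1) by (field; lra).
nra.
Qed.

Section Fejer.

Variables c om nu : R.
Hypothesis Hc : 0 < c.
Hypothesis Hnu : 0 < nu.

Let G (s : R) : R := exp (- c * s ^ 2) * sin (om * s).
Let p := PI / nu.

Let p_pos : 0 < p.
Proof. apply Rdiv_lt_0_compat; [apply PI_RGT_0|exact Hnu]. Qed.

(** Symmetric partial sums over the frequencies [om + 2 j nu], |j| <= J: the integral of [G] against
    the Dirichlet kernel. The averages of these sums are the integrals of [G] against the Fejér
    kernel. *)
Let q (J : nat) : R :=
  Dw c om + rsum (fun j => Dw c (om + 2 * INR (S j) * nu) + Dw c (om - 2 * INR (S j) * nu)) J.

Let G_deriv (s : R) : is_derive G s (exp (- c * s ^ 2) * (om * cos (om * s) - 2 * c * s * sin (om * s))).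
Proof. unfold G; auto_derive; [exact I|simpl; ring]. Qed.

Let G_cont (s : R) : continuous G s.
Proof. apply (continuous_of_derive _ _ _ (G_deriv s)). Qed.

(** Lipschitz constant of [G] beyond [a], up to a factor [exp (- a)]: the derivative of [G] involves
    the Gaussian moments of order 0 and 1, bounded as in [gauss_moment_le]. The decay makes the
    errors of the successive periods summable. *)
Let La : R := Rabs om * exp (INR 1 ^ 2 / (4 * c)) + 2 * c * exp (INR 2 ^ 2 / (4 * c)).

Let La_pos : 0 < La.
Proof.
unfold La; apply Rplus_le_lt_0_compat.
- apply Rmult_le_pos; [apply Rabs_pos|left; apply exp_pos].
- apply Rmult_lt_0_compat; [lra|apply exp_pos].
Qed.

Let G_lip (a s s' : R) : 0 <= a -> a <= s -> a <= s' -> Rabs (G s' - G s) <= La * exp (- a) * Rabs (s' - s).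
Proof.
intros Ha Hs Hs'.
destruct (MVT_gen G s s' (fun s => exp (- c * s ^ 2) * (om * cos (om * s) - 2 * c * s * sin (om * s)))) as [x [Hx E]].
- intros x _; apply G_deriv.
- intros x _; apply continuity_pt_filterlim, G_cont.
- rewrite E, Rabs_mult; apply Rmult_le_compat_r; [apply Rabs_pos|].
  assert (Hax : a <= x) by (apply Rle_trans with (2 := proj1 Hx), Rmin_glb; assumption).
  assert (M0 := gauss_moment_le c 0 x Hc ltac:(lra)).
  assert (M1 := gauss_moment_le c 1 x Hc ltac:(lra)).
  change (0 + 1)%nat with 1%nat in M0; change (1 + 1)%nat with 2%nat in M1.
  rewrite pow_O, Rmult_1_l in M0; rewrite pow_1 in M1.
  assert (Ee : exp (-1 * x) <= exp (- a)) by (apply exp_le; lra).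
  rewrite Rabs_mult, (Rabs_pos_eq (exp _)) by (left; apply exp_pos).
  set (g := exp (- c * x ^ 2)) in *; assert (Hg : 0 < g) by apply exp_pos.
  apply Rle_trans with (g * (Rabs om + 2 * c * x)).
  + apply Rmult_le_compat_l; [lra|].
    unfold Rminus; eapply Rle_trans; [apply Rabs_triang|]; rewrite Rabs_Ropp, !Rabs_mult.
    rewrite (Rabs_pos_eq 2), (Rabs_pos_eq c), (Rabs_pos_eq x) by lra.
    assert (Rabs (cos (om * x)) <= 1) by (apply Rabs_le; apply COS_bound).
    assert (Rabs (sin (om * x)) <= 1) by (apply Rabs_le; apply SIN_bound).
    pose proof (Rabs_pos om); pose proof (Rabs_pos (cos (om * x))); pose proof (Rabs_pos (sin (om * x))).
    apply Rplus_le_compat; [nra|].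
    rewrite <- (Rmult_1_r (2 * c * x)) at 2; apply Rmult_le_compat_l; [|assumption].
    apply Rmult_le_pos; lra.
  + unfold La; set (A := exp (INR 1 ^ 2 / (4 * c))) in *; set (B := exp (INR 2 ^ 2 / (4 * c))) in *.
    assert (HA : 0 < A) by apply exp_pos; assert (HB : 0 < B) by apply exp_pos.
    pose proof (Rabs_pos om).
    assert (A * exp (-1 * x) <= A * exp (- a)) by (apply Rmult_le_compat_l; lra).
    assert (B * exp (-1 * x) <= B * exp (- a)) by (apply Rmult_le_compat_l; lra).
    assert (Rabs om * g <= Rabs om * (A * exp (- a))) by (apply Rmult_le_compat_l; lra).
    assert (2 * c * (x * g) <= 2 * c * (B * exp (- a))) by (apply Rmult_le_compat_l; lra).
    lra.
Qed.

Let Gfej (K : nat) : (1 <= K)%nat ->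
  is_RI (fun s => G s * Fej K (nu * s)) (/ INR K * rsum q K).
Proof.
intros HK.
assert (HD : forall J, is_RI (fun s => G s * Dir J (nu * s)) (q J)).
{ intros J; unfold q, Dir.
  apply (is_RI_ext (fun s => exp (- c * s ^ 2) * sin (om * s)
    + rsum (fun j => exp (- c * s ^ 2) * sin ((om + 2 * INR (S j) * nu) * s)
                   + exp (- c * s ^ 2) * sin ((om - 2 * INR (S j) * nu) * s)) J)).
  { intros s; rewrite Rmult_plus_distr_l, Rmult_1_r; unfold G; f_equal.
    rewrite <- Rmult_assoc, <- rsum_scal; apply rsum_ext; intros j _.
    replace ((om + 2 * INR (S j) * nu) * s) with (om * s + 2 * INR (S j) * (nu * s)) by ring.
    replace ((om - 2 * INR (S j) * nu) * s) with (om * s - 2 * INR (S j) * (nu * s)) by ring.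
    rewrite sin_plus, sin_minus; ring. }
  apply is_RI_plus; [apply Dw_is_RI, Hc|].
  apply (is_RI_rsum (fun j s => exp (- c * s ^ 2) * sin ((om + 2 * INR (S j) * nu) * s)
                   + exp (- c * s ^ 2) * sin ((om - 2 * INR (S j) * nu) * s))).
  intros j; apply is_RI_plus; apply Dw_is_RI, Hc. }
generalize (is_RI_scal (/ INR K) _ _ (is_RI_rsum _ _ K HD)); apply is_RI_ext; intros s.
rewrite Fej_sum, rsum_scal; ring.
Qed.

Let nu_p : nu * p = PI.
Proof. unfold p; field; lra. Qed.

Let sin_half (k : nat) (e : R) (He : e = 1 \/ e = -1) (j : nat) :
  sin (2 * INR (S j) * (nu * (p * INR k + e * (p / 2)))) = 0.
Proof.
replace (2 * INR (S j) * (nu * (p * INR k + e * (p / 2))))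
  with (e * INR (S j) * PI + 2 * INR (S j * k) * PI).
- rewrite sin_period.
  assert (E : sin (INR (S j) * PI) = 0) by (apply sin_eq_0_1; exists (Z.of_nat (S j)); rewrite <- INR_IZR_INZ; reflexivity).
  destruct He as [->| ->].
  + rewrite Rmult_1_l; exact E.
  + replace (-1 * INR (S j) * PI) with (- (INR (S j) * PI)) by ring; rewrite sin_neg, E; ring.
- rewrite mult_INR, <- nu_p; field.
Qed.

(** Within [de] of the node [p k] the Lipschitz bound gives [de] times the kernel. Farther away the
    kernel is at most 2 / (K sin^2 (nu de)) and the distance at most [p / 2]. The exponential is the
    decay factor at [p k - p / 2], the left end of the period. *)
Let pw (K k : nat) (de s : R) : (1 <= K)%nat -> 0 < de <= p / 2 -> 0 <= s -> Rabs (s - p * INR k) <= p / 2 ->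
  Rabs ((G s - G (p * INR k)) * Fej K (nu * s))
  <= La * exp (p / 2 - p * INR k) * (de * Fej K (nu * s) + p / sin (nu * de) ^ 2 / INR K).
Proof.
intros HK Hde Hs Hsk.
assert (Hk0 : 0 < INR K) by (apply lt_0_INR; lia).
assert (Hpk : 0 <= p * INR k) by (apply Rmult_le_pos; [lra|apply pos_INR]).
assert (Habs := Rabs_def2 _ _ (Rle_lt_trans _ _ (p / 2 + p) Hsk ltac:(lra))).
assert (Hsk' := proj1 (Rabs_le_between _ _) Hsk).
assert (HL : Rabs (G s - G (p * INR k)) <= La * exp (p / 2 - p * INR k) * Rabs (s - p * INR k)).
{ set (a := Rmax 0 (p * INR k - p / 2)).
  apply Rle_trans with (La * exp (- a) * Rabs (s - p * INR k)).
  - apply G_lip; unfold a; [apply Rmax_l| |]; apply Rmax_lub; lra.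
  - apply Rmult_le_compat_r; [apply Rabs_pos|]; apply Rmult_le_compat_l; [lra|].
    apply exp_le; unfold a; pose proof (Rmax_r 0 (p * INR k - p / 2)); lra. }
assert (HLe : 0 <= La * exp (p / 2 - p * INR k)) by (apply Rmult_le_pos; [lra|left; apply exp_pos]).
assert (HF := Fej_pos K (nu * s)).
rewrite Rabs_mult, (Rabs_pos_eq (Fej _ _)) by exact HF.
apply Rle_trans with (La * exp (p / 2 - p * INR k) * Rabs (s - p * INR k) * Fej K (nu * s)).
{ apply Rmult_le_compat_r; assumption. }
rewrite Rmult_assoc; apply Rmult_le_compat_l; [exact HLe|].
assert (Hsd : 0 < sin (nu * de)).
{ apply sin_gt_0; [apply Rmult_lt_0_compat; lra|].
  apply Rle_lt_trans with (nu * (p / 2)); [apply Rmult_le_compat_l; lra|].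
  replace (nu * (p / 2)) with (PI / 2) by (rewrite <- nu_p; field); pose proof PI_RGT_0; lra. }
assert (Hsd2 : 0 < sin (nu * de) ^ 2) by (apply pow_lt, Hsd).
assert (Hrest : 0 <= p / sin (nu * de) ^ 2 / INR K).
{ apply Rdiv_le_0_compat; [apply Rdiv_le_0_compat; lra|exact Hk0]. }
destruct (Rle_lt_dec (Rabs (s - p * INR k)) de) as [L|L].
- assert (Rabs (s - p * INR k) * Fej K (nu * s) <= de * Fej K (nu * s)) by (apply Rmult_le_compat_r; assumption).
  lra.
- assert (0 <= de * Fej K (nu * s)) by (apply Rmult_le_pos; lra).
  apply Rle_trans with (p / sin (nu * de) ^ 2 / INR K); [|lra].
  assert (Esin : sin (nu * s) ^ 2 = sin (nu * Rabs (s - p * INR k)) ^ 2).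
  { assert (E1 : sin (nu * Rabs (s - p * INR k)) ^ 2 = sin (nu * (s - p * INR k)) ^ 2).
    { unfold Rabs; destruct (Rcase_abs (s - p * INR k)); [|reflexivity].
      replace (nu * - (s - p * INR k)) with (- (nu * (s - p * INR k))) by ring; rewrite sin_neg; ring. }
    rewrite E1; replace (nu * s) with (nu * (s - p * INR k) + INR k * PI) by (rewrite <- nu_p; ring).
    rewrite sin_plus.
    assert (Es : sin (INR k * PI) = 0) by (apply sin_eq_0_1; exists (Z.of_nat k); rewrite <- INR_IZR_INZ; reflexivity).
    assert (Ec : cos (INR k * PI) ^ 2 = 1) by (generalize (sin2_cos2 (INR k * PI)); unfold Rsqr; rewrite Es; intros; lra).
    rewrite Es; transitivity (sin (nu * (s - p * INR k)) ^ 2 * cos (INR k * PI) ^ 2); [ring|rewrite Ec; ring]. }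
  assert (Hge : sin (nu * de) <= sin (nu * Rabs (s - p * INR k))).
  { assert (Hb : nu * (p / 2) = PI / 2) by (rewrite <- nu_p; field).
    assert (0 < nu * de) by (apply Rmult_lt_0_compat; lra).
    assert (nu * de <= nu * Rabs (s - p * INR k)) by (apply Rmult_le_compat_l; lra).
    assert (nu * Rabs (s - p * INR k) <= nu * (p / 2)) by (apply Rmult_le_compat_l; lra).
    pose proof PI_RGT_0; apply sin_incr_1; lra. }
  assert (Hge2 : sin (nu * de) ^ 2 <= sin (nu * s) ^ 2) by (rewrite Esin; apply pow_incr; lra).
  assert (HFs := Fej_sin_le K (nu * s) HK).
  assert (HF2 : Fej K (nu * s) <= 2 / INR K / sin (nu * de) ^ 2).
  { apply Rmult_le_reg_r with (1 := Hsd2).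
    replace (2 / INR K / sin (nu * de) ^ 2 * sin (nu * de) ^ 2) with (2 / INR K) by (field; lra).
    apply Rle_trans with (2 := HFs); apply Rmult_le_compat_l; assumption. }
  apply Rle_trans with (p / 2 * (2 / INR K / sin (nu * de) ^ 2)); [|right; field; lra].
  apply Rmult_le_compat; [apply Rabs_pos|exact HF|exact Hsk|exact HF2].
Qed.

(** Error on one period, over which the kernel has integral at most [p]. Fixing a small [de]
    controls the first term; a large [K] then controls the second. *)
Let er (K : nat) (de : R) : R := de * p + p * (p / sin (nu * de) ^ 2 / INR K).

Let GF_ex (K : nat) (a b : R) : ex_RInt (fun s => G s * Fej K (nu * s)) a b.
Proof.
apply (@ex_RInt_continuous R_CompleteNormedModule); intros s _.
apply (continuous_mult (K := R_AbsRing) G (fun s => Fej K (nu * s))); [apply G_cont|apply Fej_continuous].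
Qed.

Let piece (K k : nat) (de a b : R) : (1 <= K)%nat -> 0 < de <= p / 2 ->
  0 <= a <= b -> b - a <= p ->
  (forall s, a <= s <= b -> Rabs (s - p * INR k) <= p / 2) ->
  (forall j, sin (2 * INR (S j) * (nu * a)) = 0) ->
  (forall j, sin (2 * INR (S j) * (nu * b)) = 0) ->
  Rabs (RInt (fun s => G s * Fej K (nu * s)) a b - G (p * INR k) * (b - a))
  <= La * exp (p / 2 - p * INR k) * er K de.
Proof.
intros HK Hde Hab Hba Hs Ha Hb.
assert (HFi := Fej_int K nu a b HK Hnu Ha Hb).
assert (HLe : 0 <= La * exp (p / 2 - p * INR k)) by (apply Rmult_le_pos; [lra|left; apply exp_pos]).
set (rr := p / sin (nu * de) ^ 2 / INR K).
assert (Hrr : 0 <= rr).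
{ unfold rr; assert (0 < sin (nu * de)).
  { apply sin_gt_0; [apply Rmult_lt_0_compat; lra|].
    apply Rle_lt_trans with (nu * (p / 2)); [apply Rmult_le_compat_l; lra|].
    replace (nu * (p / 2)) with (PI / 2) by (rewrite <- nu_p; field); pose proof PI_RGT_0; lra. }
  apply Rdiv_le_0_compat; [apply Rdiv_le_0_compat; [lra|apply pow_lt; assumption]|apply lt_0_INR; lia]. }
assert (Hi1 : is_RInt (fun s => (G s - G (p * INR k)) * Fej K (nu * s)) a b
  (RInt (fun s => G s * Fej K (nu * s)) a b - G (p * INR k) * (b - a))).
{ apply (is_RInt_ext (fun s => minus (G s * Fej K (nu * s)) (scal (G (p * INR k)) (Fej K (nu * s))))).
  { intros s _; unfold minus, plus, opp, scal; simpl; unfold mult; simpl; ring. }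
  apply (is_RInt_minus (V := R_NormedModule)).
  - apply (@RInt_correct R_CompleteNormedModule), GF_ex.
  - apply (is_RInt_scal (V := R_NormedModule)), HFi. }
assert (Hi2 : is_RInt (fun s => La * exp (p / 2 - p * INR k) * (de * Fej K (nu * s) + rr)) a b
  (La * exp (p / 2 - p * INR k) * (de * (b - a) + (b - a) * rr))).
{ apply (is_RInt_scal (V := R_NormedModule)).
  apply (is_RInt_plus (V := R_NormedModule)).
  - apply (is_RInt_scal (V := R_NormedModule)), HFi.
  - exact (is_RInt_const (V := R_NormedModule) a b rr). }
apply Rle_trans with (La * exp (p / 2 - p * INR k) * (de * (b - a) + (b - a) * rr)).
- apply (norm_RInt_le (V := R_NormedModule) _ _ a b _ _ (proj2 Hab)) with (3 := Hi2) (2 := Hi1).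
  intros s Hs'; apply (pw K k de s HK Hde); [lra|apply Hs, Hs'].
- apply Rmult_le_compat_l; [exact HLe|]; unfold er; fold rr.
  apply Rplus_le_compat; [apply Rmult_le_compat_l; lra|apply Rmult_le_compat_r; lra].
Qed.

(** The half-line is cut midway between the nodes: a half-period to the right of node 0, then whole
    periods centred at the nodes [p m]. *)
Let partial (K : nat) (de : R) (M : nat) : (1 <= K)%nat -> 0 < de <= p / 2 ->
  Rabs (RInt (fun s => G s * Fej K (nu * s)) 0 (p * INR M + 1 * (p / 2))
        - p * rsum (fun m => G (p * INR (S m))) M)
  <= La * er K de * rsum (fun m => exp (p / 2 - p * INR m)) (S M).
Proof.
intros HK Hde; induction M as [|M IH].
- assert (P := piece K 0 de 0 (p * INR 0 + 1 * (p / 2)) HK Hde).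
  (* Node 0 has only half a period and would enter with half the weight, but [G] vanishes there;
     this is why the sums start at [S m]. *)
  assert (EG : G (p * INR 0) = 0).
  { unfold G; simpl; rewrite !Rmult_0_r, sin_0; ring. }
  rewrite EG, Rmult_0_l in P.
  change (Rabs (RInt (fun s => G s * Fej K (nu * s)) 0 (p * INR 0 + 1 * (p / 2)) - p * 0)
          <= La * er K de * (0 + exp (p / 2 - p * INR 0))).
  replace (p * 0) with 0 by ring.
  eapply Rle_trans; [apply P|right; ring].
  + simpl; lra.
  + simpl; lra.
  + intros s Hs; simpl in *; apply Rabs_le; lra.
  + intros j; rewrite !Rmult_0_r; apply sin_0.
  + intros j; apply sin_half; auto.
- set (b1 := p * INR M + 1 * (p / 2)) in *.
  set (b2 := p * INR (S M) + 1 * (p / 2)).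
  assert (Eb : b1 = p * INR (S M) + -1 * (p / 2)) by (unfold b1; rewrite S_INR; field).
  assert (Hb1 : 0 <= b1).
  { unfold b1; pose proof (pos_INR M); nra. }
  assert (Hb12 : b2 - b1 = p) by (rewrite Eb; unfold b2; field).
  assert (P := piece K (S M) de b1 b2 HK Hde).
  rewrite Hb12 in P.
  assert (P' : Rabs (RInt (fun s => G s * Fej K (nu * s)) b1 b2 - G (p * INR (S M)) * p)
    <= La * exp (p / 2 - p * INR (S M)) * er K de).
  { apply P; try lra.
    - intros s Hs; apply Rabs_le; unfold b2 in Hs; rewrite Eb in Hs; lra.
    - intros j; rewrite Eb; apply sin_half; auto.
    - intros j; unfold b2; apply sin_half; auto. }
  rewrite <- (RInt_Chasles (V := R_CompleteNormedModule) _ 0 b1 b2) by apply GF_ex.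
  change (plus (RInt (fun s => G s * Fej K (nu * s)) 0 b1) (RInt (fun s => G s * Fej K (nu * s)) b1 b2))
    with (RInt (fun s => G s * Fej K (nu * s)) 0 b1 + RInt (fun s => G s * Fej K (nu * s)) b1 b2).
  set (r1 := RInt (fun s => G s * Fej K (nu * s)) 0 b1) in *.
  set (r2 := RInt (fun s => G s * Fej K (nu * s)) b1 b2) in *.
  change (rsum (fun m => G (p * INR (S m))) (S M)) with (rsum (fun m => G (p * INR (S m))) M + G (p * INR (S M))).
  change (rsum (fun m => exp (p / 2 - p * INR m)) (S (S M)))
    with (rsum (fun m => exp (p / 2 - p * INR m)) (S M) + exp (p / 2 - p * INR (S M))).
  replace (r1 + r2 - p * (rsum (fun m => G (p * INR (S m))) M + G (p * INR (S M))))
    with ((r1 - p * rsum (fun m => G (p * INR (S m))) M) + (r2 - G (p * INR (S M)) * p)) by ring.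
  eapply Rle_trans; [apply Rabs_triang|].
  replace (La * er K de * (rsum (fun m => exp (p / 2 - p * INR m)) (S M) + exp (p / 2 - p * INR (S M))))
    with (La * er K de * rsum (fun m => exp (p / 2 - p * INR m)) (S M)
          + La * exp (p / 2 - p * INR (S M)) * er K de) by ring.
  apply Rplus_le_compat; assumption.
Qed.

Let exp_geom (m : nat) : exp (p / 2 - p * INR m) = exp (p / 2) * exp (- p) ^ m.
Proof.
rewrite <- Rpower_pow by apply exp_pos; unfold Rpower; rewrite ln_exp, <- exp_plus; f_equal; ring.
Qed.

Let geom_bound (n : nat) : rsum (fun m => exp (p / 2 - p * INR m)) n <= exp (p / 2) / (1 - exp (- p)).
Proof.
set (r := exp (- p)).
assert (Hr : 0 < r < 1) by (split; [apply exp_pos|unfold r; rewrite <- exp_0; apply exp_increasing; lra]).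
assert (E : rsum (fun m => exp (p / 2 - p * INR m)) n * (1 - r) = exp (p / 2) * (1 - r ^ n)).
{ induction n as [|n IH]; [simpl; ring|].
  cbn [rsum]; rewrite Rmult_plus_distr_r, IH, exp_geom; fold r; simpl; ring. }
apply Rmult_le_reg_r with (1 - r); [lra|]; rewrite E.
replace (exp (p / 2) / (1 - r) * (1 - r)) with (exp (p / 2) * 1) by (field; lra).
apply Rmult_le_compat_l; [left; apply exp_pos|]; pose proof (pow_lt r n (proj1 Hr)); lra.
Qed.

Let ex_G : ex_series (fun m => G (p * INR (S m))).
Proof.
set (r := exp (- p)).
assert (Hr : 0 < r < 1) by (split; [apply exp_pos|unfold r; rewrite <- exp_0; apply exp_increasing; lra]).
apply (@ex_series_le R_AbsRing R_CompleteNormedModule _ (fun m => exp (INR 1 ^ 2 / (4 * c)) * r ^ m)).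
- intros m; change (Rabs (G (p * INR (S m))) <= exp (INR 1 ^ 2 / (4 * c)) * r ^ m).
  set (s := p * INR (S m)).
  assert (Hs : 0 <= s) by (apply Rmult_le_pos; [lra|apply pos_INR]).
  assert (M0 := gauss_moment_le c 0 s Hc Hs); rewrite pow_O, Rmult_1_l in M0.
  change (0 + 1)%nat with 1%nat in M0.
  unfold G; rewrite Rabs_mult, (Rabs_pos_eq (exp _)) by (left; apply exp_pos).
  assert (Rabs (sin (om * s)) <= 1) by (apply Rabs_le, SIN_bound).
  pose proof (exp_pos (- c * s ^ 2)).
  apply Rle_trans with (exp (- c * s ^ 2) * 1); [apply Rmult_le_compat_l; lra|].
  rewrite Rmult_1_r; apply Rle_trans with (1 := M0), Rmult_le_compat_l; [left; apply exp_pos|].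
  unfold r; rewrite <- Rpower_pow by apply exp_pos; unfold Rpower; rewrite ln_exp.
  apply exp_le; unfold s; rewrite S_INR; lra.
- apply (ex_series_scal (V := R_NormedModule) (exp (INR 1 ^ 2 / (4 * c))) (fun m => r ^ m)).
  apply ex_series_geom; rewrite Rabs_pos_eq; lra.
Qed.

Let sigma_bound (K : nat) (de : R) : (1 <= K)%nat -> 0 < de <= p / 2 ->
  Rabs (/ INR K * rsum q K - p * Series (fun m => G (p * INR (S m))))
  <= La * er K de * (exp (p / 2) / (1 - exp (- p))).
Proof.
intros HK Hde.
destruct (Gfej K HK) as [I [HI Hlim]].
set (b := fun M : nat => p * INR M + 1 * (p / 2)).
assert (Hb0 : forall M, 0 <= b M) by (intros M; unfold b; pose proof (pos_INR M); nra).
assert (Hb : is_lim_seq b p_infty).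
{ unfold b; apply is_lim_seq_plus with p_infty (1 * (p / 2)); [|apply is_lim_seq_const|reflexivity].
  replace p_infty with (Rbar_mult p p_infty).
  - apply is_lim_seq_scal_l, is_lim_seq_INR.
  - simpl; destruct (Rle_dec 0 p) as [H|H]; [|lra].
    destruct (Rle_lt_or_eq_dec 0 p H); [reflexivity|lra]. }
assert (L1 : is_lim_seq (fun M => I (b M)) (/ INR K * rsum q K)).
{ exact (filterlim_comp _ _ _ b I _ _ _ Hb Hlim). }
assert (L2 : is_lim_seq (fun M => rsum (fun m => G (p * INR (S m))) M) (Series (fun m => G (p * INR (S m))))).
{ apply is_lim_seq_incr_1.
  apply (is_lim_seq_ext (sum_n (fun m => G (p * INR (S m))))).
  - intros n; rewrite rsum_sum_f_R0, sum_n_Reals; reflexivity.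
  - apply (Series_correct _ ex_G). }
assert (L3 := is_lim_seq_minus' _ _ _ _ L1 (is_lim_seq_scal_l _ p _ L2)).
apply is_lim_seq_abs in L3.
apply (is_lim_seq_le (fun M => Rabs (I (b M) - p * rsum (fun m => G (p * INR (S m))) M))
  (fun _ => La * er K de * (exp (p / 2) / (1 - exp (- p)))) _ (La * er K de * (exp (p / 2) / (1 - exp (- p))))
  ) with (2 := L3).
- intros M; rewrite <- (is_RInt_unique _ _ _ _ (HI (b M) (Hb0 M))).
  apply Rle_trans with (1 := partial K de M HK Hde).
  apply Rmult_le_compat_l; [|apply geom_bound].
  apply Rmult_le_pos; [lra|]; unfold er.
  assert (0 < sin (nu * de)).
  { apply sin_gt_0; [apply Rmult_lt_0_compat; lra|].
    apply Rle_lt_trans with (nu * (p / 2)); [apply Rmult_le_compat_l; lra|].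
    replace (nu * (p / 2)) with (PI / 2) by (rewrite <- nu_p; field); pose proof PI_RGT_0; lra. }
  apply Rplus_le_le_0_compat; apply Rmult_le_pos; try lra.
  apply Rdiv_le_0_compat; [apply Rdiv_le_0_compat; [lra|apply pow_lt; assumption]|apply lt_0_INR; lia].
- apply is_lim_seq_const.
Qed.

(** Poisson summation for the odd function [G], starting from the convergence of the frequency side:
    the Cesàro means have the same limit, and as integrals against Fejér's kernel they concentrate
    at the nodes. *)
Lemma fejer_sum (L : R) : Un_cv q L ->
  is_series (fun m => PI / nu * (exp (- c * (PI / nu * INR (S m)) ^ 2) * sin (om * (PI / nu * INR (S m))))) L.
Proof.
intros HL.
assert (HS := is_series_scal (V := R_NormedModule) p _ _ (Series_correct _ ex_G)).
set (Sg := Series (fun m => G (p * INR (S m)))) in *.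
cut (L = p * Sg); [intros ->; exact HS|].
apply Cesaro_1 in HL.
set (Lt := exp (p / 2) / (1 - exp (- p))).
assert (HLt : 0 < Lt).
{ apply Rdiv_lt_0_compat; [apply exp_pos|].
  assert (exp (- p) < 1) by (rewrite <- exp_0; apply exp_increasing; lra); lra. }
apply Rminus_diag_uniq, Rabs_eq_0.
apply Rle_antisym; [|apply Rabs_pos]; apply Rnot_lt_le; intros Hpos.
set (eta := Rabs (L - p * Sg)) in *.
set (W := La * Lt); assert (HW : 0 < W) by (apply Rmult_lt_0_compat; assumption).
(* Makes the first error term at most [eta / 4]. The second error term and the Cesàro error are then
   brought below [eta / 4] by the choice of [K], and three quarters of [eta] cannot bound [eta]. *)
set (de := Rmin (p / 2) (eta / (4 * (W * p)))).
assert (HWp : 0 < W * p) by (apply Rmult_lt_0_compat; assumption).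
assert (Hde : 0 < de <= p / 2).
{ split; [apply Rmin_glb_lt; [lra|apply Rdiv_lt_0_compat; lra]|apply Rmin_l]. }
assert (Hde2 : W * p * de <= eta / 4).
{ apply Rle_trans with (W * p * (eta / (4 * (W * p)))); [apply Rmult_le_compat_l; [lra|apply Rmin_r]|].
  right; field; lra. }
set (A := W * p * (p / sin (nu * de) ^ 2)).
destruct (HL (eta / 4) ltac:(lra)) as [N1 HN1].
destruct (INR_unbounded (4 * A / eta)) as [N2 HN2].
set (K := (N1 + N2 + 1)%nat).
assert (HK : (1 <= K)%nat) by (unfold K; lia).
assert (HKr : 0 < INR K) by (apply lt_0_INR; lia).
specialize (HN1 K ltac:(unfold K; lia)).
assert (HN2' : 4 * A / eta < INR K) by (apply Rlt_le_trans with (1 := HN2), le_INR; unfold K; lia).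
assert (HA : A / INR K < eta / 4).
{ apply Rmult_lt_compat_r with (r := eta) in HN2'; [|exact Hpos].
  replace (4 * A / eta * eta) with (4 * A) in HN2' by (field; lra).
  apply Rmult_lt_reg_r with (INR K); [exact HKr|].
  replace (A / INR K * INR K) with A by (field; lra); lra. }
assert (B := sigma_bound K de HK Hde); fold Sg Lt in B.
replace (La * er K de * Lt) with (W * p * de + A / INR K) in B
  by (unfold er, A, W; unfold Rdiv; ring).
unfold R_dist, Rdist in HN1.
replace (sum_f_R0 q (pred K) / INR K) with (/ INR K * rsum q K) in HN1.
2:{ destruct K as [|K']; [lia|]; rewrite rsum_sum_f_R0; simpl pred; unfold Rdiv; ring. }
assert (T := Rabs_triang (/ INR K * rsum q K - p * Sg) (L - / INR K * rsum q K)).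
replace (/ INR K * rsum q K - p * Sg + (L - / INR K * rsum q K)) with (L - p * Sg) in T by ring.
rewrite (Rabs_minus_sym L (/ INR K * rsum q K)) in T; fold eta in T; lra.
Qed.

End Fejer.

(** On the imaginary axis the real part of each transform is even and the imaginary part odd, so
    [sg] appears in the second formula only: the two lateral values are complex conjugates. *)
Lemma Sfun_imag (c al N Y sg : R) : 0 < c -> 0 < al < N -> 0 < Y -> sg = 1 \/ sg = -1 ->
  Re (Sfun c al N (0, sg * Y))
  = / 2 * sqrt (PI / c) * Series (fun k => exp (- (nk al N k ^ 2 * Y ^ 2 / (4 * c)))
                                         - exp (- (nk (N - al) N k ^ 2 * Y ^ 2 / (4 * c)))) /\
  Im (Sfun c al N (0, sg * Y))
  = - sg * (2 * PI / (N * Y)) * Series (fun m => exp (- (c * (2 * PI * INR (S m) / (N * Y)) ^ 2))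
       * sin (2 * PI * INR (S m) * al / N)).
Proof.
intros Hc Ha HY Hsg.
set (w := (0, sg * Y) : C).
assert (Hsg2 : sg * sg = 1) by (destruct Hsg; subst; ring).
assert (Hw0 : w <> 0%C).
{ intros E; apply (f_equal Im) in E; unfold w in E; simpl in E.
  apply Rmult_integral in E; destruct E as [E|E]; [rewrite E in Hsg2; lra|lra]. }
destruct (Sfun_series c al N Hc Ha w (Rle_refl 0) Hw0) as [S1 S2].
assert (Ew : forall n, (RtoC n * w)%C = (0, n * (sg * Y))) by (intros n; unfold w; apply C_ext; simpl; ring).
split.
- rewrite <- Series_scal_l; symmetry; apply is_series_unique.
  revert S1; apply is_series_ext; intros k.
  change (Re (LG (RtoC c) 0 (RtoC (nk al N k) * w)) - Re (LG (RtoC c) 0 (RtoC (nk (N - al) N k) * w)) =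
    / 2 * sqrt (PI / c) * (exp (- (nk al N k ^ 2 * Y ^ 2 / (4 * c))) - exp (- (nk (N - al) N k ^ 2 * Y ^ 2 / (4 * c))))).
  rewrite !Ew, !LG_im_Re by exact Hc.
  assert (Es : forall n, (n * (sg * Y)) ^ 2 = n ^ 2 * Y ^ 2)
    by (intros n; replace ((n * (sg * Y)) ^ 2) with (n ^ 2 * Y ^ 2 * (sg * sg)) by ring; rewrite Hsg2; ring).
  rewrite !Es; ring.
- set (ss := Im (Sfun c al N w)) in *.
  assert (Hodd : forall y, Im (LG (RtoC c) 0 (0, sg * y)) = - sg * Dw c y).
  { intros y; replace (Im (LG (RtoC c) 0 (0, sg * y))) with (- Dw c (sg * y)) by (unfold Dw; ring).
    destruct Hsg; subst sg.
    - rewrite Rmult_1_l; ring.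
    - replace (-1 * y) with (- y) by ring; rewrite Dw_opp by exact Hc; ring. }
  assert (SD : is_series (fun k => Dw c (nk al N k * Y) - Dw c (nk (N - al) N k * Y)) (- sg * ss)).
  { generalize (is_series_scal (V := R_NormedModule) (- sg) _ _ S2); apply is_series_ext; intros k.
    change (- sg * (Im (LG (RtoC c) 0 (RtoC (nk al N k) * w)) - Im (LG (RtoC c) 0 (RtoC (nk (N - al) N k) * w)))
      = Dw c (nk al N k * Y) - Dw c (nk (N - al) N k * Y)).
    rewrite !Ew.
    replace (nk al N k * (sg * Y)) with (sg * (nk al N k * Y)) by ring.
    replace (nk (N - al) N k * (sg * Y)) with (sg * (nk (N - al) N k * Y)) by ring.
    rewrite !Hodd.
    transitivity ((sg * sg) * (Dw c (nk al N k * Y) - Dw c (nk (N - al) N k * Y))); [ring|rewrite Hsg2; ring]. }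
  (* Matches the frequencies to the pairs: [om + 2 (j + 1) nu] is [nk al N (j + 1) * Y], while
     [om - 2 (j + 1) nu] is minus [nk (N - al) N j * Y], which the oddness of [Dw] turns into the
     subtracted member of a pair. *)
  set (om := al * Y); set (nu := N * Y / 2).
  assert (Hnu : 0 < nu) by (unfold nu; assert (0 < N * Y) by (apply Rmult_lt_0_compat; lra); lra).
  assert (Hq : Un_cv (fun J => Dw c om + rsum (fun j => Dw c (om + 2 * INR (S j) * nu)
      + Dw c (om - 2 * INR (S j) * nu)) J) (- sg * ss)).
  { apply is_lim_seq_Reals.
    (* The symmetric sum up to [J] consists of [J] complete pairs and one unpaired term, which tends
       to 0 by [Dw_decay]. *)
    apply (is_lim_seq_ext (fun J => rsum (fun k => Dw c (nk al N k * Y) - Dw c (nk (N - al) N k * Y)) J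
       + Dw c (nk al N J * Y))).
    { induction n as [|n IH].
      - simpl; unfold nk, om; simpl; rewrite Rmult_0_r, !Rplus_0_r; ring.
      - cbn [rsum].
        replace (om + 2 * INR (S n) * nu) with (nk al N (S n) * Y) by (unfold om, nu, nk; field).
        replace (om - 2 * INR (S n) * nu) with (- (nk (N - al) N n * Y))
          by (unfold om, nu, nk; rewrite S_INR; field).
        rewrite Dw_opp by exact Hc; lra. }
    replace (- sg * ss) with (- sg * ss + 0) by ring; apply is_lim_seq_plus'.
    - apply is_lim_seq_incr_1.
      apply (is_lim_seq_ext (sum_n (fun k => Dw c (nk al N k * Y) - Dw c (nk (N - al) N k * Y)))); [|exact SD].
      intros n; rewrite rsum_sum_f_R0, sum_n_Reals; reflexivity.
    - destruct (Dw_decay c Hc) as [K HK].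
      assert (HnY : forall J, 0 < nk al N J * Y) by (intros J; apply Rmult_lt_0_compat; [apply nk_pos; lra|lra]).
      apply is_lim_seq_abs_0.
      apply (is_lim_seq_le_le (fun _ => 0) _ (fun J => K / (nk al N J * Y))).
      + intros J; split; [apply Rabs_pos|apply HK, HnY].
      + apply is_lim_seq_const.
      + replace 0 with (K * 0) by ring; apply (is_lim_seq_scal_l (fun J => / (nk al N J * Y)) K 0).
        apply (is_lim_seq_inv _ p_infty); [|discriminate].
        apply (is_lim_seq_ext (fun J => N * Y * INR J + al * Y)); [intros J; unfold nk; ring|].
        apply is_lim_seq_plus with p_infty (al * Y); [|apply is_lim_seq_const|reflexivity].
        replace p_infty with (Rbar_mult (N * Y) p_infty).
        * apply is_lim_seq_scal_l, is_lim_seq_INR.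
        * assert (HNY : 0 < N * Y) by (apply Rmult_lt_0_compat; lra).
          simpl; destruct (Rle_dec 0 (N * Y)) as [H|H]; [|lra].
          destruct (Rle_lt_or_eq_dec 0 (N * Y) H); [reflexivity|lra]. }
  assert (F := fejer_sum c om nu Hc Hnu _ Hq).
  assert (F2 : is_series (fun m => 2 * PI / (N * Y) * (exp (- (c * (2 * PI * INR (S m) / (N * Y)) ^ 2))
       * sin (2 * PI * INR (S m) * al / N))) (- sg * ss)).
  { revert F; apply is_series_ext; intros m.
    assert (E1 : PI / nu = 2 * PI / (N * Y)) by (unfold nu; field; split; lra).
    rewrite E1; f_equal; f_equal; f_equal.
    - replace (2 * PI * INR (S m) / (N * Y)) with (2 * PI / (N * Y) * INR (S m)) by (field; split; lra); ring.
    - unfold om; field; split; lra. }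
  apply is_series_unique in F2; rewrite Series_scal_l in F2.
  rewrite Rmult_assoc, F2.
  transitivity ((sg * sg) * ss); [rewrite Hsg2; ring|ring].
Qed.

(** * False theta series as sums over pairs *)

Lemma is_lim_seq_rsum (a : nat -> R) (l : R) : is_series a l <-> is_lim_seq (rsum a) l.
Proof.
split; intros H.
- apply is_lim_seq_incr_1; apply (is_lim_seq_ext (sum_n a)); [|exact H].
  intros n; rewrite rsum_sum_f_R0, sum_n_Reals; reflexivity.
- apply is_lim_seq_incr_1 in H; revert H; apply is_lim_seq_ext.
  intros n; rewrite rsum_sum_f_R0, sum_n_Reals; reflexivity.
Qed.

Lemma rsum_add (a : nat -> R) (m n : nat) : rsum a (m + n) = rsum a m + rsum (fun i => a (m + i)%nat) n.
Proof.
induction n as [|n IH]; [rewrite Nat.add_0_r; simpl; ring|].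
rewrite Nat.add_succ_r; cbn [rsum]; rewrite IH; ring.
Qed.

Lemma is_series_regroup (a : nat -> R) (l : R) (d : nat) : (0 < d)%nat ->
  is_series a l -> is_series (fun k => rsum (fun i => a (d * k + i)%nat) d) l.
Proof.
intros Hd H; apply is_lim_seq_rsum in H; apply is_lim_seq_rsum.
apply (is_lim_seq_ext (fun n => rsum a (d * n))).
- induction n as [|n IH]; [rewrite Nat.mul_0_r; reflexivity|].
  replace (d * S n)%nat with (d * n + d)%nat by lia.
  rewrite rsum_add; cbn [rsum]; rewrite IH; reflexivity.
- apply (is_lim_seq_subseq (rsum a) l (fun n => d * n)%nat); [|exact H].
  apply eventually_subseq; intros n; lia.
Qed.

Lemma rsum_zero (f : nat -> R) (n : nat) : (forall k, (k < n)%nat -> f k = 0) -> rsum f n = 0.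
Proof.
induction n as [|n IH]; intros H; simpl; [reflexivity|].
rewrite IH, H by (auto; intros; apply H; lia); ring.
Qed.

Lemma rsum_one (f : nat -> R) (n i : nat) : (i < n)%nat ->
  (forall k, (k < n)%nat -> k <> i -> f k = 0) -> rsum f n = f i.
Proof.
induction n as [|n IH]; intros Hi H; [lia|]; simpl.
destruct (Nat.eq_dec i n) as [->|E].
- rewrite rsum_zero; [ring|]; intros k Hk; apply H; lia.
- rewrite IH, (H n) by (try lia; intros; apply H; lia); ring.
Qed.

Lemma rsum_two (f : nat -> R) (n i j : nat) : (i < n)%nat -> (j < n)%nat -> i <> j ->
  (forall k, (k < n)%nat -> k <> i -> k <> j -> f k = 0) -> rsum f n = f i + f j.
Proof.
intros Hi Hj Hij H.
rewrite (rsum_ext f (fun k => (if Nat.eq_dec k i then f i else 0) + (if Nat.eq_dec k j then f j else 0))).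
- rewrite rsum_plus, (rsum_one (fun k => if Nat.eq_dec k i then f i else 0) n i),
    (rsum_one (fun k => if Nat.eq_dec k j then f j else 0) n j); auto.
  + destruct (Nat.eq_dec i i), (Nat.eq_dec j j); congruence.
  + intros k _ Hk; destruct (Nat.eq_dec k j); [contradiction|reflexivity].
  + intros k _ Hk; destruct (Nat.eq_dec k i); [contradiction|reflexivity].
- intros k Hk; destruct (Nat.eq_dec k i) as [E1|E1], (Nat.eq_dec k j) as [E2|E2].
  + congruence.
  + rewrite E1; ring.
  + rewrite E2; ring.
  + rewrite H by assumption; ring.
Qed.

(** For [a = m] the residues [a] and [- a] coincide modulo [2 m] and the first test of [psi] decides
    for both, so oddness fails there. *)
Lemma psi_opp (m a : Z) (n : nat) : (0 < m)%Z -> (0 < a < 2 * m)%Z -> a <> m ->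
  psi m (- a) n = (- psi m a n)%Z.
Proof.
intros Hm Ha Ham; unfold psi.
replace (Z.of_nat n - - a)%Z with (Z.of_nat n + a)%Z by ring.
replace (Z.of_nat n + - a)%Z with (Z.of_nat n - a)%Z by ring.
destruct (Z.eqb_spec ((Z.of_nat n - a) mod (2 * m)) 0) as [E1|E1],
  (Z.eqb_spec ((Z.of_nat n + a) mod (2 * m)) 0) as [E2|E2]; try reflexivity.
exfalso.
apply Z.mod_divide in E1; [|lia]; apply Z.mod_divide in E2; [|lia].
destruct E1 as [u Hu], E2 as [v Hv].
assert (E : (a = (v - u) * m)%Z) by lia.
assert (v - u = 1)%Z by nia; nia.
Qed.

Lemma psi_periodic (m a : Z) (n k : nat) : (0 < m)%Z ->
  psi m a (Z.to_nat (2 * m) * k + n) = psi m a n.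
Proof.
intros Hm; unfold psi.
assert (E : Z.of_nat (Z.to_nat (2 * m) * k + n) = (Z.of_nat n + Z.of_nat k * (2 * m))%Z) by nia.
rewrite E.
replace (Z.of_nat n + Z.of_nat k * (2 * m) - a)%Z with ((Z.of_nat n - a) + Z.of_nat k * (2 * m))%Z by ring.
replace (Z.of_nat n + Z.of_nat k * (2 * m) + a)%Z with ((Z.of_nat n + a) + Z.of_nat k * (2 * m))%Z by ring.
rewrite !Z.mod_add by lia; reflexivity.
Qed.

Lemma psi_0 (m a : Z) : (0 < m)%Z -> (0 < a < 2 * m)%Z -> psi m a 0 = 0%Z.
Proof.
intros Hm Ha; unfold psi; simpl Z.of_nat.
destruct (Z.eqb_spec ((0 - a) mod (2 * m)) 0) as [E1|_].
{ apply Z.mod_divide in E1; [|lia]; destruct E1 as [u Hu]; assert (u = 0 \/ u <= -1 \/ 1 <= u)%Z by lia; nia. }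
destruct (Z.eqb_spec ((0 + a) mod (2 * m)) 0) as [E1|_]; [|reflexivity].
apply Z.mod_divide in E1; [|lia]; destruct E1 as [u Hu]; assert (u = 0 \/ u <= -1 \/ 1 <= u)%Z by lia; nia.
Qed.

Lemma Rpower_exp (x y : R) : Rpower (exp x) y = exp (y * x).
Proof. unfold Rpower; rewrite ln_exp; reflexivity. Qed.

Lemma Psi_series (m a : Z) (E : R) : (0 < m)%Z -> 0 < E ->
  is_series (fun n => IZR (psi m a n) * exp (- (E * INR n ^ 2 / (4 * IZR m)))) (Psi m a (exp (- E))).
Proof.
intros Hm HE.
assert (Hx : 0 < exp (- E) < 1).
{ split; [apply exp_pos|rewrite <- exp_0; apply exp_increasing; lra]. }
generalize (Series_correct _ (ex_Psi m a (exp (- E)) Hm Hx)); apply is_series_ext; intros n.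
change (IZR (psi m a n) * Rpower (exp (- E)) (INR n ^ 2 / (4 * IZR m))
  = IZR (psi m a n) * exp (- (E * INR n ^ 2 / (4 * IZR m)))).
rewrite Rpower_exp; f_equal; f_equal; unfold Rdiv; ring.
Qed.

Lemma Psi_opp (m a : Z) (E : R) : (0 < m)%Z -> (0 < a < 2 * m)%Z -> a <> m -> 0 < E ->
  Psi m (- a) (exp (- E)) = - Psi m a (exp (- E)).
Proof.
intros Hm Ha Ham HE; rewrite <- (is_series_unique _ _ (Psi_series m (- a) E Hm HE)).
apply is_series_unique.
generalize (is_series_opp (V := R_NormedModule) _ _ (Psi_series m a E Hm HE)); apply is_series_ext; intros n.
rewrite psi_opp by assumption; rewrite opp_IZR.
change (- (IZR (psi m a n) * exp (- (E * INR n ^ 2 / (4 * IZR m))))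
   = - IZR (psi m a n) * exp (- (E * INR n ^ 2 / (4 * IZR m)))); ring.
Qed.

(** A period of length [2 m] holds exactly two nonzero coefficients, +1 at [a] and -1 at [2 m - a].
    Regrouped by periods, the series runs over a pair of progressions of the kind summed in
    [Sfun]. *)
Lemma Psi_pairs (m a : Z) (E : R) : (0 < m)%Z -> (0 < a < 2 * m)%Z -> a <> m -> 0 < E ->
  Series (fun k => exp (- (E * nk (IZR a) (2 * IZR m) k ^ 2 / (4 * IZR m)))
                 - exp (- (E * nk (2 * IZR m - IZR a) (2 * IZR m) k ^ 2 / (4 * IZR m))))
  = Psi m a (exp (- E)).
Proof.
intros Hm Ha Ham HE; apply is_series_unique.
set (d := Z.to_nat (2 * m)); set (i := Z.to_nat a); set (j := Z.to_nat (2 * m - a)).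
assert (Hd : (0 < d)%nat) by (unfold d; lia).
generalize (is_series_regroup _ _ d Hd (Psi_series m a E Hm HE)); apply is_series_ext; intros k.
rewrite (rsum_two _ d i j); try (unfold d, i, j; lia).
- unfold d at 1 4; rewrite !psi_periodic by exact Hm; fold d.
  assert (Pi : psi m a i = 1%Z).
  { unfold psi, i; rewrite Z2Nat.id by lia; rewrite Z.sub_diag, Z.mod_0_l by lia; reflexivity. }
  assert (Pj : psi m a j = (-1)%Z).
  { unfold psi, j; rewrite Z2Nat.id by lia.
    destruct (Z.eqb_spec ((2 * m - a - a) mod (2 * m)) 0) as [E1|_].
    - exfalso; apply Z.mod_divide in E1; [|lia]; destruct E1 as [u Hu].
      assert (u <= -1 \/ u = 0 \/ 1 <= u)%Z as [|[|]] by lia; nia.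
    - replace (2 * m - a + a)%Z with (1 * (2 * m))%Z by ring; rewrite Z.mod_mul by lia; reflexivity. }
  rewrite Pi, Pj.
  assert (Ei : INR (d * k + i) = nk (IZR a) (2 * IZR m) k).
  { unfold nk; rewrite plus_INR, mult_INR; unfold d, i; rewrite !INR_IZR_INZ, !Z2Nat.id by lia.
    rewrite mult_IZR; ring. }
  assert (Ej : INR (d * k + j) = nk (2 * IZR m - IZR a) (2 * IZR m) k).
  { unfold nk; rewrite plus_INR, mult_INR; unfold d, j; rewrite !INR_IZR_INZ, !Z2Nat.id by lia.
    rewrite minus_IZR, mult_IZR; ring. }
  rewrite Ei, Ej; match goal with |- ?x = ?y => change (@eq R x y) end; ring.
- intros n Hn Hni Hnj; unfold d at 1; rewrite psi_periodic by exact Hm.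
  replace (psi m a n) with 0%Z; [ring|]; symmetry; unfold psi.
  destruct (Z.eqb_spec ((Z.of_nat n - a) mod (2 * m)) 0) as [E1|_].
  { exfalso; apply Z.mod_divide in E1; [|lia]; destruct E1 as [u Hu].
    unfold d, i, j in *; assert (u <= -1 \/ u = 0 \/ 1 <= u)%Z as [|[|]] by lia; nia. }
  destruct (Z.eqb_spec ((Z.of_nat n + a) mod (2 * m)) 0) as [E1|_]; [|reflexivity].
  exfalso; apply Z.mod_divide in E1; [|lia]; destruct E1 as [u Hu].
  unfold d, i, j in *; assert (u <= 0 \/ u = 1 \/ 2 <= u)%Z as [|[|]] by lia; nia.
Qed.

Lemma is_series_shift0 (a : nat -> R) (l : R) : a 0%nat = 0 ->
  is_series a l -> is_series (fun n => a (S n)) l.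
Proof.
intros H0 H; apply is_lim_seq_rsum in H; apply is_lim_seq_rsum.
apply is_lim_seq_incr_1 in H; revert H; apply is_lim_seq_ext; intros n.
rewrite rsum_shift, H0; ring.
Qed.

Local Open Scope bool_scope.

(** * The finite Fourier transform of the coefficients *)

(** For [n] prime to 6 this is the sign of [cos (PI n / 6)], that is, the Kronecker symbol (12 /
    n). *)
Definition chi12 (n : nat) : Z :=
  if (n mod 12 =? 1)%nat || (n mod 12 =? 11)%nat then 1%Z else (-1)%Z.

Definition parity_sign (n : nat) : Z := if Nat.even n then 1%Z else (-1)%Z.

(** The first line lists the frequencies at which one of the three factors in [four_sines] vanishes;
    every component must then have coefficient 0. *)
Definition dual_null (p n : nat) : bool :=
  (Nat.even n || (n mod 3 =? 0)%nat || (n mod p =? 0)%nat)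
  && forallb (fun k => (phi_coef p k n =? 0)%Z) (seq 1 (ell p)).

(* For n coprime to 6p there is exactly one component k of the vector with a
   nonzero coefficient at n, and n = e (6k - p) mod 2p. *)
Definition dual_unit (p n : nat) : bool :=
  negb (Nat.even n) && negb (n mod 3 =? 0)%nat
  && existsb (fun k => existsb (fun e =>
       ((Z.of_nat n - e * (6 * Z.of_nat k - Z.of_nat p)) mod (2 * Z.of_nat p) =? 0)%Z
       && (phi_coef p k n =? e * chi12 n * parity_sign (k + (p + 3) / 6))%Z
       && ((e =? 1)%Z || (e =? -1)%Z)
       && forallb (fun k' => (k' =? k)%nat || (phi_coef p k' n =? 0)%Z) (seq 1 (ell p)))
       [1%Z; (-1)%Z]) (seq 1 (ell p)).

(** The coefficients and all the signs involved have period [12 p] in [n], so a finite computation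
    settles every frequency. *)
Definition dual_check (p : nat) : bool :=
  forallb (fun n => dual_null p n || dual_unit p n) (seq 0 (12 * p)).

Lemma dual_check_5 : dual_check 5 = true. Proof. vm_compute; reflexivity. Qed.
Lemma dual_check_7 : dual_check 7 = true. Proof. vm_compute; reflexivity. Qed.
Lemma dual_check_11 : dual_check 11 = true. Proof. vm_compute; reflexivity. Qed.

Lemma phi_coef_periodic (p k n q : nat) : (0 < p)%nat ->
  phi_coef p k (12 * p * q + n) = phi_coef p k n.
Proof.
intros Hp; unfold phi_coef.
replace (12 * p * q + n)%nat with (Z.to_nat (2 * (6 * Z.of_nat p)) * q + n)%nat
  by (f_equal; f_equal; lia).
rewrite !psi_periodic by lia; reflexivity.
Qed.

Lemma IZR_parity_sign (n : nat) : IZR (parity_sign n) = (-1) ^ n.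
Proof.
unfold parity_sign; destruct (Nat.even n) eqn:E.
- apply Nat.even_spec in E; destruct E as [k ->]; rewrite pow_1_even; reflexivity.
- assert (O : Nat.odd n = true) by (unfold Nat.odd; rewrite E; reflexivity).
  apply Nat.odd_spec in O; destruct O as [k ->].
  replace (2 * k + 1)%nat with (S (2 * k)) by lia; rewrite pow_1_odd; reflexivity.
Qed.

Lemma sin_INR_PI (n : nat) : sin (INR n * PI) = 0.
Proof. apply sin_eq_0_1; exists (Z.of_nat n); rewrite <- INR_IZR_INZ; reflexivity. Qed.

Lemma cos_INR_PI (n : nat) : cos (INR n * PI) = (-1) ^ n.
Proof.
induction n as [|n IH]; [simpl; rewrite Rmult_0_l; apply cos_0|].
replace (INR (S n) * PI) with (INR n * PI + PI) by (rewrite S_INR; ring).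
rewrite neg_cos, IH; simpl; ring.
Qed.

Lemma sin_IZR_period (x : R) (z : Z) : sin (x + IZR z * (2 * PI)) = sin x.
Proof.
destruct (Z_le_gt_dec 0 z) as [L|L].
- rewrite <- (Z2Nat.id z L), <- INR_IZR_INZ.
  rewrite <- (sin_period x (Z.to_nat z)); f_equal; ring.
- set (n := Z.to_nat (- z)).
  assert (E : IZR z = - INR n) by (unfold n; rewrite INR_IZR_INZ, Z2Nat.id, opp_IZR by lia; ring).
  rewrite <- (sin_period (x + IZR z * (2 * PI)) n), E; f_equal; ring.
Qed.

Lemma cos_chi12 (n : nat) : Nat.even n = false -> (n mod 3 <> 0)%nat ->
  cos (PI * INR n / 6) = IZR (chi12 n) * (sqrt 3 / 2).
Proof.
intros He H3; unfold chi12.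
assert (O : Nat.odd n = true) by (unfold Nat.odd; rewrite He; reflexivity).
apply Nat.odd_spec in O; destruct O as [i Hi].
set (r := (n mod 12)%nat); set (q := (n / 12)%nat).
assert (En : n = (12 * q + r)%nat) by (apply Nat.div_mod; lia).
assert (Hr : (r < 12)%nat) by (apply Nat.mod_upper_bound; lia).
assert (Er : (r = 1 \/ r = 5 \/ r = 7 \/ r = 11)%nat).
{ assert (A : forall m, (r <> 3 * m)%nat).
  { intros m Hm; apply H3; rewrite En, Hm.
    replace (12 * q + 3 * m)%nat with ((4 * q + m) * 3)%nat by lia; apply Nat.Div0.mod_mul. }
  assert (A0 := A 0%nat); assert (A1 := A 1%nat); assert (A2 := A 2%nat); assert (A3 := A 3%nat); lia. }
replace (PI * INR n / 6) with (PI * INR r / 6 + 2 * INR q * PI).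
2:{ rewrite En, plus_INR, mult_INR; simpl; field. }
rewrite cos_period; clearbody r.
destruct Er as [->|[->|[->| ->]]]; simpl (_ =? _)%nat; simpl orb; simpl INR.
- replace (PI * 1 / 6) with (PI / 6) by field; rewrite cos_PI6; simpl; ring.
- replace (PI * (1 + 1 + 1 + 1 + 1) / 6) with (- (PI / 6) + PI) by field.
  rewrite neg_cos, cos_neg, cos_PI6; simpl; ring.
- replace (PI * (1 + 1 + 1 + 1 + 1 + 1 + 1) / 6) with (PI / 6 + PI) by field.
  rewrite neg_cos, cos_PI6; simpl; ring.
- replace (PI * (1 + 1 + 1 + 1 + 1 + 1 + 1 + 1 + 1 + 1 + 1) / 6) with (- (PI / 6) + 2 * INR 1 * PI)
    by (simpl; field).
  rewrite cos_period, cos_neg, cos_PI6; simpl; ring.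
Qed.

(** With [x = PI j n / p] and [y = PI n / 6] the angles are [x - y], [x + y] and the reflections
    [n PI - (x - y)], [n PI - (x + y)]. The product form isolates three factors: they vanish for odd
    multiples of 3, for even [n] and for multiples of [p]. *)
Lemma four_sines (p j n : nat) : (0 < p)%nat ->
  sin (PI * INR n * (6 * INR j - INR p) / (6 * INR p))
  + sin (PI * INR n * (7 * INR p - 6 * INR j) / (6 * INR p))
  + sin (PI * INR n * (6 * INR j + INR p) / (6 * INR p))
  + sin (PI * INR n * (5 * INR p - 6 * INR j) / (6 * INR p))
  = 2 * cos (PI * INR n / 6) * (1 - (-1) ^ n) * sin (PI * INR j * INR n / INR p).
Proof.
intros Hp; assert (Hp0 : INR p <> 0) by (apply not_0_INR; lia).
set (x := PI * INR j * INR n / INR p); set (y := PI * INR n / 6).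
replace (PI * INR n * (6 * INR j - INR p) / (6 * INR p)) with (x - y) by (unfold x, y; field; exact Hp0).
replace (PI * INR n * (6 * INR j + INR p) / (6 * INR p)) with (x + y) by (unfold x, y; field; exact Hp0).
replace (PI * INR n * (7 * INR p - 6 * INR j) / (6 * INR p)) with (INR n * PI - (x - y))
  by (unfold x, y; field; exact Hp0).
replace (PI * INR n * (5 * INR p - 6 * INR j) / (6 * INR p)) with (INR n * PI - (x + y))
  by (unfold x, y; field; exact Hp0).
rewrite !(sin_minus (INR n * PI)), sin_INR_PI, cos_INR_PI, sin_minus, sin_plus; ring.
Qed.

(** If [n] is divisible by 2, 3 or [p], both sides vanish; otherwise a single component contributes
    on the right, with the sign recorded in [dual_unit]. This identity is the source of the matrix
    in the law: it carries the sine coefficients of the four residues to the coefficient vector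
    itself. *)
Lemma trig_dual (p j n : nat) : (0 < p)%nat -> dual_check p = true ->
  sin (PI * INR n * (6 * INR j - INR p) / (6 * INR p))
  + sin (PI * INR n * (7 * INR p - 6 * INR j) / (6 * INR p))
  + sin (PI * INR n * (6 * INR j + INR p) / (6 * INR p))
  + sin (PI * INR n * (5 * INR p - 6 * INR j) / (6 * INR p))
  = sqrt 3 * sqrt (INR p) * rsum (fun i => Mmat p j (S i) * IZR (phi_coef p (S i) n)) (ell p).
Proof.
intros Hp Hck; rewrite four_sines by exact Hp.
assert (Hp0 : 0 < INR p) by (apply lt_0_INR; exact Hp).
set (r := (n mod (12 * p))%nat); set (q := (n / (12 * p))%nat).
assert (En : n = (12 * p * q + r)%nat) by (apply Nat.div_mod; lia).
assert (Hr : (r < 12 * p)%nat) by (apply Nat.mod_upper_bound; lia).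
assert (Eph : forall k, phi_coef p k n = phi_coef p k r).
{ intros k; rewrite En; apply phi_coef_periodic, Hp. }
assert (Hc : (dual_null p r || dual_unit p r)%bool = true).
{ unfold dual_check in Hck; rewrite forallb_forall in Hck; apply Hck, in_seq; lia. }
assert (Epow : (-1) ^ n = (-1) ^ r).
{ rewrite En, pow_add.
  replace (12 * p * q)%nat with (2 * (6 * p * q))%nat by lia; rewrite pow_1_even; ring. }
apply orb_true_iff in Hc; destruct Hc as [Hc|Hc].
- unfold dual_null in Hc; apply andb_true_iff in Hc; destruct Hc as [Hc1 Hc2].
  rewrite forallb_forall in Hc2.
  rewrite rsum_zero.
  2:{ intros i Hi; rewrite Eph.
      assert (Z0 : phi_coef p (S i) r = 0%Z) by (apply Z.eqb_eq, Hc2, in_seq; lia).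
      rewrite Z0; ring. }
  rewrite Rmult_0_r.
  apply orb_true_iff in Hc1; destruct Hc1 as [Hc1|Hc1]; [apply orb_true_iff in Hc1; destruct Hc1 as [Hc1|Hc1]|].
  + assert (E1 : (-1) ^ n = 1).
    { rewrite Epow; apply Nat.even_spec in Hc1; destruct Hc1 as [i ->]; apply pow_1_even. }
    rewrite E1; ring.
  + destruct (Nat.Even_Odd_dec n) as [[i Ei]|[i Ei]].
    { rewrite Ei at 2; rewrite pow_1_even; ring. }
    apply Nat.eqb_eq in Hc1.
    assert (E3 : exists i', n = (3 * (2 * i' + 1))%nat).
    { apply Nat.Lcm0.mod_divide in Hc1; destruct Hc1 as [u Hu].
      assert (E3 : exists v, n = (3 * v)%nat) by (exists (4 * p * q + u)%nat; lia).
      destruct E3 as [v Hv]; exists (v / 2)%nat.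
      assert (D := Nat.div_mod v 2 ltac:(lia)); assert (v mod 2 < 2)%nat by (apply Nat.mod_upper_bound; lia); lia. }
    destruct E3 as [i' E3].
    assert (Ec : cos (PI * INR n / 6) = 0).
    { replace (PI * INR n / 6) with (INR i' * PI + PI / 2).
      - rewrite cos_plus, cos_PI2, sin_INR_PI; ring.
      - rewrite E3, !mult_INR, plus_INR, mult_INR; simpl; field. }
    rewrite Ec; ring.
  + apply Nat.eqb_eq in Hc1; apply Nat.Lcm0.mod_divide in Hc1; destruct Hc1 as [u Hu].
    assert (Es : sin (PI * INR j * INR n / INR p) = 0).
    { replace (PI * INR j * INR n / INR p) with (INR (j * (12 * q + u)) * PI); [apply sin_INR_PI|].
      replace n with (p * (12 * q + u))%nat by lia; rewrite !mult_INR; field; lra. }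
    rewrite Es; ring.
- unfold dual_unit in Hc; apply andb_true_iff in Hc; destruct Hc as [Hc Hex].
  apply andb_true_iff in Hc; destruct Hc as [Hodd H3].
  apply negb_true_iff in Hodd; apply negb_true_iff, Nat.eqb_neq in H3.
  apply existsb_exists in Hex; destruct Hex as [k [Hk Hex]].
  apply existsb_exists in Hex; destruct Hex as [e [_ Hex]].
  apply andb_true_iff in Hex; destruct Hex as [Hex Hoth].
  apply andb_true_iff in Hex; destruct Hex as [Hex He].
  apply andb_true_iff in Hex; destruct Hex as [Hmod Hval].
  apply in_seq in Hk; apply Z.eqb_eq in Hval; apply Z.eqb_eq in Hmod.
  rewrite forallb_forall in Hoth.
  apply Z.mod_divide in Hmod; [|lia]; destruct Hmod as [z Hz].
  rewrite (rsum_one _ (ell p) (k - 1)); [|lia|].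
  2:{ intros i Hi Hne; rewrite Eph.
      assert (A : ((S i =? k)%nat || (phi_coef p (S i) r =? 0)%Z)%bool = true) by (apply Hoth, in_seq; lia).
      apply orb_true_iff in A; destruct A as [A|A]; [apply Nat.eqb_eq in A; lia|].
      apply Z.eqb_eq in A; rewrite A; ring. }
  replace (S (k - 1)) with k by lia.
  rewrite Eph, Hval, !mult_IZR, IZR_parity_sign.
  assert (Hcos : cos (PI * INR n / 6) = IZR (chi12 r) * (sqrt 3 / 2)).
  { rewrite <- cos_chi12 by assumption.
    replace (PI * INR n / 6) with (PI * INR r / 6 + 2 * INR (p * q) * PI); [apply cos_period|].
    rewrite En, plus_INR, !mult_INR; simpl; field. }
  assert (Hp1 : (-1) ^ n = -1).
  { rewrite Epow; assert (O : Nat.odd r = true) by (unfold Nat.odd; rewrite Hodd; reflexivity).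
    apply Nat.odd_spec in O; destruct O as [i ->].
    replace (2 * i + 1)%nat with (S (2 * i)) by lia; apply pow_1_odd. }
  (* The congruence n = e (6 k - p) modulo 2 p turns the angle PI j n / p into e (6 PI j k / p - j
     PI) up to full turns, which is the angle in [Mmat] apart from the sign [(-1) ^ j]. *)
  assert (Hsin : sin (PI * INR j * INR n / INR p) = IZR e * ((-1) ^ j * sin (6 * PI * INR j * INR k / INR p))).
  { assert (Er : INR r = IZR e * (6 * INR k - INR p) + 2 * INR p * IZR z).
    { rewrite !INR_IZR_INZ.
      replace (6 * IZR (Z.of_nat k) - IZR (Z.of_nat p)) with (IZR (6 * Z.of_nat k - Z.of_nat p))
        by (rewrite minus_IZR, mult_IZR; reflexivity).
      replace (2 * IZR (Z.of_nat p)) with (IZR (2 * Z.of_nat p)) by (rewrite mult_IZR; reflexivity).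
      rewrite <- !mult_IZR, <- plus_IZR; f_equal; lia. }
    replace (PI * INR j * INR n / INR p) with
      (IZR e * (6 * PI * INR j * INR k / INR p - INR j * PI)
        + IZR (Z.of_nat j * z + 6 * Z.of_nat (j * q)) * (2 * PI)).
    2:{ rewrite En, plus_INR, Er, plus_IZR, !mult_IZR, <- !INR_IZR_INZ, !mult_INR; simpl; field; lra. }
    rewrite sin_IZR_period.
    assert (Eb : sin (6 * PI * INR j * INR k / INR p - INR j * PI)
      = (-1) ^ j * sin (6 * PI * INR j * INR k / INR p))
      by (rewrite sin_minus, sin_INR_PI, cos_INR_PI; ring).
    apply orb_true_iff in He; destruct He as [He|He]; apply Z.eqb_eq in He; subst e.
    - rewrite !Rmult_1_l; exact Eb.
    - replace (-1 * (6 * PI * INR j * INR k / INR p - INR j * PI))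
        with (- (6 * PI * INR j * INR k / INR p - INR j * PI)) by ring.
      rewrite sin_neg, Eb; ring. }
  rewrite Hcos, Hp1, Hsin; unfold Mmat.
  set (f := ((p + 3) / 6)%nat).
  assert (Esq : (-1) ^ (k + f) * (-1) ^ (k + f) = 1).
  { rewrite <- pow_add; replace (k + f + (k + f))%nat with (2 * (k + f))%nat by lia; apply pow_1_even. }
  replace (j + k + f)%nat with (j + (k + f))%nat by lia; rewrite pow_add.
  assert (Hsp : 0 < sqrt (INR p)) by (apply sqrt_lt_R0, Hp0).
  set (sn := sin (6 * PI * INR j * INR k / INR p)).
  transitivity (2 * sqrt 3 * IZR e * IZR (chi12 r) * (-1) ^ j * sn * ((-1) ^ (k + f) * (-1) ^ (k + f))).
  + rewrite Esq; field.
  + field; lra.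
Qed.

(** * Continuation of the Mordell integrals *)

(** The plane slit along the closed negative axis. On all of it [Csqrt] is the principal branch,
    with values in the right half-plane where [Sfun] is holomorphic; so composition with [Csqrt]
    performs the continuation from either side. *)
Definition off_cut (t : C) : Prop := 0 < Re t \/ Im t <> 0.

Lemma off_cut_Re (t : C) : off_cut t -> 0 < Cmod t + Re t.
Proof.
intros [H|H]; [pose proof (Cmod_ge_0 t); lra|].
assert (E := Cmod2_alt t).
assert (0 < Im t ^ 2) by (rewrite <- pow2_abs; apply pow_lt, Rabs_pos_lt, H).
pose proof (Cmod_ge_0 t); pose proof (re_le_Cmod t) as A; apply Rabs_le_between in A.
assert (- Cmod t <> Re t); [|lra].
intros E2; rewrite <- E2 in E; nra.
Qed.

Lemma Csqrt_Re (t : C) : off_cut t -> 0 < Re (Csqrt t).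
Proof. intros H; simpl; apply sqrt_lt_R0; assert (P := off_cut_Re t H); lra. Qed.

Lemma Csqrt_sqr (t : C) : off_cut t -> (Csqrt t * Csqrt t)%C = t.
Proof.
intros H; assert (P := off_cut_Re t H).
assert (Hm : 0 <= Cmod t - Re t).
{ pose proof (re_le_Cmod t) as A; apply Rabs_le_between in A; lra. }
assert (E := Cmod2_alt t).
set (u := sqrt ((Cmod t + Re t) / 2)); set (v := sqrt ((Cmod t - Re t) / 2)).
assert (Hu : u * u = (Cmod t + Re t) / 2) by (apply sqrt_sqrt; lra).
assert (Hv : v * v = (Cmod t - Re t) / 2) by (apply sqrt_sqrt; lra).
assert (Huv : u * v = Rabs (Im t) / 2).
{ unfold u, v; rewrite <- sqrt_mult by lra.
  replace ((Cmod t + Re t) / 2 * ((Cmod t - Re t) / 2)) with ((Rabs (Im t) / 2) ^ 2).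
  - apply sqrt_pow2; pose proof (Rabs_pos (Im t)); lra.
  - replace ((Rabs (Im t) / 2) ^ 2) with (Rabs (Im t) ^ 2 / 4) by field; rewrite pow2_abs; nra. }
assert (Hsg : sign (Im t) * Rabs (Im t) = Im t).
{ destruct (Rtotal_order (Im t) 0) as [L|[L|L]].
  - rewrite sign_eq_m1, Rabs_left by exact L; ring.
  - rewrite L, Rabs_R0; ring.
  - rewrite sign_eq_1, Rabs_pos_eq by lra; ring. }
assert (Hv2 : sign (Im t) * sign (Im t) * (v * v) = v * v).
{ destruct (Req_dec (Im t) 0) as [E0|E0].
  - destruct H as [H|H]; [|contradiction].
    rewrite E0 in E.
    assert (Cmod t = Re t) by (pose proof (Cmod_ge_0 t); nra).
    rewrite Hv; replace (Cmod t - Re t) with 0 by lra; field.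
  - destruct (Rtotal_order (Im t) 0) as [L|[L|L]]; [rewrite sign_eq_m1 by exact L|contradiction|rewrite sign_eq_1 by exact L]; ring. }
apply C_ext; unfold Csqrt; fold u v; simpl.
- replace (u * u - sign (Im t) * v * (sign (Im t) * v)) with (u * u - sign (Im t) * sign (Im t) * (v * v)) by ring.
  rewrite Hv2, Hu, Hv; field.
- replace (u * (sign (Im t) * v) + sign (Im t) * v * u) with (2 * sign (Im t) * (u * v)) by ring.
  rewrite Huv; lra.
Qed.

Lemma Csqrt_neq_0 (t : C) : off_cut t -> Csqrt t <> 0%C.
Proof. intros H E; assert (P := Csqrt_Re t H); rewrite E in P; simpl in P; lra. Qed.

Lemma sq_unique (u v : C) : 0 < Re u -> 0 < Re v -> (u * u)%C = (v * v)%C -> u = v.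
Proof.
intros Hu Hv E.
assert (E2 : ((u - v) * (u + v))%C = 0%C).
{ replace ((u - v) * (u + v))%C with (u * u - v * v)%C by ring; rewrite E; ring. }
apply (f_equal Cmod) in E2; rewrite Cmod_mult, Cmod_0 in E2.
apply Rmult_integral in E2; destruct E2 as [E2|E2]; apply Cmod_eq_0 in E2.
- replace u with ((u - v) + v)%C by ring; rewrite E2; ring.
- exfalso; apply (f_equal Re) in E2; simpl in E2; unfold Re in *; lra.
Qed.

Lemma Csqrt_scal (k : R) (t : C) : 0 < k -> 0 < Re t ->
  Csqrt (RtoC k * t) = (RtoC (sqrt k) * Csqrt t)%C.
Proof.
intros Hk Ht.
assert (Ho : off_cut t) by (left; exact Ht).
assert (Hok : off_cut (RtoC k * t)) by (left; rewrite Re_scal; apply Rmult_lt_0_compat; assumption).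
apply sq_unique.
- apply Csqrt_Re, Hok.
- rewrite Re_scal; apply Rmult_lt_0_compat; [apply sqrt_lt_R0, Hk|apply Csqrt_Re, Ho].
- rewrite Csqrt_sqr by exact Hok.
  replace (RtoC (sqrt k) * Csqrt t * (RtoC (sqrt k) * Csqrt t))%C
    with (RtoC (sqrt k) * RtoC (sqrt k) * (Csqrt t * Csqrt t))%C by ring.
  rewrite Csqrt_sqr, <- RtoC_mult, sqrt_sqrt by (assumption || lra); reflexivity.
Qed.

Lemma off_cut_open (t : C) : off_cut t -> exists d, 0 < d /\ forall h, Cmod h < d -> off_cut (t + h).
Proof.
intros [H|H].
- exists (Re t); split; [exact H|]; intros h Hh; left.
  replace (Re (t + h)) with (Re t + Re h) by reflexivity.
  pose proof (re_le_Cmod h) as A; apply Rabs_le_between in A; lra.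
- exists (Rabs (Im t)); split; [apply Rabs_pos_lt, H|]; intros h Hh; right.
  replace (Im (t + h)) with (Im t + Im h) by reflexivity.
  intros E; assert (E2 : Im h = - Im t) by lra.
  pose proof (Im_le_Cmod h) as A; rewrite E2, Rabs_Ropp in A; lra.
Qed.

(** From h = (w1 - w0) (w1 + w0), where w1 + w0 has real part at least [rho], the increment of the
    root is at most |h| / rho; the Taylor remainder is exactly - (w1 - w0)^2 / (2 w0). *)
Lemma Csqrt_holomorphic (t : C) : off_cut t -> holomorphic_at Csqrt t.
Proof.
intros H; exists (/ (2 * Csqrt t))%C.
destruct (off_cut_open t H) as [d [Hd Ho]].
assert (Hr := Csqrt_Re t H); assert (Hw0 := Csqrt_neq_0 t H).
set (w0 := Csqrt t) in *; set (rho := Re w0) in *.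
assert (Hm0 : rho <= Cmod w0) by (pose proof (re_le_Cmod w0); pose proof (Rle_abs (Re w0)); unfold rho; lra).
assert (H2 : (2 * w0)%C <> 0%C) by (apply Cmult_neq_0; [apply RtoC_neq_0; lra|exact Hw0]).
apply (is_Cderive_quad _ _ _ (/ (rho ^ 2 * (2 * rho))) d Hd); intros h Hh.
specialize (Ho h Hh); assert (Hr1 := Csqrt_Re _ Ho); assert (E1 := Csqrt_sqr _ Ho).
assert (E0 := Csqrt_sqr _ H); fold w0 in E0 |- *; set (w1 := Csqrt (t + h)%C) in *.
assert (Eh : h = ((w1 - w0) * (w1 + w0))%C).
{ replace ((w1 - w0) * (w1 + w0))%C with (w1 * w1 - w0 * w0)%C by ring; rewrite E1, E0; ring. }
assert (Hs : rho <= Cmod (w1 + w0)).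
{ apply Rle_trans with (Re (w1 + w0)).
  - replace (Re (w1 + w0)) with (Re w1 + Re w0) by reflexivity; unfold rho; lra.
  - pose proof (re_le_Cmod (w1 + w0)); pose proof (Rle_abs (Re (w1 + w0))); lra. }
assert (Hd1 : Cmod (w1 - w0) * rho <= Cmod h).
{ rewrite Eh, Cmod_mult; apply Rmult_le_compat_l; [apply Cmod_ge_0|exact Hs]. }
replace (w1 - w0 - h * / (2 * w0))%C with (- ((w1 - w0) * (w1 - w0) * / (2 * w0)))%C
  by (rewrite Eh at 1; field; exact Hw0).
rewrite Cmod_opp, !Cmod_mult, Cmod_inv, Cmod_mult, (Cmod_RtoC_pos 2) by (assumption || lra).
assert (Hx := Cmod_ge_0 (w1 - w0)); set (x := Cmod (w1 - w0)) in *; set (y := Cmod h) in *.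
apply Rle_trans with (x * x * / (2 * rho)).
- apply Rmult_le_compat_l; [nra|]; apply Rinv_le_contravar; lra.
- replace (/ (rho ^ 2 * (2 * rho)) * y ^ 2) with ((y * / rho) * (y * / rho) * / (2 * rho)) by (field; lra).
  apply Rmult_le_compat_r; [left; apply Rinv_0_lt_compat; lra|].
  assert (Hxy : x <= y * / rho).
  { apply Rmult_le_reg_r with rho; [exact Hr|]; rewrite Rmult_assoc, Rinv_l by lra; lra. }
  apply Rmult_le_compat; assumption.
Qed.

Lemma Csqrt_lateral (s : side) (t : R) : t < 0 ->
  filterlim (fun e : R => Csqrt (t, sgn s * e)) (at_right 0)
    (@locally C_UniformSpace (0, sgn s * sqrt (- t))).
Proof.
intros Ht.
assert (Hsg : forall e, 0 < e -> sign (sgn s * e) = sgn s).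
{ intros e He; destruct s; simpl; [apply sign_eq_1|apply sign_eq_m1]; lra. }
assert (Hs2 : sgn s * sgn s = 1) by (destruct s; simpl; ring).
pose (m := fun e => sqrt (t ^ 2 + e ^ 2)).
assert (Hm : forall e, Cmod (t, sgn s * e) = m e).
{ intros e; unfold Cmod, m; cbn [fst snd]; f_equal.
  replace ((sgn s * e) ^ 2) with (sgn s * sgn s * e ^ 2) by ring; rewrite Hs2; ring. }
assert (Cm : filterlim m (at_right 0) (locally (- t))).
{ apply (filterlim_filter_le_1 (F := locally 0) (G := at_right 0) m).
  - intros P [d Hd]; exists d; intros y Hy _; apply Hd, Hy.
  - replace (- t) with (m 0).
    + apply (continuous_comp (fun e => t ^ 2 + e ^ 2) sqrt).
      * apply (@ex_derive_continuous R_AbsRing R_NormedModule); auto_derive; exact I.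
      * apply continuous_sqrt.
    + unfold m; replace (t ^ 2 + 0 ^ 2) with ((- t) ^ 2) by ring; apply sqrt_pow2; lra. }
assert (C1 : filterlim (fun e => sqrt ((m e + t) / 2)) (at_right 0) (locally 0)).
{ replace 0 with (sqrt ((- t + t) / 2)) at 2.
  - apply (filterlim_comp _ _ _ m (fun x => sqrt ((x + t) / 2)) _ (locally (- t))); [exact Cm|].
    apply (continuous_comp (fun x => (x + t) / 2) sqrt).
    + apply (@ex_derive_continuous R_AbsRing R_NormedModule); auto_derive; exact I.
    + apply continuous_sqrt.
  - replace ((- t + t) / 2) with 0 by field; apply sqrt_0. }
assert (C2 : filterlim (fun e => sgn s * sqrt ((m e - t) / 2)) (at_right 0) (locally (sgn s * sqrt (- t)))).
{ replace (- t) with ((- t - t) / 2) by field.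
  apply (filterlim_comp _ _ _ m (fun x => sgn s * sqrt ((x - t) / 2)) _ (locally (- t))); [exact Cm|].
  apply (continuous_mult (K := R_AbsRing) (fun _ => sgn s) (fun x => sqrt ((x - t) / 2)) (- t));
    [apply continuous_const|].
  apply (continuous_comp (fun x => (x - t) / 2) sqrt).
  - apply (@ex_derive_continuous R_AbsRing R_NormedModule); auto_derive; exact I.
  - apply continuous_sqrt. }
apply filterlim_C_Cmod; [apply at_right_proper_filter|intros eps].
assert (He : 0 < eps / 2) by (generalize (cond_pos eps); lra).
assert (G1 := proj1 (filterlim_locally _ _) C1 (mkposreal _ He)).
assert (G2 := proj1 (filterlim_locally _ _) C2 (mkposreal _ He)).
assert (G3 : at_right 0 (fun e => 0 < e)).
{ exists (mkposreal 1 Rlt_0_1); intros y _ Hy; exact Hy. }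
generalize (filter_and _ _ G3 (filter_and _ _ G1 G2)); apply filter_imp; intros e [He0 [A B]].
apply Rle_lt_trans with (1 := Cmod_le_ReIm _).
change (Rabs (sqrt ((m e + t) / 2) - 0) < eps / 2) in A.
change (Rabs (sgn s * sqrt ((m e - t) / 2) - sgn s * sqrt (- t)) < eps / 2) in B.
unfold Csqrt; rewrite Hm; cbn [Re Im fst snd]; rewrite Hsg by exact He0.
change (Rabs (sqrt ((m e + t) / 2) - 0) + Rabs (sgn s * sqrt ((m e - t) / 2) - sgn s * sqrt (- t)) < eps).
lra.
Qed.

(** A Mordell integral divided by [t] is S / w, that is, [Fmor]. In [calL] the square root in front
    cancels the 1 / w, so orders 5, 7, 11 continue [Smor] and order 3 continues [Fmor]. *)
Definition Smor (c al N : R) (t : C) : C := Sfun c al N (Csqrt t).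
Definition Fmor (c al N : R) (t : C) : C := (/ Csqrt t * Smor c al N t)%C.

Lemma lateral_off_cut (s : side) (t : C) : 0 < Re t \/ 0 < sgn s * Im t -> off_cut t.
Proof.
intros [H|H]; [left; exact H|right]; intros E; rewrite E, Rmult_0_r in H; lra.
Qed.

Lemma Smor_holomorphic (c al N : R) (t : C) : 0 < c -> 0 < al < N -> off_cut t ->
  holomorphic_at (Smor c al N) t.
Proof.
intros Hc Ha Ht; apply (holomorphic_comp (Sfun c al N) Csqrt).
- apply Sfun_holomorphic; [exact Hc|exact Ha|apply Csqrt_Re, Ht].
- apply Csqrt_holomorphic, Ht.
Qed.

Lemma Fmor_holomorphic (c al N : R) (t : C) : 0 < c -> 0 < al < N -> off_cut t ->
  holomorphic_at (Fmor c al N) t.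
Proof.
intros Hc Ha Ht; apply (holomorphic_mult (fun t => / Csqrt t)%C (Smor c al N)).
- apply (holomorphic_comp Cinv Csqrt); [apply holomorphic_inv, Csqrt_neq_0, Ht|apply Csqrt_holomorphic, Ht].
- apply Smor_holomorphic; assumption.
Qed.

Lemma Smor_lateral (s : side) (c al N t : R) : 0 < c -> 0 < al < N -> t < 0 ->
  filterlim (fun e : R => Smor c al N (t, sgn s * e)) (at_right 0)
    (@locally C_UniformSpace (Sfun c al N (0, sgn s * sqrt (- t)))).
Proof.
intros Hc Ha Ht; apply Sfun_filterlim; auto.
- apply at_right_proper_filter.
- intros e; simpl; apply sqrt_pos.
- apply Rle_refl.
- assert (0 < sqrt (- t)) by (apply sqrt_lt_R0; lra).
  intros E; apply (f_equal Im) in E; simpl in E; destruct s; simpl in E; lra.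
- apply Csqrt_lateral, Ht.
Qed.

Lemma Fmor_lateral (s : side) (c al N t : R) : 0 < c -> 0 < al < N -> t < 0 ->
  filterlim (fun e : R => Fmor c al N (t, sgn s * e)) (at_right 0)
    (@locally C_UniformSpace (/ (0, sgn s * sqrt (- t))%R * Sfun c al N (0, sgn s * sqrt (- t))%R)%C).
Proof.
intros Hc Ha Ht.
apply (filterlim_Cmult (at_right 0) (fun e => / Csqrt (t, (sgn s * e)%R))%C
  (fun e => Smor c al N (t, sgn s * e))).
- apply (filterlim_comp _ _ _ (fun e : R => Csqrt (t, sgn s * e)) Cinv _
    (@locally C_UniformSpace (0, sgn s * sqrt (- t)))); [apply Csqrt_lateral, Ht|].
  apply holomorphic_at_continuous, holomorphic_inv.
  assert (0 < sqrt (- t)) by (apply sqrt_lt_R0; lra).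
  intros E; apply (f_equal Im) in E; simpl in E; destruct s; simpl in E; lra.
- apply Smor_lateral; assumption.
Qed.

Lemma Fmor_mordell (c al N : R) (t : C) (g : R -> R) : 0 < c -> 0 < al < N -> 0 < Re t ->
  (forall u, 0 < u -> g u = hfun al N u) ->
  (/ t * CInt0oo (fun u => Cexp (- RtoC (c * u ^ 2) / t) * RtoC (g u))%C)%C = Fmor c al N t.
Proof.
intros Hc Ha Ht Hg.
assert (Ho : off_cut t) by (left; exact Ht).
assert (M := mordell_int c al N t (Csqrt t) Hc Ha Ht (Csqrt_Re t Ho) (Csqrt_sqr t Ho)).
rewrite (is_CInt_CInt0oo _ (Csqrt t * Sfun c al N (Csqrt t))%C).
- unfold Fmor, Smor; rewrite <- (Csqrt_sqr t Ho) at 1; field; apply Csqrt_neq_0, Ho.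
- revert M; apply is_CInt_ext; intros u Hu; rewrite Hg by exact Hu; reflexivity.
Qed.

Lemma JS_Fmor (P a : R) (t : C) : 0 < a < 2 * P -> 0 < Re t -> JS P a t = Fmor P a (2 * P) t.
Proof.
intros Ha Ht; unfold JS; apply (Fmor_mordell P a (2 * P) t); try assumption; [lra|].
intros u _; unfold hfun; replace (2 * P / 2) with P by field; reflexivity.
Qed.

Lemma W3_Fmor (t : C) : 0 < Re t -> W3 t = Fmor 3 2 6 t.
Proof.
intros Ht; unfold W3; apply (Fmor_mordell 3 2 6 t (fun x => sinh x / sinh (3 * x))); try lra.
intros u _; unfold hfun; replace ((6 / 2 - 2) * u) with u by field;
  replace (6 / 2 * u) with (3 * u) by field; reflexivity.
Qed.

(** Multiplying numerator and denominator by [2 sinh (3 u)] gives (sinh 4u + sinh 2u) / sinh 6u; the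
    kernel of [W2] thus splits into two of the standard form with [N = 12]. The proof compares
    polynomials in e^u and its inverse. *)
Lemma cosh_ratio (u : R) : 0 < u -> cosh u / cosh (3 * u) = hfun 2 12 u + hfun 4 12 u.
Proof.
intros Hu; unfold hfun.
replace ((12 / 2 - 2) * u) with (4 * u) by field; replace ((12 / 2 - 4) * u) with (2 * u) by field.
replace (12 / 2 * u) with (6 * u) by field.
assert (H6 := sinh_pos (6 * u) ltac:(lra)).
assert (H3 : 0 < cosh (3 * u)) by (unfold cosh; pose proof (exp_pos (3 * u)); pose proof (exp_pos (- (3 * u))); lra).
apply Rmult_eq_reg_r with (cosh (3 * u) * sinh (6 * u)); [|apply Rgt_not_eq, Rmult_lt_0_compat; assumption].
replace (cosh u / cosh (3 * u) * (cosh (3 * u) * sinh (6 * u))) with (cosh u * sinh (6 * u)) by (field; lra).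
replace ((sinh (4 * u) / sinh (6 * u) + sinh (2 * u) / sinh (6 * u)) * (cosh (3 * u) * sinh (6 * u)))
  with ((sinh (4 * u) + sinh (2 * u)) * cosh (3 * u)) by (field; lra).
unfold sinh, cosh.
set (x := exp u); set (y := exp (- u)).
assert (Hp : forall k, exp (INR k * u) = x ^ k).
{ intros k; unfold x; rewrite <- Rpower_pow by apply exp_pos; unfold Rpower; rewrite ln_exp; reflexivity. }
assert (Hq : forall k, exp (- (INR k * u)) = y ^ k).
{ intros k; unfold y; rewrite <- Rpower_pow by apply exp_pos; unfold Rpower; rewrite ln_exp; f_equal; ring. }
assert (E6 := Hp 6%nat); assert (E4 := Hp 4%nat); assert (E3 := Hp 3%nat); assert (E2 := Hp 2%nat).
assert (F6 := Hq 6%nat); assert (F4 := Hq 4%nat); assert (F3 := Hq 3%nat); assert (F2 := Hq 2%nat).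
replace (INR 6) with 6 in E6, F6 by (simpl; ring); replace (INR 4) with 4 in E4, F4 by (simpl; ring).
replace (INR 3) with 3 in E3, F3 by (simpl; ring); replace (INR 2) with 2 in E2, F2 by (simpl; ring).
rewrite E6, E4, E3, E2, F6, F4, F3, F2.
assert (Hy : y = / x) by (unfold x, y; apply exp_Ropp).
assert (Hx : 0 < x) by apply exp_pos.
rewrite Hy; field; lra.
Qed.

Lemma W2_Fmor (t : C) : 0 < Re t -> W2 t = (Fmor (3 / 2) 2 12 t + Fmor (3 / 2) 4 12 t)%C.
Proof.
intros Ht.
assert (Ho : off_cut t) by (left; exact Ht).
assert (M1 := mordell_int (3 / 2) 2 12 t (Csqrt t) ltac:(lra) ltac:(lra) Ht (Csqrt_Re t Ho) (Csqrt_sqr t Ho)).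
assert (M2 := mordell_int (3 / 2) 4 12 t (Csqrt t) ltac:(lra) ltac:(lra) Ht (Csqrt_Re t Ho) (Csqrt_sqr t Ho)).
assert (M := is_CInt_plus _ _ _ _ M1 M2).
unfold W2.
rewrite (is_CInt_CInt0oo _ (Csqrt t * Sfun (3 / 2) 2 12 (Csqrt t) + Csqrt t * Sfun (3 / 2) 4 12 (Csqrt t))%C).
- unfold Fmor, Smor; rewrite <- (Csqrt_sqr t Ho) at 1; field; apply Csqrt_neq_0, Ho.
- revert M; apply is_CInt_ext; intros u Hu; rewrite cosh_ratio, RtoC_plus by exact Hu; ring.
Qed.

(** * Holomorphy of the false theta series *)

(** Induction through the recursion R(e+1) = (z + h) R(e) + e h^2 z^(e-1) for the remainders. The
    factor [rho ^ 2] stands on the left to avoid the exponent e - 2, which truncated subtraction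
    would spoil for small e. *)
Lemma Cpow_taylor (z h : C) (rho : R) (e : nat) : 0 < rho -> Cmod z <= rho -> Cmod (z + h) <= rho ->
  rho ^ 2 * Cmod ((z + h) ^ e - z ^ e - h * (RtoC (INR e) * z ^ pred e)) <= INR e ^ 2 * rho ^ e * Cmod h ^ 2.
Proof.
intros Hr Hz Hzh; induction e as [|e IH].
- simpl; replace (1 - 1 - h * (0 * 1))%C with (RtoC 0) by ring; rewrite Cmod_0; right; ring.
- set (Re := ((z + h) ^ e - z ^ e - h * (RtoC (INR e) * z ^ pred e))%C) in *.
  assert (E : ((z + h) ^ S e - z ^ S e - h * (RtoC (INR (S e)) * z ^ pred (S e)))%C
    = ((z + h) * Re + RtoC (INR e) * (h * h) * z ^ pred e)%C).
  { unfold Re; rewrite S_INR, RtoC_plus; simpl pred; destruct e as [|e]; simpl pred;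
      rewrite ?Cpow_S; simpl INR; ring. }
  rewrite E; clear E.
  assert (T := Cmod_triangle ((z + h) * Re) (RtoC (INR e) * (h * h) * z ^ pred e)).
  rewrite !Cmod_mult, Cmod_pow, (Cmod_RtoC_pos (INR e)) in T by apply pos_INR.
  set (x := Cmod h) in *; set (r := Cmod Re) in *.
  assert (Hx : 0 <= x) by apply Cmod_ge_0; assert (Hr0 : 0 <= r) by apply Cmod_ge_0.
  assert (He := pos_INR e); assert (Hp := pow_lt rho e Hr).
  assert (A : INR e * (x * x) * Cmod z ^ pred e * rho ^ 2 <= INR e * rho ^ S e * x ^ 2).
  { destruct e as [|e]; [simpl; right; ring|].
    simpl pred; apply Rle_trans with (INR (S e) * (x * x) * rho ^ e * rho ^ 2).
    - apply Rmult_le_compat_r; [apply pow2_ge_0|].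
      apply Rmult_le_compat_l; [apply Rmult_le_pos; [exact He|nra]|].
      apply pow_incr; split; [apply Cmod_ge_0|exact Hz].
    - right; simpl; ring. }
  assert (B : Cmod (z + h) * r * rho ^ 2 <= rho * (INR e ^ 2 * rho ^ e * x ^ 2)).
  { apply Rle_trans with (rho * (rho ^ 2 * r)); [|apply Rmult_le_compat_l; [lra|exact IH]].
    replace (rho * (rho ^ 2 * r)) with (rho * r * rho ^ 2) by ring.
    apply Rmult_le_compat_r; [apply pow2_ge_0|]; apply Rmult_le_compat_r; assumption. }
  apply Rle_trans with (rho * (INR e ^ 2 * rho ^ e * x ^ 2) + INR e * rho ^ S e * x ^ 2).
  + apply Rle_trans with (rho ^ 2 * (Cmod (z + h) * r + INR e * (x * x) * Cmod z ^ pred e)).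
    * apply Rmult_le_compat_l; [apply pow2_ge_0|exact T].
    * lra.
  + rewrite S_INR; simpl.
    assert (0 <= rho * rho ^ e * (x * (x * 1))) by (apply Rmult_le_pos; [apply Rmult_le_pos; lra|nra]).
    nra.
Qed.

Section Sparse.

Variables (cf : nat -> R) (ex : nat -> nat) (B ka D : R).
Hypothesis Hcf : forall n, Rabs (cf n) <= B.
Hypothesis Hka : 0 < ka.
Hypothesis Hex : forall n, ka * INR n - D <= INR (ex n).

(** Half of the decay of rho^e absorbs the factor 1 + e^2; the other half is geometric in [n],
    because the exponents grow at least linearly. *)
Let ex_sum (rho : R) : 0 < rho < 1 -> ex_series (fun n => (1 + INR (ex n) ^ 2) * rho ^ ex n).
Proof.
intros Hr.
set (la := - ln rho).
assert (Hla : 0 < la).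
{ unfold la; assert (ln rho < ln 1) by (apply ln_increasing; lra); rewrite ln_1 in *; lra. }
set (A := (1 + (4 / la) ^ 2) * exp (la / 2 * D)).
set (r := exp (- (la / 2 * ka))).
assert (Hrr : 0 < r < 1).
{ split; [apply exp_pos|unfold r; rewrite <- exp_0; apply exp_increasing].
  assert (0 < la / 2 * ka) by (apply Rmult_lt_0_compat; lra); lra. }
apply (@ex_series_le R_AbsRing R_CompleteNormedModule _ (fun n => A * r ^ n)).
- intros n; set (e := INR (ex n)); assert (He : 0 <= e) by apply pos_INR.
  change (Rabs ((1 + e ^ 2) * rho ^ ex n) <= A * r ^ n).
  rewrite Rabs_pos_eq by (apply Rmult_le_pos; [nra|apply pow_le; lra]).
  assert (E1 : rho ^ ex n = exp (- (la * e))).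
  { rewrite <- Rpower_pow by lra; unfold Rpower; f_equal; unfold la, e; ring. }
  assert (E2 : r ^ n = exp (- (la / 2 * (ka * INR n)))).
  { rewrite <- Rpower_pow by lra; unfold Rpower, r; rewrite ln_exp; f_equal; ring. }
  rewrite E1, E2; unfold A.
  assert (Hx : 1 + e ^ 2 <= (1 + (4 / la) ^ 2) * exp (la / 2 * e)).
  { assert (I1 := exp_ineq1_le (la / 4 * e)).
    assert (Hy : 0 <= la / 4 * e) by (apply Rmult_le_pos; lra).
    replace (exp (la / 2 * e)) with (exp (la / 4 * e) * exp (la / 4 * e)) by (rewrite <- exp_plus; f_equal; field).
    set (y := exp (la / 4 * e)) in *.
    assert (Hye : e <= 4 / la * y).
    { apply Rmult_le_reg_l with (la / 4); [lra|].
      replace (la / 4 * (4 / la * y)) with y by (field; lra); lra. }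
    assert (1 <= y) by lra.
    assert (H4 : 0 < 4 / la) by (apply Rdiv_lt_0_compat; lra).
    assert (e ^ 2 <= (4 / la * y) ^ 2) by (apply pow_incr; lra).
    nra. }
  apply Rle_trans with ((1 + (4 / la) ^ 2) * exp (la / 2 * e) * exp (- (la * e))).
  + apply Rmult_le_compat_r; [left; apply exp_pos|exact Hx].
  + rewrite !Rmult_assoc, <- !exp_plus; apply Rmult_le_compat_l.
    * pose proof (pow2_ge_0 (4 / la)); lra.
    * apply exp_le; assert (H := Hex n); fold e in H.
      assert (la / 2 * (ka * INR n - D) <= la / 2 * e) by (apply Rmult_le_compat_l; lra); lra.
- apply (ex_series_scal (V := R_NormedModule) A (fun n => r ^ n)).
  apply ex_series_geom; rewrite Rabs_pos_eq; lra.
Qed.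

(** The series is indexed by the terms of a theta series instead of by powers, so exponents may
    repeat. Majorants are taken at the radius [rho], halfway between [Cmod z] and 1, which leaves a
    disc of radius [d] around [z]. *)
Lemma sparse_holomorphic (z : C) : Cmod z < 1 ->
  holomorphic_at (fun z => Cseries (fun n => RtoC (cf n) * z ^ ex n)%C) z.
Proof.
intros Hz; assert (Hz0 := Cmod_ge_0 z).
assert (HB : 0 <= B) by (apply Rle_trans with (2 := Hcf 0), Rabs_pos).
set (rho := (Cmod z + 1) / 2); set (d := (1 - Cmod z) / 2).
assert (Hrho : 0 < rho < 1) by (unfold rho; lra); assert (Hd : 0 < d) by (unfold d; lra).
assert (Hzr : Cmod z <= rho) by (unfold rho; lra).
assert (Hnear : forall w, Cmod (w - z) < d -> Cmod w <= rho).
{ intros w Hw; assert (T := Cmod_triangle z (w - z)).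
  replace (z + (w - z))%C with w in T by ring; unfold rho, d in *; lra. }
assert (S0 := ex_sum rho Hrho).
assert (Hb : forall K, ex_series (fun n => K * ((1 + INR (ex n) ^ 2) * rho ^ ex n))).
{ intros K; exact (ex_series_scal (V := R_NormedModule) K _ S0). }
assert (Hpow : forall e, 0 < rho ^ e) by (intros; apply pow_lt; lra).
apply (holomorphic_series (fun n z => RtoC (cf n) * z ^ ex n)%C
  (fun n => RtoC (cf n) * (RtoC (INR (ex n)) * z ^ pred (ex n)))%C
  (fun n => B / rho ^ 2 * ((1 + INR (ex n) ^ 2) * rho ^ ex n)) z d Hd).
- apply Hb.
- intros w Hw; apply (is_Cseries_dominated _ (fun n => B * ((1 + INR (ex n) ^ 2) * rho ^ ex n))); [|apply Hb].
  intros n; rewrite Cmod_mult, Cmod_R, Cmod_pow.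
  apply Rmult_le_compat; [apply Rabs_pos|apply pow_le, Cmod_ge_0|apply Hcf|].
  apply Rle_trans with (rho ^ ex n).
  + apply pow_incr; split; [apply Cmod_ge_0|apply Hnear, Hw].
  + assert (P := Hpow (ex n)); pose proof (pow2_ge_0 (INR (ex n))); nra.
- apply (is_Cseries_dominated _ (fun n => B / rho * ((1 + INR (ex n) ^ 2) * rho ^ ex n))); [|apply Hb].
  intros n; rewrite !Cmod_mult, !Cmod_R, Cmod_pow, (Rabs_pos_eq (INR _)) by apply pos_INR.
  replace (B / rho * ((1 + INR (ex n) ^ 2) * rho ^ ex n)) with (B * ((1 + INR (ex n) ^ 2) * rho ^ ex n / rho))
    by (field; lra).
  apply Rmult_le_compat; [apply Rabs_pos| |apply Hcf|].
  + apply Rmult_le_pos; [apply pos_INR|apply pow_le, Cmod_ge_0].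
  + set (e := ex n); destruct e as [|e].
    * simpl; rewrite Rmult_0_l; apply Rdiv_le_0_compat; lra.
    * replace ((1 + INR (S e) ^ 2) * rho ^ S e / rho) with ((1 + INR (S e) ^ 2) * rho ^ e) by (simpl; field; lra).
      simpl pred; apply Rmult_le_compat; [apply pos_INR|apply pow_le, Cmod_ge_0| |].
      -- pose proof (pos_INR (S e)); nra.
      -- apply pow_incr; split; assumption.
- intros n h Hh.
  replace (RtoC (cf n) * (z + h) ^ ex n - RtoC (cf n) * z ^ ex n - h * (RtoC (cf n) * (RtoC (INR (ex n)) * z ^ pred (ex n))))%C
    with (RtoC (cf n) * ((z + h) ^ ex n - z ^ ex n - h * (RtoC (INR (ex n)) * z ^ pred (ex n))))%C by ring.
  rewrite Cmod_mult, Cmod_R.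
  assert (Hzh : Cmod (z + h) <= rho) by (apply Hnear; replace (z + h - z)%C with h by ring; exact Hh).
  assert (T := Cpow_taylor z h rho (ex n) (proj1 Hrho) Hzr Hzh).
  set (X := Cmod ((z + h) ^ ex n - z ^ ex n - h * (RtoC (INR (ex n)) * z ^ pred (ex n)))) in *.
  assert (HX : X <= INR (ex n) ^ 2 * rho ^ ex n * Cmod h ^ 2 / rho ^ 2).
  { apply Rmult_le_reg_l with (rho ^ 2); [apply Hpow|].
    replace (rho ^ 2 * (INR (ex n) ^ 2 * rho ^ ex n * Cmod h ^ 2 / rho ^ 2))
      with (INR (ex n) ^ 2 * rho ^ ex n * Cmod h ^ 2) by (field; lra); exact T. }
  apply Rle_trans with (B * (INR (ex n) ^ 2 * rho ^ ex n * Cmod h ^ 2 / rho ^ 2)).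
  + apply Rmult_le_compat; [apply Rabs_pos|apply Cmod_ge_0|apply Hcf|exact HX].
  + assert (P := Hpow (ex n)).
    replace (B / rho ^ 2 * ((1 + INR (ex n) ^ 2) * rho ^ ex n) * Cmod h ^ 2)
      with (B * (INR (ex n) ^ 2 * rho ^ ex n * Cmod h ^ 2 / rho ^ 2) + B / rho ^ 2 * rho ^ ex n * Cmod h ^ 2) by (field; lra).
    assert (0 <= B / rho ^ 2 * rho ^ ex n * Cmod h ^ 2).
    { apply Rmult_le_pos; [apply Rmult_le_pos; [apply Rdiv_le_0_compat; [exact HB|apply Hpow]|lra]|apply pow2_ge_0]. }
    lra.
Qed.

End Sparse.

Lemma INR_le_sq (n : nat) : INR n <= INR n ^ 2.
Proof. destruct n as [|n]; [simpl; lra|]; rewrite S_INR; pose proof (pos_INR n); nra. Qed.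

Lemma Phi_holomorphic (p j : nat) (z : C) : (0 < p)%nat -> Cmod z < 1 -> holomorphic_at (Phi p j) z.
Proof.
intros Hp Hz; unfold Phi.
assert (Hp0 : 0 < INR p) by (apply lt_0_INR; exact Hp).
(* 4 counts the values of [psi] in a coefficient. Slope and intercept come from n <= n^2; the final
   1 pays for the rounding in the integer division. *)
apply (sparse_holomorphic (fun n => IZR (phi_coef p j n)) (phi_exp p j) 4 (/ (24 * INR p))
  ((6 * INR j - INR p) ^ 2 / (24 * INR p) + 1)); [| | |exact Hz].
- intros n; unfold phi_coef; rewrite !plus_IZR.
  assert (X := fun a => psi_bound (6 * Z.of_nat p) a n).
  assert (X1 := X (6 * Z.of_nat j - Z.of_nat p)%Z); assert (X2 := X (7 * Z.of_nat p - 6 * Z.of_nat j)%Z).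
  assert (X3 := X (6 * Z.of_nat j + Z.of_nat p)%Z); assert (X4 := X (5 * Z.of_nat p - 6 * Z.of_nat j)%Z).
  apply Rabs_le_between in X1, X2, X3, X4; apply Rabs_le; lra.
- apply Rinv_0_lt_compat; lra.
- intros n; unfold phi_exp.
  set (u := (Z.of_nat n ^ 2 - (6 * Z.of_nat j - Z.of_nat p) ^ 2)%Z); set (v := (24 * Z.of_nat p)%Z).
  assert (Hv : (0 < v)%Z) by (unfold v; lia).
  assert (Hq : (u < v * (u / v) + v)%Z).
  { assert (D := Z.div_mod u v ltac:(lia)); assert (M := Z.mod_pos_bound u v Hv); lia. }
  apply Rle_trans with (IZR (u / v)).
  2:{ rewrite INR_IZR_INZ; apply IZR_le; lia. }
  apply IZR_lt in Hq; rewrite plus_IZR, mult_IZR in Hq.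
  assert (Ev : IZR v = 24 * INR p) by (unfold v; rewrite mult_IZR, <- INR_IZR_INZ; reflexivity).
  assert (Eu : IZR u = INR n ^ 2 - (6 * INR j - INR p) ^ 2).
  { unfold u; rewrite minus_IZR, !Z.pow_2_r, !mult_IZR, minus_IZR, mult_IZR, <- !INR_IZR_INZ; ring. }
  rewrite Ev, Eu in Hq; pose proof (INR_le_sq n).
  apply Rmult_le_reg_l with (24 * INR p); [lra|].
  replace (24 * INR p * (/ (24 * INR p) * INR n - ((6 * INR j - INR p) ^ 2 / (24 * INR p) + 1)))
    with (INR n - (6 * INR j - INR p) ^ 2 - 24 * INR p) by (field; lra); lra.
Qed.

Lemma INR_div_ge (a b : nat) : (0 < b)%nat -> INR a / INR b - 1 <= INR (a / b).
Proof.
intros Hb; assert (Hb0 : 0 < INR b) by (apply lt_0_INR; exact Hb).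
assert (D := Nat.div_mod a b ltac:(lia)); assert (M := Nat.mod_upper_bound a b ltac:(lia)).
assert (H : (a < b * (a / b) + b)%nat) by lia.
apply lt_INR in H; rewrite plus_INR, mult_INR in H.
apply Rmult_le_reg_l with (INR b); [exact Hb0|].
replace (INR b * (INR a / INR b - 1)) with (INR a - INR b) by (field; lra); lra.
Qed.

Lemma Phi3_1_holomorphic (z : C) : Cmod z < 1 -> holomorphic_at Phi3_1 z.
Proof.
intros Hz.
apply (holomorphic_comp (fun z => Cseries (fun n => RtoC (IZR (psi 3 2 n)) * z ^ ((n ^ 2 + 8) / 12)%nat)%C)
  (fun z => - z)%C).
- apply (sparse_holomorphic _ (fun n => (n ^ 2 + 8) / 12)%nat 1 (/ 12) 1); [apply psi_bound|lra| |rewrite Cmod_opp; exact Hz].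
  intros n; apply Rle_trans with (2 := INR_div_ge (n ^ 2 + 8) 12 ltac:(lia)).
  rewrite plus_INR, pow_INR; pose proof (INR_le_sq n); simpl INR; simpl in *; lra.
- apply (holomorphic_ext (fun z => RtoC (-1) * z)%C); [intros [a b]; apply C_ext; simpl; ring|].
  apply (holomorphic_mult (fun _ => RtoC (-1)) (fun z => z)); [apply holomorphic_const|apply holomorphic_id].
Qed.

Lemma Phi3_2_holomorphic (z : C) : Cmod z < 1 -> holomorphic_at Phi3_2 z.
Proof.
intros Hz; unfold Phi3_2.
apply (holomorphic_mult (fun _ => RtoC 2)
  (fun z => Cseries (fun n => RtoC (IZR (psi 6 1 n - psi 6 5 n)) * z ^ ((n ^ 2 - 1) / 24)%nat)%C));
  [apply holomorphic_const|].
apply (sparse_holomorphic (fun n => IZR (psi 6 1 n - psi 6 5 n)) (fun n => (n ^ 2 - 1) / 24)%nat 2 (/ 24) 2); [|lra| |exact Hz].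
- intros n; rewrite minus_IZR; unfold Rminus; eapply Rle_trans; [apply Rabs_triang|]; rewrite Rabs_Ropp.
  pose proof (psi_bound 6 1 n); pose proof (psi_bound 6 5 n); lra.
- intros n; apply Rle_trans with (2 := INR_div_ge (n ^ 2 - 1) 24 ltac:(lia)).
  destruct n as [|n].
  + simpl; lra.
  + rewrite minus_INR by (simpl; lia); rewrite pow_INR.
    pose proof (INR_le_sq (S n)).
    replace (INR 24) with 24 by (simpl; ring); replace (INR 1) with 1 by reflexivity; lra.
Qed.

Lemma holomorphic_Cinv_comp (f : C -> C) (Q : C) : 1 < Cmod Q ->
  (forall z, Cmod z < 1 -> holomorphic_at f z) -> holomorphic_at (fun Q => f (/ Q)%C) Q.
Proof.
intros HQ Hf.
assert (HQ0 : Q <> 0%C) by (apply Cmod_gt_0; lra).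
apply (holomorphic_comp f Cinv); [|apply holomorphic_inv, HQ0].
apply Hf; rewrite Cmod_inv by exact HQ0; rewrite <- Rinv_1; apply Rinv_lt_contravar; lra.
Qed.

(** * The transformation law for orders 5, 7 and 11 *)

Lemma sum_n_m_csum (f : nat -> C) (l : nat) :
  @sum_n_m C_AbelianMonoid f 1 l = csum (fun i => f (S i)) l.
Proof.
induction l as [|l IH]; [exact (@sum_n_m_zero C_AbelianMonoid f 1 0 ltac:(lia))|].
rewrite sum_n_Sm by lia; rewrite IH; reflexivity.
Qed.

Lemma csum_ext (f g : nat -> C) (n : nat) :
  (forall i, (i < n)%nat -> f i = g i) -> csum f n = csum g n.
Proof.
induction n as [|n IH]; intros H; simpl; [reflexivity|].
rewrite IH, H; auto; intros; apply H; lia.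
Qed.

Lemma csum_RtoC (f : nat -> R) (n : nat) : csum (fun i => RtoC (f i)) n = RtoC (rsum f n).
Proof. induction n as [|n IH]; simpl; [reflexivity|]; rewrite IH, <- RtoC_plus; reflexivity. Qed.

Lemma csum_Re (f : nat -> C) (n : nat) : Re (csum f n) = rsum (fun i => Re (f i)) n.
Proof. induction n as [|n IH]; [reflexivity|]; cbn [rsum csum]; rewrite <- IH; reflexivity. Qed.

Lemma csum_Im (f : nat -> C) (n : nat) : Im (csum f n) = rsum (fun i => Im (f i)) n.
Proof. induction n as [|n IH]; [reflexivity|]; cbn [rsum csum]; rewrite <- IH; reflexivity. Qed.

Lemma csum_Cmult (c : C) (f : nat -> C) (n : nat) : csum (fun i => c * f i)%C n = (c * csum f n)%C.
Proof. induction n as [|n IH]; simpl; [ring|]; rewrite IH; ring. Qed.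

Lemma csum_minus (f g : nat -> C) (n : nat) : csum (fun i => f i - g i)%C n = (csum f n - csum g n)%C.
Proof. induction n as [|n IH]; simpl; [ring|]; rewrite IH; ring. Qed.

Lemma is_series_rsum (f : nat -> nat -> R) (l : nat -> R) (d : nat) :
  (forall i, (i < d)%nat -> is_series (f i) (l i)) ->
  is_series (fun n => rsum (fun i => f i n) d) (rsum l d).
Proof.
induction d as [|d IH]; intros H.
- apply is_lim_seq_rsum; apply (is_lim_seq_ext (fun _ => 0)); [|apply is_lim_seq_const].
  intros n; symmetry; apply rsum_zero; reflexivity.
- exact (is_series_plus (V := R_NormedModule) _ _ _ _ (IH (fun i Hi => H i ltac:(lia))) (H d ltac:(lia))).
Qed.

Lemma ex_series_gauss (A : R) (u : nat -> R) : 0 < A -> (forall n, Rabs (u n) <= 1) ->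
  ex_series (fun m => exp (- (A * INR (S m) ^ 2)) * u m).
Proof.
intros HA Hu; set (r := exp (- A)).
assert (Hr : 0 < r < 1) by (split; [apply exp_pos|unfold r; rewrite <- exp_0; apply exp_increasing; lra]).
apply (@ex_series_le R_AbsRing R_CompleteNormedModule _ (fun n => r ^ n)).
- intros m; change (Rabs (exp (- (A * INR (S m) ^ 2)) * u m) <= r ^ m).
  rewrite Rabs_mult, (Rabs_pos_eq (exp _)) by (left; apply exp_pos).
  apply Rle_trans with (exp (- (A * INR (S m) ^ 2)) * 1);
    [apply Rmult_le_compat_l; [left; apply exp_pos|apply Hu]|].
  rewrite Rmult_1_r; unfold r; rewrite <- (Rpower_pow m (exp (- A))) by apply exp_pos; unfold Rpower; rewrite ln_exp.
  apply exp_le; rewrite S_INR; pose proof (pos_INR m).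
  assert (0 <= A * (INR m ^ 2 + INR m + 1)) by (apply Rmult_le_pos; nra); nra.
- apply ex_series_geom; rewrite Rabs_pos_eq; lra.
Qed.

(** The component [Phi p j] with its fractional power restored, the natural object on the real ray:
    both sides of the law become values of this vector. *)
Definition Th (p j : nat) (x : R) : R :=
  let P := Z.of_nat p in let J := Z.of_nat j in
  Psi (6 * P) (6 * J - P) x + Psi (6 * P) (7 * P - 6 * J) x
  + Psi (6 * P) (6 * J + P) x + Psi (6 * P) (5 * P - 6 * J) x.

(** The power of [Q] prescribed by the order vector cancels against the shift of [Delta], so the
    order vector disappears on the real ray and all normalizations are treated at once. *)
Lemma false_theta_value (p : nat) (nn : list nat) (j : nat) (Q : R) :
  (1 <= j)%nat -> (2 * j < p)%nat -> 1 < Q ->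
  (RtoC (Rpower Q (- (Delta p j + INR (order nn j)))) * false_theta_vector p nn j (RtoC Q))%C
  = RtoC (Th p j (/ Q)).
Proof.
intros Hj Hp HQ; unfold false_theta_vector, Th.
assert (Hx : 0 < / Q < 1).
{ split; [apply Rinv_0_lt_compat; lra|rewrite <- Rinv_1; apply Rinv_lt_contravar; lra]. }
rewrite <- RtoC_inv by lra; rewrite (Phi_Psi p j (/ Q) Hj Hp Hx).
rewrite <- RtoC_pow, <- !RtoC_mult; f_equal.
set (S4 := (_ + _ + _ + _)%R).
assert (E1 : Rpower (/ Q) (- Delta p j) = Rpower Q (Delta p j)).
{ unfold Rpower; rewrite ln_Rinv by lra; f_equal; ring. }
rewrite E1, <- (Rpower_pow (order nn j) Q) by lra.
rewrite <- !Rmult_assoc, <- !Rpower_plus.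
replace (- (Delta p j + INR (order nn j)) + INR (order nn j) + Delta p j) with 0 by ring.
rewrite Rpower_O by lra; ring.
Qed.

Section OrderP.

Variable p : nat.
Hypothesis Hp5 : (5 <= p)%nat.
Hypothesis Hp6 : (p mod 6 = 1 \/ p mod 6 = 5)%nat.
Hypothesis Hck : dual_check p = true.

Let P := INR p.
Let HP : 0 < P.
Proof. apply lt_0_INR; lia. Qed.

Let ell_lt (j : nat) : (j <= ell p)%nat -> (2 * j < p)%nat.
Proof.
unfold ell; intros H.
assert (D := Nat.div_mod (p - 1) 2 ltac:(lia)); lia.
Qed.

(** Coprimality with 6 in a form usable by [lia]; it excludes [6 j = p], where the sign in [calL]
    and the first residue would degenerate. *)
Let p6 : exists q r : Z, (Z.of_nat p = 6 * q + r /\ (r = 1 \/ r = 5))%Z.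
Proof.
assert (D := Nat.div_mod p 6 ltac:(lia)).
exists (Z.of_nat (p / 6)), (Z.of_nat (p mod 6)); split; lia.
Qed.

Let cc := 12 * P.
Let NN := 2 * (12 * P).

(** The parameters in [calL] are doubled residues, [al = 2 a] with [N = 24 p]. With T = - t the
    Gaussian exponent (2 n)^2 T / (48 p) equals 2 T n^2 / (24 p), which is the power n^2 / (24 p) of
    1 / Q = e^(-2 T). *)
Let block (s : side) (t : R) (a : Z) : t < 0 -> (0 < a < 12 * Z.of_nat p)%Z -> (a <> 6 * Z.of_nat p)%Z ->
  Sfun cc (2 * IZR a) NN (0, sgn s * sqrt (- t))
  = (/ 2 * sqrt (PI / cc) * Psi (6 * Z.of_nat p) a (exp (- (2 * - t))),
     - sgn s * (2 * PI / (NN * sqrt (- t)))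
       * Series (fun m => exp (- (PI ^ 2 / (12 * P * - t) * INR (S m) ^ 2)) * sin (PI * INR (S m) * IZR a / (6 * P)))).
Proof.
intros Ht Ha Ham.
assert (HY : 0 < sqrt (- t)) by (apply sqrt_lt_R0; lra).
assert (HY2 : sqrt (- t) ^ 2 = - t) by (apply pow2_sqrt; lra).
assert (EP : IZR (6 * Z.of_nat p) = 6 * P) by (rewrite mult_IZR, <- INR_IZR_INZ; reflexivity).
assert (Hal : 0 < 2 * IZR a < NN).
{ destruct Ha as [A1 A2]; apply IZR_lt in A1, A2; rewrite mult_IZR, <- INR_IZR_INZ in A2; fold P in A2.
  unfold NN; lra. }
assert (Hsg : sgn s = 1 \/ sgn s = -1) by (destruct s; simpl; auto).
destruct (Sfun_imag cc (2 * IZR a) NN (sqrt (- t)) (sgn s)) as [E1 E2]; auto.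
{ unfold cc; lra. }
apply C_ext; [rewrite E1|rewrite E2]; cbn [Re Im fst snd]; f_equal.
- rewrite <- (Psi_pairs (6 * Z.of_nat p) a (2 * - t)) by lia || lra.
  + apply Series_ext; intros k; rewrite EP, HY2; unfold nk, cc, NN; f_equal; f_equal; f_equal; field; lra.
- apply Series_ext; intros m; f_equal.
  + f_equal; f_equal; unfold cc, NN.
    replace ((2 * PI * INR (S m) / (2 * (12 * P) * sqrt (- t))) ^ 2)
      with (PI ^ 2 * INR (S m) ^ 2 / (144 * P ^ 2 * sqrt (- t) ^ 2)) by (field; split; lra).
    rewrite HY2; field; split; lra.
  + f_equal; unfold NN; field; lra.
Qed.

(** Boundary value of [calL]: the square root contributes [sqrt (48 P / PI)] times w, and this w
    cancels the 1 / w of each Mordell integral. *)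
Let Ls (s : side) (j : nat) (t : R) : C :=
  let J := INR j in let w := ((0, sgn s * sqrt (- t)) : C) in
  (RtoC (sqrt (48 * P / PI))
   * (RtoC (sign (6 * J - P)) * Sfun cc (Rabs (12 * J - 2 * P)) NN w
      + Sfun cc (14 * P - 12 * J)%R NN w
      + Sfun cc (12 * J + 2 * P)%R NN w
      + Sfun cc (10 * P - 12 * J)%R NN w))%C.

Let ranges (j : nat) : (1 <= j <= ell p)%nat ->
  0 < Rabs (12 * INR j - 2 * P) < NN /\ 0 < 14 * P - 12 * INR j < NN /\
  0 < 12 * INR j + 2 * P < NN /\ 0 < 10 * P - 12 * INR j < NN.
Proof.
intros Hj; assert (H2 := ell_lt j ltac:(lia)).
assert (J1 : 1 <= INR j) by (replace 1 with (INR 1) by reflexivity; apply le_INR; lia).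
apply lt_INR in H2; rewrite mult_INR in H2; change (INR 2) with 2 in H2; fold P in H2.
unfold NN; repeat split; try lra.
- apply Rabs_pos_lt; intros E.
  destruct p6 as [q [r [Eq Er]]].
  assert (E2 : IZR (6 * Z.of_nat j) = IZR (Z.of_nat p)).
  { rewrite mult_IZR, <- !INR_IZR_INZ; fold P; lra. }
  apply eq_IZR in E2; lia.
- apply Rabs_def1; lra.
Qed.

Lemma calL_lateral (s : side) (j : nat) : (1 <= j <= ell p)%nat ->
  lateral_continuation s (calL p j) (Ls s j).
Proof.
intros Hj; destruct (ranges j Hj) as (R1 & R2 & R3 & R4).
assert (Hcc : 0 < cc) by (unfold cc; lra).
exists (fun t => RtoC (sqrt (48 * P / PI))
   * (RtoC (sign (6 * INR j - P)) * Smor cc (Rabs (12 * INR j - 2 * P)) NN t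
      + Smor cc (14 * P - 12 * INR j)%R NN t
      + Smor cc (12 * INR j + 2 * P)%R NN t
      + Smor cc (10 * P - 12 * INR j)%R NN t))%C.
split; [|split].
- intros t Ht; apply lateral_off_cut in Ht.
  assert (Hm : forall (a : C) (f : C -> C), holomorphic_at f t -> holomorphic_at (fun t => a * f t)%C t).
  { intros a f Hf; apply (holomorphic_mult (fun _ => a) f); [apply holomorphic_const|exact Hf]. }
  assert (HS : forall al, 0 < al < NN -> holomorphic_at (Smor cc al NN) t).
  { intros al Hal; apply Smor_holomorphic; assumption. }
  apply Hm.
  apply (holomorphic_plus (fun t => RtoC (sign (6 * INR j - P)) * Smor cc (Rabs (12 * INR j - 2 * P)) NN t
      + Smor cc (14 * P - 12 * INR j)%R NN t + Smor cc (12 * INR j + 2 * P)%R NN t)%C (Smor cc (10 * P - 12 * INR j) NN));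
    [|apply HS, R4].
  apply (holomorphic_plus (fun t => RtoC (sign (6 * INR j - P)) * Smor cc (Rabs (12 * INR j - 2 * P)) NN t
      + Smor cc (14 * P - 12 * INR j)%R NN t)%C (Smor cc (12 * INR j + 2 * P) NN)); [|apply HS, R3].
  apply (holomorphic_plus (fun t => RtoC (sign (6 * INR j - P)) * Smor cc (Rabs (12 * INR j - 2 * P)) NN t)%C
      (Smor cc (14 * P - 12 * INR j) NN)); [|apply HS, R2].
  apply Hm, HS, R1.
- intros t Ht; unfold calL; cbv zeta; fold P.
  rewrite Csqrt_scal; [|apply Rdiv_lt_0_compat; [lra|apply PI_RGT_0]|exact Ht].
  rewrite !JS_Fmor by assumption.
  fold cc; change (2 * cc) with NN; unfold Fmor.
  assert (Hw : Csqrt t <> 0%C) by (apply Csqrt_neq_0; left; exact Ht).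
  field; exact Hw.
- intros t Ht; unfold Ls; cbv zeta.
  assert (HS : forall al, 0 < al < NN -> filterlim (fun e : R => Smor cc al NN (t, sgn s * e)) (at_right 0)
    (@locally C_UniformSpace (Sfun cc al NN (0, sgn s * sqrt (- t))))).
  { intros al Hal; apply Smor_lateral; assumption. }
  assert (Hm : forall (a b : C) (g : R -> C), filterlim g (at_right 0) (@locally C_UniformSpace b) ->
    filterlim (fun x => a * g x)%C (at_right 0) (@locally C_UniformSpace (a * b)%C)).
  { intros a b g Hg; apply (filterlim_Cmult (at_right 0) (fun _ => a) g); [|exact Hg].
    apply (filterlim_const (U := C_UniformSpace) a). }
  apply Hm.
  apply (filterlim_Cplus (at_right 0) (fun e => _ + _ + _)%C); [|apply HS, R4].
  apply (filterlim_Cplus (at_right 0) (fun e => _ + _)%C); [|apply HS, R3].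
  apply (filterlim_Cplus (at_right 0) (fun e => _ * _)%C); [|apply HS, R2].
  apply Hm, HS, R1.
Qed.

Let V (t : R) (a : Z) : R :=
  Series (fun m => exp (- (PI ^ 2 / (12 * P * - t) * INR (S m) ^ 2)) * sin (PI * INR (S m) * IZR a / (6 * P))).

Let At (t : R) : t < 0 -> 0 < PI ^ 2 / (12 * P * - t).
Proof.
intros Ht; apply Rdiv_lt_0_compat; [apply pow_lt, PI_RGT_0|apply Rmult_lt_0_compat; lra].
Qed.

Let ex_V (t : R) (a : Z) : t < 0 ->
  ex_series (fun m => exp (- (PI ^ 2 / (12 * P * - t) * INR (S m) ^ 2)) * sin (PI * INR (S m) * IZR a / (6 * P))).
Proof.
intros Ht; apply (ex_series_gauss _ (fun m => sin (PI * INR (S m) * IZR a / (6 * P)))); [apply At, Ht|].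
intros m; apply Rabs_le, SIN_bound.
Qed.

Let Ls_value (s : side) (j : nat) (t : R) : t < 0 -> (1 <= j <= ell p)%nat ->
  Ls s j t = (sqrt (48 * P / PI) * (/ 2 * sqrt (PI / cc)) * Th p j (exp (- (2 * - t))),
    sqrt (48 * P / PI) * (- sgn s * (2 * PI / (NN * sqrt (- t))))
    * (let PZ := Z.of_nat p in let J := Z.of_nat j in
       V t (6 * J - PZ) + V t (7 * PZ - 6 * J) + V t (6 * J + PZ) + V t (5 * PZ - 6 * J))).
Proof.
intros Ht Hj; assert (H2 := ell_lt j ltac:(lia)).
destruct p6 as [q [r [Eq Er]]].
unfold Ls; cbv zeta; unfold Th; cbv zeta.
set (PZ := Z.of_nat p) in *; set (J := Z.of_nat j) in *.
assert (EP : IZR PZ = P) by (unfold PZ; rewrite <- INR_IZR_INZ; reflexivity).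
assert (EJ : IZR J = INR j) by (unfold J; rewrite <- INR_IZR_INZ; reflexivity).
replace (14 * P - 12 * INR j) with (2 * IZR (7 * PZ - 6 * J)) by (rewrite minus_IZR, !mult_IZR, EP, EJ; ring).
replace (12 * INR j + 2 * P) with (2 * IZR (6 * J + PZ)) by (rewrite plus_IZR, !mult_IZR, EP, EJ; ring).
replace (10 * P - 12 * INR j) with (2 * IZR (5 * PZ - 6 * J)) by (rewrite minus_IZR, !mult_IZR, EP, EJ; ring).
rewrite (block s t (7 * PZ - 6 * J)), (block s t (6 * J + PZ)), (block s t (5 * PZ - 6 * J)) by lia || lra.
(* [Psi] and the sine series are odd in the residue, so the sign and the absolute value in [calL]
   combine into the residue [6 j - p], be it positive or negative. *)
assert (E1 : (RtoC (sign (6 * INR j - P)) * Sfun cc (Rabs (12 * INR j - 2 * P)) NN (0, (sgn s * sqrt (- t))%R))%C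
  = (/ 2 * sqrt (PI / cc) * Psi (6 * PZ) (6 * J - PZ) (exp (- (2 * - t))),
     - sgn s * (2 * PI / (NN * sqrt (- t))) * V t (6 * J - PZ))).
{ replace (6 * INR j - P) with (IZR (6 * J - PZ)) by (rewrite minus_IZR, mult_IZR, EP, EJ; ring).
  replace (12 * INR j - 2 * P) with (2 * IZR (6 * J - PZ)) by (rewrite minus_IZR, mult_IZR, EP, EJ; ring).
  destruct (Z_lt_le_dec 0 (6 * J - PZ)) as [L|L].
  - rewrite sign_eq_1 by (apply IZR_lt; lia).
    rewrite Rabs_pos_eq by (apply IZR_lt in L; lra).
    rewrite (block s t (6 * J - PZ)) by lia || lra.
    fold (V t (6 * J - PZ)) (V t (- (6 * J - PZ))) (V t (7 * PZ - 6 * J)) (V t (6 * J + PZ)) (V t (5 * PZ - 6 * J)); apply C_ext; unfold Cmult, Cplus, RtoC, Re, Im; cbn [fst snd]; ring.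
  - assert (L' : (6 * J - PZ < 0)%Z) by lia.
    assert (LR : IZR (6 * J - PZ) < 0) by (apply IZR_lt; lia).
    rewrite sign_eq_m1 by exact LR; rewrite Rabs_left by lra.
    replace (- (2 * IZR (6 * J - PZ))) with (2 * IZR (- (6 * J - PZ))) by (rewrite opp_IZR; ring).
    rewrite (block s t (- (6 * J - PZ))) by lia || lra.
    assert (EPsi : Psi (6 * PZ) (6 * J - PZ) (exp (- (2 * - t))) = - Psi (6 * PZ) (- (6 * J - PZ)) (exp (- (2 * - t)))).
    { rewrite <- Psi_opp by lia || lra; f_equal; lia. }
    assert (EV : V t (6 * J - PZ) = - V t (- (6 * J - PZ))).
    { unfold V; rewrite <- Series_opp; apply Series_ext; intros m; rewrite opp_IZR.
      replace (PI * INR (S m) * - IZR (6 * J - PZ) / (6 * P)) with (- (PI * INR (S m) * IZR (6 * J - PZ) / (6 * P)))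
        by (field; lra).
      rewrite sin_neg; ring. }
    rewrite EPsi, EV; fold (V t (6 * J - PZ)) (V t (- (6 * J - PZ))) (V t (7 * PZ - 6 * J)) (V t (6 * J + PZ)) (V t (5 * PZ - 6 * J)); apply C_ext; unfold Cmult, Cplus, RtoC, Re, Im; cbn [fst snd]; ring. }
rewrite E1; fold (V t (6 * J - PZ)) (V t (- (6 * J - PZ))) (V t (7 * PZ - 6 * J)) (V t (6 * J + PZ)) (V t (5 * PZ - 6 * J)); apply C_ext; unfold Cmult, Cplus, RtoC, Re, Im; cbn [fst snd]; ring.
Qed.

Let psi_zero (a : Z) : (0 < a < 12 * Z.of_nat p)%Z -> psi (6 * Z.of_nat p) a 0 = 0%Z.
Proof. intros Ha; apply psi_0; lia. Qed.

(** Allows the theta series, which starts at index 0, to be compared with the sine series, which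
    starts at 1. *)
Let phi_coef_0 (k : nat) : (1 <= k <= ell p)%nat -> phi_coef p k 0 = 0%Z.
Proof.
intros Hk; assert (H2 := ell_lt k ltac:(lia)); destruct p6 as [q [r [Eq Er]]].
unfold phi_coef; cbv zeta.
rewrite (psi_zero (7 * Z.of_nat p - 6 * Z.of_nat k)), (psi_zero (6 * Z.of_nat k + Z.of_nat p)),
  (psi_zero (5 * Z.of_nat p - 6 * Z.of_nat k)) by lia.
assert (E : psi (6 * Z.of_nat p) (6 * Z.of_nat k - Z.of_nat p) 0 = 0%Z); [|rewrite E; reflexivity].
destruct (Z_lt_le_dec 0 (6 * Z.of_nat k - Z.of_nat p)) as [L|L]; [apply psi_zero; lia|].
replace (6 * Z.of_nat k - Z.of_nat p)%Z with (- (Z.of_nat p - 6 * Z.of_nat k))%Z by ring.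
rewrite psi_opp by lia; rewrite psi_zero by lia; reflexivity.
Qed.

Let Th_series (k : nat) (E : R) : (1 <= k <= ell p)%nat -> 0 < E ->
  is_series (fun m => IZR (phi_coef p k (S m)) * exp (- (E / (24 * P) * INR (S m) ^ 2))) (Th p k (exp (- E))).
Proof.
intros Hk HE.
apply (is_series_shift0 (fun n => IZR (phi_coef p k n) * exp (- (E / (24 * P) * INR n ^ 2)))).
{ rewrite phi_coef_0 by exact Hk; ring. }
assert (EP : IZR (6 * Z.of_nat p) = 6 * P) by (rewrite mult_IZR, <- INR_IZR_INZ; reflexivity).
assert (X := fun a => Psi_series (6 * Z.of_nat p) a E ltac:(lia) HE).
generalize (is_series_plus (V := R_NormedModule) _ _ _ _ (is_series_plus (V := R_NormedModule) _ _ _ _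
  (is_series_plus (V := R_NormedModule) _ _ _ _ (X (6 * Z.of_nat k - Z.of_nat p)%Z) (X (7 * Z.of_nat p - 6 * Z.of_nat k)%Z))
  (X (6 * Z.of_nat k + Z.of_nat p)%Z)) (X (5 * Z.of_nat p - 6 * Z.of_nat k)%Z)).
apply is_series_ext; intros n; rewrite EP; unfold phi_coef; cbv zeta; rewrite !plus_IZR.
replace (E * INR n ^ 2 / (4 * (6 * P))) with (E / (24 * P) * INR n ^ 2) by (field; lra).
unfold plus; simpl; ring.
Qed.

(** With T = - t, the Gaussian e^(- PI^2 m^2 / (12 p T)) is the power - m^2 / (24 p) of Q_1. Applied
    at each frequency, [trig_dual] therefore returns the same false theta vector at the dual
    nome. *)
Let V_sum (j : nat) (t : R) : t < 0 -> (1 <= j <= ell p)%nat ->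
  (let PZ := Z.of_nat p in let J := Z.of_nat j in
   V t (6 * J - PZ) + V t (7 * PZ - 6 * J) + V t (6 * J + PZ) + V t (5 * PZ - 6 * J))
  = sqrt 3 * sqrt P * rsum (fun i => Mmat p j (S i) * Th p (S i) (exp (- (2 * (PI ^ 2 / - t))))) (ell p).
Proof.
intros Ht Hj; cbv zeta; unfold V.
set (PZ := Z.of_nat p); set (J := Z.of_nat j).
assert (EP : IZR PZ = P) by (unfold PZ; rewrite <- INR_IZR_INZ; reflexivity).
assert (EJ : IZR J = INR j) by (unfold J; rewrite <- INR_IZR_INZ; reflexivity).
assert (Hpi := PI_RGT_0).
set (E := 2 * (PI ^ 2 / - t)).
assert (HE : 0 < E) by (unfold E; apply Rmult_lt_0_compat; [lra|apply Rdiv_lt_0_compat; [apply pow_lt; lra|lra]]).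
rewrite <- !Series_plus by (repeat (apply (@ex_series_plus R_AbsRing R_NormedModule)); apply ex_V, Ht).
rewrite <- rsum_scal; apply is_series_unique.
assert (HS : is_series (fun m => rsum (fun i => sqrt 3 * sqrt P * (Mmat p j (S i)
    * (IZR (phi_coef p (S i) (S m)) * exp (- (E / (24 * P) * INR (S m) ^ 2))))) (ell p))
   (rsum (fun i => sqrt 3 * sqrt P * (Mmat p j (S i) * Th p (S i) (exp (- E)))) (ell p))).
{ apply is_series_rsum; intros i Hi.
  apply (is_series_scal (V := R_NormedModule) (sqrt 3 * sqrt P)
    (fun m => Mmat p j (S i) * (IZR (phi_coef p (S i) (S m)) * exp (- (E / (24 * P) * INR (S m) ^ 2))))).
  apply (is_series_scal (V := R_NormedModule) (Mmat p j (S i))).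
  apply Th_series; [lia|exact HE]. }
revert HS; apply is_series_ext; intros m.
assert (EE : E / (24 * P) = PI ^ 2 / (12 * P * - t)) by (unfold E; field; split; lra).
rewrite EE; set (x := exp _).
assert (TD := trig_dual p j (S m) ltac:(lia) Hck); fold P in TD.
rewrite !minus_IZR, !plus_IZR, !mult_IZR, EP, EJ.
rewrite <- !Rmult_plus_distr_l, TD, <- !rsum_scal; apply rsum_ext; intros i _; ring.
Qed.

Let constant (t : R) : t < 0 ->
  sqrt (48 * P / PI) * (2 * PI / (NN * sqrt (- t))) * (sqrt 3 * sqrt P) = sqrt (PI / - t).
Proof.
intros Ht; assert (Hpi := PI_RGT_0).
assert (HY : 0 < sqrt (- t)) by (apply sqrt_lt_R0; lra).
assert (HY2 : sqrt (- t) ^ 2 = - t) by (apply pow2_sqrt; lra).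
assert (H1 : 0 < 48 * P / PI) by (apply Rdiv_lt_0_compat; lra).
assert (H2 : 0 < PI / - t) by (apply Rdiv_lt_0_compat; lra).
assert (HNN : 0 < NN) by (unfold NN; lra).
apply Rsqr_inj.
- apply Rmult_le_pos; [apply Rmult_le_pos; [apply sqrt_pos|]|apply Rmult_le_pos; apply sqrt_pos].
  apply Rdiv_le_0_compat; [lra|apply Rmult_lt_0_compat; lra].
- apply sqrt_pos.
- rewrite Rsqr_sqrt by lra; unfold Rsqr.
  replace (sqrt (48 * P / PI) * (2 * PI / (NN * sqrt (- t))) * (sqrt 3 * sqrt P) *
    (sqrt (48 * P / PI) * (2 * PI / (NN * sqrt (- t))) * (sqrt 3 * sqrt P)))
    with ((sqrt (48 * P / PI) * sqrt (48 * P / PI)) * (4 * PI ^ 2 / (NN ^ 2 * sqrt (- t) ^ 2))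
      * ((sqrt 3 * sqrt 3) * (sqrt P * sqrt P))) by (field; split; lra).
  rewrite !sqrt_sqrt, HY2 by lra; unfold NN; field; repeat split; lra.
Qed.

Let nome_gt (t : R) : t < 0 -> 1 < nome t ^ 2 /\ 1 < nome1 t ^ 2 /\
  / nome t ^ 2 = exp (- (2 * - t)) /\ / nome1 t ^ 2 = exp (- (2 * (PI ^ 2 / - t))).
Proof.
intros Ht; assert (Hpi := PI_RGT_0).
assert (H1 : PI ^ 2 / t < 0).
{ assert (0 < PI ^ 2 / - t) by (apply Rdiv_lt_0_compat; [apply pow_lt; lra|lra]).
  replace (PI ^ 2 / t) with (- (PI ^ 2 / - t)) by (field; lra); lra. }
assert (E : forall x, exp x ^ 2 = exp (2 * x)).
{ intros x; simpl; rewrite Rmult_1_r, <- exp_plus; f_equal; ring. }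
unfold nome, nome1; rewrite !E, <- !exp_Ropp.
repeat split.
- rewrite <- exp_0; apply exp_increasing; lra.
- rewrite <- exp_0; apply exp_increasing; lra.
- f_equal; field; lra.
Qed.

Lemma false_theta_law (s : side) (nn : list nat) : lawE s p nn (Ls s) (false_theta_vector p nn).
Proof.
intros t j Ht Hj; cbv zeta.
destruct (nome_gt t Ht) as (HQ & HQ1 & EQ & EQ1).
rewrite false_theta_value by (try lia; try apply ell_lt; try lia; assumption).
rewrite sum_n_m_csum.
rewrite (csum_ext _ (fun i => RtoC (Mmat p j (S i) * Th p (S i) (/ nome1 t ^ 2)))).
2:{ intros i Hi; rewrite false_theta_value by (try lia; try apply ell_lt; try lia; assumption).
    rewrite RtoC_mult; reflexivity. }
rewrite csum_RtoC, EQ, EQ1, (Ls_value s j t Ht Hj), (V_sum j t Ht Hj).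
rewrite Rabs_left by exact Ht.
assert (Hpi := PI_RGT_0).
(* The prefactor of [calL] is what normalizes the real part to the theta vector itself; [constant]
   then gives the factor of the imaginary part. *)
assert (K1 : sqrt (48 * P / PI) * (/ 2 * sqrt (PI / cc)) = 1).
{ replace (sqrt (48 * P / PI) * (/ 2 * sqrt (PI / cc))) with (/ 2 * (sqrt (48 * P / PI) * sqrt (PI / cc))) by ring.
  rewrite <- sqrt_mult by (apply Rdiv_le_0_compat; unfold cc; lra).
  replace (48 * P / PI * (PI / cc)) with (2 ^ 2) by (unfold cc; field; split; lra).
  rewrite sqrt_pow2 by lra; field. }
rewrite K1, <- (constant t Ht).
set (R0 := rsum _ _); set (T0 := Th _ _ _).
apply C_ext; simpl; ring.
Qed.

(** * Uniqueness for the systems with the matrix [Mmat] *)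

Lemma Mmat_sym (j k : nat) : Mmat p j k = Mmat p k j.
Proof.
unfold Mmat; rewrite (Nat.add_comm j k).
replace (6 * PI * INR j * INR k / INR p) with (6 * PI * INR k * INR j / INR p) by (field; fold P; lra).
reflexivity.
Qed.

Lemma rsum_exchange (f : nat -> nat -> R) (m n : nat) :
  rsum (fun i => rsum (fun j => f i j) n) m = rsum (fun j => rsum (fun i => f i j) m) n.
Proof.
induction m as [|m IH]; simpl.
- symmetry; apply rsum_zero; reflexivity.
- rewrite IH, <- rsum_plus; reflexivity.
Qed.

Lemma rsum_nonneg (f : nat -> R) (n : nat) : (forall i, 0 <= f i) -> 0 <= rsum f n.
Proof. intros H; induction n as [|n IH]; simpl; [lra|]; specialize (H n); lra. Qed.

Lemma rsum_sq_zero (f : nat -> R) (n : nat) : rsum (fun i => f i * f i) n <= 0 ->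
  forall i, (i < n)%nat -> f i = 0.
Proof.
induction n as [|n IH]; intros H i Hi; [lia|]; simpl in H.
assert (A := rsum_nonneg (fun i => f i * f i) n ltac:(intros; nra)).
assert (B : 0 <= f n * f n) by nra.
destruct (Nat.eq_dec i n) as [->|E]; [nra|apply IH; [lra|lia]].
Qed.

(* A real symmetric matrix has no eigenvalue i: if x = - M (M x) then
   |x|^2 = - |M x|^2. *)
Lemma sym_square_neg (l : nat) (x : nat -> R) :
  (forall i, (i < l)%nat -> x i = - rsum (fun k => Mmat p (S i) (S k)
     * rsum (fun m => Mmat p (S k) (S m) * x m) l) l) ->
  forall i, (i < l)%nat -> x i = 0.
Proof.
intros H; apply rsum_sq_zero.
set (y := fun k => rsum (fun m => Mmat p (S k) (S m) * x m) l).
assert (E : rsum (fun i => x i * x i) l = - rsum (fun k => y k * y k) l).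
{ rewrite (rsum_ext _ (fun i => -1 * rsum (fun k => x i * (Mmat p (S i) (S k) * y k)) l)).
  - rewrite rsum_scal, rsum_exchange.
    rewrite (rsum_ext (fun j => rsum (fun i => x i * (Mmat p (S i) (S j) * y j)) l) (fun k => y k * y k)); [ring|].
    intros k _; unfold y at 3; rewrite <- rsum_scal; apply rsum_ext; intros i _.
    rewrite (Mmat_sym (S k) (S i)); ring.
  - intros i Hi; rewrite rsum_scal; unfold y; rewrite (H i Hi) at 2; ring. }
rewrite E; assert (A := rsum_nonneg (fun k => y k * y k) l ltac:(intros; nra)); lra.
Qed.

Lemma lawE_unique (s : side) (nn : list nat) (L : nat -> R -> C) (G H : nat -> C -> C) :
  lawE s p nn L G -> lawE s p nn L H ->
  forall j x, (1 <= j <= ell p)%nat -> 1 < x -> H j (RtoC x) = G j (RtoC x).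
Proof.
intros LG LH.
assert (Hpi := PI_RGT_0).
(* The difference of the two solutions, weighted so that the terms with the Mordell integrals drop
   out and the rest is homogeneous. Since [nome (PI ^ 2 / t)] is [nome1 t] by definition, the
   equation links [X] at [t] with [X] at [PI ^ 2 / t]. *)
pose (X := fun (j : nat) (t : R) =>
  (RtoC (Rpower (nome t ^ 2) (- (Delta p j + INR (order nn j))))
   * (H j (RtoC (nome t ^ 2)) - G j (RtoC (nome t ^ 2))))%C).
assert (HX : forall j t, t < 0 -> (1 <= j <= ell p)%nat ->
  X j t = (RtoC (sgn s) * Ci * RtoC (sqrt (PI / - t))
    * csum (fun i => RtoC (Mmat p j (S i)) * X (S i) (PI ^ 2 / t)%R)%C (ell p))%C).
{ intros j t Ht Hj; specialize (LG t j Ht Hj); specialize (LH t j Ht Hj); cbv zeta in LG, LH.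
  rewrite sum_n_m_csum, Rabs_left in LG, LH by exact Ht.
  set (A := RtoC (Rpower (nome t ^ 2) (- (Delta p j + INR (order nn j))))) in *.
  set (K := (RtoC (- sgn s) * Ci * RtoC (sqrt (PI / - t)))%C) in *.
  set (SG := csum (fun i => RtoC (Mmat p j (S i)) * (RtoC (Rpower (nome1 t ^ 2) (- (Delta p (S i) + INR (order nn (S i))))) * G (S i) (RtoC (nome1 t ^ 2))))%C (ell p)) in *.
  set (SH := csum (fun i => RtoC (Mmat p j (S i)) * (RtoC (Rpower (nome1 t ^ 2) (- (Delta p (S i) + INR (order nn (S i))))) * H (S i) (RtoC (nome1 t ^ 2))))%C (ell p)) in *.
  assert (ES : csum (fun i => RtoC (Mmat p j (S i)) * X (S i) (PI ^ 2 / t)%R)%C (ell p) = (SH - SG)%C).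
  { unfold SH, SG; rewrite <- csum_minus; apply csum_ext; intros i _; unfold X.
    change (nome (PI ^ 2 / t)) with (nome1 t); ring. }
  rewrite ES; unfold X; fold A.
  assert (EK : (RtoC (sgn s) * Ci * RtoC (sqrt (PI / - t)))%C = (- K)%C) by (unfold K; rewrite RtoC_opp; ring).
  rewrite EK.
  replace (A * (H j (RtoC (nome t ^ 2)) - G j (RtoC (nome t ^ 2))))%C
    with ((A * H j (RtoC (nome t ^ 2)) + K * SH) - (A * G j (RtoC (nome t ^ 2)) + K * SG) - K * (SH - SG))%C by ring.
  rewrite <- LH, <- LG; ring. }
assert (Hs2 : sgn s * sgn s = 1) by (destruct s; simpl; ring).
(* In the second application the square roots at [t] and [PI ^ 2 / t] have product 1, and the square
   of [sgn s * Ci] is -1 on either side. *)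
assert (HXX : forall t j, t < 0 -> (1 <= j <= ell p)%nat ->
  X j t = (- csum (fun i => RtoC (Mmat p j (S i)) * csum (fun m => RtoC (Mmat p (S i) (S m)) * X (S m) t) (ell p)) (ell p))%C).
{ intros t j Ht Hj; rewrite (HX j t Ht Hj).
  assert (Ht' : PI ^ 2 / t < 0).
  { assert (0 < PI ^ 2 / - t) by (apply Rdiv_lt_0_compat; [apply pow_lt; lra|lra]).
    replace (PI ^ 2 / t) with (- (PI ^ 2 / - t)) by (field; lra); lra. }
  assert (Et : PI ^ 2 / (PI ^ 2 / t) = t) by (field; split; lra).
  rewrite (csum_ext _ (fun i => (RtoC (sgn s) * Ci * RtoC (sqrt (PI / - (PI ^ 2 / t))))
    * (RtoC (Mmat p j (S i)) * csum (fun m => RtoC (Mmat p (S i) (S m)) * X (S m) t) (ell p)))%C).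
  2:{ intros i Hi; rewrite (HX (S i) (PI ^ 2 / t) Ht' ltac:(lia)), Et; ring. }
  rewrite csum_Cmult.
  assert (Es : sqrt (PI / - t) * sqrt (PI / - (PI ^ 2 / t)) = 1).
  { rewrite <- sqrt_mult by (apply Rdiv_le_0_compat; lra).
    replace (PI / - t * (PI / - (PI ^ 2 / t))) with 1 by (field; split; lra); apply sqrt_1. }
  set (CS := csum _ _).
  transitivity (RtoC (sgn s * sgn s) * (Ci * Ci) * RtoC (sqrt (PI / - t) * sqrt (PI / - (PI ^ 2 / t))) * CS)%C.
  - rewrite !RtoC_mult; ring.
  - rewrite Hs2, Es; replace (Ci * Ci)%C with (- (1))%C by (apply C_ext; simpl; ring); ring. }
assert (Hzero : forall t j, t < 0 -> (1 <= j <= ell p)%nat -> X j t = 0%C).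
{ intros t j Ht Hj.
  (* The matrix being real, the real and imaginary parts of [X] satisfy the equation separately;
     [pr] stands for either. *)
  assert (RR : forall (pr : C -> R),
     (forall f n, pr (csum f n) = rsum (fun i => pr (f i)) n) ->
     (forall a z, pr (RtoC a * z)%C = a * pr z) -> (forall z, pr (- z)%C = - pr z) -> pr (X j t) = 0).
  { intros pr P1 P2 P3.
    replace j with (S (j - 1)) by lia.
    apply (sym_square_neg (ell p) (fun i => pr (X (S i) t))); [|lia].
    intros i Hi; rewrite (HXX t (S i) Ht ltac:(lia)) at 1; rewrite P3, P1; f_equal; apply rsum_ext; intros k _.
    rewrite P2, P1; f_equal; apply rsum_ext; intros m _; apply P2. }
  apply C_ext.
  - apply (RR Re); [apply csum_Re|intros; apply Re_scal|reflexivity].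
  - apply (RR Im); [apply csum_Im|intros a [u v]; simpl; ring|reflexivity]. }
intros j x Hj Hx.
(* Solves [nome t ^ 2 = x], so every real point of the exterior domain beyond 1 is reached. *)
set (t := - (ln x / 2)).
assert (Hln : 0 < ln x) by (rewrite <- ln_1; apply ln_increasing; lra).
assert (Ht : t < 0) by (unfold t; lra).
assert (Ex : nome t ^ 2 = x).
{ unfold nome, t; simpl; rewrite Rmult_1_r, <- exp_plus; rewrite <- (exp_ln x) at 3 by lra; f_equal; field. }
assert (Z := Hzero t j Ht Hj); unfold X in Z; rewrite Ex in Z.
apply (f_equal Cmod) in Z; rewrite Cmod_mult, Cmod_0 in Z.
apply Rmult_integral in Z; destruct Z as [Z|Z].
- exfalso; rewrite Cmod_RtoC_pos in Z by (left; apply exp_pos).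
  assert (Q := exp_pos (- (Delta p j + INR (order nn j)) * ln x)); unfold Rpower in Z; lra.
- apply Cmod_eq_0 in Z.
  replace (H j (RtoC x)) with ((H j (RtoC x) - G j (RtoC x)) + G j (RtoC x))%C by ring; rewrite Z; ring.
Qed.

(** The competitors are arbitrary holomorphic vectors: the law fixes them on the real ray, and
    [exterior_identity] extends the agreement component by component. *)
Theorem crossing_p (s : side) (nn : list nat) : crossing s p nn.
Proof.
exists (Ls s); split; [intros j Hj; apply calL_lateral, Hj|].
assert (HG : forall (j : nat) (Q : C), (1 <= j <= ell p)%nat -> 1 < Cmod Q -> holomorphic_at (false_theta_vector p nn j) Q).
{ intros j Q Hj HQ; unfold false_theta_vector.
  apply (holomorphic_mult (fun Q => Q ^ order nn j)%C (fun Q => Phi p j (/ Q)%C)).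
  - apply (holomorphic_pow (fun z => z)), holomorphic_id.
  - apply holomorphic_Cinv_comp; [exact HQ|]; intros z Hz; apply Phi_holomorphic; [lia|exact Hz]. }
split; [exact HG|split; [apply false_theta_law|]].
intros H HH LH j Q Hj HQ.
apply (exterior_identity (H j) (false_theta_vector p nn j)); auto.
intros x Hx; apply (lawE_unique s nn (Ls s)); auto; apply false_theta_law.
Qed.

End OrderP.

(** * Order 3 *)

Lemma sin_4PI3 : sin (4 * PI / 3) = - (sqrt 3 / 2).
Proof. replace (4 * PI / 3) with (PI / 3 + PI) by field; rewrite neg_sin, sin_PI3; reflexivity. Qed.

Lemma sin_5PI3 : sin (5 * PI / 3) = - (sqrt 3 / 2).
Proof.
replace (5 * PI / 3) with (2 * (PI / 3) + PI) by field; rewrite neg_sin, sin_2PI3; reflexivity.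
Qed.

(** Both sides have period 3 in [M]. The residue classes 2 and 4 modulo 6 contain only even
    integers, which is why the coefficient is read at [2 * M]; the series attached to [W3] is
    thereby its own dual. *)
Lemma sin_psi_3 (M : nat) : sin (2 * PI * INR M * 2 / 6) = sqrt 3 / 2 * IZR (psi 3 2 (2 * M)).
Proof.
assert (D := Nat.div_mod M 3 ltac:(lia)); assert (B := Nat.mod_upper_bound M 3 ltac:(lia)).
set (k := (M / 3)%nat) in *; set (r := (M mod 3)%nat) in *; clearbody k r; subst M.
replace (2 * (3 * k + r))%nat with (Z.to_nat (2 * 3) * k + 2 * r)%nat by (simpl Z.to_nat; lia).
rewrite psi_periodic by lia.
replace (2 * PI * INR (3 * k + r) * 2 / 6) with (2 * INR r * PI / 3 + IZR (Z.of_nat k) * (2 * PI)).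
2:{ rewrite plus_INR, mult_INR, <- INR_IZR_INZ; simpl; field. }
rewrite sin_IZR_period.
destruct r as [|[|[|r]]]; [| | |lia]; simpl INR.
- replace (2 * 0 * PI / 3) with 0 by field; rewrite sin_0; cbn; ring.
- replace (2 * 1 * PI / 3) with (2 * (PI / 3)) by field; rewrite sin_2PI3; cbn; ring.
- replace (2 * (1 + 1) * PI / 3) with (4 * PI / 3) by field; rewrite sin_4PI3; cbn; ring.
Qed.

Lemma sin_PI3_mult (r : nat) : (r < 12)%nat ->
  sin (INR r * PI / 3) = sqrt 3 / 2 * match (r mod 6)%nat with 0%nat | 3%nat => 0 | 1%nat | 2%nat => 1 | _ => -1 end.
Proof.
assert (H6 : forall r, (r < 6)%nat ->
  sin (INR r * PI / 3) = sqrt 3 / 2 * match r with 0%nat | 3%nat => 0 | 1%nat | 2%nat => 1 | _ => -1 end).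
{ intros [|[|[|[|[|[|w]]]]]] Hw; [| | | | | |lia]; simpl INR.
  - replace (0 * PI / 3) with 0 by field; rewrite sin_0; ring.
  - replace (1 * PI / 3) with (PI / 3) by field; rewrite sin_PI3; ring.
  - replace ((1 + 1) * PI / 3) with (2 * (PI / 3)) by field; rewrite sin_2PI3; ring.
  - replace ((1 + 1 + 1) * PI / 3) with PI by field; rewrite sin_PI; ring.
  - replace ((1 + 1 + 1 + 1) * PI / 3) with (4 * PI / 3) by field; rewrite sin_4PI3; ring.
  - replace ((1 + 1 + 1 + 1 + 1) * PI / 3) with (5 * PI / 3) by field; rewrite sin_5PI3; ring. }
intros Hr; destruct (Nat.lt_ge_cases r 6) as [L|L].
- rewrite Nat.mod_small by exact L; apply H6, L.
- replace r with (r - 6 + 1 * 6)%nat by lia; rewrite Nat.Div0.mod_add, Nat.mod_small by lia.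
  rewrite <- (H6 (r - 6)%nat) by lia; rewrite <- (sin_IZR_period (INR (r - 6) * PI / 3) 1); f_equal.
  rewrite plus_INR, mult_INR; simpl (INR 6); simpl (INR 1); field.
Qed.

(** Both sides have period 12 in [M]. The residues 2 and 4 coming from [W2] are exchanged for 1 and
    5, which is how the second law leads from [Phi3_1] to [Phi3_2]. *)
Lemma sin_psi_6 (M : nat) :
  sin (2 * PI * INR M * 2 / 12) + sin (2 * PI * INR M * 4 / 12)
  = sqrt 3 * (IZR (psi 6 1 M) - IZR (psi 6 5 M)).
Proof.
replace (2 * PI * INR M * 4 / 12) with (2 * PI * INR M * 2 / 6) by field.
rewrite sin_psi_3.
assert (D := Nat.div_mod M 12 ltac:(lia)); assert (B := Nat.mod_upper_bound M 12 ltac:(lia)).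
set (k := (M / 12)%nat) in *; set (r := (M mod 12)%nat) in *; clearbody k r.
assert (P1 : forall a, psi 6 a M = psi 6 a r).
{ intros a; rewrite <- (psi_periodic 6 a r k) by lia; f_equal; change (Z.to_nat (2 * 6)) with 12%nat; lia. }
assert (P2 : psi 3 2 (2 * M) = psi 3 2 (2 * r)).
{ rewrite <- (psi_periodic 3 2 (2 * r) (4 * k)) by lia; f_equal; change (Z.to_nat (2 * 3)) with 6%nat; lia. }
rewrite !P1, P2.
replace (2 * PI * INR M * 2 / 12) with (INR r * PI / 3 + IZR (2 * Z.of_nat k) * (2 * PI)).
2:{ rewrite D, plus_INR, mult_INR, mult_IZR, <- INR_IZR_INZ; simpl; field. }
rewrite sin_IZR_period, sin_PI3_mult by exact B.
clear D P1 P2; do 12 (destruct r as [|r]; [cbn; field|]); lia.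
Qed.

Lemma Psi_3_2_even (E : R) : 0 < E ->
  is_series (fun m => IZR (psi 3 2 (2 * S m)) * exp (- (E * INR (S m) ^ 2 / 3))) (Psi 3 2 (exp (- E))).
Proof.
intros HE.
apply (is_series_shift0 (fun m => IZR (psi 3 2 (2 * m)) * exp (- (E * INR m ^ 2 / 3)))).
{ rewrite psi_0 by lia; ring. }
generalize (is_series_regroup _ _ 2 ltac:(lia) (Psi_series 3 2 E ltac:(lia) HE)).
apply is_series_ext; intros m; cbn [rsum].
assert (Z1 : psi 3 2 (2 * m + 1) = 0%Z).
{ destruct (Z.eq_dec (psi 3 2 (2 * m + 1)) 0) as [e|e]; [exact e|].
  apply psi_neq0 in e; [|lia]; destruct e as [k [e|e]]; lia. }
rewrite Z1, Nat.add_0_r, mult_INR; simpl (INR 2).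
replace (E * ((1 + 1) * INR m) ^ 2 / (4 * 3)) with (E * INR m ^ 2 / 3) by field.
match goal with |- ?a = ?b => change (@eq R a b) end; ring.
Qed.

(** S / w at the boundary point w = + i sqrt (- t), the one reached through the upper half-plane. *)
Definition W3_upper (t : R) : C :=
  (/ (0, (sgn Upper * sqrt (- t))%R) * Sfun 3 2 6 (0, (sgn Upper * sqrt (- t))%R))%C.

Definition W2_upper (t : R) : C :=
  (/ (0, (sgn Upper * sqrt (- t))%R) * Sfun (3 / 2) 2 12 (0, (sgn Upper * sqrt (- t))%R)
   + / (0, (sgn Upper * sqrt (- t))%R) * Sfun (3 / 2) 4 12 (0, (sgn Upper * sqrt (- t))%R))%C.

Lemma W3_lateral : lateral_continuation Upper W3 W3_upper.
Proof.
exists (Fmor 3 2 6); split; [|split].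
- intros t Ht; apply Fmor_holomorphic; [lra|lra|apply (lateral_off_cut Upper), Ht].
- intros t Ht; symmetry; apply W3_Fmor, Ht.
- intros t Ht; apply Fmor_lateral; lra.
Qed.

Lemma W2_lateral : lateral_continuation Upper W2 W2_upper.
Proof.
exists (fun t => Fmor (3 / 2) 2 12 t + Fmor (3 / 2) 4 12 t)%C; split; [|split].
- intros t Ht; apply lateral_off_cut in Ht; apply holomorphic_plus; apply Fmor_holomorphic; lra || exact Ht.
- intros t Ht; symmetry; apply W2_Fmor, Ht.
- intros t Ht; apply (filterlim_Cplus (at_right 0)); apply Fmor_lateral; lra.
Qed.

Lemma Cinv_imag (y : R) : y <> 0 -> (/ ((0, y) : C))%C = (0, - / y).
Proof. intros Hy; apply C_ext; simpl; field; intros; nra. Qed.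

(** The factor [Ci] cancels the i in 1 / w, so the real part of [Sfun] gives the series in q and its
    imaginary part the series in q_1, by [sin_psi_3]. *)
Lemma W3_upper_value (t : R) : t < 0 ->
  (Ci * RtoC (sqrt (12 * - t / PI)) * W3_upper t)%C
  = (Psi 3 2 (exp (- - t)), - (sqrt (PI / - t) * Psi 3 2 (exp (- (PI ^ 2 / - t))))).
Proof.
intros Ht; assert (Hpi := PI_RGT_0).
assert (HY : 0 < sqrt (- t)) by (apply sqrt_lt_R0; lra).
assert (HY2 : sqrt (- t) ^ 2 = - t) by (apply pow2_sqrt; lra).
assert (HE : 0 < PI ^ 2 / - t) by (apply Rdiv_lt_0_compat; [apply pow_lt; lra|lra]).
unfold W3_upper; rewrite Cinv_imag by (simpl; lra).
destruct (Sfun_imag 3 2 6 (sqrt (- t)) (sgn Upper)) as [E1 E2]; try lra; [left; reflexivity|].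
replace (Sfun 3 2 6 (0, sgn Upper * sqrt (- t))) with
  ((Re (Sfun 3 2 6 (0, sgn Upper * sqrt (- t))), Im (Sfun 3 2 6 (0, sgn Upper * sqrt (- t)))) : C)
  by (symmetry; apply C_ext; reflexivity).
rewrite E1, E2, HY2; cbn [sgn].
assert (R1 : Series (fun k => exp (- (nk 2 6 k ^ 2 * - t / (4 * 3))) - exp (- (nk (6 - 2) 6 k ^ 2 * - t / (4 * 3))))
  = Psi 3 2 (exp (- - t))).
{ rewrite <- (Psi_pairs 3 2 (- t)) by lia || lra; apply Series_ext; intros k.
  replace (2 * 3) with 6 by ring; f_equal; f_equal; f_equal; field. }
assert (R2 : Series (fun m => exp (- (3 * (2 * PI * INR (S m) / (6 * sqrt (- t))) ^ 2)) * sin (2 * PI * INR (S m) * 2 / 6))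
  = sqrt 3 / 2 * Psi 3 2 (exp (- (PI ^ 2 / - t)))).
{ apply is_series_unique.
  generalize (is_series_scal (V := R_NormedModule) (sqrt 3 / 2) _ _ (Psi_3_2_even _ HE)).
  apply is_series_ext; intros m; rewrite sin_psi_3.
  replace (3 * (2 * PI * INR (S m) / (6 * sqrt (- t))) ^ 2) with (PI ^ 2 / (sqrt (- t) ^ 2) * INR (S m) ^ 2 / 3)
    by (field; lra).
  rewrite HY2; unfold scal; cbn -[INR psi pow Nat.mul]; unfold mult; cbn -[INR psi pow Nat.mul]; ring. }
rewrite R1, R2.
assert (K : sqrt (12 * - t / PI) = sqrt 12 / sqrt PI * sqrt (- t)).
{ replace (12 * - t / PI) with (12 / PI * - t) by (field; lra).
  rewrite sqrt_mult by (lra || (apply Rdiv_le_0_compat; lra)); rewrite sqrt_div by lra; reflexivity. }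
assert (K12 : sqrt 12 = 2 * sqrt 3).
{ replace 12 with (2 ^ 2 * 3) by ring; rewrite sqrt_mult, sqrt_pow2 by lra; reflexivity. }
assert (H3 : 0 < sqrt 3) by (apply sqrt_lt_R0; lra).
assert (H33 : sqrt 3 ^ 2 = 3) by (apply pow2_sqrt; lra).
assert (Hsp : 0 < sqrt PI) by (apply sqrt_lt_R0; lra).
assert (Hsp2 : PI = sqrt PI ^ 2) by (symmetry; apply pow2_sqrt; lra).
rewrite K, K12, !(sqrt_div PI) by lra.
generalize (Psi 3 2 (exp (- - t))) (Psi 3 2 (exp (- (PI ^ 2 / - t)))); intros A B.
apply C_ext; unfold Cmult, RtoC, Re, Im, Ci; cbn [fst snd].
- field; lra.
- transitivity (- (sqrt 3 ^ 2 * PI / (3 * sqrt PI * sqrt (- t)) * B)); [field; lra|].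
  rewrite H33; rewrite Hsp2 at 1; field; lra.
Qed.

(** At [t / 2], with c = 3/2 and T = - t, the Gaussian exponent is n^2 T / 12 = 2 T n^2 / 24, so the
    series of modulus 6 appear at the square of 1 / q; on the dual side [sin_psi_6] produces the
    residues 1 and 5. *)
Lemma W2_upper_value (t : R) : t < 0 ->
  (- Ci * RtoC (sqrt (3 * - t / PI)) * W2_upper (t / 2))%C
  = (- Psi 6 2 (exp (- (2 * - t))) - Psi 6 4 (exp (- (2 * - t))),
     sqrt (PI / - t) * (Psi 6 1 (exp (- (2 * (PI ^ 2 / - t)))) - Psi 6 5 (exp (- (2 * (PI ^ 2 / - t)))))).
Proof.
intros Ht; assert (Hpi := PI_RGT_0).
assert (Ht2 : 0 < - (t / 2)) by lra.
assert (HY : 0 < sqrt (- (t / 2))) by (apply sqrt_lt_R0; lra).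
assert (HY2 : sqrt (- (t / 2)) ^ 2 = - (t / 2)) by (apply pow2_sqrt; lra).
assert (HE : 0 < PI ^ 2 / - t) by (apply Rdiv_lt_0_compat; [apply pow_lt; lra|lra]).
unfold W2_upper; rewrite Cinv_imag by (simpl; lra).
destruct (Sfun_imag (3 / 2) 2 12 (sqrt (- (t / 2))) (sgn Upper)) as [E1 E2]; try lra; [left; reflexivity|].
destruct (Sfun_imag (3 / 2) 4 12 (sqrt (- (t / 2))) (sgn Upper)) as [E3 E4]; try lra; [left; reflexivity|].
set (w := ((0, sgn Upper * sqrt (- (t / 2))) : C)) in *.
replace (Sfun (3 / 2) 2 12 w) with ((Re (Sfun (3 / 2) 2 12 w), Im (Sfun (3 / 2) 2 12 w)) : C)
  by (symmetry; apply C_ext; reflexivity).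
replace (Sfun (3 / 2) 4 12 w) with ((Re (Sfun (3 / 2) 4 12 w), Im (Sfun (3 / 2) 4 12 w)) : C)
  by (symmetry; apply C_ext; reflexivity).
rewrite E1, E2, E3, E4, HY2; cbn [sgn].
assert (R1 : forall (a : Z) (b : R), b = IZR a -> (a = 2 \/ a = 4)%Z ->
  Series (fun k => exp (- (nk b 12 k ^ 2 * - (t / 2) / (4 * (3 / 2))))
    - exp (- (nk (12 - b) 12 k ^ 2 * - (t / 2) / (4 * (3 / 2))))) = Psi 6 a (exp (- (2 * - t)))).
{ intros a b -> Ha; rewrite <- (Psi_pairs 6 a (2 * - t)) by lia || lra; apply Series_ext; intros k.
  replace (2 * 6) with 12 by ring; f_equal; f_equal; f_equal; field. }
rewrite (R1 2%Z 2), (R1 4%Z 4) by (reflexivity || lia).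
set (V := fun a m => exp (- (3 / 2 * (2 * PI * INR (S m) / (12 * sqrt (- (t / 2)))) ^ 2)) * sin (2 * PI * INR (S m) * a / 12)).
assert (EV : forall m, 3 / 2 * (2 * PI * INR (S m) / (12 * sqrt (- (t / 2)))) ^ 2 = 2 * (PI ^ 2 / - t) / 24 * INR (S m) ^ 2).
{ intros m; transitivity (PI ^ 2 * INR (S m) ^ 2 / (24 * sqrt (- (t / 2)) ^ 2)); [field; lra|].
  rewrite HY2; field; lra. }
assert (XV : forall a, ex_series (V a)).
{ intros a; unfold V; apply (ex_series_ext (fun m => exp (- (2 * (PI ^ 2 / - t) / 24 * INR (S m) ^ 2)) * sin (2 * PI * INR (S m) * a / 12))).
  - intros m; rewrite EV; reflexivity.
  - apply (ex_series_gauss _ (fun m => sin (2 * PI * INR (S m) * a / 12))); [lra|intros; apply Rabs_le, SIN_bound]. }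
set (D := Psi 6 1 (exp (- (2 * (PI ^ 2 / - t)))) - Psi 6 5 (exp (- (2 * (PI ^ 2 / - t))))).
assert (R2 : Series (V 2) + Series (V 4) = sqrt 3 * D).
{ rewrite <- Series_plus by apply XV; apply is_series_unique.
  assert (HE2 : 0 < 2 * (PI ^ 2 / - t)) by lra.
  assert (X := fun a => Psi_series 6 a _ ltac:(lia) HE2).
  assert (HS := is_series_minus (V := R_NormedModule) _ _ _ _ (X 1%Z) (X 5%Z)).
  apply is_series_shift0 in HS; [|rewrite !psi_0 by lia; unfold minus, plus, opp; simpl; ring].
  generalize (is_series_scal (V := R_NormedModule) (sqrt 3) _ _ HS).
  apply is_series_ext; intros m; unfold V.
  rewrite <- Rmult_plus_distr_l, sin_psi_6, EV.
  replace (2 * (PI ^ 2 / - t) * INR (S m) ^ 2 / (4 * 6)) with (2 * (PI ^ 2 / - t) / 24 * INR (S m) ^ 2) by (field; lra).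
  generalize (exp (- (2 * (PI ^ 2 / - t) / 24 * INR (S m) ^ 2))) (IZR (psi 6 1 (S m))) (IZR (psi 6 5 (S m))).
  intros x y z; unfold scal, minus, plus, opp; simpl; unfold mult; simpl; ring. }
fold (V 2) (V 4).
assert (K : sqrt (3 * - t / PI) = sqrt 3 * sqrt 2 / sqrt PI * sqrt (- (t / 2))).
{ replace (3 * - t / PI) with (3 * 2 / PI * - (t / 2)) by (field; lra).
  rewrite sqrt_mult by (lra || (apply Rdiv_le_0_compat; lra)); rewrite sqrt_div, sqrt_mult by lra; reflexivity. }
assert (KT : sqrt (- t) = sqrt 2 * sqrt (- (t / 2))).
{ rewrite <- sqrt_mult by lra; f_equal; field. }
assert (H3 : 0 < sqrt 3) by (apply sqrt_lt_R0; lra).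
assert (H33 : sqrt 3 ^ 2 = 3) by (apply pow2_sqrt; lra).
assert (H2 : 0 < sqrt 2) by (apply sqrt_lt_R0; lra).
assert (H22 : sqrt 2 ^ 2 = 2) by (apply pow2_sqrt; lra).
assert (Hsp : 0 < sqrt PI) by (apply sqrt_lt_R0; lra).
assert (Hsp2 : PI = sqrt PI ^ 2) by (symmetry; apply pow2_sqrt; lra).
assert (K3 : sqrt (PI / (3 / 2)) = sqrt PI * sqrt 2 / sqrt 3).
{ replace (PI / (3 / 2)) with (PI * 2 / 3) by field.
  rewrite sqrt_div, sqrt_mult by lra; reflexivity. }
rewrite K, K3, (sqrt_div PI (- t)), KT by lra.
generalize (Psi 6 2 (exp (- (2 * - t)))) (Psi 6 4 (exp (- (2 * - t)))); intros A B.
apply C_ext; unfold Cmult, Cplus, Copp, RtoC, Re, Im, Ci; cbn [fst snd].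
- transitivity (- (sqrt 2 ^ 2 / 2 * (A + B))); [field; lra|]; rewrite H22; field.
- transitivity (sqrt 3 * sqrt 2 * PI / (6 * sqrt PI * sqrt (- (t / 2))) * (Series (V 2) + Series (V 4))); [field; lra|].
  rewrite R2; transitivity (sqrt 3 ^ 2 * sqrt 2 ^ 2 * PI / (6 * sqrt PI * (sqrt 2 * sqrt (- (t / 2)))) * D); [field; lra|].
  rewrite H33, H22; rewrite Hsp2 at 1; field; lra.
Qed.

Lemma order3_law : law3 W3_upper W2_upper order3_pair.
Proof.
intros t Ht; cbv zeta; rewrite Rabs_left by exact Ht.
assert (Hpi := PI_RGT_0).
assert (HE : 0 < PI ^ 2 / - t) by (apply Rdiv_lt_0_compat; [apply pow_lt; lra|lra]).
assert (Hq : nome t <> 0) by (assert (H := exp_pos (- t)); unfold nome; lra).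
assert (Hq1 : nome1 t <> 0) by (assert (H := exp_pos (- (PI ^ 2 / t))); unfold nome1; lra).
assert (Eq : / nome t = exp (- - t)) by (unfold nome; rewrite <- exp_Ropp; reflexivity).
assert (Eq1 : / nome1 t = exp (- (PI ^ 2 / - t))).
{ unfold nome1; rewrite <- exp_Ropp; f_equal; field; lra. }
assert (B : 0 < / nome t < 1).
{ rewrite Eq; split; [apply exp_pos|rewrite <- exp_0; apply exp_increasing; lra]. }
assert (B1 : 0 < / nome1 t < 1).
{ rewrite Eq1; split; [apply exp_pos|rewrite <- exp_0; apply exp_increasing; lra]. }
assert (N : forall x : R, x <> 0 -> (/ - RtoC x)%C = (- RtoC (/ x))%C).
{ intros x Hx; rewrite <- RtoC_opp, <- RtoC_inv, <- RtoC_opp by lra; f_equal; field; exact Hx. }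
split; cbn [order3_pair].
- rewrite !N, !Phi3_1_neg by assumption.
  rewrite W3_upper_value by exact Ht; rewrite Eq, Eq1.
  generalize (Psi 3 2 (exp (- - t))) (Psi 3 2 (exp (- (PI ^ 2 / - t)))) (sqrt (PI / - t)); intros x y z.
  apply C_ext; unfold Cmult, Cplus, RtoC, Re, Im, Ci; cbn [fst snd]; ring.
- rewrite <- !RtoC_inv by (try apply pow_nonzero; assumption).
  assert (Eq2 : / nome1 t ^ 2 = exp (- (2 * (PI ^ 2 / - t)))).
  { replace (/ nome1 t ^ 2) with (/ nome1 t * / nome1 t) by (field; exact Hq1); rewrite Eq1, <- exp_plus; f_equal; ring. }
  assert (Eq3 : exp (- - t) ^ 2 = exp (- (2 * - t))).
  { simpl; rewrite Rmult_1_r, <- exp_plus; f_equal; ring. }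
  rewrite Phi3_1_pos by exact B.
  rewrite Phi3_2_Psi.
  2:{ rewrite Eq2; split; [apply exp_pos|rewrite <- exp_0; apply exp_increasing; lra]. }
  assert (EM := W2_upper_value t Ht).
  set (X := (Ci * RtoC (sqrt (3 * - t / PI)) * W2_upper (t / 2))%C).
  replace (- Ci * RtoC (sqrt (3 * - t / PI)) * W2_upper (t / 2))%C with (- X)%C in EM by (unfold X; ring).
  unfold Cminus; rewrite EM, Eq2, Eq1, Eq, Eq3.
  (* The power 1/12 of 1 / q_1 is the power 1/24 of its square and cancels the prefactor of [Phi3_2]
     at that square. *)
  assert (E4 : Rpower (exp (- (PI ^ 2 / - t))) (1 / 12) * Rpower (exp (- (2 * (PI ^ 2 / - t)))) (- (1 / 24)) = 1).
  { rewrite !Rpower_exp, <- exp_plus, <- exp_0; f_equal; field; lra. }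
  assert (E5 : sqrt (PI / (4 * - t)) = sqrt (PI / - t) / 2).
  { replace (PI / (4 * - t)) with (PI / - t / 2 ^ 2) by (field; lra).
    rewrite sqrt_div, sqrt_pow2; try lra; apply Rdiv_le_0_compat; lra. }
  rewrite E5, <- RtoC_mult.
  set (D := Psi 6 1 _ - Psi 6 5 _).
  replace (Rpower (exp (- (PI ^ 2 / - t))) (1 / 12) * (2 * Rpower (exp (- (2 * (PI ^ 2 / - t)))) (- (1 / 24)) * D))
    with (2 * (Rpower (exp (- (PI ^ 2 / - t))) (1 / 12) * Rpower (exp (- (2 * (PI ^ 2 / - t)))) (- (1 / 24))) * D) by ring.
  rewrite E4.
  generalize (Psi 6 2 (exp (- (2 * - t)))) (Psi 6 4 (exp (- (2 * - t)))) (sqrt (PI / - t)); intros x y z.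
  apply C_ext; unfold Cmult, Cplus, Copp, RtoC, Re, Im, Ci; cbn [fst snd]; field.
Qed.

(** * Uniqueness for order 3 *)

Lemma Cmult_cancel_l (a z w : C) : a <> 0%C -> (a * z = a * w)%C -> z = w.
Proof.
intros Ha H; replace z with (/ a * (a * z))%C by (field; exact Ha); rewrite H; field; exact Ha.
Qed.

(* Applying t -> pi^2/t twice to the first law multiplies the difference of two
   solutions by i^2 = -1. *)
Lemma law3_unique_1 (W3m W2m : R -> C) (G H : nat -> C -> C) :
  law3 W3m W2m G -> law3 W3m W2m H ->
  forall x, 1 < x -> H 1%nat (- RtoC x)%C = G 1%nat (- RtoC x)%C.
Proof.
intros LG LH; assert (Hpi := PI_RGT_0).
pose (X := fun t => (RtoC (Rpower (/ nome t) (- (2 / 3))) * (H 1%nat (- RtoC (nome t)) - G 1%nat (- RtoC (nome t))))%C).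
assert (HX : forall t, t < 0 -> X t = (Ci * RtoC (sqrt (PI / - t)) * X (PI ^ 2 / t)%R)%C).
{ intros t Ht; destruct (LG t Ht) as [A _]; destruct (LH t Ht) as [B _].
  rewrite Rabs_left in A, B by exact Ht; unfold X; change (nome (PI ^ 2 / t)) with (nome1 t).
  match goal with |- (?a * (?h - ?g) = _)%C => replace (a * (h - g))%C with (a * h - a * g)%C by ring end.
  rewrite A, B; ring. }
assert (HX0 : forall t, t < 0 -> X t = 0%C).
{ intros t Ht.
  assert (Ht' : PI ^ 2 / t < 0).
  { assert (0 < PI ^ 2 / - t) by (apply Rdiv_lt_0_compat; [apply pow_lt; lra|lra]).
    replace (PI ^ 2 / t) with (- (PI ^ 2 / - t)) by (field; lra); lra. }
  assert (E := HX t Ht); rewrite (HX _ Ht') in E.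
  replace (PI ^ 2 / (PI ^ 2 / t)) with t in E by (field; split; lra).
  assert (Es : sqrt (PI / - t) * sqrt (PI / - (PI ^ 2 / t)) = 1).
  { rewrite <- sqrt_mult by (apply Rdiv_le_0_compat; lra).
    replace (PI / - t * (PI / - (PI ^ 2 / t))) with 1 by (field; split; lra); apply sqrt_1. }
  assert (E2 : X t = (- X t)%C).
  { rewrite E at 1; transitivity (Ci * Ci * (RtoC (sqrt (PI / - t) * sqrt (PI / - (PI ^ 2 / t)))) * X t)%C.
    - rewrite RtoC_mult; ring.
    - rewrite Es; replace (Ci * Ci)%C with (- (1))%C by (apply C_ext; simpl; ring); ring. }
  destruct (X t) as [u v]; injection E2; intros; apply C_ext; simpl; lra. }
intros x Hx; assert (Hl : 0 < ln x) by (rewrite <- ln_1; apply ln_increasing; lra).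
assert (Z := HX0 (- ln x) ltac:(lra)); unfold X, nome in Z; rewrite Ropp_involutive, exp_ln in Z by lra.
assert (Z' : (H 1%nat (- RtoC x) - G 1%nat (- RtoC x))%C = 0%C).
{ apply (Cmult_cancel_l (RtoC (Rpower (/ x) (- (2 / 3))))); [apply RtoC_neq_0, Rgt_not_eq, exp_pos|].
  rewrite Z; ring. }
replace (H 1%nat (- RtoC x)%C) with ((H 1%nat (- RtoC x) - G 1%nat (- RtoC x)) + G 1%nat (- RtoC x))%C by ring.
rewrite Z'; ring.
Qed.

(** Once the first component is known, the second law can be solved for the second one, whose
    coefficient never vanishes. *)
Lemma law3_unique_2 (W3m W2m : R -> C) (G H : nat -> C -> C) :
  law3 W3m W2m G -> law3 W3m W2m H ->
  (forall x, 1 < x -> H 1%nat (RtoC x) = G 1%nat (RtoC x)) ->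
  forall x, 1 < x -> H 2%nat (RtoC x) = G 2%nat (RtoC x).
Proof.
intros LG LH H1 x Hx; assert (Hpi := PI_RGT_0).
assert (Hl : 0 < ln x) by (rewrite <- ln_1; apply ln_increasing; lra).
(* Solves [nome1 t ^ 2 = x]. *)
set (t := - (2 * PI ^ 2 / ln x)).
assert (Hpos : 0 < 2 * PI ^ 2 / ln x) by (apply Rdiv_lt_0_compat; [|exact Hl]; assert (P := pow_lt PI 2 Hpi); lra).
assert (Ht : t < 0) by (unfold t; lra).
assert (Ex : nome1 t ^ 2 = x).
{ replace (nome1 t ^ 2) with (nome1 t * nome1 t) by ring; unfold nome1; rewrite <- exp_plus.
  rewrite <- (exp_ln x) by lra; f_equal; unfold t; field; split; lra. }
assert (Hq : 1 < nome t) by (unfold nome; rewrite <- exp_0; apply exp_increasing; lra).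
destruct (LG t Ht) as [_ A]; destruct (LH t Ht) as [_ B]; cbv zeta in A, B.
rewrite (H1 _ Hq), A, Ex in B; clear A.
set (a := RtoC (sqrt (PI / (4 * Rabs t)))) in *; set (b := RtoC (Rpower (/ nome1 t) (1 / 12))) in *.
set (w := (Ci * _ * W2m _)%C) in B.
assert (Ha : a <> 0%C).
{ apply RtoC_neq_0, Rgt_not_eq, sqrt_lt_R0, Rdiv_lt_0_compat; [lra|]; rewrite Rabs_left by exact Ht; lra. }
assert (Hb : b <> 0%C) by (apply RtoC_neq_0, Rgt_not_eq, exp_pos).
assert (Hi : (- Ci)%C <> 0%C) by (intros E; injection E; lra).
apply (Cmult_cancel_l b _ _ Hb), (Cmult_cancel_l a _ _ Ha), (Cmult_cancel_l (- Ci)%C _ _ Hi).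
transitivity (- Ci * a * (b * H 2%nat (RtoC x)) - w + w)%C; [ring|].
rewrite <- B; ring.
Qed.

Lemma order3_crossing_holds : order3_crossing.
Proof.
exists W3_upper, W2_upper; split; [apply W3_lateral|split; [apply W2_lateral|]].
assert (HG1 : forall Q, 1 < Cmod Q -> holomorphic_at (order3_pair 1) Q).
{ intros Q HQ; apply (holomorphic_Cinv_comp Phi3_1 Q HQ), Phi3_1_holomorphic. }
assert (HG2 : forall Q, 1 < Cmod Q -> holomorphic_at (order3_pair 2) Q).
{ intros Q HQ; apply (holomorphic_Cinv_comp Phi3_2 Q HQ), Phi3_2_holomorphic. }
split; [|split; [apply order3_law|]].
{ intros [|[|[|j]]] Q Hj HQ; try lia; [apply HG1, HQ|apply HG2, HQ]. }
intros H HH LH.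
(* The first law sees the first component only at [- q] and [- q_1]. Uniqueness therefore comes out
   on the negative ray, and the identity theorem is applied after the reflection Q -> - Q. *)
assert (Hneg : forall f, (forall Q, 1 < Cmod Q -> holomorphic_at f Q) ->
  forall Q, 1 < Cmod Q -> holomorphic_at (fun Q => f (- Q)%C) Q).
{ intros f Hf Q HQ; apply (holomorphic_comp f (fun Q => - Q)%C).
  - apply Hf; rewrite Cmod_opp; exact HQ.
  - apply (holomorphic_ext (fun z => - (1) * z)%C); [intros z; ring|].
    apply (holomorphic_mult (fun _ => - (1))%C (fun z => z)); [apply holomorphic_const|apply holomorphic_id]. }
assert (U1 : forall Q, 1 < Cmod Q -> H 1%nat Q = order3_pair 1 Q).
{ intros Q HQ; replace Q with (- - Q)%C by ring.
  apply (exterior_identity (fun Q => H 1%nat (- Q)%C) (fun Q => order3_pair 1 (- Q)%C)).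
  - apply Hneg; intros; apply HH; [lia|assumption].
  - apply Hneg, HG1.
  - apply (law3_unique_1 W3_upper W2_upper order3_pair H order3_law LH).
  - rewrite Cmod_opp; exact HQ. }
intros [|[|[|j]]] Q Hj HQ; try lia; [apply U1, HQ|].
apply (exterior_identity (H 2%nat) (order3_pair 2)); auto.
apply (law3_unique_2 W3_upper W2_upper order3_pair H order3_law LH).
intros x Hx; apply U1; rewrite Cmod_RtoC_pos; lra.
Qed.

(** The zero order vectors give the systems with the exponents [Delta] unshifted; the others carry
    the stated powers of Q together with the compensating shifts. Both lateral continuations are
    covered. *)
Theorem theorem3p28 :
  order3_crossing /\
  (forall s : side,
     (crossing s 5 [0; 0]%nat /\ crossing s 5 [0; 1]%nat) /\
     (crossing s 7 [0; 0; 0]%nat /\ crossing s 7 [0; 1; 1]%nat) /\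
     (crossing s 11 [0; 0; 0; 0; 0]%nat /\
      crossing s 11 [0; 0; 1; 1; 2]%nat)).
Proof.
split; [exact order3_crossing_holds|]; intros s.
assert (C5 := crossing_p 5 ltac:(lia) (or_intror eq_refl) dual_check_5 s).
assert (C7 := crossing_p 7 ltac:(lia) (or_introl eq_refl) dual_check_7 s).
assert (C11 := crossing_p 11 ltac:(lia) (or_intror eq_refl) dual_check_11 s).
auto 6.
Qed.
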